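(* Let $(N,h,J,\sigma)$ be a Kähler manifold of real dimension 6, endowed with a compatible $SU(3)$ structure defined by a $(3,0)$-form $\psi^++i\psi^-$. Then this structure is obtained (locally) as the quotient of a 7-dimensional manifold $Y$ with a torsion-free $G_2$ structure by a nontrivial infinitesimal isometry $V$ if and only if (i) $d\psi^+=-\tfrac12(d^c\log t)\wedge\psi^-$ and $d\psi^-=\tfrac12(d^c\log t)\wedge\psi^+$ for a smooth positive function $t$, and (ii) the Hamiltonian vector field $U$ on $(N,\sigma)$ corresponding to $-t$ (that is, $\imath_U\sigma=-dt$) is an infinitesimal isometry of the $SU(3)$ structure. In this case, the corresponding 7-manifold $Y$ is locally $\mathbb{R}\times N$, and the metric $k$, infinitesimal isometry $V$ and $G_2$ invariant forms $\varphi,*\varphi$ are given by $$k=t\,h+t^{-2}\eta\otimes\eta,\qquad V=\frac{\partial}{\partial y},$$ $$\varphi=\sigma\wedge\eta+t^{3/2}\psi^+,\qquad *\varphi=t^{1/2}\psi^-\wedge\eta+\tfrac12t^2\,\sigma\wedge\sigma,$$ where $y$ is a variable for the $\mathbb{R}$ factor, and $\eta=dy+\eta_N$ is a 1-form on $\mathbb{R}\times N$ for which $$d\eta_N=-t^{1/2}(\imath_U\psi^+).$$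
   Context: A torsion-free $G_2$ structure on a 7-manifold $Y$ is an admissible 3-form $\varphi$ (at each point linearly equivalent to $(e^{12}+e^{34}+e^{56})\wedge e^7+\mathrm{Re}\big((e^1+ie^2)\wedge(e^3+ie^4)\wedge(e^5+ie^6)\big)$ with $(e^i)$ an orthonormal oriented coframe, which determines a Riemannian metric $k$, an orientation and a Hodge operator $*$) such that $d\varphi=0$ and $d{*\varphi}=0$. An infinitesimal isometry $V$ of it is a vector field with $\mathcal L_V\varphi=0$. All considerations are local, near points where $V\ne 0$. On a Kähler 6-manifold, $\sigma(\cdot,\cdot)=h(J\cdot,\cdot)$; $J$ acts on 1-forms by $J\gamma(\cdot)=-\gamma(J\cdot)$, and $d^cf=J\,df$. A compatible $SU(3)$ structure is given by real 3-forms $\psi^\pm$ with $\psi^++i\psi^-$ of type $(3,0)$ (so $\psi^+(\cdot,\cdot,\cdot)=\psi^-(J\cdot,\cdot,\cdot)$), $\sigma\wedge\psi^\pm=0$ and $\psi^+\wedge\psi^-=\tfrac23\sigma^3=4\,\mathrm{vol}_h$. An infinitesimal isometry of the $SU(3)$ structure is a vector field $U$ with $\mathcal L_U\sigma=0$ and $\mathcal L_U\psi^\pm=0$. Quotient construction: given $(Y,\varphi,V)$, put $t=k(V,V)^{-1/2}$ and $\eta=k(\cdot,t^2V)$; write $k=\check k+t^{-2}\eta\otimes\eta$, where $\check k$ is the quotient metric on the orbit space $N$ of $V$. The quotient structure on $N$ is: $\sigma=\imath_V\varphi$, $h=t^{-1}\check k$, $J$ defined by $h(J\cdot,\cdot)=\sigma$,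 and $\psi^\pm=t^{-1/2}\Psi^\pm$, where $\Psi^\pm$ are the 3-forms on $N$ with $\varphi=\sigma\wedge\eta+t\,\Psi^+$ and $\Psi^-=-\imath_V( *\varphi)$. Functions and forms on $N$ are identified with their pullbacks to $Y$. ''Obtained as the quotient'' means equal to the structure so constructed, the function $t$ in (i) being $k(V,V)^{-1/2}$. *)

(* Defs.v *)
From HB Require Import structures.
From mathcomp Require Import all_boot all_order all_algebra all_fingroup.
From mathcomp Require Import all_classical all_reals all_analysis.

Set Implicit Arguments.
Unset Strict Implicit.
Unset Printing Implicit Defensive.

Import Order.TTheory GRing.Theory Num.Theory.
Import numFieldNormedType.Exports.

Local Open Scope classical_set_scope.
Local Open Scope ring_scope.

Reserved Notation "S \wedge T" (at level 40, left associativity).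

(* C^oo on an open set A: every iterated directional derivative is (Frechet)
   differentiable, hence continuous, at every point of A. *)
Definition smooth_on (R : realType) n (V : normedModType R)
    (A : set 'rV[R]_n) (f : 'rV[R]_n -> V) : Prop :=
  forall (s : seq 'rV[R]_n) x, A x ->
    differentiable (foldr (fun v g => 'D_v g) f s) x.

(* A smooth manifold of dimension n: a Hausdorff space with a C^oo atlas.
   The atlas is a sequence of charts, which encodes second countability (charts
   with empty domain are allowed, so finite atlases are covered).  [mcrd i] is
   the i-th coordinate map, meaningful on [mdom i], and [mpar i] its inverse,
   meaningful on the image of [mdom i]. *)
Record manifold (R : realType) (n : nat) := Manifold {
  msort :> topologicalType;
  mdom : nat -> set msort;
  mcrd : nat -> msort -> 'rV[R]_n;
  mpar : nat -> 'rV[R]_n -> msort;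
  mhausdorff : hausdorff_space msort;
  mcover : forall p, exists i, mdom i p;
  mdom_open : forall i, open (mdom i);
  mimg_open : forall i, open (mcrd i @` mdom i);
  mcrdK : forall i p, mdom i p -> mpar i (mcrd i p) = p;
  mcrd_continuous : forall i p, mdom i p -> {for p, continuous (mcrd i)};
  mpar_continuous : forall i p, mdom i p ->
    {for mcrd i p, continuous (mpar i)};
  mtransition_smooth : forall i j,
    smooth_on (mcrd i @` (mdom i `&` mdom j)) (mcrd j \o mpar i) }.

Section Fields.
Variable R : realType.

(* Covectors of degree p, and tensor fields, vector fields and fields of
   endomorphisms given by their expressions in the charts: [T i x] is the
   value, in the i-th chart, at the point with coordinates x.  The values at
   points x outside the image of the chart carry no information. *)
Definition cov n p := ('I_p -> 'rV[R]_n) -> R.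
Definition tens n p := nat -> 'rV[R]_n -> cov n p.
Definition vfield n := nat -> 'rV[R]_n -> 'rV[R]_n.
Definition endo n := nat -> 'rV[R]_n -> 'rV[R]_n -> 'rV[R]_n.

Definition pair2 n (u w : 'rV[R]_n) : 'I_2 -> 'rV[R]_n := tnth [tuple u; w].

Definition multilinear n p (a : cov n p) : Prop :=
  forall (v : 'I_p -> 'rV[R]_n) i (c : R) u w,
    let upd z := fun j => if j == i then z else v j in
    a (upd (c *: u + w)) = c * a (upd u) + a (upd w).

Definition alternating n p (a : cov n p) : Prop :=
  forall (v : 'I_p -> 'rV[R]_n) i j, i != j -> v i = v j -> a v = 0.

(* Normalised so that (e1 ^ e2)(u, w) = e1(u) e2(w) - e1(w) e2(u). *)
Definition cwedge n p q (a : cov n p) (b : cov n q) : cov n (p + q) := fun v =>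
  (p`! * q`!)%:R^-1 *
  \sum_(s : 'S_(p + q)) (-1) ^+ s *
    (a (fun i => v (s (lshift q i))) * b (fun j => v (s (rshift p j)))).

Definition wedge n p q (S : tens n p) (T : tens n q) : tens n (p + q) :=
  fun i x => cwedge (S i x) (T i x).

Definition dext n p (S : tens n p) : tens n p.+1 := fun i x v =>
  \sum_(a < p.+1) (-1) ^+ a *
    'D_(v a) (fun y => S i y (fun b => v (lift a b))) x.

Definition iprod n p (V : vfield n) (S : tens n p.+1) : tens n p :=
  fun i x v => S i x (fun a => oapp v (V i x) (unlift ord0 a)).

(* (L_V S)(X1, ..., Xp) = V(S(X1, ..., Xp)) - sum_a S(.., [V, Xa], ..) for the
   coordinate-constant fields Xa = v a, for which [V, Xa] = - 'D_(v a) V. *)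
Definition lie n p (V : vfield n) (S : tens n p) : tens n p := fun i x v =>
  'D_(V i x) (fun y => S i y v) x +
  \sum_(a < p) S i x (fun b => if b == a then 'D_(v a) (V i) x else v b).

Definition tens0 n p : tens n p := fun _ _ _ => 0.

Definition bracket n (X Y : 'rV[R]_n -> 'rV[R]_n) (x : 'rV[R]_n) : 'rV[R]_n :=
  'D_(X x) Y x - 'D_(Y x) X x.

(* The Nijenhuis tensor, evaluated on coordinate-constant fields. *)
Definition nijenhuis n (J : 'rV[R]_n -> 'rV[R]_n -> 'rV[R]_n) x u w :=
  let Ju y := J y u in let Jw y := J y w in
  bracket Ju Jw x - J x (bracket Ju (cst w) x)
    - J x (bracket (cst u) Jw x) - bracket (cst u) (cst w) x.

(* J acts on 1-forms by (J gamma)(w) = - gamma(J w). *)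
Definition Jact n (J : endo n) (gamma : tens n 1) : tens n 1 :=
  fun i x v => - gamma i x (fun a => J i x (v a)).

End Fields.

Notation "S \wedge T" := (wedge S T) : ring_scope.

Section OnManifold.
Variables (R : realType) (n : nat) (M : manifold R n).

Definition chart_img (i : nat) (D : set M) : set 'rV[R]_n :=
  @mcrd R n M i @` (mdom i `&` D).

Definition on_charts (D : set M) (P : nat -> 'rV[R]_n -> Prop) : Prop :=
  forall i x, chart_img i D x -> P i x.

Definition eq_on p (D : set M) (S T : tens R n p) : Prop :=
  on_charts D (fun i x => S i x =1 T i x).

Definition smooth_fun (D : set M) (f : M -> R) : Prop :=
  forall i, smooth_on (chart_img i D) (f \o mpar M i).

Definition dfun (f : M -> R) : tens R n 1 :=
  fun i x v => 'D_(v ord0) (f \o mpar M i) x.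

Definition dc (J : endo R n) (f : M -> R) : tens R n 1 := Jact J (dfun f).

End OnManifold.

Section Maps.
Variables (R : realType) (n n' : nat) (M : manifold R n) (M' : manifold R n').

Definition rep (f : M -> M') (i j : nat) : 'rV[R]_n -> 'rV[R]_n' :=
  fun x => mcrd j (f (mpar M i x)).

Definition on_chart_pairs (D : set M) (f : M -> M')
    (P : nat -> nat -> 'rV[R]_n -> Prop) : Prop :=
  forall i j x, chart_img i (D `&` f @^-1` mdom j) x -> P i j x.

(* Continuity makes the domains of the coordinate expressions open. *)
Definition smooth_map (D : set M) (f : M -> M') : Prop :=
  (forall p, D p -> {for p, continuous f}) /\
  forall i j, smooth_on (chart_img i (D `&` f @^-1` mdom j)) (rep f i j).

(* T = f^* T' on D *)
Definition pulled p (D : set M) (f : M -> M') (T' : tens R n' p)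
    (T : tens R n p) : Prop :=
  on_chart_pairs D f (fun i j x => forall v,
    T i x v = T' j (rep f i j x) (fun a => 'D_(v a) (rep f i j) x)).

(* f_* V = V' along D *)
Definition related (D : set M) (f : M -> M') (V : vfield R n)
    (V' : vfield R n') : Prop :=
  on_chart_pairs D f (fun i j x =>
    'D_(V i x) (rep f i j) x = V' j (rep f i j x)).

Definition submersion (D : set M) (f : M -> M') : Prop :=
  smooth_map D f /\
  on_chart_pairs D f (fun i j x => forall w, exists v, 'D_v (rep f i j) x = w).

End Maps.

Definition diffeo (R : realType) n n' (M : manifold R n) (M' : manifold R n')
    (D : set M) (E : set M') (f : M -> M') (g : M' -> M) : Prop :=
  [/\ open D, open E & f @` D = E] /\
  [/\ forall p, D p -> g (f p) = p, smooth_map D f & smooth_map E g].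


Section GeometricObjects.
Variables (R : realType) (n : nat) (M : manifold R n).

(* Here and in [vfield_on] and [endo_on], the condition on the identity map is
   the compatibility of the expressions in the different charts. *)
Definition tensor_on p (D : set M) (T : tens R n p) : Prop :=
  [/\ pulled D (fun q : M => q) T T, on_charts D (fun i x => multilinear (T i x))
    & forall i v, smooth_on (chart_img i D) (fun x => T i x v)].

Definition form_on p (D : set M) (T : tens R n p) : Prop :=
  tensor_on D T /\ on_charts D (fun i x => alternating (T i x)).

Definition vfield_on (D : set M) (V : vfield R n) : Prop :=
  related D (fun q : M => q) V V /\
  forall i, smooth_on (chart_img i D) (V i).

Definition endo_on (D : set M) (J : endo R n) : Prop :=
  [/\ on_chart_pairs D (fun q : M => q) (fun i j x => forall v,
        let f := rep (fun q : M => q) i j in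
        'D_(J i x v) f x = J j (f x) ('D_v f x)),
      on_charts D (fun i x => forall (c : R) u w,
        J i x (c *: u + w) = c *: J i x u + J i x w)
    & forall i v, smooth_on (chart_img i D) (fun x => J i x v)].

Definition riemannian (D : set M) (h : tens R n 2) : Prop :=
  [/\ tensor_on D h,
      on_charts D (fun i x => forall u w,
        h i x (pair2 u w) = h i x (pair2 w u))
    & on_charts D (fun i x => forall u, u != 0 -> 0 < h i x (pair2 u u))].

Definition complex_structure (D : set M) (J : endo R n) : Prop :=
  [/\ endo_on D J,
      on_charts D (fun i x => forall u, J i x (J i x u) = - u)
    & on_charts D (fun i x => forall u w, nijenhuis (J i) x u w = 0)].

Definition kahler (h : tens R n 2) (J : endo R n) (sg : tens R n 2) : Prop :=
  [/\ riemannian [set: M] h, complex_structure [set: M] J,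
      on_charts [set: M] (fun i x => forall u w,
        h i x (pair2 (J i x u) (J i x w)) = h i x (pair2 u w)),
      form_on [set: M] sg /\ on_charts [set: M] (fun i x => forall u w,
        sg i x (pair2 u w) = h i x (pair2 (J i x u) w))
    & eq_on [set: M] (dext sg) (@tens0 R n 3)].

End GeometricObjects.

Section SU3.
Variables (R : realType) (N : manifold R 6).

Definition Jfirst (J : endo R 6) (S : tens R 6 3) : tens R 6 3 := fun i x v =>
  S i x (fun a => if a == ord0 then J i x (v a) else v a).

(* A form psi = psp + i psm is of type (3,0) iff psi(J ., ., .) = i psi; the
   third component consists of the real and imaginary parts of this equation.
   The equality (2/3) sg^3 = 4 vol_h, for the complex orientation, holds for
   every Hermitian metric on a complex 3-fold and is not repeated. *)
Definition su3 (J : endo R 6) (sg : tens R 6 2) (psp psm : tens R 6 3) : Prop :=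
  [/\ form_on [set: N] psp, form_on [set: N] psm,
      eq_on [set: N] (Jfirst J psp) (fun i x v => - psm i x v) /\
      eq_on [set: N] (Jfirst J psm) psp,
      eq_on [set: N] (sg \wedge psp) (@tens0 R 6 5) /\
      eq_on [set: N] (sg \wedge psm) (@tens0 R 6 5)
    & eq_on [set: N] (psp \wedge psm)
        (fun i x v => 2 / 3 * (sg \wedge sg \wedge sg) i x v)].

Definition su3_isometry (W : set N) (sg : tens R 6 2) (psp psm : tens R 6 3)
    (U : vfield R 6) : Prop :=
  [/\ vfield_on W U, eq_on W (lie U sg) (@tens0 R 6 2),
      eq_on W (lie U psp) (@tens0 R 6 3) & eq_on W (lie U psm) (@tens0 R 6 3)].

Definition hamiltonian (W : set N) (sg : tens R 6 2) (t : N -> R)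
    (U : vfield R 6) : Prop :=
  vfield_on W U /\ eq_on W (iprod U sg) (fun i x v => - dfun t i x v).

Definition smooth_pos (W : set N) (t : N -> R) : Prop :=
  smooth_fun W t /\ forall p, W p -> 0 < t p.

Definition cond_i (W : set N) (J : endo R 6) (psp psm : tens R 6 3)
    (t : N -> R) : Prop :=
  let dclogt := dc J (fun p => ln (t p)) in
  eq_on W (dext psp) (fun i x v => - (1 / 2) * (dclogt \wedge psm) i x v) /\
  eq_on W (dext psm) (fun i x v => 1 / 2 * (dclogt \wedge psp) i x v).

Definition cond_ii (W : set N) (sg : tens R 6 2) (psp psm : tens R 6 3)
    (t : N -> R) : Prop :=
  exists U, hamiltonian W sg t U /\ su3_isometry W sg psp psm U.

End SU3.

Section G2.
Variable R : realType.

(* A coframe (e^1, ..., e^7) of R^7 is given by an invertible matrix A whose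
   columns are the e^i, i.e. e^i(v) = (v A)_i; the rows of A^-1 are then the
   dual frame. *)
Definition coframe (A : 'M[R]_7) (k : nat) : cov R 7 1 :=
  fun v => (v ord0 *m A) ord0 (inord k.-1).

(* (e12 + e34 + e56) ^ e7 + Re ((e1 + i e2) ^ (e3 + i e4) ^ (e5 + i e6)),
   the real part being e135 - e146 - e236 - e245. *)
Definition g2_model (A : 'M[R]_7) : cov R 7 3 :=
  let e := coframe A in
  let e2 a b := cwedge (e a) (e b) in
  let e3 a b c := cwedge (e2 a b) (e c) in
  fun v =>
    cwedge (fun u => e2 1 2 u + e2 3 4 u + e2 5 6 u) (e 7) v +
    (e3 1 3 5 v - e3 1 4 6 v - e3 2 3 6 v - e3 2 4 5 v).

Definition coframe_metric (A : 'M[R]_7) (u w : 'rV[R]_7) : R :=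
  \sum_(i < 7) (u *m A) ord0 i * (w *m A) ord0 i.

Definition coframe_vol m (A : 'M[R]_m) : cov R m m :=
  fun v => \det (\matrix_(i < m) (v i *m A)).

(* Hodge star of a p-form, for the metric and orientation of the coframe A
   (E being the dual frame):
     ( *a)(w) = 1/p! sum_f a(E_f1, .., E_fp) vol(E_f1, .., E_fp, w),
   so that a ^ *b = <a, b> vol. *)
Definition hodge p q (A : 'M[R]_(p + q)) (a : cov R (p + q) p) :
    cov R (p + q) q := fun w =>
  (p`!)%:R^-1 * \sum_(f : {ffun 'I_p -> 'I_(p + q)})
    let E := fun i : 'I_p => row (f i) (invmx A) in
    a E * coframe_vol A (fun k => match fintype.split k with
                                  | inl i => E i | inr j => w j end).

Variable Y : manifold R 7.

(* phi is a G2 structure on the open set D of Y, k the metric and sphi = *phi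
   the Hodge dual which it determines.  All coframes adapted to phi at a point
   differ by G2 < SO(7), so they give the same metric and the same dual. *)
Definition g2_structure (D : set Y) (phi : tens R 7 3) (k : tens R 7 2)
    (sphi : tens R 7 4) : Prop :=
  [/\ form_on D phi, riemannian D k, form_on D sphi
    & on_charts D (fun i x => exists2 A : 'M[R]_7, A \in unitmx &
        [/\ phi i x =1 g2_model A,
            forall u w, k i x (pair2 u w) = coframe_metric A u w
          & sphi i x =1 @hodge 3 4 A (phi i x)])].

Definition torsion_free_g2 (D : set Y) (phi : tens R 7 3) (k : tens R 7 2)
    (sphi : tens R 7 4) : Prop :=
  [/\ g2_structure D phi k sphi, eq_on D (dext phi) (@tens0 R 7 4)
    & eq_on D (dext sphi) (@tens0 R 7 5)].

(* "Nontrivial" is read as nowhere zero, all considerations being local near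
   points where V does not vanish. *)
Definition g2_isometry (D : set Y) (phi : tens R 7 3) (V : vfield R 7) : Prop :=
  [/\ vfield_on D V, eq_on D (lie V phi) (@tens0 R 7 3)
    & on_charts D (fun i x => V i x != 0)].

(* p and q lie on a common integral curve of V contained in D *)
Definition same_orbit (D : set Y) (V : vfield R 7) (p q : Y) : Prop :=
  exists (c : R -> Y) (a b : R), [/\ c a = p, c b = q
    & forall s, Num.min a b <= s <= Num.max a b ->
      [/\ D (c s), {for s, continuous c}
        & forall i, mdom i (c s) ->
            is_derive s 1 (fun r => mcrd i (c r)) (V i (mcrd i (c s)))]].

Variable N : manifold R 6.

(* The open set W of N is, through pi, the orbit space of V on D: the fibres
   of the surjective submersion pi : D -> W are exactly the orbits.  (That pi
   is constant along integral curves is the condition pi_* V = 0.) *)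
Definition orbit_projection (D : set Y) (V : vfield R 7) (W : set N)
    (pi : Y -> N) : Prop :=
  [/\ submersion D pi, pi @` D = W, related D pi V (fun _ _ => 0)
    & forall p q, D p -> D q -> pi p = pi q -> same_orbit D V p q].

Variables (k : tens R 7 2) (V : vfield R 7).

Definition quot_t (i : nat) (x : 'rV[R]_7) : R :=
  k i x (pair2 (V i x) (V i x)) `^ (- (1 / 2)).

Definition quot_eta : tens R 7 1 := fun i x v =>
  k i x (pair2 (v ord0) (quot_t i x ^+ 2 *: V i x)).

Definition quot_h : tens R 7 2 := fun i x v =>
  (quot_t i x)^-1 * (k i x v - quot_t i x ^- 2 *
    (quot_eta i x (fun=> v ord0) * quot_eta i x (fun=> v ord_max))).

Definition quot_Psip (phi : tens R 7 3) : tens R 7 3 := fun i x v =>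
  (quot_t i x)^-1 * (phi i x v - (iprod V phi \wedge quot_eta) i x v).

Definition quot_Psim (sphi : tens R 7 4) : tens R 7 3 := fun i x v =>
  - iprod V sphi i x v.

(* The structure (h, J, sg, psp, psm) on the open set W of N is the quotient,
   with k(V,V)^(-1/2) = t, of the torsion-free G2 structure phi on D by V.  The
   forms and the metric constructed on D are the pullbacks of those on W. *)
Definition g2_quotient (D : set Y) (phi : tens R 7 3) (sphi : tens R 7 4)
    (pi : Y -> N) (W : set N) (h : tens R 6 2) (J : endo R 6) (sg : tens R 6 2)
    (psp psm : tens R 6 3) (t : N -> R) : Prop :=
  [/\ [/\ open D, torsion_free_g2 D phi k sphi & g2_isometry D phi V],
      [/\ open W, smooth_pos W t & orbit_projection D V W pi],
      [/\ on_charts D (fun i x => t (pi (mpar Y i x)) = quot_t i x),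
          pulled D pi h quot_h & pulled D pi sg (iprod V phi)],
      on_charts W (fun i x => forall u w,
        h i x (pair2 (J i x u) w) = sg i x (pair2 u w))
    & pulled D pi psp
        (fun i x v => quot_t i x `^ (- (1 / 2)) * quot_Psip phi i x v) /\
      pulled D pi psm
        (fun i x v => quot_t i x `^ (- (1 / 2)) * quot_Psim sphi i x v)].

End G2.

Section Quotient.
Variables (R : realType) (N : manifold R 6).

Definition is_g2_quotient (W : set N) (h : tens R 6 2) (J : endo R 6)
    (sg : tens R 6 2) (psp psm : tens R 6 3) (t : N -> R) : Prop :=
  exists (Y : manifold R 7) (D : set Y) (phi : tens R 7 3) (k : tens R 7 2)
    (sphi : tens R 7 4) (V : vfield R 7) (pi : Y -> N),
    g2_quotient k V D phi sphi pi W h J sg psp psm t.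

Definition locally_g2_quotient (W : set N) (h : tens R 6 2) (J : endo R 6)
    (sg : tens R 6 2) (psp psm : tens R 6 3) (t : N -> R) : Prop :=
  forall p, W p -> exists W' : set N,
    [/\ W' p, W' `<=` W & is_g2_quotient W' h J sg psp psm t].

End Quotient.

Section ProductWithLine.
Variable R : realType.

Lemma near_eq_differentiable (V W : normedModType R) (f g : V -> W) (x : V) :
  (\near x, f x = g x) -> differentiable f x -> differentiable g x.
Proof.
move=> fg df; have fgx : f x = g x := nbhs_singleton fg.
apply/diffP => /=; apply: (@getPex _ (fun dg : {linear V -> W} =>
  continuous dg /\ forall y, g y = g (lim (nbhs x)) + dg (y - lim (nbhs x))
    +o_(y \near x) (y - lim (nbhs x)))).
exists ('d f x); split; first exact: diff_continuous.
suff : g = (fun y => g (lim (nbhs x)) + 'd f x (y - lim (nbhs x)))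
    +o_x (fun y => y - lim (nbhs x)).
  by move=> H y; have := congr1 (fun F => F y) H.
have H : f = (fun y => f (lim (nbhs x)) + 'd f x (y - lim (nbhs x)))
    +o_x (fun y => y - lim (nbhs x)).
  by apply/funext => z; apply: diffE.
apply/eqaddoP => e e0; move/eqaddoP : H => /(_ e e0) H; near=> y.
have -> : (g - (fun y => g (lim (nbhs x)) + 'd f x (y - lim (nbhs x)))) y =
          (f - (fun y => f (lim (nbhs x)) + 'd f x (y - lim (nbhs x)))) y.
  rewrite !fctE lim_id// fgx; congr (_ - _); apply/esym; near: y; exact: fg.
by near: y; exact: H.
Unshelve. all: by end_near. Qed.

Lemma smooth_on_comp_linear m n (V : normedModType R)
    (L : {linear 'rV[R]_m -> 'rV[R]_n}) (A : set 'rV[R]_n) (f : 'rV[R]_n -> V) :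
  continuous L -> smooth_on A f -> smooth_on (L @^-1` A) (f \o L).
Proof.
move=> cL sf s x Ax.
have -> : foldr (fun v g => 'D_v g) (f \o L) s =
          foldr (fun v g => 'D_v g) f (map L s) \o L.
  elim: s => //= v s ->; apply/funext => y; rewrite /derive /=.
  have H r : L (r *: v + y) = r *: L v + L y by rewrite linearD linearZ.
  by under eq_fun do rewrite H.
apply: differentiable_comp; first exact: linear_differentiable.
exact: sf.
Qed.

Lemma smooth_on_linear_comp n (V W : normedModType R) (L : {linear V -> W})
    (A : set 'rV[R]_n) (f : 'rV[R]_n -> V) :
  open A -> continuous L -> smooth_on A f -> smooth_on A (L \o f).
Proof.
move=> oA cL sf s.
have E x : A x -> foldr (fun v g => 'D_v g) (L \o f) s x =
    L (foldr (fun v g => 'D_v g) f s x).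
  elim: s x => //= v s IH x Ax.
  have -> : 'D_v (foldr (fun v g => 'D_v g) (L \o f) s) x =
            'D_v (L \o foldr (fun v g => 'D_v g) f s) x.
    apply: near_eq_derive; near=> y; apply: IH; near: y.
    exact: open_nbhs_nbhs.
  have df := sf s x Ax; have dL y : differentiable L y.
    exact: linear_differentiable.
  rewrite !deriveE//; last exact: differentiable_comp.
  by rewrite diff_comp//= diff_lin.
move=> x Ax; apply: (@near_eq_differentiable _ _
  (L \o foldr (fun v g => 'D_v g) f s)).
  by near=> y; apply/esym/E; near: y; exact: open_nbhs_nbhs.
apply: differentiable_comp; first exact: sf.
exact: linear_differentiable.
Unshelve. all: by end_near. Qed.

Lemma smooth_onD n (V : normedModType R) (A : set 'rV[R]_n)
    (f g : 'rV[R]_n -> V) :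
  open A -> smooth_on A f -> smooth_on A g -> smooth_on A (f \+ g).
Proof.
move=> oA sf sg s; pose D u (h : 'rV[R]_n -> V) := foldr (fun v g => 'D_v g) h u.
have E x : A x -> D s (f \+ g) x = (D s f + D s g) x.
  elim: s x => //= v s IH x Ax.
  have -> : 'D_v (D s (f \+ g)) x = 'D_v (D s f + D s g) x.
    apply: near_eq_derive; near=> y; apply: IH; near: y.
    exact: open_nbhs_nbhs.
  by rewrite deriveD//; apply: diff_derivable; [exact: sf|exact: sg].
move=> x Ax; apply: (@near_eq_differentiable _ _ (D s f + D s g)).
  by near=> y; apply/esym/E; near: y; exact: open_nbhs_nbhs.
by apply: differentiableD; [exact: sf|exact: sg].
Unshelve. all: by end_near. Qed.

Lemma smooth_on_id n (A : set 'rV[R]_n) : smooth_on A id.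
Proof.
move=> s x _; suff [|[c ->]] : foldr (fun v g => 'D_v g) id s = id \/
    exists c, foldr (fun v g => 'D_v g) (@id 'rV[R]_n) s = cst c.
- by move=> ->.
- exact: differentiable_cst.
elim: s => [|v s [|[c]]] /=; first by left.
  by move=> ->; right; exists v; apply/funext => y; rewrite derive_id.
by move=> ->; right; exists 0; apply/funext => y; rewrite derive_cst.
Qed.

Variable n : nat.

Definition row_inl (a : 'rV[R]_1) : 'rV[R]_(1 + n) := row_mx a 0.
Definition row_inr (b : 'rV[R]_n) : 'rV[R]_(1 + n) := row_mx 0 b.

Lemma row_inl_linear : linear row_inl.
Proof. by move=> c a b; rewrite /row_inl scale_row_mx add_row_mx scaler0 addr0. Qed.
HB.instance Definition _ := GRing.isLinear.Build R _ _ _ row_inl row_inl_linear.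

Lemma row_inr_linear : linear row_inr.
Proof. by move=> c a b; rewrite /row_inr scale_row_mx add_row_mx scaler0 addr0. Qed.
HB.instance Definition _ := GRing.isLinear.Build R _ _ _ row_inr row_inr_linear.

Lemma row_inl_continuous : continuous row_inl.
Proof.
move=> u A /nbhs_ballP[e /= e0 eA].
apply/nbhs_ballP; exists e => //= v [_ uv]; apply: eA; split => // i j.
rewrite /row_inl; case: (split_ordP j) => k ->; rewrite ?row_mxEl ?row_mxEr.
  exact: uv.
by rewrite mxE; exact: ballxx.
Qed.

Lemma row_inr_continuous : continuous row_inr.
Proof.
move=> u A /nbhs_ballP[e /= e0 eA].
apply/nbhs_ballP; exists e => //= v [_ uv]; apply: eA; split => // i j.
rewrite /row_inr; case: (split_ordP j) => k ->; rewrite ?row_mxEl ?row_mxEr.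
  by rewrite mxE; exact: ballxx.
exact: uv.
Qed.

Lemma row_mx_inlr (a : 'rV[R]_1) (b : 'rV[R]_n) :
  row_mx a b = row_inl a + row_inr b.
Proof. by rewrite /row_inl /row_inr add_row_mx addr0 add0r. Qed.

Variable N : manifold R n.

(* The manifold R x N, in the charts (y, p) |-> (y, mcrd i p). *)
Definition line_dom (i : nat) : set (R * N) := [set z | mdom i z.2].
Definition line_crd (i : nat) (z : R * N) : 'rV[R]_(1 + n) :=
  row_mx (const_mx z.1) (mcrd i z.2).
Definition line_par (i : nat) (w : 'rV[R]_(1 + n)) : R * N :=
  (lsubmx w ord0 ord0, mpar N i (rsubmx w)).

Let const_mx_lsub (w : 'rV[R]_(1 + n)) :
  const_mx (lsubmx w ord0 ord0) = lsubmx w :> 'rV[R]_1.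
Proof. by apply/rowP => j; rewrite mxE (ord1 j). Qed.

Lemma line_img (D : set N) i :
  line_crd i @` [set z | D z.2] = rsubmx @^-1` (mcrd i @` D).
Proof.
apply/seteqP; split=> [_ [[y p] Dp <-]|w [p Dp pw]] /=.
  by rewrite /line_crd row_mxKr; exists p.
exists (lsubmx w ord0 ord0, p) => //.
by rewrite /line_crd /= const_mx_lsub pw hsubmxK.
Qed.

Lemma line_hausdorff : hausdorff_space (R * N)%type.
Proof.
move=> [y p] [z q] H; congr pair.
  apply: (@Rhausdorff R) => A B yA zB.
  have := H (A `*` setT) (B `*` setT).
  case.
  - exists (A, setT); first by split => //=; exact: filterT.
    by move=> ? [].
  - exists (B, setT); first by split => //=; exact: filterT.
    by move=> ? [].
  - by move=> [a b] [[/= Aa _] [/= Ba _]]; exists a.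
apply: (@mhausdorff R n N) => A B pA qB.
have := H (setT `*` A) (setT `*` B).
case.
- exists (setT, A); first by split => //=; exact: filterT.
    by move=> ? [].
- exists (setT, B); first by split => //=; exact: filterT.
    by move=> ? [].
- by move=> [a b] [[/= _ Aa] [/= _ Ba]]; exists b.
Qed.

Lemma line_cover (z : R * N) : exists i, line_dom i z.
Proof. exact: mcover. Qed.

Lemma line_dom_open i : open (line_dom i).
Proof.
apply: (@open_comp _ _ snd (mdom i)); last exact: mdom_open.
by move=> z _; exact: cvg_snd.
Qed.

Lemma line_img_open i : open (line_crd i @` line_dom i).
Proof.
rewrite line_img; apply: open_comp; last exact: mimg_open.
by move=> w _; exact: continuous_rsubmx.
Qed.

Lemma line_crdK i z : line_dom i z -> line_par i (line_crd i z) = z.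
Proof.
case: z => y p; rewrite /line_dom /line_par /line_crd /= => Dp.
by rewrite row_mxKl row_mxKr mxE mcrdK.
Qed.

Lemma line_crd_continuous i z : line_dom i z -> {for z, continuous (line_crd i)}.
Proof.
move=> Dz; rewrite /continuous_at.
have -> : line_crd i = (fun w => row_inl (const_mx w.1) + row_inr (mcrd i w.2)).
  by apply/funext => w; rewrite /line_crd row_mx_inlr.
apply: cvgD.
  apply: (@continuous_comp _ _ _ (fun w : R * N => const_mx w.1 : 'rV[R]_1)).
    move=> A /nbhs_ballP[e /= e0 eA].
    have : \forall w \near z, ball z.1 e w.1.
      by apply: cvg_fst; exact: nbhsx_ballx.
    apply: filterS => w zw; apply: eA; split=> // a b; rewrite !mxE; exact: zw.
  exact: row_inl_continuous.
apply: (@continuous_comp _ _ _ (fun w : R * N => mcrd i w.2)).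
  apply: (@continuous_comp _ _ _ snd (mcrd i)); first exact: cvg_snd.
  exact: mcrd_continuous.
exact: row_inr_continuous.
Qed.

Lemma line_par_continuous i z :
  line_dom i z -> {for line_crd i z, continuous (line_par i)}.
Proof.
move=> Dz; set w0 := line_crd i z.
have h1 : {for w0, continuous (fun w : 'rV[R]_(1 + n) => lsubmx w ord0 ord0)}.
  apply: (@continuous_comp _ _ _ (fun w : 'rV[R]_(1 + n) => lsubmx w)
    (fun a => a ord0 ord0)); first exact: continuous_lsubmx.
  exact: coord_continuous.
have h2 : {for w0, continuous (fun w : 'rV[R]_(1 + n) => mpar N i (rsubmx w))}.
  apply: (@continuous_comp _ _ _ (fun w : 'rV[R]_(1 + n) => rsubmx w)
    (mpar N i)); first exact: continuous_rsubmx.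
  by rewrite row_mxKr; exact: mpar_continuous.
exact: (cvg_pair h1 h2).
Qed.

Lemma line_transition_smooth i j :
  smooth_on (line_crd i @` (line_dom i `&` line_dom j)) (line_crd j \o line_par i).
Proof.
rewrite (line_img (mdom i `&` mdom j)).
have -> : line_crd j \o line_par i =
    (row_inl \o lsubmx) \+ (row_inr \o ((mcrd j \o mpar N i) \o rsubmx)).
  apply/funext => w; rewrite /= -row_mx_inlr /line_crd /=.
  by rewrite const_mx_lsub.
have oA : open (@mcrd R n N i @` (mdom i `&` mdom j) : set 'rV[R]_n).
  rewrite openE => _ [p [pi pj] <-].
  have h1 : nbhs (mcrd i p) (@mcrd R n N i @` mdom i).
    by apply: open_nbhs_nbhs; split; [exact: mimg_open|exists p].
  have h2 : nbhs (mcrd i p) (mpar N i @^-1` mdom j).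
    apply: mpar_continuous => //; rewrite mcrdK//; apply: open_nbhs_nbhs.
    by split => //; exact: mdom_open.
  apply: filterS (filterI h1 h2) => _ [[q qi <-] /= qj].
  by exists q => //; split => //; rewrite mcrdK in qj.
have oB : open ((rsubmx : 'rV[R]_(1 + n) -> 'rV[R]_n) @^-1`
    (@mcrd R n N i @` (mdom i `&` mdom j))).
  by apply: open_comp => // w _; exact: continuous_rsubmx.
apply: smooth_onD => //.
  apply: smooth_on_linear_comp => //; first exact: row_inl_continuous.
  apply: (@smooth_on_linear_comp _ _ _ lsubmx _ id) => //.
    exact: continuous_lsubmx.
  exact: smooth_on_id.
apply: smooth_on_linear_comp => //; first exact: row_inr_continuous.
apply: smooth_on_comp_linear; first exact: continuous_rsubmx.
exact: mtransition_smooth.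
Qed.

Definition line_manifold : manifold R (1 + n) :=
  Manifold line_hausdorff line_cover line_dom_open line_img_open line_crdK
    line_crd_continuous line_par_continuous line_transition_smooth.

End ProductWithLine.

Section LocalModel.
Variables (R : realType) (N : manifold R 6).
Variables (h sg : tens R 6 2) (psp psm : tens R 6 3) (t : N -> R).
Variable etaN : tens R 6 1.

Definition pullN p (T : tens R 6 p) : tens R (1 + 6) p :=
  fun i w v => T i (rsubmx w) (fun a => rsubmx (v a)).

Definition dy : tens R (1 + 6) 1 := fun _ _ v => lsubmx (v ord0) ord0 ord0.

Definition ddy : vfield R (1 + 6) := fun _ _ => row_inl 6 (const_mx 1).

Definition model_t (i : nat) (w : 'rV[R]_(1 + 6)) : R :=
  t (mpar N i (rsubmx w)).

Definition model_eta : tens R (1 + 6) 1 :=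
  fun i w v => dy i w v + pullN etaN i w v.

Definition model_k : tens R (1 + 6) 2 := fun i w v =>
  model_t i w * pullN h i w v +
  model_t i w ^- 2 *
    (model_eta i w (fun=> v ord0) * model_eta i w (fun=> v ord_max)).

Definition model_phi : tens R (1 + 6) 3 := fun i w v =>
  (pullN sg \wedge model_eta) i w v + model_t i w `^ (3 / 2) * pullN psp i w v.

Definition model_sphi : tens R (1 + 6) 4 := fun i w v =>
  model_t i w `^ (1 / 2) * (pullN psm \wedge model_eta) i w v +
  1 / 2 * model_t i w ^+ 2 * (pullN sg \wedge pullN sg) i w v.

Definition eta_potential (W : set N) (U : vfield R 6) : Prop :=
  form_on W etaN /\
  eq_on W (dext etaN)
    (fun i x v => - (t (mpar N i x) `^ (1 / 2) * iprod U psp i x v)).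

End LocalModel.

(* Near each point of D, the map F = (y, pi) is a diffeomorphism onto an open
   subset E of R x N under which V, k, phi, *phi and eta = k(., t^2 V) become
   the objects of the explicit model. *)
Definition locally_model (R : realType) (Y : manifold R 7) (N : manifold R 6)
    (D : set Y) (phi : tens R 7 3) (k : tens R 7 2) (sphi : tens R 7 4)
    (V : vfield R 7) (pi : Y -> N) (W : set N) (h sg : tens R 6 2)
    (psp psm : tens R 6 3) (t : N -> R) (U : vfield R 6) : Prop :=
  forall q, D q ->
  exists (D' : set Y) (W' : set N) (E : set (line_manifold N))
    (F : Y -> line_manifold N) (G : line_manifold N -> Y) (etaN : tens R 6 1),
  [/\ [/\ D' q, D' `<=` D, open W', W' `<=` W
        & forall z : R * N, E z -> W' z.2],
      diffeo D' E F G /\ (forall p, D' p -> (F p : R * N).2 = pi p),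
      eta_potential psp t etaN W' U,
      related D' F V (@ddy R)
    & [/\ pulled D' F (model_k h t etaN) k,
          pulled D' F (model_phi sg psp t etaN) phi,
          pulled D' F (model_sphi sg psm t etaN) sphi
        & pulled D' F (model_eta etaN) (quot_eta k V)]].

(* Main.v *)
(* Everything is done in charts.  Put psi'+- = t^(1/2) psi+-.  Since dt = - i_U sg, one has
   (d^c log t) ^ psi-+ = +- t^-1 dt ^ psi+-, so that (i) says that psi'+ and psi'- are closed.

   For a quotient, phi = sg ^ eta + t psi'+ and *phi = psi'- ^ eta + t^2/2 sg ^ sg.  The
   contraction of d phi = 0 with V gives sg ^ i_V d eta = 0, hence i_V d eta = 0; that of
   d *phi = 0 then gives d psi'- = 0, and d psi'+ = 0 because J is integrable.  Now d phi = 0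
   reads sg ^ (d eta + i_U psi'+) = 0, i.e. d eta = - i_U psi'+, so i_U psi'+ is closed;
   again by integrability so is i_U psi'-, and Cartan's formula yields L_U psi+- = 0.

   Conversely L_U psi+ = 0 makes i_U psi'+ closed, the Poincare lemma provides etaN, and the
   explicit model is a torsion-free G2 structure by the identities
   sg ^ i_U psi+ = dt ^ psi+ and psi- ^ i_U psi+ = - dt ^ sg ^ sg.

   Finally eta - pi^* etaN is closed, hence equal to dy near a point, and (y, pi) is a local
   diffeomorphism by the inverse function theorem.

   The algebraic identities are checked on adapted frames, on which all the forms involved
   take integer values. *)

From HB Require Import structures.
From mathcomp Require Import all_boot all_order all_algebra all_fingroup.
From mathcomp Require Import all_classical all_reals all_analysis.
From mathcomp Require Import ring lra zify.
Require Import Defs.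

Set Implicit Arguments.
Unset Strict Implicit.
Unset Printing Implicit Defensive.

Import Order.TTheory GRing.Theory Num.Theory.
Import numFieldNormedType.Exports.

Local Open Scope classical_set_scope.
Local Open Scope ring_scope.

(** Both appeals to integrability are one type argument. A form Psi of type (q,0) has a differential
    of type (q+1,0) + (q,1), without (q-1,2) part because [J] is integrable. If its real or
    imaginary part is closed, then d Psi is up to a factor i a real form, so it is also of the
    conjugate types (0,q+1) + (1,q); for q >= 2 these are disjoint from the former and d Psi = 0.
    This is applied to psi' with q = 3 and to i_U psi' with q = 2, and proved with real forms only.

    Cancelling sg is Lefschetz injectivity: on a 6-dimensional space the product with sg is
    injective on 1-forms and on 2-forms.

    The quotient records *phi only through i_V *phi. The remaining part, t^2/2 sg ^ sg, comes from
    an identity of the G2 model: |v|^2 *phi = 1/2 (i_v phi)^2 + v^flat ^ i_v *phi.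

    Forms are bare functions of tuples of vectors. Several rules of the exterior calculus are
    therefore proved by expansion on explicit vectors, in just the degrees that occur. *)

(** * Calculus of directional derivatives *)

Section DirectionalDerivative.
Variable R : realType.
Implicit Types V W : normedModType R.

Lemma Dadd V W (f g : V -> W) x v : differentiable f x -> differentiable g x ->
  'D_v (fun y => f y + g y) x = 'D_v f x + 'D_v g x.
Proof.
by move=> df dg; rewrite -[LHS]/('D_v (f + g) x) deriveD//; exact: diff_derivable.
Qed.

Lemma Dopp V W (f : V -> W) x v : differentiable f x ->
  'D_v (fun y => - f y) x = - 'D_v f x.
Proof.
by move=> df; rewrite -[LHS]/('D_v (- f) x) deriveN//; exact: diff_derivable.
Qed.

Lemma Dmul V (f g : V -> R) x v : differentiable f x -> differentiable g x ->
  'D_v (fun y => f y * g y) x = 'D_v f x * g x + f x * 'D_v g x.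
Proof.
move=> df dg; rewrite -[LHS]/('D_v (f * g) x) deriveM; try exact: diff_derivable.
by rewrite addrC /GRing.scale /= (mulrC (g x)).
Qed.

Lemma Dcomp V W (U : normedModType R) (f : W -> U) (g : V -> W) x v :
  differentiable g x -> differentiable f (g x) ->
  'D_v (fun y => f (g y)) x = 'D_('D_v g x) f (g x).
Proof.
move=> dg df; rewrite -[LHS]/('D_v (f \o g) x).
rewrite deriveE; last exact: differentiable_comp.
by rewrite diff_comp// (deriveE _ df) (deriveE _ dg).
Qed.

(** Differentiability is part of the conclusion because the induction for the formula needs it for
    the tail of the sum. *)
Lemma Dsum V W (I : Type) (r : seq I) (P : pred I) (F : I -> V -> W) x v :
  (forall i, P i -> differentiable (F i) x) ->
  differentiable (fun y => \sum_(i <- r | P i) F i y) x /\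
  'D_v (fun y => \sum_(i <- r | P i) F i y) x = \sum_(i <- r | P i) 'D_v (F i) x.
Proof.
move=> dF; elim: r => [|i r [IH1 IH2]].
  under eq_fun do rewrite big_nil.
  by rewrite big_nil; split; [exact: differentiable_cst|exact: derive_cst].
under eq_fun do rewrite big_cons; rewrite big_cons.
case: ifPn => // Pi; rewrite Dadd ?IH2//; last exact: dF.
by split => //; apply: differentiableD => //; exact: dF.
Qed.

Lemma Dlin V W (f : V -> W) x (c : R) u v : differentiable f x ->
  'D_(c *: u + v) f x = c *: 'D_u f x + 'D_v f x.
Proof. by move=> df; rewrite !deriveE// linearP. Qed.

Lemma DZ V W (f : V -> W) x (c : R) u : differentiable f x ->
  'D_(c *: u) f x = c *: 'D_u f x.
Proof. by move=> df; rewrite !deriveE// linearZ. Qed.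

Lemma DZr V (f : V -> R) x (c : R) u : differentiable f x ->
  'D_(c *: u) f x = c * 'D_u f x.
Proof. by move=> df; rewrite !deriveE// linearZ. Qed.

Lemma DlinD V W (f : V -> W) x u v : differentiable f x ->
  'D_(u + v) f x = 'D_u f x + 'D_v f x.
Proof. by move=> df; rewrite !deriveE// linearD. Qed.

Lemma Dlinsum V W (f : V -> W) x (I : Type) (r : seq I) (c : I -> R) (u : I -> V) :
  differentiable f x ->
  'D_(\sum_(i <- r) c i *: u i) f x = \sum_(i <- r) c i *: 'D_(u i) f x.
Proof.
move=> df; rewrite deriveE// linear_sum; apply: eq_bigr => i _.
by rewrite linearZ deriveE.
Qed.

Lemma Dcoord n V (f : V -> 'rV[R]_n) x v j : differentiable f x ->
  'D_v (fun y => f y ord0 j) x = 'D_v f x ord0 j.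
Proof. by move=> df; rewrite derive_mx ?mxE//; exact: diff_derivable. Qed.

Lemma rV_delta n (u : 'rV[R]_n) : u = \sum_j u ord0 j *: 'e_j.
Proof. exact: row_sum_delta. Qed.

Lemma D_delta n W (f : 'rV[R]_n -> W) x v : differentiable f x ->
  'D_v f x = \sum_j v ord0 j *: 'D_('e_j) f x.
Proof. by move=> df; rewrite [in LHS](rV_delta v) Dlinsum. Qed.

Lemma D_deltar n (f : 'rV[R]_n -> R) x v : differentiable f x ->
  'D_v f x = \sum_j v ord0 j * 'D_('e_j) f x.
Proof. exact: (@D_delta n R^o). Qed.

Lemma open_near (T : topologicalType) (A : set T) (P : T -> Prop) x :
  open A -> A x -> (forall y, A y -> P y) -> \near x, P x.
Proof. by move=> oA Ax AP; near=> y; apply: AP; near: y; exact: open_nbhs_nbhs.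
Unshelve. all: by end_near. Qed.

Lemma D_eq_on V W (A : set V) (f g : V -> W) x v : open A -> A x ->
  (forall y, A y -> f y = g y) -> 'D_v f x = 'D_v g x.
Proof. by move=> oA Ax fg; apply: near_eq_derive; exact: open_near fg. Qed.

Lemma differentiable_coordsP n V (f : V -> 'rV[R]_n) x :
  (forall j, differentiable (fun y => f y ord0 j) x) -> differentiable f x.
Proof.
move=> df.
have -> : f = fun y => \sum_j (f y ord0 j) *: ('e_j : 'rV[R]_n).
  by apply/funext => y; rewrite -rV_delta.
have /(_ 0) [] // := @Dsum _ _ _ (index_enum 'I_n) predT
  (fun j y => f y ord0 j *: ('e_j : 'rV[R]_n)) x.
by move=> j _; exact: differentiableZl.
Qed.

End DirectionalDerivative.

(** * Stability properties of smoothness *)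

Section Smooth.
Variable R : realType.
Implicit Types (n m : nat) (V : normedModType R).

Lemma smooth_onW n V (A B : set 'rV[R]_n) (f : 'rV[R]_n -> V) :
  A `<=` B -> smooth_on B f -> smooth_on A f.
Proof. by move=> AB sf s x /AB; exact: sf. Qed.

Lemma smooth_on_diff n V (A : set 'rV[R]_n) (f : 'rV[R]_n -> V) x :
  smooth_on A f -> A x -> differentiable f x.
Proof. by move=> sf; exact: (sf [::]). Qed.

Lemma smooth_on_derive n V (A : set 'rV[R]_n) (f : 'rV[R]_n -> V) v :
  smooth_on A f -> smooth_on A ('D_v f).
Proof. by move=> sf s x Ax; have := sf (rcons s v) x Ax; rewrite foldr_rcons. Qed.

Lemma iterD_eq_on n V (A : set 'rV[R]_n) (f g : 'rV[R]_n -> V) s x : open A ->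
  (forall y, A y -> f y = g y) -> A x ->
  foldr (fun v g => 'D_v g) f s x = foldr (fun v g => 'D_v g) g s x.
Proof.
move=> oA fg; elim: s x => /= [|v s IH] x Ax; first exact: fg.
exact: (@D_eq_on _ _ _ A).
Qed.

Lemma smooth_on_eq n V (A : set 'rV[R]_n) (f g : 'rV[R]_n -> V) : open A ->
  (forall y, A y -> f y = g y) -> smooth_on A f -> smooth_on A g.
Proof.
move=> oA fg sf s x Ax; apply: near_eq_differentiable (sf s x Ax).
by apply: (open_near oA Ax) => y Ay; exact: (iterD_eq_on _ oA).
Qed.

(* Smoothness as the largest class of differentiable functions stable under
   directional derivatives. *)
Lemma smooth_on_coind n V (A : set 'rV[R]_n) (P : ('rV[R]_n -> V) -> Prop) :
  open A -> (forall f, P f -> (forall x, A x -> differentiable f x) /\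
    forall v, exists g, P g /\ forall x, A x -> 'D_v f x = g x) ->
  forall f, P f -> smooth_on A f.
Proof.
move=> oA PA f Pf s; elim/last_ind: s f Pf => [|s v IH] f Pf x Ax.
  by have [df _] := PA f Pf; exact: df.
rewrite foldr_rcons; have [_ /(_ v) [g [Pg fg]]] := PA f Pf.
apply: near_eq_differentiable (IH g Pg x Ax).
apply: (open_near oA Ax) => y Ay; apply: (iterD_eq_on _ oA) => // z Az.
by rewrite fg.
Qed.

Lemma smooth_on_coord n m (A : set 'rV[R]_n) (f : 'rV[R]_n -> 'rV[R]_m) j :
  open A -> smooth_on A f -> smooth_on A (fun x => f x ord0 j).
Proof.
(* The class for the coinduction: coordinates of iterated derivatives of [f]. *)
move=> oA sf; pose P g := exists s, forall x, A x ->
  g x = foldr (fun v g => 'D_v g) f s x ord0 j.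
apply: (@smooth_on_coind n R A P oA); last by exists [::].
move=> g [s gE]; have dE x : A x -> differentiable
    (fun y => foldr (fun v g => 'D_v g) f s y ord0 j) x.
  move=> Ax; have := sf s x Ax => dsf.
  exact: (differentiable_comp dsf (differentiable_coord _ _ _)).
split=> [x Ax|v].
  by apply: near_eq_differentiable (dE x Ax); apply: (open_near oA Ax) => y /gE.
exists (fun x => foldr (fun v g => 'D_v g) f (v :: s) x ord0 j); split.
  by exists (v :: s).
move=> x Ax; rewrite (D_eq_on v oA Ax gE) Dcoord//; exact: sf.
Qed.

(** The derivative of such an expression is again such an expression, so the class fits the
    coinduction principle, and one induction gives stability under all these operations. [SCcomp]
    composes smooth functions themselves, so that the chain rule stays inside the class. *)
Inductive smooth_closure n (A : set 'rV[R]_n) : ('rV[R]_n -> R) -> Prop :=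
| SCbase f : smooth_on A f -> smooth_closure A f
| SCadd f g : smooth_closure A f -> smooth_closure A g ->
    smooth_closure A (fun x => f x + g x)
| SCmul f g : smooth_closure A f -> smooth_closure A g ->
    smooth_closure A (fun x => f x * g x)
| SCinv f : (forall x, A x -> f x != 0) -> smooth_closure A f ->
    smooth_closure A (fun x => (f x)^-1)
| SCpow f a : (forall x, A x -> 0 < f x) -> smooth_closure A f ->
    smooth_closure A (fun x => f x `^ a)
| SCcomp m (B : set 'rV[R]_m) f (g : 'rV[R]_n -> 'rV[R]_m) :
    smooth_on B f -> smooth_on A g -> (forall x, A x -> B (g x)) ->
    smooth_closure A (fun x => f (g x)).

Lemma smooth_on_cst n V (A : set 'rV[R]_n) (c : V) : smooth_on A (fun=> c).
Proof.
move=> s x _; have [d E] : exists d : V,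
    foldr (fun (v : 'rV[R]_n) (g : 'rV[R]_n -> V) => 'D_v g) (fun=> c) s = (fun=> d).
  elim: s => [|v s [d /= ->]]; first by exists c.
  by exists 0; apply/funext => y; rewrite derive_cst.
by rewrite /= in E *; rewrite E; exact: differentiable_cst.
Qed.

Lemma smooth_closure_sum n (A : set 'rV[R]_n) (I : Type) (r : seq I) (P : pred I)
    (F : I -> 'rV[R]_n -> R) :
  (forall i, P i -> smooth_closure A (F i)) ->
  smooth_closure A (fun x => \sum_(i <- r | P i) F i x).
Proof.
move=> sF; elim: r => [|i r IH].
  by under eq_fun do rewrite big_nil; apply: SCbase; exact: smooth_on_cst.
under eq_fun do rewrite big_cons; have [Pi|//] := boolP (P i).
by apply: SCadd => //; exact: sF.
Qed.

Lemma is_derive_powR (a x : R) : 0 < x ->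
  differentiable (fun y : R => y `^ a) x /\
  forall v, 'D_v (fun y : R => y `^ a) x = v * (a * x `^ (a - 1)).
Proof.
move=> x0; have H := is_derive1_powR a x0; have dx : differentiable (fun y : R => y `^ a) x.
  by apply/derivable1_diffP; have [] := H.
split => // v; rewrite (deriveE _ dx).
have {1}-> : v = v *: (1 : R^o) by rewrite /GRing.scale /= mulr1.
by rewrite linearZ -(deriveE _ dx) derive_val.
Qed.

Lemma smooth_closureP n (A : set 'rV[R]_n) (f : 'rV[R]_n -> R) : open A ->
  smooth_closure A f -> smooth_on A f.
Proof.
move=> oA; apply: smooth_on_coind => // {}f; elim=> {f}.
- move=> f sf; split=> [x Ax|v]; first exact: smooth_on_diff sf Ax.
  by exists ('D_v f); split => //; apply: SCbase; exact: smooth_on_derive.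
- move=> f g sf [df Df] sg [dg Dg]; split=> [x Ax|v].
    by apply: differentiableD; [exact: df|exact: dg].
  have [f' [sf' fE]] := Df v; have [g' [sg' gE]] := Dg v.
  exists (fun x => f' x + g' x); split; first exact: SCadd.
  by move=> x Ax; rewrite Dadd ?fE ?gE//; [exact: df|exact: dg].
- move=> f g sf [df Df] sg [dg Dg]; split=> [x Ax|v].
    by apply: differentiableM; [exact: df|exact: dg].
  have [f' [sf' fE]] := Df v; have [g' [sg' gE]] := Dg v.
  exists (fun x => f' x * g x + f x * g' x); split.
    by apply: SCadd; exact: SCmul.
  by move=> x Ax; rewrite Dmul ?fE ?gE//; [exact: df|exact: dg].
- move=> f f0 sf [df Df]; split=> [x Ax|v].
    by apply: differentiableV; [exact: df|exact: f0].
  have [f' [sf' fE]] := Df v.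
  exists (fun x => (- 1) * f' x * ((f x)^-1 * (f x)^-1)); split.
    apply: SCmul; first by apply: SCmul => //; apply/SCbase/smooth_on_cst.
    by apply: SCmul; exact: SCinv.
  move=> x Ax; rewrite -[LHS]/('D_v (fun x => (f x)^-1) x) deriveV ?fE//.
  - by rewrite /GRing.scale /= expr2 invfM; ring.
  - exact: f0.
  - by apply: diff_derivable; exact: df.
- move=> f a f0 sf [df Df]; split=> [x Ax|v].
    have [h _] := is_derive_powR a (f0 x Ax).
    exact: (differentiable_comp (df x Ax) h).
  have [f' [sf' fE]] := Df v.
  exists (fun x => f' x * (a * f x `^ (a - 1))); split.
    apply: SCmul => //; apply: SCmul; first by apply/SCbase/smooth_on_cst.
    exact: SCpow.
  move=> x Ax; have [h hE] := is_derive_powR a (f0 x Ax).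
  by rewrite (Dcomp v (df x Ax) h) hE fE.
move=> m B f g sf sg AB; split=> [x Ax|v].
  exact: (differentiable_comp (smooth_on_diff sg Ax) (smooth_on_diff sf (AB x Ax))).
(* Chain rule in coordinates: a sum of products of a base function with a composite of the same
   kind. *)
exists (fun x => \sum_j 'D_v g x ord0 j * 'D_('e_j) f (g x)); split.
  apply: smooth_closure_sum => j _; apply: SCmul.
    by apply: SCbase; apply: smooth_on_coord => //; exact: smooth_on_derive.
  exact: (SCcomp (smooth_on_derive ('e_j) sf) sg AB).
move=> x Ax; have df := smooth_on_diff sf (AB x Ax).
rewrite (Dcomp _ (smooth_on_diff sg Ax) df).
exact: D_deltar.
Qed.

Section Closure.
Variables (n : nat) (A : set 'rV[R]_n).
Hypothesis oA : open A.
Implicit Types f g : 'rV[R]_n -> R.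

Lemma smoothD f g : smooth_on A f -> smooth_on A g -> smooth_on A (fun x => f x + g x).
Proof. by move=> *; apply: smooth_closureP => //; apply: SCadd; exact: SCbase. Qed.

Lemma smoothM f g : smooth_on A f -> smooth_on A g -> smooth_on A (fun x => f x * g x).
Proof. by move=> *; apply: smooth_closureP => //; apply: SCmul; exact: SCbase. Qed.

Lemma smoothV f : (forall x, A x -> f x != 0) -> smooth_on A f ->
  smooth_on A (fun x => (f x)^-1).
Proof. by move=> *; apply: smooth_closureP => //; apply: SCinv => //; exact: SCbase. Qed.

Lemma smooth_pow f a : (forall x, A x -> 0 < f x) -> smooth_on A f ->
  smooth_on A (fun x => f x `^ a).
Proof. by move=> *; apply: smooth_closureP => //; apply: SCpow => //; exact: SCbase. Qed.

Lemma smoothN f : smooth_on A f -> smooth_on A (fun x => - f x).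
Proof.
move=> sf; apply: (smooth_on_eq (f := fun x => (- 1) * f x)) => //.
  by move=> x _; rewrite mulN1r.
by apply: smoothM => //; exact: smooth_on_cst.
Qed.

Lemma smoothB f g : smooth_on A f -> smooth_on A g -> smooth_on A (fun x => f x - g x).
Proof. by move=> sf sg; apply: smoothD => //; exact: smoothN. Qed.

Lemma smooth_sum (I : Type) (r : seq I) (P : pred I) (F : I -> 'rV[R]_n -> R) :
  (forall i, P i -> smooth_on A (F i)) ->
  smooth_on A (fun x => \sum_(i <- r | P i) F i x).
Proof.
by move=> sF; apply: smooth_closureP => //; apply: smooth_closure_sum => i /sF/SCbase.
Qed.

Lemma smooth_prod (I : Type) (r : seq I) (P : pred I) (F : I -> 'rV[R]_n -> R) :
  (forall i, P i -> smooth_on A (F i)) ->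
  smooth_on A (fun x => \prod_(i <- r | P i) F i x).
Proof.
move=> sF; elim: r => [|i r IH].
  by under eq_fun do rewrite big_nil; exact: smooth_on_cst.
under eq_fun do rewrite big_cons; have [Pi|//] := boolP (P i).
by apply: smoothM => //; exact: sF.
Qed.

Lemma smooth_comp m (B : set 'rV[R]_m) (f : 'rV[R]_m -> R) (g : 'rV[R]_n -> 'rV[R]_m) :
  smooth_on B f -> smooth_on A g -> (forall x, A x -> B (g x)) ->
  smooth_on A (fun x => f (g x)).
Proof. by move=> sf sg AB; apply: smooth_closureP => //; exact: SCcomp AB. Qed.

Lemma smooth_rV m (f : 'rV[R]_n -> 'rV[R]_m) :
  (forall j, smooth_on A (fun x => f x ord0 j)) -> smooth_on A f.
Proof.
move=> sf; pose P (g : 'rV[R]_n -> 'rV[R]_m) :=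
  forall j, smooth_on A (fun x => g x ord0 j).
apply: (@smooth_on_coind n _ A P oA) => // g Pg.
have dg x : A x -> differentiable g x.
  by move=> Ax; apply: differentiable_coordsP => j; exact: smooth_on_diff (Pg j) Ax.
split=> // v; exists ('D_v g); split => // j.
apply: (smooth_on_eq (f := 'D_v (fun x => g x ord0 j))) => //.
  by move=> x Ax; rewrite Dcoord//; exact: dg.
exact: smooth_on_derive.
Qed.

Lemma smooth_comp_rV m k (B : set 'rV[R]_m) (f : 'rV[R]_m -> 'rV[R]_k)
    (g : 'rV[R]_n -> 'rV[R]_m) : open B ->
  smooth_on B f -> smooth_on A g -> (forall x, A x -> B (g x)) ->
  smooth_on A (fun x => f (g x)).
Proof.
move=> oB sf sg AB; apply: smooth_rV => j.
by apply: (smooth_comp (f := fun y => f y ord0 j)) sg AB; exact: smooth_on_coord.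
Qed.

Lemma smooth_det m (M : 'rV[R]_n -> 'M[R]_m) :
  (forall i j, smooth_on A (fun x => M x i j)) -> smooth_on A (fun x => \det (M x)).
Proof.
move=> sM; apply: smooth_sum => s _; apply: smoothM; first exact: smooth_on_cst.
by apply: smooth_prod => i _; exact: sM.
Qed.

(** By Cramer's rule the entries are cofactors, polynomial in the entries of [M], divided by the
    determinant. *)
Lemma smooth_invmx m (M : 'rV[R]_n -> 'M[R]_m) :
  (forall x, A x -> M x \in unitmx) ->
  (forall i j, smooth_on A (fun x => M x i j)) ->
  forall i j, smooth_on A (fun x => invmx (M x) i j).
Proof.
move=> uM sM i j.
apply: (smooth_on_eq (f := fun x => (\det (M x))^-1 * cofactor (M x) j i)) => //.
  by move=> x Ax; rewrite /invmx uM// !mxE.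
apply: smoothM.
  apply: smoothV; last exact: smooth_det.
  by move=> x Ax; have := uM x Ax; rewrite unitmxE unitfE.
apply: smoothM; first exact: smooth_on_cst.
apply: smooth_det => a b.
apply: (smooth_on_eq (f := fun x => M x (lift j a) (lift i b))) => //.
by move=> x _; rewrite !mxE.
Qed.

End Closure.
End Smooth.

(** * Differentiability in epsilon form and the mean value theorem on segments *)

Section FrechetEstimates.
Variable R : realType.

Lemma diff_eps (V W : normedModType R) (f : V -> W) x : differentiable f x ->
  forall e, 0 < e -> exists2 d, 0 < d & forall w, `|w| < d ->
    `|f (x + w) - f x - 'D_w f x| <= e * `|w|.
Proof.
move=> df e e0; have := diff_locally df => /eqaddoP /(_ e e0) /nbhs_ballP [d d0 H].
exists d => // w wd; have := H w; rewrite -ball_normE /ball_ /= sub0r normrN wd.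
move=> /(_ isT); rewrite !fctE /= deriveE// (addrC w). by rewrite -addrA -opprD.
Qed.

(** Serves where only a candidate for the differential is known beforehand: the inverse of a map,
    and an integral depending on a parameter. *)
Lemma diff_linear_eps (V W : normedModType R) (f : V -> W) x (L : {linear V -> W}) :
  continuous L -> (forall e, 0 < e -> exists2 d, 0 < d & forall w, `|w| < d ->
    `|f (x + w) - f x - L w| <= e * `|w|) ->
  differentiable f x /\ 'd f x = L :> (V -> W).
Proof.
move=> cL H; have E : f \o shift x = cst (f x) + L +o_ 0 id.
  apply/eqaddoP => e e0; have [d d0 Hd] := H e e0.
  apply/nbhs_ballP; exists d => //= w; rewrite -ball_normE /ball_ /= sub0r normrN.
  by move=> wd; have := Hd w wd; rewrite !fctE /= (addrC w x) opprD addrA.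
have dE := diff_unique cL E.
by split => //; apply/diff_locallyP; split; rewrite dE.
Qed.

Section FromEstimate.
Variables (n : nat) (f : 'rV[R]_n -> R) (x : 'rV[R]_n) (a : 'I_n -> R).

Let lin (w : 'rV[R]_n) : R := \sum_j w ord0 j * a j.

Let lin_linear : linear lin.
Proof.
move=> c u v; rewrite /lin /GRing.scale /= mulr_sumr -big_split /=.
by apply: eq_bigr => j _; rewrite !mxE; ring.
Qed.

HB.instance Definition _ := GRing.isLinear.Build R 'rV[R]_n R^o _ lin lin_linear.

Lemma diff_from_eps : (forall e, 0 < e -> exists2 d, 0 < d & forall w, `|w| < d ->
    `|f (x + w) - f x - \sum_j w ord0 j * a j| <= e * `|w|) ->
  differentiable f x /\ forall v, 'D_v f x = \sum_j v ord0 j * a j.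
Proof.
move=> H; have cl : continuous (lin : 'rV[R]_n -> R^o).
  move=> w; apply: (@differentiable_continuous _ _ _ w (lin : 'rV[R]_n -> R^o)).
  have dF j : predT j -> differentiable (fun u : 'rV[R]_n => u ord0 j * a j : R^o) w.
    move=> _; apply: differentiableM; last exact: differentiable_cst.
    exact: differentiable_coord.
  by have [] := Dsum (index_enum 'I_n) 0 dF.
have [df dE] := @diff_linear_eps _ R^o f x (lin : {linear 'rV[R]_n -> R^o}) cl H.
by split => // v; rewrite (deriveE _ df) dE.
Qed.

End FromEstimate.

Lemma is_derive_line n (f : 'rV[R]_n -> R) (x v : 'rV[R]_n) (s : R) :
  differentiable f (x + s *: v) ->
  is_derive s 1 (fun r : R => f (x + r *: v)) ('D_v f (x + s *: v)).
Proof.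
move=> df; have dg : differentiable (fun r : R => x + r *: v) s.
  by apply: differentiableD; [exact: differentiable_cst|exact: differentiableZl].
have dfg : differentiable (fun r : R => f (x + r *: v)) s.
  exact: (differentiable_comp dg df).
apply: DeriveDef; first exact/diff_derivable.
rewrite (@Dcomp R R^o _ _ _ _ s 1 dg df); congr ('D__ f _).
rewrite Dadd ?derive_cst ?add0r; [|exact: differentiable_cst|exact: differentiableZl].
rewrite deriveE; last exact: differentiableZl.
by case: (is_diff_scalel s v) => _ ->; rewrite scale1r.
Qed.

Lemma line_MVT n (f : 'rV[R]_n -> R) (x v : 'rV[R]_n) :
  (forall s, 0 <= s <= 1 -> differentiable f (x + s *: v)) ->
  exists2 c, 0 <= c <= 1 & f (x + v) - f x = 'D_v f (x + c *: v).
Proof.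
move=> df; have [||c cI E] := @MVT_segment R (fun r : R => f (x + r *: v))
  (fun r => 'D_v f (x + r *: v)) 0 1 ler01.
- by move=> s /[!in_itv]/= /andP[s0 s1]; apply/is_derive_line/df; rewrite !ltW.
- apply: derivable_within_continuous => s; rewrite in_itv /= => sI.
  have [] // := is_derive_line (df s sI).
- exists c; first by move: cI; rewrite in_itv.
  by move: E; rewrite scale1r scale0r addr0 subr0 mulr1.
Qed.

End FrechetEstimates.

(** * Symmetry of second derivatives *)

Section Schwarz.
Variables (R : realType) (n : nat) (A : set 'rV[R]_n) (f : 'rV[R]_n -> R).
Hypotheses (oA : open A) (sf : smooth_on A f).

Lemma open_ballE (x : 'rV[R]_n) : A x ->
  exists2 d, 0 < d & forall w, `|w| < d -> A (x + w).
Proof.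
move=> Ax; have /nbhs_ballP [d d0 H] : nbhs x A by exact: open_nbhs_nbhs.
exists d => // w wd; apply: H; rewrite -ball_normE /ball_ /=.
by rewrite opprD addrA subrr add0r normrN.
Qed.

Let quotient_estimate (e r p q D z Fx : R) : 0 < r ->
  `|q - Fx - z| <= e * r / 2 -> `|p - Fx - (z + r * D)| <= e * r / 2 ->
  `|r * (p - q) / r ^+ 2 - D| <= e.
Proof.
move=> r0; have -> : r * (p - q) / r ^+ 2 - D = (p - q - r * D) / r.
  by field; rewrite gt_eqF.
rewrite normrM normfV (gtr0_norm r0) ler_pdivrMr//.
rewrite !ler_norml => /andP[a1 a2] /andP[a3 a4].
by apply/andP; split; lra.
Qed.

Let dist_estimate (e a b q : R) : `|q - a| <= e / 2 -> `|q - b| <= e / 2 ->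
  `|b - a| <= e.
Proof.
rewrite !ler_norml => /andP[a1 a2] /andP[a3 a4].
by apply/andP; split; lra.
Qed.

(** The mean value theorem along [u], applied to y |-> f (y + r v) - f y, turns the second
    difference into r times a difference of two values of 'D_u f near [x]; the first-order expansion
    of 'D_u f at [x] then gives the limit. *)
Let second_difference (u v : 'rV[R]_n) x : A x -> forall e, 0 < e ->
  exists2 d, 0 < d & forall r, 0 < r < d ->
    `|(f (x + r *: u + r *: v) - f (x + r *: u) - f (x + r *: v) + f x) / r ^+ 2
       - 'D_v ('D_u f) x| <= e.
Proof.
move=> Ax e e0.
have [d1 d10 H1] := open_ballE Ax.
pose M := `|u| + `|v| + 1.
have M0 : 0 < M by rewrite ltr_wpDl// addr_ge0.
(* [M] bounds the displacements, of norm at most r M. With this tolerance each of the two expansions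
   has error at most e r / 2, and the sum divided by r is at most e. *)
have e'0 : 0 < e / (2 * M) by rewrite divr_gt0// mulr_gt0.
have sFu := smooth_on_derive u sf; have dF := smooth_on_diff sFu Ax.
have [d2 d20 H2] := diff_eps dF e'0.
exists (Num.min d1 d2 / M); first by rewrite divr_gt0// lt_min d10.
move=> r /andP[r0]; rewrite ltr_pdivlMr// lt_min => /andP[rd1 rd2].
have small c k : 0 <= c <= 1 -> 0 <= k <= 1 ->
    `|(c * r) *: u + (k * r) *: v| <= r * M.
  move=> /andP[c0 c1] /andP[k0 k1]; apply: le_trans (ler_normD _ _) _.
  rewrite !normrZ !ger0_norm ?mulr_ge0 ?(ltW r0)//.
  have hu : 0 <= `|u| by []. have hv : 0 <= `|v| by [].
  have ha : c * (r * `|u|) <= r * `|u| by rewrite ler_piMl// mulr_ge0// ltW.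
  have hb : k * (r * `|v|) <= r * `|v| by rewrite ler_piMl// mulr_ge0// ltW.
  rewrite /M; move: r0; nra.
pose g := fun y => f (y + r *: v) - f y.
have dfy y : A y -> differentiable f y by exact: smooth_on_diff.
have dfs y : A (y + r *: v) -> differentiable (fun z => f (z + r *: v)) y /\
    'D_u (fun z => f (z + r *: v)) y = 'D_u f (y + r *: v).
  move=> Ay; have ds : differentiable (fun z : 'rV[R]_n => z + r *: v) y.
    by apply: differentiableD; [by case: (is_diff_id y)|exact: differentiable_cst].
  split; first exact: (differentiable_comp ds (dfy _ Ay)).
  rewrite (Dcomp _ ds (dfy _ Ay)); congr ('D__ f _).
  by rewrite Dadd ?derive_id ?derive_cst ?addr0//; exact: differentiable_cst.
have in1 s : 0 <= s <= 1 -> A (x + s *: (r *: u)) /\ A (x + s *: (r *: u) + r *: v).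
  move=> s01; split; last rewrite -addrA.
    apply: H1; rewrite scalerA; have := small s 0 s01; rewrite mul0r scale0r addr0.
    by rewrite lexx ler01 => /(_ isT)/le_lt_trans; apply.
  apply: H1; rewrite scalerA; have := small s 1 s01; rewrite mul1r.
  by rewrite lexx ler01 => /(_ isT)/le_lt_trans; apply.
have dg s : 0 <= s <= 1 -> differentiable g (x + s *: (r *: u)).
  move=> /in1 [A1 A2]; apply: differentiableB; last exact: dfy.
  by have [] := dfs _ A2.
have [c c01 Ec] := line_MVT dg.
have [A1 A2] := in1 c c01.
have Eg : 'D_(r *: u) g (x + c *: (r *: u)) = r * ('D_u f (x + c *: (r *: u) + r *: v)
    - 'D_u f (x + c *: (r *: u))).
  rewrite DZr; last exact: dg.
  congr (_ * _).
  have [h1 h2] := dfs _ A2.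
  by rewrite /g Dadd ?Dopp ?h2//; [exact: dfy|exact/differentiableN/dfy].
have -> : f (x + r *: u + r *: v) - f (x + r *: u) - f (x + r *: v) + f x =
    r * ('D_u f (x + c *: (r *: u) + r *: v) - 'D_u f (x + c *: (r *: u))).
  by rewrite -Eg -Ec /g; ring.
have B1 : `|'D_u f (x + c *: (r *: u)) - 'D_u f x - 'D_(c *: (r *: u)) ('D_u f) x| <=
    e / (2 * M) * (r * M).
  have S : `|c *: (r *: u)| <= r * M.
    have := small c 0 c01; rewrite mul0r scale0r addr0 scalerA; apply.
    by rewrite lexx ler01.
  apply: le_trans (H2 _ (le_lt_trans S rd2)) _.
  by rewrite ler_wpM2l// ltW.
have B2 : `|'D_u f (x + c *: (r *: u) + r *: v) - 'D_u f x - 'D_(c *: (r *: u) + r *: v) ('D_u f) x| <=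
    e / (2 * M) * (r * M).
  have S : `|c *: (r *: u) + r *: v| <= r * M.
    have := small c 1 c01; rewrite mul1r scalerA; apply.
    by rewrite lexx ler01.
  rewrite -[x + _ + _]addrA; apply: le_trans (H2 _ (le_lt_trans S rd2)) _.
  by rewrite ler_wpM2l// ltW.
move: B2; rewrite (DlinD _ _ dF) !(DZr _ _ dF); move: B1; rewrite !(DZr _ _ dF).
have -> : e / (2 * M) * (r * M) = e * r / 2.
  by field; rewrite gt_eqF.
move: ('D_u f (x + _ + _)) ('D_u f (x + _)) ('D_v ('D_u f) x) (c * _) ('D_u f x) => p q D z Fx B1 B2.
exact: quotient_estimate B1 B2.
Qed.

Lemma schwarz (u v : 'rV[R]_n) x : A x -> 'D_v ('D_u f) x = 'D_u ('D_v f) x.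
Proof.
move=> Ax; apply/eqP; rewrite -subr_eq0 -normr_le0; apply/ler_addgt0Pl => e e0.
have e20 : 0 < e / 2 by rewrite divr_gt0.
have [d1 d10 H1] := second_difference u v Ax e20.
have [d2 d20 H2] := second_difference v u Ax e20.
pose r := Num.min d1 d2 / 2.
have r0 : 0 < r by rewrite divr_gt0// lt_min d10.
have rd : r < Num.min d1 d2 by rewrite ltr_pdivrMr// mulr_natr mulr2n ltrDl lt_min d10.
have := H2 r; rewrite r0; move: rd; rewrite lt_min => /andP[rd1 rd2].
rewrite rd2 => /(_ isT); have := H1 r; rewrite r0 rd1 => /(_ isT).
(* The second difference is symmetric in [u] and [v], so both iterated derivatives approximate the
   same quotient. *)
have -> : x + r *: v + r *: u = x + r *: u + r *: v by rewrite addrAC.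
rewrite [X in (X + f x) / _]addrAC; move=> h1 h2; rewrite addr0.
exact: dist_estimate h2 h1.
Qed.

End Schwarz.

(** * Estimates in the maximum norm of row vectors *)

Section RowNorm.
Variable R : realType.

Lemma coord_le_norm n (v : 'rV[R]_n) j : `|v ord0 j| <= `|v|.
Proof.
rewrite [leRHS]mx_normrE; exact: (@le_bigmax _ _ _ 0 (fun ij => `|v ij.1 ij.2|) (ord0, j)).
Qed.

Lemma rV_norm_le n (v : 'rV[R]_n) (c : R) : 0 <= c ->
  (forall j, `|v ord0 j| <= c) -> `|v| <= c.
Proof.
move=> c0 H; rewrite [leLHS]mx_normrE; apply: bigmax_le => // -[i j] _ /=.
by rewrite (ord1 i).
Qed.

Lemma sum_norm_le n (v : 'rV[R]_n) (a : 'I_n -> R) (c : R) :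
  (forall j, `|a j| <= c) -> `|\sum_j v ord0 j * a j| <= n%:R * c * `|v|.
Proof.
move=> H; apply: le_trans (ler_norm_sum _ _ _) _.
apply: (@le_trans _ _ (\sum_(j < n) c * `|v|)).
  apply: ler_sum => j _; rewrite normrM mulrC ler_pM//; exact: coord_le_norm.
by rewrite sumr_const card_ord -(mulr_natl (c * _)) mulrA.
Qed.

Lemma mulmx_bound n m (N : 'M[R]_(n, m)) :
  exists2 C, 0 < C & forall v : 'rV_n, `|v *m N| <= C * `|v|.
Proof.
pose c := \sum_i \sum_j `|N i j|; have c0 : 0 <= c.
  by apply: sumr_ge0 => i _; apply: sumr_ge0.
have Nc i j : `|N i j| <= c.
  rewrite /c (bigD1 i)//= (bigD1 j)//= -addrA lerDl addr_ge0//; first exact: sumr_ge0.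
  by apply: sumr_ge0 => k _; apply: sumr_ge0.
exists (n%:R * c + 1); first by rewrite ltr_wpDl// mulr_ge0.
move=> v; apply: rV_norm_le => [|j]; first by rewrite mulr_ge0// addr_ge0// mulr_ge0.
rewrite mxE; apply: le_trans (sum_norm_le _ (fun i => Nc i j)) _.
by rewrite ler_wpM2r// lerDl.
Qed.

(** Transposed with respect to the usual Jacobian matrix: vectors are rows and differentials act on
    the right. *)
Definition jac n m (F : 'rV[R]_n -> 'rV[R]_m) x : 'M[R]_(n, m) :=
  \matrix_(i, j) 'D_('e_i) F x ord0 j.

Lemma jacE n m (F : 'rV[R]_n -> 'rV[R]_m) x v : differentiable F x ->
  'D_v F x = v *m jac F x.
Proof.
move=> dF; rewrite D_delta//; apply/rowP => j.
by rewrite summxE mxE; apply: eq_bigr => i _; rewrite !mxE.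
Qed.

Lemma diff_jac n m (F : 'rV[R]_n -> 'rV[R]_m) x (N : 'M[R]_(n, m)) :
  (forall e, 0 < e -> exists2 d, 0 < d & forall w, `|w| < d ->
    `|F (x + w) - F x - w *m N| <= e * `|w|) ->
  differentiable F x /\ forall v, 'D_v F x = v *m N.
Proof.
move=> H.
have Hj j : differentiable (fun y => F y ord0 j) x /\
    forall v, 'D_v (fun y => F y ord0 j) x = \sum_i v ord0 i * N i j.
  apply: diff_from_eps => e e0; have [d d0 Hd] := H e e0; exists d => // w wd.
  apply: le_trans (Hd w wd); apply: le_trans (coord_le_norm _ j).
  by rewrite !mxE.
have dF : differentiable F x by apply: differentiable_coordsP => j; have [] := Hj j.
split => // v; apply/rowP => j; rewrite -Dcoord//; have [_ ->] := Hj j.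
by rewrite mxE.
Qed.

Lemma line_bound n (f : 'rV[R]_n -> R) (c : R) (x y : 'rV[R]_n) :
  (forall s, 0 <= s <= 1 -> differentiable f (y + s *: (x - y)) /\
    forall j, `|'D_('e_j) f (y + s *: (x - y))| <= c) ->
  `|f x - f y| <= n%:R * c * `|x - y|.
Proof.
move=> H; have [|s s01] := @line_MVT R n f y (x - y); first by move=> s /H[].
rewrite (addrC y) subrK => ->; have [df fb] := H s s01.
rewrite D_deltar//; exact: sum_norm_le.
Qed.

Lemma segment_ball n (a x y : 'rV[R]_n) r (s : R) : `|x - a| < r -> `|y - a| < r ->
  0 <= s <= 1 -> `|y + s *: (x - y) - a| < r.
Proof.
move=> xa ya /andP[s0 s1].
have -> : y + s *: (x - y) - a = s *: (x - a) + (1 - s) *: (y - a).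
  by apply/rowP => j; rewrite !mxE; ring.
apply: le_lt_trans (ler_normD _ _) _; rewrite !normrZ ger0_norm// ger0_norm ?subr_ge0//.
case: (ltgtP s 0) s0 => // [s0|->] _; last by rewrite mul0r add0r subr0 mul1r.
have h1 : s * `|x - a| < s * r by rewrite ltr_pM2l.
have h2 : (1 - s) * `|y - a| <= (1 - s) * r by rewrite ler_wpM2l ?subr_ge0// ltW.
by apply: lt_le_trans (ltr_leD h1 h2) _; rewrite -mulrDl addrC subrK mul1r.
Qed.

End RowNorm.

Lemma smooth_mulmx (R : realType) n m (A : set 'rV[R]_n) (N : 'M[R]_(n, m)) :
  open A -> smooth_on A (fun x => x *m N).
Proof.
move=> oA; apply: smooth_rV => // j.
apply: (smooth_on_eq (f := fun x => \sum_i x ord0 i * N i j)) => //.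
  by move=> x _; rewrite mxE.
apply: smooth_sum => // i _; apply: smoothM => //; last exact: smooth_on_cst.
by apply: smooth_on_coord => //; exact: smooth_on_id.
Qed.

Lemma open_norm_ball (R : realType) n (c : 'rV[R]_n) (s : R) :
  open [set x : 'rV[R]_n | `|x - c| < s].
Proof.
have -> : [set x : 'rV[R]_n | `|x - c| < s] = ball c s; last exact: ball_open.
by apply/seteqP; split=> x; rewrite -ball_normE /ball_ /= distrC.
Qed.

Lemma open_setI_preimage (T U : topologicalType) (A : set T) (B : set U) (f : T -> U) :
  open A -> open B -> (forall x, A x -> {for x, continuous f}) ->
  open (A `&` f @^-1` B).
Proof.
move=> oA oB cf; rewrite openE => x [Ax Bfx]; apply: filterI.
  exact: open_nbhs_nbhs.
by apply: (cf x Ax); exact: open_nbhs_nbhs.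
Qed.

(** * The inverse function theorem *)

Section InverseFunction.
Variables (R : realType) (n : nat) (A : set 'rV[R]_n) (F : 'rV[R]_n -> 'rV[R]_n).
Variable a : 'rV[R]_n.
Hypotheses (oA : open A) (sF : smooth_on A F) (Aa : A a).
Hypothesis injF : forall v, 'D_v F a = 0 -> v = 0.

Let dF x : A x -> differentiable F x.
Proof. exact: smooth_on_diff. Qed.

Let unit_jac x : A x -> (forall v, 'D_v F x = 0 -> v = 0) -> jac F x \in unitmx.
Proof.
move=> Ax inj; rewrite -row_free_unit -kermx_eq0; apply/eqP/row_matrixP => i.
by rewrite row0; apply: inj; rewrite (jacE _ (dF Ax)) -row_mul mulmx_ker row0.
Qed.

(** [H] is [F] normalised to have the identity as differential at [a]; its deviation [G] from the
    identity then has zero differential at [a] and is a contraction nearby. *)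
Let M := jac F a.
Let uM : M \in unitmx. Proof. exact: unit_jac. Qed.
Let H x := F x *m invmx M.
Let G x : 'rV[R]_n := H x - x.

Let sH : smooth_on A H.
Proof.
apply: (smooth_comp_rV oA openT (smooth_mulmx (invmx M) openT)) => //.
Qed.

Let sG : smooth_on A G.
Proof.
apply: smooth_rV => // j.
apply: (smooth_on_eq (f := fun x => H x ord0 j - x ord0 j)) => //.
  by move=> x _; rewrite !mxE.
apply: smoothB => //; first exact: smooth_on_coord.
by apply: smooth_on_coord => //; exact: smooth_on_id.
Qed.

Let DH x v : A x -> 'D_v H x = 'D_v F x *m invmx M.
Proof.
move=> Ax; have dFx := dF Ax; apply/rowP => j.
rewrite -Dcoord; last exact: smooth_on_diff sH Ax.
have -> : (fun y => H y ord0 j) = fun y => \sum_i F y ord0 i * invmx M i j.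
  by apply/funext => y; rewrite mxE.
have dF1 i : differentiable (fun y => F y ord0 i) x.
  exact: (differentiable_comp dFx (differentiable_coord _ _ _)).
have dc (i : 'I_n) : differentiable (fun=> invmx M i j : R) x by exact: differentiable_cst.
have [_ ->] := Dsum (index_enum 'I_n) v
  (fun i (_ : predT i) => differentiableM (dF1 i) (dc i)).
rewrite mxE; apply: eq_bigr => i _.
by rewrite (Dmul _ (dF1 i) (dc i)) derive_cst mulr0 addr0 Dcoord.
Qed.

Let DG x v : A x -> 'D_v G x = 'D_v F x *m invmx M - v.
Proof.
move=> Ax; rewrite /G Dadd; last by apply: differentiableN; case: (is_diff_id x).
  by rewrite DH// Dopp ?derive_id//; case: (is_diff_id x).
exact: smooth_on_diff sH Ax.
Qed.

(** A bound [c] on the partial derivatives of [G] gives the Lipschitz constant n c <= 1/2, the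
    factor n coming from the sum over coordinates. The + 1 keeps [c] positive when n = 0. *)
Let c : R := 1 / 2 / (n%:R + 1).

Let c0 : 0 < c. Proof. by rewrite divr_gt0// ltr_wpDl. Qed.

Let nc : n%:R * c <= 1 / 2.
Proof.
have n1 : 0 < (n%:R + 1 : R) by rewrite ltr_wpDl.
rewrite /c mulrCA ger_pMr// ler_pdivrMr// mul1r lerDl ler01//.
Qed.

Let good (r : R) : Prop := forall x : 'rV[R]_n, `|x - a| < r -> A x /\
  forall j k, `|'D_('e_j) (fun y => G y ord0 k) x| <= c.

Let small_ball : exists2 r, 0 < r & good r.
Proof.
have [d d0 Hd] := open_ballE oA Aa.
have Hjk (jk : 'I_n * 'I_n) :
    \forall x \near a, `|'D_('e_(jk.1)) (fun y => G y ord0 jk.2) x| < c.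
  case: jk => j k /=.
  have sD : smooth_on A ('D_('e_j) (fun y => G y ord0 k)).
    by apply: smooth_on_derive; exact: smooth_on_coord.
  have E0 : 'D_('e_j) (fun y => G y ord0 k) a = 0.
    rewrite Dcoord; last exact: smooth_on_diff sG Aa.
    by rewrite DG// (jacE _ (dF Aa)) -mulmxA mulmxV// mulmx1 subrr mxE.
  have := differentiable_continuous (smooth_on_diff sD Aa).
  move=> /cvgrPdist_lt /(_ c c0); apply: filterS => x.
  by rewrite [X in `|X - _|](E0) sub0r normrN.
have Ha : nbhs a (A `&` [set x | forall jk : 'I_n * 'I_n,
    `|'D_('e_(jk.1)) (fun y => G y ord0 jk.2) x| < c]).
  apply: filterI; first exact: open_nbhs_nbhs.
  exact: (@filter_forall _ _ (fun jk : 'I_n * 'I_n => [set x |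
    `|'D_('e_(jk.1)) (fun y => G y ord0 jk.2) x| < c]) _ _ Hjk).
case/nbhs_ballP: Ha => r r0 Hr; exists r => // x xa.
have [Ax Hx] : A x /\ forall jk : 'I_n * 'I_n,
    `|'D_('e_(jk.1)) (fun y => G y ord0 jk.2) x| < c.
  by apply: Hr; rewrite -ball_normE /ball_ /= distrC.
by split=> // j k; exact: ltW (Hx (j, k)).
Qed.

Let lipG r : good r -> forall x y, `|x - a| < r -> `|y - a| < r ->
  `|G x - G y| <= 1 / 2 * `|x - y|.
Proof.
move=> gr x y xr yr; apply: rV_norm_le => [|k]; first by rewrite mulr_ge0.
apply: (@le_trans _ _ (n%:R * c * `|x - y|)); last by rewrite ler_wpM2r.
have -> : (G x - G y) ord0 k = G x ord0 k - G y ord0 k by rewrite !mxE.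
apply: (line_bound (f := fun z => G z ord0 k)) => s s01.
have [Az bz] := gr _ (segment_ball xr yr s01); split => // .
exact: smooth_on_diff (smooth_on_coord k oA sG) Az.
Qed.

(** If the differential of [F] kills v, then that of [G] maps v to - v; as it at least halves norms,
    v = 0. *)
Let injDF r x : good r -> `|x - a| < r -> forall v, 'D_v F x = 0 -> v = 0.
Proof.
move=> gr xr v Dv; have [Ax bx] := gr _ xr.
have dG := smooth_on_diff sG Ax.
have E : 'D_v G x = - v by rewrite DG// Dv mul0mx sub0r.
have le : `|v| <= 1 / 2 * `|v|.
  apply: rV_norm_le => [|k]; first by rewrite mulr_ge0.
  apply: (@le_trans _ _ (n%:R * c * `|v|)); last by rewrite ler_wpM2r.
  have -> : `|v ord0 k| = `|'D_v (fun y => G y ord0 k) x|.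
    by rewrite Dcoord// E mxE normrN.
  rewrite D_deltar; first by apply: sum_norm_le => j; exact: bx.
  exact: smooth_on_diff (smooth_on_coord k oA sG) Ax.
apply/eqP; rewrite -normr_le0; lra.
Qed.

Lemma inverse_function : exists (B : set 'rV[R]_n) (g : 'rV[R]_n -> 'rV[R]_n),
  [/\ open B, B a, B `<=` A & open (F @` B)] /\
  [/\ forall x, B x -> g (F x) = x & smooth_on (F @` B) g].
Proof.
have [r0 r00 gr0] := small_ball; pose r := r0 / 2.
have r_gt0 : 0 < r by rewrite divr_gt0.
have rr0 : r < r0 by rewrite ltr_pdivrMr// mulr_natr mulr2n ltrDl.
(* The second condition makes the image of [B] the preimage of a ball under the linear map
   [invmx M], hence open. The radius is half of [r0] so that the closed ball used below stays where
   the estimates hold. *)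
pose B := [set x | `|x - a| < r /\ `|H x - H a| < r / 2].
have BA : B `<=` A by move=> x [xr _]; have [] := gr0 x (lt_trans xr rr0).
have HF x : H x *m M = F x by rewrite -mulmxA mulVmx// mulmx1.
have HG x : H x = x + G x by rewrite /G addrC subrK.
have lipH x y : B x -> B y -> `|x - y| <= 2 * `|H x - H y|.
  move=> [xr _] [yr _].
  have l := lipG gr0 (lt_trans xr rr0) (lt_trans yr rr0).
  have : `|x - y| <= `|H x - H y| + `|G x - G y|.
    apply: le_trans (ler_normB _ _); have -> : H x - H y - (G x - G y) = x - y by apply/rowP => j; rewrite !mxE; ring.
    by [].
  move: l; move: (`|x - y|) (`|H x - H y|) (`|G x - G y|) => p q s; lra.
have injB x y : B x -> B y -> F x = F y -> x = y.
  move=> Bx By Fxy; have := lipH x y Bx By.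
  by rewrite /H Fxy subrr normr0 mulr0 normr_le0 subr_eq0 => /eqP.
have surj z : `|z - H a| < r / 2 -> exists2 x, B x & H x = z.
  move=> zr; pose cb := [set x : 'rV[R]_n | `|x - a| <= r].
  have cbr0 x : cb x -> `|x - a| < r0 by move=> /le_lt_trans; apply.
  have cbA x : cb x -> A x by move=> /cbr0/gr0 [].
  have ccb : compact cb.
    apply: bounded_closed_compact.
      exists (`|a| + r); split; first exact: num_real.
      move=> y yr x /= xr; rewrite -[x](subrK a).
      apply: le_trans (ler_normD _ _) _; rewrite (le_trans _ (ltW yr))// addrC.
      by rewrite lerD2l.
    have -> : cb = closed_ball_ (fun x : 'rV[R]_n => `|x|) a r.
      by apply/seteqP; split=> x; rewrite /cb /closed_ball_ /= distrC.
    exact: closed_closed_ball_.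
  have cf : {within cb, continuous (fun x => `|H x - z|)}.
    apply: continuous_in_subspaceT => x; rewrite inE => /cbA Ax.
    have dHz : differentiable (fun x => H x - z) x.
      apply: differentiableD (differentiable_cst _ _).
      exact: (smooth_on_diff sH Ax).
    have cHz := differentiable_continuous dHz.
    exact: (continuous_comp cHz (@norm_continuous _ _ _)).
  have cb0 : cb !=set0 by exists a; rewrite /cb /= subrr normr0 ltW.
  have [x /[!inE] cbx xmin] := EVT_min_rV cb0 ccb cf.
  (* One Picard step from the point [x] of the closed ball where |H - z| is minimal. [T] stays in
     the ball and |H T - z| = |G T - G x| <= 1/2 |T - x| = 1/2 |H x - z|, so minimality forces H x =
     z. *)
  pose T := z - G x.
  have Ta : `|T - a| < r.
    have -> : T - a = (z - H a) + (G a - G x).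
      by rewrite /T HG; apply/rowP => j; rewrite !mxE; ring.
    have ar0 : `|a - a| < r0 by rewrite subrr normr0.
    have l := lipG gr0 ar0 (cbr0 _ cbx).
    apply: le_lt_trans (ler_normD _ _) _; move: zr l cbx; rewrite /cb /= distrC.
    rewrite (distrC a x) (distrC (H a)).
    move: (`|z - H a|) (`|G a - G x|) (`|x - a|) => p q s; lra.
  have := xmin T; rewrite inE => /(_ (ltW Ta)).
  have -> : H T - z = G T - G x by rewrite HG /T; apply/rowP => j; rewrite !mxE; ring.
  have := lipG gr0 (lt_trans Ta rr0) (cbr0 _ cbx).
  have -> : T - x = - (H x - z) by rewrite HG /T; apply/rowP => j; rewrite !mxE; ring.
  rewrite normrN => l1 l2; have Hxz : H x = z.
    apply/eqP; rewrite -subr_eq0 -normr_le0.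
    by move: l1 l2; move: (`|H x - z|) (`|G T - G x|) => p q; lra.
  exists x => //; split; last by rewrite Hxz.
  by move: Ta; rewrite /T -Hxz HG addrK.
have oB : open B.
  have -> : B = [set x | `|x - a| < r] `&` (A `&` H @^-1` [set y : 'rV[R]_n | `|y - H a| < r / 2]).
    by apply/seteqP; split=> x; [move=> Bx; have := BA x Bx; case: Bx|case=> ? [_]].
  apply: openI; first exact: open_norm_ball.
  have cH x : A x -> {for x, continuous H}.
    by move=> Ax; exact: differentiable_continuous (smooth_on_diff sH Ax).
  exact: (@open_setI_preimage _ _ A [set y : 'rV[R]_n | `|y - H a| < r / 2] H oA
    (@open_norm_ball _ _ _ _) cH).
have imB : F @` B = [set w : 'rV[R]_n | `|w *m invmx M - H a| < r / 2].
  apply/seteqP; split=> [_ [x [_ xB] <-] //|w /= wB].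
  have [x Bx Hx] := surj _ wB; exists x => //.
  by rewrite -HF Hx -mulmxA mulVmx// mulmx1.
have oFB : open (F @` B).
  rewrite imB -[X in open X]setTI.
  have cM (w : 'rV[R]_n) : setT w -> {for w, continuous (fun u : 'rV[R]_n => u *m invmx M)}.
    move=> _; apply: differentiable_continuous.
    exact: (smooth_on_diff (smooth_mulmx (invmx M) openT)).
  exact: (@open_setI_preimage _ _ setT [set z : 'rV[R]_n | `|z - H a| < r / 2] _ openT
    (@open_norm_ball _ _ _ _) cM).
pose g w := xget a [set x | B x /\ F x = w].
have gF x : B x -> g (F x) = x.
  move=> Bx; have [Bg Fg] : B (g (F x)) /\ F (g (F x)) = F x.
    by apply: (@xgetPex _ a [set y | B y /\ F y = F x]); exists x.
  exact: injB.
have Bg w : (F @` B) w -> B (g w) /\ F (g w) = w.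
  by case=> x Bx <-; rewrite gF.
have Ba : B a by rewrite /B /= !subrr !normr0; split => //; rewrite divr_gt0.
exists B, g; split; first by split.
split => //.
have [C C0 HC] := mulmx_bound (invmx M).
have uj x : B x -> jac F x \in unitmx.
  move=> Bx; apply: unit_jac; first exact: BA.
  by apply: (injDF gr0); case: Bx => h _; exact: lt_trans h rr0.
have dg w : (F @` B) w -> differentiable g w /\
    forall v, 'D_v g w = v *m invmx (jac F (g w)).
  move=> Ew; have [Bx0 Fx0] := Bg w Ew; set x0 := g w in Bx0 Fx0 *.
  have [C0' C00 HC0] := mulmx_bound (invmx (jac F x0)).
  apply: diff_jac => e e0.
  (* [C0'] bounds the inverse of the differential at [x0], and 2 [C] is a Lipschitz constant of [g];
     the product of the three constants is [e]. *)
  have e'0 : 0 < e / (C0' * (2 * C)) by rewrite divr_gt0// !mulr_gt0.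
  have [d d0 Hd] := diff_eps (dF (BA _ Bx0)) e'0.
  have [d1 d10 Hd1] := open_ballE oFB Ew.
  exists (Num.min d1 (d / (2 * C))).
    by rewrite lt_min d10 divr_gt0// mulr_gt0.
  move=> k; rewrite lt_min ltr_pdivlMr ?mulr_gt0// => /andP[kd1 kd].
  have [Bx Fx] := Bg _ (Hd1 _ kd1); set x := g (w + k) in Bx Fx *.
  have xx0 : `|x - x0| <= 2 * C * `|k|.
    apply: le_trans (lipH _ _ Bx Bx0) _; rewrite -mulrA ler_wpM2l//.
    rewrite /H -mulmxBl; apply: le_trans (HC _) _.
    by rewrite Fx Fx0 addrC addKr.
  have xd : `|x - x0| < d by apply: le_lt_trans xx0 _; rewrite mulrC.
  have := Hd _ xd; rewrite (addrC x0) subrK Fx Fx0 (addrC w) addrK.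
  rewrite (jacE _ (dF (BA _ Bx0))) => err.
  have -> : x - x0 - k *m invmx (jac F x0) =
      - ((k - (x - x0) *m jac F x0) *m invmx (jac F x0)).
    by rewrite mulmxBl -mulmxA mulmxV ?uj// mulmx1 opprB.
  rewrite normrN; apply: le_trans (HC0 _) _.
  apply: (@le_trans _ _ (C0' * (e / (C0' * (2 * C)) * (2 * C * `|k|)))).
    rewrite ler_wpM2l ?(ltW C00)//; apply: le_trans err _.
    by rewrite ler_wpM2l// ltW.
  by rewrite le_eqVlt; apply/orP; left; apply/eqP; field; rewrite !gt_eqF.
(* The class of functions Psi o g with Psi smooth on [B]. It is stable under derivation because the
   differential of [g] at w is the inverse of [jac F] at g w, again a smooth function of g w. *)
pose P (f : 'rV[R]_n -> 'rV[R]_n) := exists2 Psi : 'rV[R]_n -> 'rV[R]_n,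
  smooth_on B Psi & forall w, (F @` B) w -> f w = Psi (g w).
apply: (@smooth_on_coind _ _ _ _ P oFB); last first.
  by exists id => //; exact: smooth_on_id.
move=> f [Psi sP fE]; split=> [w Ew|v].
  have [dgw _] := dg w Ew; have [Bgw _] := Bg w Ew.
  apply: (near_eq_differentiable (f := fun w => Psi (g w))).
    by apply: (open_near oFB Ew) => z Ez; rewrite fE.
  exact: (differentiable_comp dgw (smooth_on_diff sP Bgw)).
exists ('D_v f); split => //.
exists (fun x => \sum_j (v *m invmx (jac F x)) ord0 j *: 'D_('e_j) Psi x).
  apply: smooth_rV => // k.
  apply: (smooth_on_eq (f := fun x => \sum_j (\sum_i v ord0 i * invmx (jac F x) i j)
      * 'D_('e_j) Psi x ord0 k)) => //.
    by move=> x _; rewrite summxE; apply: eq_bigr => j _; rewrite !mxE.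
  apply: smooth_sum => // j _; apply: smoothM => //.
    apply: smooth_sum => // i _; apply: smoothM => //; first exact: smooth_on_cst.
    apply: smooth_invmx => // i' j'.
    apply: (smooth_on_eq (f := fun x => 'D_('e_i') F x ord0 j')) => //.
      by move=> x _; rewrite mxE.
    apply: smooth_on_coord => //; apply: smooth_on_derive.
    exact: smooth_onW sF.
  by apply: smooth_on_coord => //; exact: smooth_on_derive.
move=> w Ew; have [dgw Dg] := dg w Ew; have [Bgw _] := Bg w Ew.
rewrite (D_eq_on v oFB Ew fE) (Dcomp _ dgw (smooth_on_diff sP Bgw)) Dg.
by rewrite D_delta//; exact: smooth_on_diff sP Bgw.
Qed.

End InverseFunction.

(** * Integration over the unit interval *)

Section UnitIntegral.
Variable R : realType.
Implicit Types f g : R -> R.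

(** Two-sided continuity, at the end points as well: it is stable under algebraic operations and
    gives both integrability and the one-sided limits required by the fundamental theorem of
    calculus. *)
Definition cont01 g := forall s : R, 0 <= s <= 1 -> {for s, continuous g}.

Definition I01 g : R := \int[@lebesgue_measure R]_(s in `[0, 1]) g s.

Lemma cont01_within g : cont01 g -> {within `[0, 1], continuous (g : R^o -> R^o)}.
Proof.
move=> cg; apply: continuous_in_subspaceT => s; rewrite inE /= in_itv /=.
exact: cg.
Qed.

Lemma cont01_integrable g : cont01 g ->
  (@lebesgue_measure R).-integrable `[0, 1] (EFin \o g).
Proof.
move=> cg; apply: continuous_compact_integrable; first exact: segment_compact.
exact: cont01_within.
Qed.

Lemma I01D f g : cont01 f -> cont01 g -> I01 (fun s => f s + g s) = I01 f + I01 g.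
Proof. by move=> cf cg; apply: RintegralD => //; exact: cont01_integrable. Qed.

Lemma I01Z c f : cont01 f -> I01 (fun s => c * f s) = c * I01 f.
Proof. by move=> cf; apply: RintegralZl => //; exact: cont01_integrable. Qed.

Lemma I01_eq f g : (forall s, 0 <= s <= 1 -> f s = g s) -> I01 f = I01 g.
Proof. by move=> fg; apply: eq_Rintegral => s; rewrite inE /= in_itv /=; exact: fg. Qed.

Lemma I01_cst c : I01 (fun=> c) = c.
Proof.
rewrite /I01 Rintegral_cst//= lebesgue_measure_itv /= lte_fin ltr01.
by rewrite oppr0 addr0 mulr1.
Qed.

Lemma cont01_cst c : cont01 (fun=> c).
Proof. by move=> s _; exact: cst_continuous. Qed.

Lemma cont01D f g : cont01 f -> cont01 g -> cont01 (fun s => f s + g s).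
Proof. by move=> cf cg s s01; apply: continuousD; [exact: cf|exact: cg]. Qed.

Lemma cont01M f g : cont01 f -> cont01 g -> cont01 (fun s => f s * g s).
Proof. by move=> cf cg s s01; apply: continuousM; [exact: cf|exact: cg]. Qed.

Lemma cont01_sum (I : Type) (r : seq I) (F : I -> R -> R) :
  (forall i, cont01 (F i)) -> cont01 (fun s => \sum_(i <- r) F i s).
Proof.
move=> cF; elim: r => [|i r IH].
  by under eq_fun do rewrite big_nil; exact: cont01_cst.
by under eq_fun do rewrite big_cons; exact: cont01D.
Qed.

Lemma I01_sum (I : Type) (r : seq I) (c : I -> R) (F : I -> R -> R) :
  (forall i, cont01 (F i)) ->
  I01 (fun s => \sum_(i <- r) c i * F i s) = \sum_(i <- r) c i * I01 (F i).
Proof.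
have cc i : cont01 (F i) -> cont01 (fun s => c i * F i s).
  by move=> cF; apply: cont01M => //; exact: cont01_cst.
move=> cF; elim: r => [|i r IH].
  by under eq_fun do rewrite big_nil; rewrite big_nil I01_cst.
under eq_fun do rewrite big_cons.
rewrite big_cons (I01D (cc i (cF i))); last by apply: cont01_sum => j; exact: cc.
by rewrite IH; congr (_ + _); exact: I01Z.
Qed.

Lemma I01_le f g : cont01 f -> cont01 g ->
  (forall s, 0 <= s <= 1 -> f s <= g s) -> I01 f <= I01 g.
Proof.
by move=> cf cg fg; apply: le_Rintegral => //; exact: cont01_integrable.
Qed.

Lemma I01_bound f c : cont01 f -> (forall s, 0 <= s <= 1 -> `|f s| <= c) ->
  `|I01 f| <= c.
Proof.
move=> cf fc; rewrite ler_norml; apply/andP; split.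
  rewrite -[- c]I01_cst; apply: I01_le => //; first exact: cont01_cst.
  by move=> s /fc; rewrite ler_norml => /andP[].
rewrite -[leRHS]I01_cst; apply: I01_le => //; first exact: cont01_cst.
by move=> s /fc; rewrite ler_norml => /andP[].
Qed.

Lemma I01_FTC f g : cont01 g -> (forall s : R, 0 <= s <= 1 -> is_derive s 1 f (g s)) ->
  I01 g = f 1 - f 0.
Proof.
move=> cg fg; have df s : 0 <= s <= 1 -> {for s, continuous f}.
  move=> /fg [fs _]; apply: differentiable_continuous.
  exact/derivable1_diffP.
rewrite /I01 /Rintegral (@continuous_FTC2 _ g f) ?ltr01//.
- exact: cont01_within.
- split.
  + by move=> s; rewrite in_itv /= => /andP[s0 s1]; have [] // := fg s _; rewrite !ltW.
  + by apply: cvg_at_right_filter; apply: df; rewrite lexx ler01.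
  + by apply: cvg_at_left_filter; apply: df; rewrite lexx ler01.
- move=> s; rewrite in_itv /= => /andP[s0 s1].
  by rewrite derive1E; have [] // := fg s _; rewrite !ltW.
Qed.

End UnitIntegral.

(** * Radial integrals and the Poincaré lemma in degrees 1 and 2 *)

Section RadialIntegral.
Variables (R : realType) (n : nat) (x0 : 'rV[R]_n) (r : R).
Let B := [set x : 'rV[R]_n | `|x - x0| < r].
Implicit Types f g : 'rV[R]_n -> R.

Let oB : open B. Proof. exact: open_norm_ball. Qed.

Definition radial (x : 'rV[R]_n) (s : R) : 'rV[R]_n := x0 + s *: (x - x0).

(** The integral in the homotopy operator: for a form of degree k + 1 contracted with x - x0, the
    coefficients are integrated along the ray with weight s^k. *)
Definition rint k f (x : 'rV[R]_n) : R := I01 (fun s => s ^+ k * f (radial x s)).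

Lemma radial_in x s : B x -> 0 <= s <= 1 -> B (radial x s).
Proof.
rewrite /B /= => xr s01; apply: segment_ball => //.
by rewrite subrr normr0; exact: le_lt_trans xr.
Qed.

Lemma cont01_radial k f x : smooth_on B f -> B x ->
  cont01 (fun s => s ^+ k * f (radial x s)).
Proof.
move=> sf Bx; apply: cont01M => s s01.
  exact: exprn_continuous.
have [+ _] := is_derive_line (smooth_on_diff sf (radial_in Bx s01)).
by move=> /derivable1_diffP/differentiable_continuous.
Qed.

(** A Taylor estimate uniform in [s], which permits differentiation under the integral sign. *)
Let second_order_bound f x : smooth_on B f -> B x -> exists2 c, 0 <= c &
  forall s w, 0 <= s <= 1 -> `|w| < (r - `|x - x0|) / 2 ->
  B (x + w) /\ `|f (radial (x + w) s) - f (radial x s) - 'D_(s *: w) f (radial x s)|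
    <= c * `|w| * `|w|.
Proof.
(* Halfway between |x - x0| and [r]: on the closed ball of this radius the second derivatives are
   bounded by compactness, and it contains all displaced points. *)
move=> sf Bx; pose r' := (r + `|x - x0|) / 2.
have xr : `|x - x0| < r by [].
have r'r : r' < r by rewrite /r'; move: xr; move: (`|x - x0|) => q; lra.
have xr' : `|x - x0| < r' by rewrite /r'; move: xr; move: (`|x - x0|) => q; lra.
pose cb := [set y : 'rV[R]_n | `|y - x0| <= r'].
have cbB y : cb y -> B y by move=> /le_lt_trans; apply.
have ccb : compact cb.
  apply: bounded_closed_compact.
    exists (`|x0| + r'); split; first exact: num_real.
    move=> y yr z /= zr; rewrite -[z](subrK x0).
    apply: le_trans (ler_normD _ _) _; rewrite (le_trans _ (ltW yr))// addrC.
    by rewrite lerD2l.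
  have -> : cb = closed_ball_ (fun y : 'rV[R]_n => `|y|) x0 r'.
    by apply/seteqP; split=> y; rewrite /cb /closed_ball_ /= distrC.
  exact: closed_closed_ball_.
have cb0 : cb !=set0 by exists x; exact: ltW.
have bnd (g : 'rV[R]_n -> R) : smooth_on B g -> exists2 c, 0 <= c & forall y, cb y -> `|g y| <= c.
  move=> sg; have cg : {within cb, continuous (fun y => `|g y|)}.
    apply: continuous_in_subspaceT => y; rewrite inE => /cbB By.
    have cgy := differentiable_continuous (smooth_on_diff sg By).
    exact: cvg_norm cgy.
  have [y _ ymax] := EVT_max_rV cb0 ccb cg.
  by exists `|g y| => // z cbz; apply: ymax; rewrite inE.
pose D2 (ij : 'I_n * 'I_n) (y : 'rV[R]_n) : R := 'D_('e_(ij.1)) ('D_('e_(ij.2)) f) y.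
have [c c0 Hc] : exists2 c, 0 <= c & forall ij y, cb y -> `|D2 ij y| <= c.
  have H ij : exists c, 0 <= c /\ forall y, cb y -> `|D2 ij y| <= c.
    have [|c c0 cP] := bnd (D2 ij); last by exists c.
    by do 2!apply: smooth_on_derive.
  have [C HC] := choice H; exists (\sum_ij C ij).
    by apply: sumr_ge0 => ij _; have [] := HC ij.
  move=> ij y /(proj2 (HC ij)) /le_trans; apply.
  by rewrite (bigD1 ij)//= lerDl sumr_ge0// => kl _; have [] := HC kl.
exists (n%:R * (n%:R * c)); first by rewrite !mulr_ge0.
move=> s w s01 wr.
have cbr q u : `|q - x0| <= `|x - x0| -> `|u| <= `|w| -> cb (q + u).
  move=> qx uw; rewrite /cb /= addrAC; apply: le_trans (ler_normD _ _) _.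
  move: qx uw wr; rewrite /r'; move: (`|q - x0|) (`|u|) (`|x - x0|) (`|w|) => a b d e; lra.
split; first by apply: cbB; exact: cbr.
set p := radial x s.
have -> : radial (x + w) s = p + s *: w.
  by rewrite /p /radial; apply/rowP => j; rewrite !mxE; ring.
have px : `|p - x0| <= `|x - x0|.
  rewrite /p /radial addrC addKr normrZ; case/andP: s01 => s0 s1.
  by rewrite ger0_norm// ler_piMl.
have usm t : 0 <= t <= 1 -> `|t *: (s *: w)| <= `|w|.
  move=> /andP[t0 t1]; case/andP: s01 => s0 s1.
  rewrite !normrZ !ger0_norm// mulrA ler_piMl//.
  by apply: le_trans (ler_piMr t0 s1) _.
have us : `|s *: w| <= `|w| by have := usm 1; rewrite scale1r lexx ler01; apply.
have dfp t : 0 <= t <= 1 -> B (p + t *: (s *: w)).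
  by move=> /usm tw; apply: cbB; exact: cbr.
have [|t t01 ->] := @line_MVT R n f p (s *: w).
  by move=> t /dfp/(smooth_on_diff sf).
have Bp : B p by exact: radial_in.
rewrite !D_deltar; [|exact: smooth_on_diff sf Bp|exact: smooth_on_diff sf (dfp t t01)].
rewrite -sumrB; under eq_bigr do rewrite -mulrBr.
apply: le_trans (@sum_norm_le _ _ _ _ (n%:R * c * `|w|) _) _; last first.
  apply: (@le_trans _ _ (n%:R * (n%:R * c * `|w|) * `|w|)); last by rewrite !mulrA.
  by rewrite ler_wpM2l// !mulr_ge0.
move=> j; apply: (@le_trans _ _ (n%:R * c * `|p + t *: (s *: w) - p|)).
  apply: (@line_bound R n ('D_('e_j) f) c) => k k01.
  have cbk : cb (p + k *: (p + t *: (s *: w) - p)).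
    apply: cbr => //; rewrite addrC addKr.
    case/andP: k01 => k0 k1; rewrite normrZ ger0_norm//.
    by apply: le_trans (ler_piMl _ k1) _ => //; exact: usm.
  split; last by move=> i; exact: (Hc (i, j)).
  exact: smooth_on_diff (smooth_on_derive _ sf) (cbB _ cbk).
by rewrite addrC addKr ler_wpM2l ?mulr_ge0// usm.
Qed.

(** The point at parameter s moves s times as fast as [x], whence the exponent k + 1. The remainder
    is controlled by the uniform second-order bound. *)
Lemma rint_derive k f x : smooth_on B f -> B x ->
  differentiable (rint k f) x /\ forall v, 'D_v (rint k f) x = rint k.+1 ('D_v f) x.
Proof.
move=> sf Bx.
have cE v : rint k.+1 ('D_v f) x =
    \sum_j v ord0 j * rint k.+1 ('D_('e_j) f) x.
  rewrite /rint -I01_sum; last first.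
    by move=> j; exact: (cont01_radial (smooth_on_derive _ sf) Bx).
  apply: I01_eq => s s01; rewrite D_deltar; last first.
    exact: smooth_on_diff sf (radial_in Bx s01).
  by rewrite mulr_sumr; apply: eq_bigr => j _; rewrite mulrCA.
suff [d dE] : differentiable (rint k f) x /\ forall v,
    'D_v (rint k f) x = \sum_j v ord0 j * rint k.+1 ('D_('e_j) f) x.
  by split => // v; rewrite dE cE.
have [c c0 Hc] := second_order_bound sf Bx.
apply: diff_from_eps => e e0; exists (Num.min ((r - `|x - x0|) / 2) (e / (c + 1))).
  by rewrite lt_min !divr_gt0 ?subr_gt0// ltr_wpDl.
move=> w; rewrite lt_min => /andP[wr].
rewrite ltr_pdivlMr ?ltr_wpDl// => we.
have Bxw : B (x + w) by have [|] := Hc 0 w _ wr; rewrite ?lexx ?ler01.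
rewrite -cE.
have cw := cont01_radial (k := k) sf Bxw; have cx := cont01_radial (k := k) sf Bx.
have cd := cont01_radial (k := k.+1) (smooth_on_derive w sf) Bx.
have cN (g : R -> R) : cont01 g -> cont01 (fun s => - 1 * g s).
  by move=> cg; exact: (cont01M (@cont01_cst _ (- 1)) cg).
have cwx := cont01D cw (cN _ cx).
have -> : rint k f (x + w) - rint k f x - rint k.+1 ('D_w f) x =
    I01 (fun s => (s ^+ k * f (radial (x + w) s) + - 1 * (s ^+ k * f (radial x s)))
      + - 1 * (s ^+ k.+1 * 'D_w f (radial x s))).
  rewrite (I01D cwx (cN _ cd)) (I01D cw (cN _ cx)) (I01Z _ cx) (I01Z _ cd).
  by rewrite !mulN1r.
apply: (@le_trans _ _ (c * `|w| * `|w|)); last first.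
  rewrite ler_wpM2r//; apply: le_trans (ltW we).
  by rewrite mulrC ler_wpM2l// lerDl.
apply: I01_bound; first by apply: cont01D => //; exact: cN.
move=> s s01; have [_] := Hc s w s01 wr; apply: le_trans.
rewrite DZr; last exact: smooth_on_diff sf (radial_in Bx s01).
have -> : s ^+ k * f (radial (x + w) s) + -1 * (s ^+ k * f (radial x s)) +
    -1 * (s ^+ k.+1 * 'D_w f (radial x s)) = s ^+ k * (f (radial (x + w) s) -
    f (radial x s) - s * 'D_w f (radial x s)) by rewrite exprS; ring.
case/andP: s01 => s0 s1; rewrite normrM ler_piMl// normrX ger0_norm//.
exact: exprn_ile1.
Qed.

Lemma rint_smooth k f : smooth_on B f -> smooth_on B (rint k f).
Proof.
move=> sf; pose P (g : 'rV[R]_n -> R) := exists k (f : 'rV[R]_n -> R), smooth_on B f /\ g = rint k f.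
apply: (@smooth_on_coind _ _ _ B P oB); last by exists k, f.
move=> _ [{}k [{}f [{}sf ->]]]; split=> [x Bx|v].
  by have [] := rint_derive k sf Bx.
exists (rint k.+1 ('D_v f)); split.
  by exists k.+1, ('D_v f); split => //; exact: smooth_on_derive.
by move=> x Bx; have [_] := rint_derive k sf Bx.
Qed.

(** The integral over [0, 1] of the derivative of s^(k+1) f(x0 + s (x - x0)); this is the Euler
    identity behind the homotopy formula. *)
Lemma rint_FTC k f x : smooth_on B f -> B x ->
  k.+1%:R * rint k f x + rint k.+1 ('D_(x - x0) f) x = f x.
Proof.
move=> sf Bx; have c1 := cont01_radial (k := k) sf Bx.
have c2 := cont01_radial (k := k.+1) (smooth_on_derive (x - x0) sf) Bx.
have c3 := cont01M (@cont01_cst _ k.+1%:R) c1.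
rewrite /rint -(I01Z _ c1) -(I01D c3 c2).
have D (s : R) : 0 <= s <= 1 -> is_derive s 1 (fun s : R => s ^+ k.+1 * f (radial x s))
    (k.+1%:R * (s ^+ k * f (radial x s)) + s ^+ k.+1 * 'D_(x - x0) f (radial x s)).
  move=> s01; have d1 := is_derive_line (smooth_on_diff sf (radial_in Bx s01)).
  have d0 : is_derive s 1 (fun s : R => s ^+ k.+1) (k.+1%:R * s ^+ k).
    by apply: DeriveDef; [exact: exprn_derivable|rewrite exp_derive /GRing.scale /= mulr1].
  have [/derivable1_diffP df0 D0] := d0; have [/derivable1_diffP df1 D1] := d1.
  apply: DeriveDef; first exact/derivable1_diffP/differentiableM.
  by rewrite (@Dmul R R^o _ _ s 1 df0 df1) D0 D1; ring.
have -> := I01_FTC (cont01D c3 c2) D.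
by rewrite expr1n mul1r expr0n mul0r subr0 /radial scale1r addrC subrK.
Qed.

Lemma rint_sum k (I : Type) (e : seq I) (c : I -> R) (F : I -> 'rV[R]_n -> R) x :
  (forall i, smooth_on B (F i)) -> B x ->
  rint k (fun y => \sum_(i <- e) c i * F i y) x = \sum_(i <- e) c i * rint k (F i) x.
Proof.
move=> sF Bx; rewrite /rint -I01_sum => [|i]; last exact: cont01_radial.
by apply: I01_eq => s s01; rewrite mulr_sumr; apply: eq_bigr => i _; rewrite mulrCA.
Qed.

Lemma rintB k f g x : smooth_on B f -> smooth_on B g -> B x ->
  rint k (fun y => f y - g y) x = rint k f x - rint k g x.
Proof.
move=> sf sg Bx; have cf := cont01_radial (k := k) sf Bx.
have cg := cont01_radial (k := k) sg Bx.
rewrite /rint -[X in _ + X]mulN1r -(I01Z _ cg) -I01D//; last first.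
  exact: (cont01M (@cont01_cst _ (- 1)) cg).
by apply: I01_eq => s _; ring.
Qed.

Lemma rint_eq k f g x : (forall y, B y -> f y = g y) -> B x -> rint k f x = rint k g x.
Proof. by move=> fg Bx; apply: I01_eq => s s01; rewrite fg//; exact: radial_in. Qed.

(** The primitive is the integral of [a] along the ray from [x0]. In its derivative along v,
    closedness replaces the derivatives of the coefficients along v by the derivative of a(v) along
    x - x0, and [rint_FTC] with k = 0 returns a(v). *)
Lemma poincare1 (a : 'rV[R]_n -> 'rV[R]_n -> R) :
  (forall x, B x -> forall c u v, a x (c *: u + v) = c * a x u + a x v) ->
  (forall v, smooth_on B (a ^~ v)) ->
  (forall x, B x -> forall u v, 'D_u (a ^~ v) x = 'D_v (a ^~ u) x) ->
  exists2 y, smooth_on B y & forall x, B x -> forall v, 'D_v y x = a x v.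
Proof.
move=> la sa ca; have asum x v : B x -> a x v = \sum_j v ord0 j * a x 'e_j.
  move=> Bx; have a0 : a x 0 = 0.
    by have := la x Bx (- 1) 0 0; rewrite scaler0 addr0 mulN1r addrC subrr.
  rewrite {1}(rV_delta v); elim: (index_enum _) => [|j s IH]; first by rewrite !big_nil.
  by rewrite !big_cons la// IH.
pose y x := \sum_j (x - x0) ord0 j * rint 0 (a ^~ 'e_j) x.
have sx j : smooth_on B (fun x : 'rV[R]_n => (x - x0) ord0 j).
  apply: (smooth_on_eq (f := fun x : 'rV[R]_n => x ord0 j - x0 ord0 j)) => //.
    by move=> x _; rewrite !mxE.
  apply: smoothB => //; last exact: smooth_on_cst.
  by apply: smooth_on_coord => //; exact: smooth_on_id.
exists y; first by apply: smooth_sum => // j _; apply: smoothM => //; exact: rint_smooth.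
move=> x Bx v; have dx := fun j => smooth_on_diff (sx j) Bx.
have dr j := smooth_on_diff (rint_smooth 0 (sa 'e_j)) Bx.
have [_ ->] := Dsum (index_enum 'I_n) v (fun j (_ : predT j) => differentiableM (dx j) (dr j)).
have Dx j : 'D_v (fun x : 'rV[R]_n => (x - x0) ord0 j) x = v ord0 j.
  rewrite Dcoord; last exact: differentiableB.
  by rewrite Dadd ?derive_id ?derive_cst ?addr0.
under eq_bigr => j _.
  rewrite (Dmul _ (dx j) (dr j)) Dx (proj2 (rint_derive 0 (sa 'e_j) Bx)).
  over.
rewrite big_split /= -!rint_sum//; last by move=> j; exact: smooth_on_derive.
rewrite -[RHS](rint_FTC 0 (sa v) Bx) mul1r; congr (_ + _).
  by apply: rint_eq => // z Bz; rewrite asum.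
apply: rint_eq => // z Bz; rewrite D_deltar; last exact: smooth_on_diff (sa v) Bz.
by apply: eq_bigr => j _; rewrite ca.
Qed.

(** The potential is the radial integral, with weight s, of [w] contracted with x - x0. Antisymmetry
    of [w] makes the undifferentiated terms add up to twice the integral, which is the factor k + 1
    of [rint_FTC] for k = 1; closedness supplies the other term. *)
Lemma poincare2 (w : 'rV[R]_n -> 'rV[R]_n -> 'rV[R]_n -> R) :
  (forall x, B x -> forall c u v z, w x (c *: u + v) z = c * w x u z + w x v z) ->
  (forall x, B x -> forall u v, w x u v = - w x v u) ->
  (forall u v, smooth_on B (fun x => w x u v)) ->
  (forall x, B x -> forall u v z, 'D_u (fun y => w y v z) x -
    'D_v (fun y => w y u z) x + 'D_z (fun y => w y u v) x = 0) ->
  exists a : 'rV[R]_n -> 'rV[R]_n -> R,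
    [/\ forall x, B x -> forall c u v, a x (c *: u + v) = c * a x u + a x v,
        forall v, smooth_on B (a ^~ v) &
        forall x, B x -> forall u v, 'D_u (a ^~ v) x - 'D_v (a ^~ u) x = w x u v].
Proof.
move=> lw aw sw cw; have wsum x u v : B x -> w x u v = \sum_j u ord0 j * w x 'e_j v.
  move=> Bx; have w0 : w x 0 v = 0.
    by have := lw x Bx (- 1) 0 0 v; rewrite scaler0 addr0 mulN1r addrC subrr.
  rewrite {1}(rV_delta u); elim: (index_enum _) => [|j s IH]; first by rewrite !big_nil.
  by rewrite !big_cons lw// IH.
pose a x v := \sum_j (x - x0) ord0 j * rint 1 (fun y => w y 'e_j v) x.
have sx j : smooth_on B (fun x : 'rV[R]_n => (x - x0) ord0 j).
  apply: (smooth_on_eq (f := fun x : 'rV[R]_n => x ord0 j - x0 ord0 j)) => //.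
    by move=> x _; rewrite !mxE.
  apply: smoothB => //; last exact: smooth_on_cst.
  by apply: smooth_on_coord => //; exact: smooth_on_id.
have sa v : smooth_on B (a ^~ v).
  by apply: smooth_sum => // j _; apply: smoothM => //; exact: rint_smooth.
exists a; split => //.
  move=> x Bx c u v; rewrite /a mulr_sumr -big_split /=; apply: eq_bigr => j _.
  have -> : rint 1 (fun y => w y 'e_j (c *: u + v)) x =
      rint 1 (fun y => \sum_(b <- [:: true; false]) (if b then c else 1) *
        w y 'e_j (if b then u else v)) x.
    apply: rint_eq => // y By; rewrite !big_cons big_nil /= addr0 mul1r.
    by rewrite aw// lw// opprD -mulrN -!aw.
  by rewrite rint_sum// !big_cons big_nil /= addr0 mul1r; ring.
move=> x Bx u v.
have Da u' v' : 'D_u' (a ^~ v') x = rint 1 (fun y => w y u' v') x +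
    \sum_j (x - x0) ord0 j * rint 2 ('D_u' (fun y => w y 'e_j v')) x.
  have dx := fun j => smooth_on_diff (sx j) Bx.
  have dr j := smooth_on_diff (rint_smooth 1 (sw 'e_j v')) Bx.
  have [_ ->] := Dsum (index_enum 'I_n) u' (fun j (_ : predT j) => differentiableM (dx j) (dr j)).
  have Dx j : 'D_u' (fun x : 'rV[R]_n => (x - x0) ord0 j) x = u' ord0 j.
    rewrite Dcoord; last exact: differentiableB.
    by rewrite Dadd ?derive_id ?derive_cst ?addr0.
  under eq_bigr => j _.
    rewrite (Dmul _ (dx j) (dr j)) Dx (proj2 (rint_derive 1 (sw 'e_j v') Bx)).
    over.
  rewrite big_split /= -rint_sum//; congr (_ + _).
  by apply: rint_eq => // z Bz; rewrite -wsum.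
rewrite !Da -(rint_FTC 1 (sw u v) Bx).
have -> : rint 1 (fun y => w y v u) x = - rint 1 (fun y => w y u v) x.
  have -> : rint 1 (fun y => w y v u) x =
      rint 1 (fun y => \sum_(b <- [:: true]) (- 1) * w y u v) x.
    by apply: rint_eq => // y By; rewrite big_seq1 mulN1r -aw.
  by rewrite rint_sum// big_seq1 mulN1r.
have -> : rint 2 ('D_(x - x0) (fun y => w y u v)) x =
    \sum_j (x - x0) ord0 j * rint 2 ('D_u (fun y => w y 'e_j v)) x -
    \sum_j (x - x0) ord0 j * rint 2 ('D_v (fun y => w y 'e_j u)) x.
  have sD j u' v' : smooth_on B ('D_u' (fun y => w y 'e_j v')).
    exact: smooth_on_derive.
  pose X j := (x - x0) ord0 j.
  have E u' v' := @rint_sum 2 _ (index_enum 'I_n) X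
    (fun j => 'D_u' (fun y => w y 'e_j v')) x (fun j => sD j u' v') Bx.
  have sS u' v' : smooth_on B (fun y => \sum_j X j * 'D_u' (fun y => w y 'e_j v') y).
    by apply: smooth_sum => // j _; apply: smoothM => //; exact: smooth_on_cst.
  transitivity (rint 2 (fun y => \sum_j X j * 'D_u (fun y => w y 'e_j v) y) x -
      rint 2 (fun y => \sum_j X j * 'D_v (fun y => w y 'e_j u) y) x); last first.
    by congr (_ - _); exact: E.
  rewrite -(rintB 2 (sS u v) (sS v u) Bx).
  apply: rint_eq => // y By; rewrite D_deltar; last exact: smooth_on_diff (sw u v) By.
  rewrite -sumrB; apply: eq_bigr => j _; rewrite -mulrBr; congr (_ * _).
  have := cw y By 'e_j u v; move=> /eqP; rewrite -addrA addr_eq0 => /eqP ->.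
  by rewrite opprD opprK.
have aux (p a1 a2 : R) : p + a1 - (- p + a2) = 2%:R * p + (a1 - a2) by ring.
exact: aux.
Qed.

End RadialIntegral.

(** * Multilinear and alternating covectors, and their wedge products *)

Section Covectors.
Variables (R : realType) (n : nat).
Local Notation V := 'rV[R]_n.
Implicit Types (l : seq V) (u v w z : V).

(* Forms are evaluated on lists of vectors; the default value 0 is never reached. *)
Definition vec p l : 'I_p -> V := fun i => nth 0 l i.

Definition remn (T : Type) j (l : seq T) := take j l ++ drop j.+1 l.

Definition fcons p (x : V) (f : 'I_p -> V) : 'I_p.+1 -> V :=
  fun i => oapp f x (unlift ord0 i).

Lemma nth_remn (T : Type) (x0 : T) j (l : seq T) k : (j < size l)%N ->
  nth x0 (remn j l) k = nth x0 l (bump j k).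
Proof.
move=> jl; rewrite /remn nth_cat size_takel ?(ltnW jl)// /bump.
by case: (ltnP k j) => kj; [rewrite nth_take|rewrite nth_drop; congr nth; lia].
Qed.

Lemma size_remn (T : Type) j (l : seq T) : (j < size l)%N -> size (remn j l) = (size l).-1.
Proof.
by move=> jl; rewrite size_cat size_takel ?(ltnW jl)// size_drop; lia.
Qed.

Lemma vec_lift p l (a : 'I_p.+1) : size l = p.+1 ->
  (fun b => vec l (lift a b)) = vec (remn a l) :> ('I_p -> V).
Proof.
by move=> sl; apply/funext => b; rewrite /vec nth_remn ?sl.
Qed.

Lemma fcons_vec p x l : fcons x (vec l) = vec (x :: l) :> ('I_p.+1 -> V).
Proof.
apply/funext => i; rewrite /fcons /vec; case: unliftP => [j ->|->] //=.
Qed.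

Lemma vecP p (f : 'I_p -> V) : exists2 l, size l = p & f = vec l.
Proof.
exists [seq f i | i <- enum 'I_p]; first by rewrite size_map size_enum_ord.
apply/funext => i; rewrite /vec (nth_map i) ?size_enum_ord//.
by congr f; apply: val_inj; rewrite /= nth_enum_ord.
Qed.

Lemma vec_eta p (f : 'I_p -> V) : f = vec [seq f i | i <- enum 'I_p].
Proof.
apply/funext => i; rewrite /vec (nth_map i) ?size_enum_ord//.
by congr f; apply: val_inj; rewrite /= nth_enum_ord.
Qed.

Lemma pair2E u w : pair2 u w = vec [:: u; w].
Proof. by apply/funext => i; rewrite /pair2 (tnth_nth 0). Qed.

Lemma vec1E (f : 'I_1 -> V) : f = vec [:: f ord0].
Proof. by apply/funext => i; rewrite (ord1 i). Qed.

Section Multilinear.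
Variables (p : nat) (a : cov R n p).
Hypothesis ma : multilinear a.

Lemma ml_vec c u w l1 l2 : size (l1 ++ u :: l2) = p ->
  a (vec (l1 ++ (c *: u + w) :: l2)) =
  c * a (vec (l1 ++ u :: l2)) + a (vec (l1 ++ w :: l2)).
Proof.
rewrite size_cat /= => sp; have i1 : (size l1 < p)%N by rewrite -sp addnS ltnS leq_addr.
have E z : vec (l1 ++ z :: l2) =
    fun j : 'I_p => if j == Ordinal i1 then z else vec (l1 ++ 0 :: l2) j.
  apply/funext => j; rewrite /vec !nth_cat -val_eqE /=.
  case: ltngtP => // jl; last by rewrite jl subnn.
  by case Ej: (j - size l1)%N => //; lia.
by rewrite (E (c *: u + w)) (E u) (E w); exact: ma.
Qed.

Lemma ml_vec0 l1 l2 : size (l1 ++ 0 :: l2) = p -> a (vec (l1 ++ 0 :: l2)) = 0.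
Proof.
move=> sp; have E : -1 *: (0 : V) + 0 = 0 by rewrite scaler0 addr0.
have := @ml_vec (- 1) 0 0 l1 l2 sp; rewrite E; move: (a _) => x.
by rewrite mulN1r addNr.
Qed.

Lemma ml_vecZ c u l1 l2 : size (l1 ++ u :: l2) = p ->
  a (vec (l1 ++ (c *: u) :: l2)) = c * a (vec (l1 ++ u :: l2)).
Proof.
move=> sp; rewrite -[c *: u]addr0 ml_vec// ml_vec0 ?addr0//.
by rewrite -sp !size_cat.
Qed.

Lemma ml_vecD u w l1 l2 : size (l1 ++ u :: l2) = p ->
  a (vec (l1 ++ (u + w) :: l2)) = a (vec (l1 ++ u :: l2)) + a (vec (l1 ++ w :: l2)).
Proof. by move=> sp; have := @ml_vec 1 u w l1 l2 sp; rewrite scale1r mul1r. Qed.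

Lemma ml_vecN u l1 l2 : size (l1 ++ u :: l2) = p ->
  a (vec (l1 ++ (- u) :: l2)) = - a (vec (l1 ++ u :: l2)).
Proof. by move=> sp; rewrite -scaleN1r ml_vecZ// mulN1r. Qed.

Lemma ml_vec_sum (I : Type) (r : seq I) (c : I -> R) (e : I -> V) l1 l2 :
  (size l1 + size l2).+1 = p ->
  a (vec (l1 ++ (\sum_(i <- r) c i *: e i) :: l2)) =
  \sum_(i <- r) c i * a (vec (l1 ++ e i :: l2)).
Proof.
move=> sp; have S x : size (l1 ++ x :: l2) = p by rewrite size_cat /= addnS.
by elim: r => [|i r IH]; rewrite ?big_nil ?ml_vec0// !big_cons ml_vec// IH.
Qed.

Hypothesis aa : alternating a.

Lemma alt_tperm (f : 'I_p -> V) i k : i != k -> a (f \o tperm i k) = - a f.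
Proof.
move=> ik; pose g z w := a (fun j => if j == i then z else if j == k then w else f j).
have ki : (k == i) = false by rewrite eq_sym (negbTE ik).
have gD1 z z' w : g (z + z') w = g z w + g z' w.
  have := ma (fun j => if j == k then w else f j) i 1 z z'.
  by rewrite /= scale1r mul1r.
have gD2 z w w' : g z (w + w') = g z w + g z w'.
  have := ma (fun j => if j == i then z else f j) k 1 w w'.
  rewrite /= scale1r mul1r; have E x : (fun j => if j == k then x else
      if j == i then z else f j) = fun j => if j == i then z else
      if j == k then x else f j.
    by apply/funext => j; have [->|//] := eqVneq j k; rewrite ki.
  by rewrite (E (w + w')) (E w) (E w').
have g0 z : g z z = 0.
  by apply: (aa ik); rewrite eqxx ki eqxx.
have : g (f i + f k) (f i + f k) = 0 by exact: g0.
rewrite gD1 !gD2 !g0 add0r addr0 => /eqP; rewrite addr_eq0 => /eqP.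
have -> : g (f i) (f k) = a f.
  by congr a; apply/funext => j; case: eqVneq => [->//|_]; case: eqVneq => [->|].
have -> : g (f k) (f i) = a (f \o tperm i k).
  by congr a; apply/funext => j /=; case: tpermP => [->|->|/eqP/negbTE -> /eqP/negbTE ->];
    rewrite ?eqxx// ki.
by move=> ->; rewrite opprK.
Qed.

Lemma alt_perm (f : 'I_p -> V) (s : 'S_p) : a (f \o s) = (-1) ^+ s * a f.
Proof.
have [ts -> dts] := prod_tpermP s; elim: ts dts f => [|[i k] ts IH] /=.
  move=> _ f; rewrite big_nil odd_perm1 mul1r; congr a.
  by apply/funext => j /=; rewrite perm1.
move=> /andP[ik dts] f; rewrite big_cons odd_mul_tperm ik signr_addb /=.
have -> : f \o (tperm i k * \prod_(t <- ts) tperm t.1 t.2)%g =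
    (f \o (\prod_(t <- ts) tperm t.1 t.2)%g) \o tperm i k.
  by apply/funext => j /=; rewrite permM.
by rewrite alt_tperm// IH// expr1 mulN1r mulNr.
Qed.

Lemma alt_vec u w l1 l2 : size (l1 ++ u :: w :: l2) = p ->
  a (vec (l1 ++ u :: w :: l2)) = - a (vec (l1 ++ w :: u :: l2)).
Proof.
rewrite size_cat /= !addnS => sp.
have i1 : (size l1 < p)%N by lia.
have i2 : ((size l1).+1 < p)%N by lia.
have ne : Ordinal i1 != Ordinal i2 by rewrite -val_eqE /= neq_ltn ltnSn.
rewrite -(alt_tperm _ ne); congr a; apply/funext => j; rewrite /vec /=.
case: tpermP => [->|->|/eqP j1 /eqP j2] /=.
- by rewrite !nth_cat ltnn subnn ltnNge leqnSn /= subSnn.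
- by rewrite !nth_cat ltnn subnn ltnNge leqnSn /= subSnn.
rewrite !nth_cat; case: ltngtP => // jl; last first.
  by move: j1; rewrite -val_eqE /= jl eqxx.
move: j2; rewrite -val_eqE /= => j2; case Ej: (j - size l1)%N => [|[|m]] //; lia.
Qed.

Lemma alt_vec0 u l1 l2 : size (l1 ++ u :: u :: l2) = p ->
  a (vec (l1 ++ u :: u :: l2)) = 0.
Proof.
by move=> /alt_vec/eqP; rewrite -subr_eq0 opprK -mulr2n mulrn_eq0 => /eqP.
Qed.

End Multilinear.

Lemma alt2 (a : cov R n 2) u v : multilinear a -> alternating a ->
  a (vec [:: v; u]) = - a (vec [:: u; v]).
Proof. by move=> ma aa; rewrite (alt_vec ma aa (l1 := [::])). Qed.

Lemma alt3 (a : cov R n 3) u v w : multilinear a -> alternating a ->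
  [/\ a (vec [:: u; w; v]) = - a (vec [:: u; v; w]),
      a (vec [:: v; u; w]) = - a (vec [:: u; v; w]),
      a (vec [:: v; w; u]) = a (vec [:: u; v; w]),
      a (vec [:: w; u; v]) = a (vec [:: u; v; w])
    & a (vec [:: w; v; u]) = - a (vec [:: u; v; w])].
Proof.
move=> ma aa.
have h1 x y z : a (vec [:: y; x; z]) = - a (vec [:: x; y; z]).
  by rewrite (alt_vec ma aa (l1 := [::])).
have h2 x y z : a (vec [:: x; z; y]) = - a (vec [:: x; y; z]).
  by rewrite (alt_vec ma aa (l1 := [:: x])).
split; first exact: h2.
- exact: h1.
- by rewrite h2 h1 opprK.
- by rewrite h1 h2 opprK.
- by rewrite h1 h2 h1 opprK.
Qed.

(** A permutation is the image j of the first point together with a permutation of the others, with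
    relative sign (-1)^j, as in a Laplace expansion. *)
Lemma sum_perm_lift (m : nat) (F : 'S_m.+1 -> R) :
  \sum_(s : 'S_m.+1) (-1) ^+ s * F s =
  \sum_(j < m.+1) (-1) ^+ j * \sum_(s : 'S_m) (-1) ^+ s * F (lift_perm ord0 j s).
Proof.
pose g (js : 'I_m.+1 * 'S_m) : 'S_m.+1 := lift_perm ord0 js.1 js.2.
have ig : injective g.
  move=> [j s] [j' s'] E; have jj' : j = j'.
    by have := congr1 (fun s : 'S_m.+1 => s ord0) E; rewrite /g !lift_perm_id.
  rewrite jj' in E *; congr pair; apply/permP => k.
  have := congr1 (fun s : 'S_m.+1 => s (lift ord0 k)) E.
  by rewrite /g !lift_perm_lift => /lift_inj.
have bg : bijective g.
  by apply: (inj_card_bij ig); rewrite card_prod card_ord !card_Sn factS.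
rewrite (reindex g); last exact: onW_bij.
under [RHS]eq_bigr do rewrite mulr_sumr.
rewrite pair_bigA; apply: eq_bigr => -[j s] _ /=.
by rewrite /g odd_lift_perm /= signr_addb signr_odd mulrA.
Qed.

Section Wedge.
Variables (p q : nat).
Implicit Types (a : cov R n p) (b : cov R n q).

Lemma cwedge_alternating a b : alternating (cwedge a b).
Proof.
move=> f i j ij fij; set x := cwedge a b f; suff : x = - x.
  by move/eqP; rewrite -subr_eq0 opprK -mulr2n mulrn_eq0 => /eqP.
rewrite {1}/x /cwedge (reindex_inj (mulIg (tperm i j))) /= -mulrN -sumrN; congr (_ * _).
apply: eq_bigr => s _; rewrite odd_permM odd_tperm ij addbT signrN mulNr.
have E k : f ((s * tperm i j)%g k) = f (s k).
  by rewrite permM; case: tpermP => [->|->|].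
congr (- (_ * (_ * _))); [congr a|congr b]; apply/funext => k; exact: E.
Qed.

(** The injections [f] and [g] partition the slots, so changing one argument affects exactly one of
    the two factors. *)
Lemma multilinear_split (f : 'I_p -> 'I_(p + q)) (g : 'I_q -> 'I_(p + q)) a b :
  injective f -> injective g -> (forall j k, f j != g k) ->
  (forall i, (exists j, f j = i) \/ exists k, g k = i) ->
  multilinear a -> multilinear b ->
  multilinear (fun v : 'I_(p + q) -> V => a (v \o f) * b (v \o g)).
Proof.
move=> fi gi fg fgi ma mb v i c u w upd.
have [[j ji]|[k ki]] := fgi i.
  have Eb z : b (upd z \o g) = b (v \o g).
    congr b; apply/funext => k; rewrite /upd /=.
    by case: eqVneq => // gk; have := fg j k; rewrite ji -gk eqxx.
  have Ea z : upd z \o f = fun k => if k == j then z else (v \o f) k.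
    by apply/funext => k; rewrite /upd /= -ji (inj_eq fi).
  by rewrite !Eb !Ea ma mulrDl mulrA.
have Ea z : a (upd z \o f) = a (v \o f).
  congr a; apply/funext => j; rewrite /upd /=.
  by case: eqVneq => // fj; have := fg j k; rewrite ki -fj eqxx.
have Eb z : upd z \o g = fun j => if j == k then z else (v \o g) j.
  by apply/funext => j; rewrite /upd /= -ki (inj_eq gi).
by rewrite !Ea !Eb mb mulrDr; ring.
Qed.

Lemma cwedge_multilinear a b : multilinear a -> multilinear b ->
  multilinear (cwedge a b).
Proof.
move=> ma mb v i c u w upd; rewrite /cwedge [c * _]mulrCA -mulrDr; congr (_ * _).
rewrite mulr_sumr -big_split /=; apply: eq_bigr => s _.
have := @multilinear_split (fun j => s (lshift q j)) (fun k => s (rshift p k)) a b.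
move=> /(_ _ _ _ _ ma mb v i c u w) H.
rewrite [c * _]mulrCA -mulrDr; congr (_ * _); apply: H.
- by move=> j k /perm_inj/lshift_inj.
- by move=> j k /perm_inj/rshift_inj.
- by move=> j k; apply/eqP => /perm_inj/eqP; rewrite eq_lrshift.
- move=> j; rewrite -(permKV s j); case: (split_ordP (s^-1%g j)) => k ->.
    by left; exists k.
  by right; exists k.
Qed.

Lemma cwedge_linr a b b' (c : R) :
  cwedge a (fun f => c * b f + b' f) = fun f => c * cwedge a b f + cwedge a b' f.
Proof.
apply/funext => f; rewrite /cwedge [c * _]mulrCA -mulrDr; congr (_ * _).
by rewrite mulr_sumr -big_split /=; apply: eq_bigr => s _; rewrite !mulrDr !(mulrCA _ c).
Qed.

Lemma cwedge_linl a a' b (c : R) :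
  cwedge (fun f => c * a f + a' f) b = fun f => c * cwedge a b f + cwedge a' b f.
Proof.
apply/funext => f; rewrite /cwedge [c * _]mulrCA -mulrDr; congr (_ * _).
by rewrite mulr_sumr -big_split /=; apply: eq_bigr => s _; rewrite mulrDl mulrDr -mulrA (mulrCA _ c).
Qed.

End Wedge.

(** Sorts the permutations by the argument that fills the first slot of [a]. This recursion on the
    degree of the left factor yields all the explicit formulas below; the coefficient comes from the
    factorial normalisation. *)
Lemma cwedge_first p q (a : cov R n p.+1) (b : cov R n q) (v : 'I_(p.+1 + q) -> V) :
  cwedge a b v = p.+1%:R^-1 * \sum_(j < (p + q).+1) (-1) ^+ j *
    cwedge (fun f => a (fcons (v j) f)) b (fun k : 'I_(p + q) => v (lift j k)).
Proof.
rewrite {1}/cwedge.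
transitivity ((p.+1`! * q`!)%:R^-1 * \sum_(j < (p + q).+1) (-1) ^+ j *
    \sum_(s : 'S_(p + q)) (-1) ^+ s *
     (a (fcons (v j) (fun i => v (lift j (s (lshift q i))))) *
      b (fun i => v (lift j (s (rshift p i)))))).
  congr (_ * _); rewrite (@sum_perm_lift (p + q) (fun s =>
    a (fun i => v (s (lshift q i))) * b (fun i => v (s (rshift p.+1 i))))).
  apply: eq_bigr => j _; congr (_ * _); apply: eq_bigr => s _; congr (_ * (_ * _)).
    congr a; apply/funext => i; rewrite /fcons; case: unliftP => [k ->|->] /=.
      have -> : lshift q (lift ord0 k) = lift ord0 (lshift q k) :> 'I_(p + q).+1.
        exact: val_inj.
      by rewrite lift_perm_lift.
    have -> : lshift q ord0 = ord0 :> 'I_(p + q).+1 by exact: val_inj.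
    by rewrite lift_perm_id.
  congr b; apply/funext => i.
  have -> : rshift p.+1 i = lift ord0 (rshift p i) :> 'I_(p + q).+1 by exact: val_inj.
  by rewrite lift_perm_lift.
rewrite factS natrM natrM -mulrA invfM -mulrA; congr (_ * _).
rewrite mulr_sumr; apply: eq_bigr => j _; rewrite /cwedge natrM.
by rewrite mulrCA.
Qed.

Lemma cwedge0 q (a : cov R n 0) (b : cov R n q) (v : 'I_(0 + q) -> V) :
  multilinear b -> alternating b -> cwedge a b v = a (vec [::]) * b v.
Proof.
move=> mb ab; have a0 (f : 'I_0 -> V) : a f = a (vec [::]) by congr a; apply/funext => -[].
rewrite /cwedge; under eq_bigr => s _.
  rewrite a0; have -> : (fun j => v (s (rshift 0 j))) = v \o s.
    by apply/funext => j /=; congr (v (s _)); apply: val_inj.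
  rewrite (alt_perm mb ab) mulrCA signrMK.
  over.
rewrite sumr_const card_Sn; change (0 + q)%N with q.
move: (a _ * _) => x; rewrite fact0 mul1n -[x *+ _]mulr_natl.
by rewrite mulKf// pnatr_eq0 -lt0n fact_gt0.
Qed.

Lemma cwedge_vec p q (a : cov R n p.+1) (b : cov R n q) l : size l = (p + q).+1 ->
  cwedge a b (vec l) = p.+1%:R^-1 * \sum_(j < (p + q).+1) (-1) ^+ j *
    cwedge (fun f => a (fcons (nth 0 l j) f)) b (vec (remn j l)).
Proof.
move=> sl; rewrite cwedge_first; congr (_ * _); apply: eq_bigr => j _.
by rewrite vec_lift.
Qed.

End Covectors.

Section WedgeFormulas.
Variables (R : realType) (n : nat).
Local Notation V := 'rV[R]_n.
Implicit Types (l : seq V).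

Definition contract p (x : V) (a : cov R n p.+1) : cov R n p := fun f => a (fcons x f).

Lemma contract_vec p x (a : cov R n p.+1) l : contract x a (vec l) = a (vec (x :: l)).
Proof. by rewrite /contract fcons_vec. Qed.

Lemma contract_multilinear p x (a : cov R n p.+1) :
  multilinear a -> multilinear (contract x a).
Proof.
move=> ma f i c u w upd; have E z : fcons x (upd z) =
    fun j => if j == lift ord0 i then z else fcons x f j.
  apply/funext => j; rewrite /fcons /upd; case: (unliftP ord0 j) => [k ->|->] /=.
    by rewrite (inj_eq lift_inj).
  by rewrite ?(negbTE (neq_lift _ _)).
by rewrite /contract !E; exact: ma.
Qed.

Lemma contract_alternating p x (a : cov R n p.+1) :
  alternating a -> alternating (contract x a).
Proof.
move=> aa f i j ij fij; apply: (aa _ (lift ord0 i) (lift ord0 j)).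
  by rewrite (inj_eq lift_inj).
by rewrite /fcons !liftK.
Qed.

Lemma contract_lin p (a : cov R n p.+1) (c : R) x y f : multilinear a ->
  contract (c *: x + y) a f = c * contract x a f + contract y a f.
Proof.
move=> ma; have [l sl ->] := vecP f; rewrite !contract_vec.
by apply: (@ml_vec _ _ _ _ ma c x y [::] l); rewrite /= sl.
Qed.

Lemma alternating1 (a : cov R n 1) : alternating a.
Proof. by move=> v i j; rewrite (ord1 i) (ord1 j) eqxx. Qed.

Lemma wedge1E q (a : cov R n 1) (b : cov R n q) l :
  multilinear b -> alternating b -> size l = q.+1 ->
  cwedge a b (vec l) = \sum_(j < q.+1) (-1) ^+ j * (a (vec [:: nth 0 l j]) * b (vec (remn j l))).
Proof.
move=> mb ab sl; rewrite cwedge_vec// invr1 mul1r; apply: eq_bigr => j _.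
by rewrite cwedge0// fcons_vec.
Qed.

Lemma wedge2E q (a : cov R n 2) (b : cov R n q) l :
  multilinear b -> alternating b -> size l = q.+2 ->
  cwedge a b (vec l) = 2^-1 * \sum_(j < q.+2) (-1) ^+ j *
    \sum_(k < q.+1) (-1) ^+ k *
      (a (vec [:: nth 0 l j; nth 0 (remn j l) k]) * b (vec (remn k (remn j l)))).
Proof.
move=> mb ab sl; rewrite cwedge_vec//; congr (_ * _); apply: eq_bigr => j _.
rewrite wedge1E ?size_remn ?sl//; congr (_ * _); apply: eq_bigr => k _.
by rewrite fcons_vec.
Qed.

Lemma wedge3E q (a : cov R n 3) (b : cov R n q) l :
  multilinear b -> alternating b -> size l = q.+3 ->
  cwedge a b (vec l) = 3^-1 * \sum_(i < q.+3) (-1) ^+ i * (2^-1 *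
    \sum_(j < q.+2) (-1) ^+ j * \sum_(k < q.+1) (-1) ^+ k *
      (a (vec [:: nth 0 l i; nth 0 (remn i l) j; nth 0 (remn j (remn i l)) k])
       * b (vec (remn k (remn j (remn i l)))))).
Proof.
move=> mb ab sl; rewrite cwedge_vec//; congr (_ * _); apply: eq_bigr => i _.
rewrite wedge2E ?size_remn ?sl//; do 2!congr (_ * _); apply: eq_bigr => j _.
by congr (_ * _); apply: eq_bigr => k _; rewrite fcons_vec.
Qed.

Variables (u v w z y : V).

Lemma wedge13 (a : cov R n 1) (b : cov R n 3) : multilinear b -> alternating b ->
  cwedge a b (vec [:: u; v; w; z]) =
  a (vec [:: u]) * b (vec [:: v; w; z]) - a (vec [:: v]) * b (vec [:: u; w; z])
  + a (vec [:: w]) * b (vec [:: u; v; z]) - a (vec [:: z]) * b (vec [:: u; v; w]).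
Proof.
move=> mb ab; rewrite wedge1E// !big_ord_recr big_ord0 /= /remn /=.
by rewrite !exprS expr0; ring.
Qed.

Lemma wedge21 (a : cov R n 2) (b : cov R n 1) : multilinear a -> alternating a ->
  multilinear b -> cwedge a b (vec [:: u; v; w]) =
  a (vec [:: u; v]) * b (vec [:: w]) - a (vec [:: u; w]) * b (vec [:: v])
  + a (vec [:: v; w]) * b (vec [:: u]).
Proof.
move=> ma aa mb; have ab := @alternating1 b; rewrite wedge2E// !big_ord_recr !big_ord0 /= /remn /=.
rewrite (alt2 u v)// (alt2 u w)// (alt2 v w)//.
by rewrite !exprS expr0; field.
Qed.

Lemma wedge22 (a b : cov R n 2) : multilinear a -> alternating a ->
  multilinear b -> alternating b -> cwedge a b (vec [:: u; v; w; z]) =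
  a (vec [:: u; v]) * b (vec [:: w; z]) - a (vec [:: u; w]) * b (vec [:: v; z])
  + a (vec [:: u; z]) * b (vec [:: v; w]) + a (vec [:: v; w]) * b (vec [:: u; z])
  - a (vec [:: v; z]) * b (vec [:: u; w]) + a (vec [:: w; z]) * b (vec [:: u; v]).
Proof.
move=> ma aa mb ab; rewrite wedge2E// !big_ord_recr !big_ord0 /= /remn /=.
rewrite (alt2 u v ma aa) (alt2 u w ma aa) (alt2 v w ma aa).
rewrite (alt2 u z ma aa) (alt2 v z ma aa) (alt2 w z ma aa).
by rewrite !exprS expr0; field.
Qed.

(** Brings every ordering of three arguments of an alternating form to a single one, after which an
    expanded wedge product is a matter for [field]. *)
Ltac sort3 ma aa x y z :=
  let e1 := fresh in let e2 := fresh in let e3 := fresh in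
  let e4 := fresh in let e5 := fresh in
  have [e1 e2 e3 e4 e5] := alt3 x y z ma aa; rewrite ?e1 ?e2 ?e3 ?e4 ?e5;
  clear e1 e2 e3 e4 e5.

Lemma wedge31 (a : cov R n 3) (b : cov R n 1) : multilinear a -> alternating a ->
  multilinear b -> cwedge a b (vec [:: u; v; w; z]) =
  a (vec [:: u; v; w]) * b (vec [:: z]) - a (vec [:: u; v; z]) * b (vec [:: w])
  + a (vec [:: u; w; z]) * b (vec [:: v]) - a (vec [:: v; w; z]) * b (vec [:: u]).
Proof.
move=> ma aa mb; have ab := @alternating1 b; rewrite wedge3E// !big_ord_recr !big_ord0 /= /remn /=.
sort3 ma aa u v w; sort3 ma aa u v z; sort3 ma aa u w z; sort3 ma aa v w z.
by rewrite !exprS expr0; field.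
Qed.

Lemma wedge32 (a : cov R n 3) (b : cov R n 2) : multilinear a -> alternating a ->
  multilinear b -> alternating b -> cwedge a b (vec [:: u; v; w; z; y]) =
  a (vec [:: u; v; w]) * b (vec [:: z; y]) - a (vec [:: u; v; z]) * b (vec [:: w; y])
  + a (vec [:: u; v; y]) * b (vec [:: w; z]) + a (vec [:: u; w; z]) * b (vec [:: v; y])
  - a (vec [:: u; w; y]) * b (vec [:: v; z]) + a (vec [:: u; z; y]) * b (vec [:: v; w])
  - a (vec [:: v; w; z]) * b (vec [:: u; y]) + a (vec [:: v; w; y]) * b (vec [:: u; z])
  - a (vec [:: v; z; y]) * b (vec [:: u; w]) + a (vec [:: w; z; y]) * b (vec [:: u; v]).
Proof.
move=> ma aa mb ab; rewrite wedge3E// !big_ord_recr !big_ord0 /= /remn /=.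
sort3 ma aa u v w; sort3 ma aa u v z; sort3 ma aa u v y; sort3 ma aa u w z.
sort3 ma aa u w y; sort3 ma aa u z y; sort3 ma aa v w z; sort3 ma aa v w y.
sort3 ma aa v z y; sort3 ma aa w z y.
by rewrite !exprS expr0; field.
Qed.

End WedgeFormulas.

(* The values of forms on a frame are recorded by integer tables; identities
   between such forms are then decided by computation. *)
Fixpoint table_wedge p (A B : seq nat -> int) (l : seq nat) : int :=
  if p is p'.+1 then
    foldr (fun j s => (if odd j then - 1 else 1) *
      table_wedge p' (fun l' => A (nth 0%N l j :: l')) B (remn j l) + s) 0
      (iota 0 (size l))
  else A [::] * B l.

Fixpoint tuples p m : seq (seq nat) :=
  if p is p'.+1 then [seq i :: l | i <- iota 0 m, l <- tuples p' m] else [:: [::]].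

Lemma tuplesP p m l : (l \in tuples p m) = (size l == p) && all (ltn^~ m) l.
Proof.
elim: p l => [|p IH] [|i l] //=.
  by apply/negP => /allpairsP [[? ?] []].
apply/allpairsP/idP => [[[i' l'] /= [im lp [-> ->]]]|].
  by move: lp im; rewrite IH mem_iota add0n eqSS => /andP[-> ->] /= ->.
rewrite eqSS => /and3P[sl im al]; exists (i, l) => /=.
by rewrite mem_iota IH sl al add0n im.
Qed.

(** * Frames and integer tables of forms *)

Section Frames.
Variables (R : realType) (n : nat).
Local Notation V := 'rV[R]_n.

(** Spanning is what the vanishing criteria below rest on. Natural numbers as indices make words of
    indices plain lists, on which tables can be computed. *)
Definition frame m (E : nat -> V) : Prop :=
  forall v, exists c : nat -> R, v = \sum_(i <- iota 0 m) c i *: E i.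

Variables (m : nat) (E : nat -> V).

Definition has_table p (a : cov R n p) (c : R) (A : seq nat -> int) : Prop :=
  forall l, l \in tuples p m -> a (vec (map E l)) = c * (A l)%:~R.

Lemma map_remn (T U : Type) (f : T -> U) j (l : seq T) : map f (remn j l) = remn j (map f l).
Proof. by rewrite /remn map_cat map_take map_drop. Qed.

Lemma all_remn (T : Type) (P : pred T) j (l : seq T) : all P l -> all P (remn j l).
Proof.
move=> Pl; rewrite /remn all_cat; apply/andP; split.
  by move: Pl; rewrite -{1}(cat_take_drop j l) all_cat => /andP[].
by move: Pl; rewrite -{1}(cat_take_drop j.+1 l) all_cat => /andP[].
Qed.

(** [table_wedge] follows the recursion of [cwedge_vec] with the denominators dropped, so that it
    stays in the integers; the dropped denominators multiply to p!. *)
Lemma table_wedgeP p q (a : cov R n p) (b : cov R n q) (c d : R) A B :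
  multilinear b -> alternating b -> has_table a c A -> has_table b d B ->
  has_table (cwedge a b) ((p`!)%:R^-1 * (c * d)) (table_wedge p A B).
Proof.
move=> mb ab; elim: p a A => [|p IH] a A ta tb l.
  move=> lt; have {}lt : l \in tuples q m by [].
  rewrite cwedge0// (ta [::])// tb//= fact0 invr1 mul1r intrM.
  by ring.
move=> lt; have /andP[/eqP sl al] : (size l == (p + q).+1) && all (ltn^~ m) l.
  by rewrite -tuplesP.
rewrite cwedge_vec ?size_map// factS natrM invfM -!mulrA; congr (_ * _).
have foldr_sum (g : nat -> int) r : foldr (fun j s => g j + s) 0 r = \sum_(j <- r) g j.
  by elim: r => [|j r IHr]; rewrite ?big_nil// big_cons -IHr.
rewrite [table_wedge p.+1 A B l]/= foldr_sum sl.
rewrite -[iota 0 _]/(index_iota 0 (p + q).+1) big_mkord.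
rewrite raddf_sum !mulr_sumr; apply: eq_bigr => j _.
have jl : (j < size l)%N by rewrite sl.
have jm : (nth 0%N l j < m)%N by apply: (allP al); exact: mem_nth.
have ta' : has_table (contract (E (nth 0%N l j)) a) c (fun l' => A (nth 0%N l j :: l')).
  move=> l'; rewrite tuplesP => /andP[sl' al']; rewrite contract_vec.
  by rewrite -[_ :: map _ _]/(map E (_ :: _)) ta// tuplesP /= eqSS sl' jm.
have := IH _ _ ta' tb (remn j l); rewrite tuplesP size_remn ?sl// eqxx all_remn//.
move=> /(_ isT); rewrite -map_remn (nth_map 0%N)// => ->.
rewrite /= intrM -signr_odd; case: (odd j); rewrite ?expr1 ?expr0 ?mulrNz; ring.
Qed.

Hypothesis fE : frame m E.

Lemma linear_frame0 (F : V -> R) :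
  (forall (c : R) u v, F (c *: u + v) = c * F u + F v) ->
  (forall i, (i < m)%N -> F (E i) = 0) -> forall v, F v = 0.
Proof.
move=> lF F0 v; have [c ->] := fE v.
have F00 : F 0 = 0.
  have E0 : -1 *: (0 : V) + 0 = 0 by rewrite scaler0 addr0.
  by have := lF (-1) 0 0; rewrite E0; move: (F 0) => x; rewrite mulN1r addNr.
suff H s : all (ltn^~ m) s -> F (\sum_(i <- s) c i *: E i) = 0.
  by apply: H; apply/allP => i; rewrite mem_iota.
elim: s => [|i s IH]; first by rewrite big_nil.
by rewrite big_cons /= => /andP[im sm]; rewrite lF F0// IH// mulr0 addr0.
Qed.

Lemma multilinear_frame0 p (a : cov R n p) : multilinear a ->
  (forall l, l \in tuples p m -> a (vec (map E l)) = 0) -> forall f, a f = 0.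
Proof.
elim: p a => [|p IH] a ma a0 f.
  by rewrite -(a0 [::])//; congr a; apply/funext => -[].
have -> : f = fcons (f ord0) (fun i => f (lift ord0 i)).
  by apply/funext => i; rewrite /fcons; case: (unliftP ord0 i) => [j ->|->].
rewrite -[a _]/(contract (f ord0) a (fun i => f (lift ord0 i))).
apply: IH; first exact: contract_multilinear.
move=> l lp; apply: (linear_frame0 (F := fun x => contract x a (vec (map E l)))).
  by move=> c u v; exact: contract_lin.
move=> i im; rewrite contract_vec -[_ :: map _ _]/(map E (_ :: _)); apply: a0.
by move: lp; rewrite !tuplesP /= eqSS im.
Qed.

(** A word with a repeated index gives zero and any other one is a permutation of its sorted form;
    this keeps the later computations small. *)
Lemma alternating_frame0 p (a : cov R n p) : multilinear a -> alternating a ->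
  (forall l, l \in tuples p m -> sorted ltn l -> a (vec (map E l)) = 0) ->
  forall f, a f = 0.
Proof.
move=> ma aa a0; apply: multilinear_frame0 => // l.
rewrite tuplesP => /andP[/eqP sl al].
have [ul|] := boolP (uniq l); last first.
  move=> /(uniqPn 0%N) [i [j [ij jl ijE]]].
  have ip : (i < p)%N by rewrite -sl (ltn_trans ij).
  have jp : (j < p)%N by rewrite -sl.
  apply: (aa _ (Ordinal ip) (Ordinal jp)); first by rewrite -val_eqE /= neq_ltn ij.
  by rewrite /vec /= !(nth_map 0%N) ?ijE// sl.
pose l' := sort leq l.
have sl' : size l' == p by rewrite size_sort sl.
have [s sE] : exists s : 'S_p, l = [tuple tnth (Tuple sl') (s i) | i < p].
  by apply/tuple_permP; rewrite perm_sym; apply/permPl/perm_sort.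
have -> : vec (map E l) = vec (map E l') \o s.
  apply/funext => i; rewrite /vec /= (nth_map 0%N) ?sl// (nth_map 0%N); last first.
    by rewrite (eqP sl').
  congr E; rewrite [in LHS]sE -[LHS]/(nth 0%N (tval [tuple tnth (Tuple sl') (s i) | i < p]) i).
  by rewrite -tnth_nth tnth_mktuple (tnth_nth 0%N).
rewrite alt_perm// a0 ?mulr0//.
  rewrite tuplesP sl' /=; apply/allP => k; rewrite mem_sort; exact: (allP al).
by rewrite ltn_sorted_uniq_leq sort_uniq ul sort_le_sorted.
Qed.

End Frames.

(** The Kähler form e^01 + e^23 + e^45, in a frame numbered so that [J] maps vector 2k to vector 2k
    + 1. *)
Definition sgT (l : seq nat) : int :=
  if l is [:: i; j] then
    if i./2 == j./2 then (if (i < j)%N then 1 else if (j < i)%N then - 1 else 0) else 0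
  else 0.

(* [rc false m] and [rc true m] are the real and imaginary parts of i^m. *)
Fixpoint rc (s : bool) m : int :=
  if m is m'.+1 then (if s then rc false m' else - rc true m') else (if s then 0 else 1).

Definition eps3 (i j k : nat) : int :=
  if [:: i; j; k] \in [:: [:: 0; 1; 2]; [:: 1; 2; 0]; [:: 2; 0; 1]]%N then 1
  else if [:: i; j; k] \in [:: [:: 0; 2; 1]; [:: 2; 1; 0]; [:: 1; 0; 2]]%N then - 1
  else 0.

(* The real part ([s = false]) and imaginary part ([s = true]) of dz1 dz2 dz3,
   z_k having real coordinate 2k and imaginary coordinate 2k + 1. *)
Definition psT (s : bool) (l : seq nat) : int :=
  if l is [:: i; j; k] then
    eps3 i./2 j./2 k./2 * rc s (odd i + odd j + odd k)
  else 0.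

Definition dl (k i : nat) : int := if i == k then 1 else 0.

(** The G2 form psi^+ + sg ^ e^6, the index 6 being the seventh covector. On indices below 7, [sgT]
    and [psT] vanish as soon as 6 occurs. *)
Definition g3T (l : seq nat) : int :=
  if l is [:: i; j; k] then psT false l + sgT [:: i; j] * dl 6 k
    - sgT [:: i; k] * dl 6 j + sgT [:: j; k] * dl 6 i else 0.

(** The dual 4-form psi^- ^ e^6 + 1/2 sg ^ sg; the factor 1/2 cancels the repetition of the three
    products of sg with itself. *)
Definition g4T (l : seq nat) : int :=
  if l is [:: i; j; k; m] then
    psT true [:: i; j; k] * dl 6 m - psT true [:: i; j; m] * dl 6 k
    + psT true [:: i; k; m] * dl 6 j - psT true [:: j; k; m] * dl 6 i
    + sgT [:: i; j] * sgT [:: k; m] - sgT [:: i; k] * sgT [:: j; m]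
    + sgT [:: i; m] * sgT [:: j; k] else 0.

(** Together with [Jsgn]: [J] maps E_2k to E_(2k+1) and E_(2k+1) to - E_2k. *)
Definition Jidx (i : nat) := if odd i then i.-1 else i.+1.
Definition Jsgn (i : nat) : int := if odd i then - 1 else 1.

(** The 1-form J(i_E sg) for E the i-th frame vector, with the convention J gamma = - gamma(J .). *)
Definition JsgT (i : nat) (l : seq nat) : int :=
  if l is [:: k] then - (Jsgn k * sgT [:: i; Jidx k]) else 0.

Section TableTools.
Variables (R : realType) (n m : nat) (E : nat -> 'rV[R]_n).
Local Notation V := 'rV[R]_n.
Local Notation has_table := (has_table m E).

Lemma multilinearD p (a b : cov R n p) (c : R) : multilinear a -> multilinear b ->
  multilinear (fun f => c * a f + b f).
Proof.
move=> ma mb f i d u w upd; rewrite ma mb.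
by move: (a _) (a _) (b _) (b _) => x y z t; ring.
Qed.

Lemma alternatingD p (a b : cov R n p) (c : R) : alternating a -> alternating b ->
  alternating (fun f => c * a f + b f).
Proof. by move=> aa ab f i j ij fij; rewrite (aa _ _ _ ij fij) (ab _ _ _ ij fij) mulr0 addr0. Qed.

Lemma table_contract p (a : cov R n p.+1) c A i : (i < m)%N -> has_table a c A ->
  has_table (contract (E i) a) c (fun l => A (i :: l)).
Proof.
move=> im ta l; rewrite tuplesP => lp; rewrite contract_vec.
by rewrite -[_ :: map _ _]/(map E (_ :: _)) ta// tuplesP /= eqSS im.
Qed.

Lemma table_rescale p (a : cov R n p) c A (k : int) d B : has_table a c A ->
  all (fun l => A l == k * B l) (tuples p m) -> c * k%:~R = d -> has_table a d B.
Proof.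
by move=> ta /allP AB <- l lp; rewrite ta// (eqP (AB l lp)) intrM mulrA.
Qed.

Lemma tableD p (a b : cov R n p) c A B : has_table a c A -> has_table b c B ->
  has_table (fun f => a f + b f) c (fun l => A l + B l).
Proof. by move=> ta tb l lp; rewrite ta// tb// intrD mulrDr. Qed.

Lemma tableB p (a b : cov R n p) c A B : has_table a c A -> has_table b c B ->
  has_table (fun f => a f - b f) c (fun l => A l - B l).
Proof. by move=> ta tb l lp; rewrite ta// tb// intrB mulrBr. Qed.

Hypothesis fE : frame m E.

(* Alternating forms depending linearly on a vector are proportional if they are
   so on the frame, where they are compared through their tables. *)
Lemma linear_forms_eq p (F G : V -> cov R n p) (c d e r : R) A B (k1 k2 : int) :
  (forall U, multilinear (F U)) -> (forall U, alternating (F U)) ->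
  (forall U, multilinear (G U)) -> (forall U, alternating (G U)) ->
  (forall (c : R) U U' f, F (c *: U + U') f = c * F U f + F U' f) ->
  (forall (c : R) U U' f, G (c *: U + U') f = c * G U f + G U' f) ->
  (forall i, (i < m)%N -> has_table (F (E i)) c (A i)) ->
  (forall i, (i < m)%N -> has_table (G (E i)) d (B i)) ->
  all (fun i => all (fun l => if sorted ltn l then k1 * A i l == k2 * B i l else true) (tuples p m))
    (iota 0 m) -> c = r * k1%:~R -> e * d = r * k2%:~R ->
  forall U f, F U f = e * G U f.
Proof.
move=> mF aF mG aG lF lG tF tG AB ck ek U f.
have H0 : (- e) * G U f + F U f = 0; last by apply/eqP; rewrite -subr_eq0 -mulNr addrC H0.
move: U; apply: (linear_frame0 fE) => [x U U'|i im].
  by rewrite lF lG; move: (F _ _) (F _ _) (G _ _) (G _ _) => ? ? ? ?; ring.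
move: f; apply: (alternating_frame0 fE).
- exact: multilinearD.
- exact: alternatingD.
move=> l lp sl; rewrite tF// tG//.
have /allP /(_ l lp) : all (fun l => if sorted ltn l then k1 * A i l == k2 * B i l else true) (tuples p m).
  by apply: (allP AB); rewrite mem_iota.
rewrite sl /= => /eqP/(congr1 (fun z : int => z%:~R : R)); rewrite !intrM => h.
by rewrite mulrA mulNr ek ck -!mulrA h; ring.
Qed.

Lemma cwedge_contractr p q (a : cov R n p) (b : cov R n q.+1) : multilinear b ->
  forall (c : R) U U' f, cwedge a (contract (c *: U + U') b) f =
    c * cwedge a (contract U b) f + cwedge a (contract U' b) f.
Proof.
move=> mb c U U' f; have -> : contract (c *: U + U') b =
    fun g => c * contract U b g + contract U' b g.
  by apply/funext => g; rewrite contract_lin.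
by rewrite cwedge_linr.
Qed.

Lemma cwedge_contractl p q (a : cov R n p.+1) (b : cov R n q) : multilinear a ->
  forall (c : R) U U' f, cwedge (contract (c *: U + U') a) b f =
    c * cwedge (contract U a) b f + cwedge (contract U' a) b f.
Proof.
move=> ma c U U' f; have -> : contract (c *: U + U') a =
    fun g => c * contract U a g + contract U' a g.
  by apply/funext => g; rewrite contract_lin.
by rewrite cwedge_linl.
Qed.

End TableTools.

(** A frame in which the structure is the flat one of C^3. [psi false] and [psi true] are psi^+ and
    psi^-; the boolean lets one argument treat both. *)
Record adapted (R : realType) (J : 'rV[R]_6 -> 'rV[R]_6) (sg : cov R 6 2)
    (psi : bool -> cov R 6 3) (E : nat -> 'rV[R]_6) : Prop := Adapted {
  ad_frame : frame 6 E;
  ad_J : forall i, (i < 6)%N -> J (E i) = (Jsgn i)%:~R *: E (Jidx i);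
  ad_sg : has_table 6 E sg 1 sgT;
  ad_psi : forall s, has_table 6 E (psi s) 1 (psT s) }.

(** * Algebraic identities of an SU(3) structure *)

Section SU3Identities.
Variables (R : realType) (J : 'rV[R]_6 -> 'rV[R]_6) (sg : cov R 6 2).
Variables (psi : bool -> cov R 6 3) (E : nat -> 'rV[R]_6).
Hypothesis adE : adapted J sg psi E.
Hypotheses (msg : multilinear sg) (asg : alternating sg).
Hypotheses (mpsi : forall s, multilinear (psi s)) (apsi : forall s, alternating (psi s)).
Hypothesis lJ : forall (c : R) u w, J (c *: u + w) = c *: J u + J w.

Let fE := ad_frame adE.

Let mc p (a : cov R 6 p.+1) U : multilinear a -> multilinear (contract U a).
Proof. exact: contract_multilinear. Qed.

Let ac p (a : cov R 6 p.+1) U : alternating a -> alternating (contract U a).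
Proof. exact: contract_alternating. Qed.

(** This is the contraction of sg ^ psi^+ = 0 with U, checked here on the frame. *)
Lemma sg_wedge_contract U f : cwedge sg (contract U (psi false)) f =
  - 1 * cwedge (contract U sg) (psi false) f.
Proof.
(* The left table carries 1/2!, because its first factor has degree 2, and the right one carries 1.
   With r = 1/2 the sign - 1 becomes the integer ratio 1 : - 2. *)
apply: (@linear_forms_eq _ _ _ _ fE 4 (fun U => cwedge sg (contract U (psi false)))
  (fun U => cwedge (contract U sg) (psi false)) _ _ _ 2^-1
  (fun i => table_wedge 2 sgT (fun l => psT false (i :: l)))
  (fun i => table_wedge 1 (fun l => sgT (i :: l)) (psT false)) 1 (- 2)).
- by move=> V; exact: (cwedge_multilinear msg (mc V (mpsi false))).
- by move=> V; exact: (@cwedge_alternating _ _ 2 2).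
- by move=> V; exact: (cwedge_multilinear (mc V msg) (mpsi false)).
- by move=> V; exact: (@cwedge_alternating _ _ 1 3).
- by move=> *; exact: (@cwedge_contractr _ _ 2 2).
- by move=> *; exact: (@cwedge_contractl _ _ 1 3).
- move=> i i6; have tp := table_contract i6 (ad_psi adE false).
  exact: (table_wedgeP (mc _ (mpsi false)) (ac _ (apsi false)) (ad_sg adE) tp).
- move=> i i6; have ts := table_contract i6 (ad_sg adE).
  exact: (table_wedgeP (mpsi false) (apsi false) ts (ad_psi adE false)).
- by vm_compute.
- by rewrite !mul1r mulr1.
- by rewrite !mulr1 invr1 mulr1; field.
Qed.

(** Half of the contraction of psi^+ ^ psi^- = 2/3 sg^3 with U: the (5,0)-form i_U psi ^ psi
    vanishes, so i_U psi^+ ^ psi^- = - i_U psi^- ^ psi^+ and the two terms of the contraction are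
    equal. *)
Lemma psm_wedge_contract U f : cwedge (psi true) (contract U (psi false)) f =
  1 * cwedge (contract U sg) (cwedge sg sg) f.
Proof.
have ms2 : multilinear (cwedge sg sg) by exact: cwedge_multilinear.
have as2 : alternating (cwedge sg sg) by exact: cwedge_alternating.
apply: (@linear_forms_eq _ _ _ _ fE 5 (fun U => cwedge (psi true) (contract U (psi false)))
  (fun U => cwedge (contract U sg) (cwedge sg sg)) _ _ _ 6^-1
  (fun i => table_wedge 3 (psT true) (fun l => psT false (i :: l)))
  (fun i => table_wedge 1 (fun l => sgT (i :: l)) (table_wedge 2 sgT sgT)) 1 3).
- by move=> V; exact: (cwedge_multilinear (mpsi true) (mc V (mpsi false))).
- by move=> V; exact: (@cwedge_alternating _ _ 3 2).
- by move=> V; exact: (cwedge_multilinear (mc V msg) ms2).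
- by move=> V; exact: (@cwedge_alternating _ _ 1 (2 + 2)).
- by move=> *; exact: (@cwedge_contractr _ _ 3 2).
- by move=> *; exact: (@cwedge_contractl _ _ 1 (2 + 2)).
- move=> i i6; have tp := table_contract i6 (ad_psi adE false).
  exact: (table_wedgeP (mc _ (mpsi false)) (ac _ (apsi false)) (ad_psi adE true) tp).
- move=> i i6; have ts := table_contract i6 (ad_sg adE).
  exact: (table_wedgeP ms2 as2 ts (table_wedgeP msg asg (ad_sg adE) (ad_sg adE))).
- by vm_compute.
- by rewrite !mul1r mulr1.
- rewrite -[(1`!)%:R]/(1 : R) -[(2`!)%:R]/(2 : R) -[3%:~R]/(3 : R).
  by field.
Qed.

Let Jg U : cov R 6 1 := fun f => - contract U sg (fun i => J (f i)).

Let Jgml U : multilinear (Jg U).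
Proof.
move=> f i c u w upd; rewrite /Jg.
have E1 z : (fun i => J (upd z i)) = vec [:: J z].
  by apply/funext => j; rewrite (ord1 j) /upd (ord1 i) eqxx.
rewrite !E1 lJ !contract_vec (@ml_vec _ _ _ _ msg c (J u) (J w) [:: U] [::])//=.
by move: (sg _) (sg _) => x y; ring.
Qed.

Let Jglin (c : R) U U' f : Jg (c *: U + U') f = c * Jg U f + Jg U' f.
Proof. by rewrite /Jg contract_lin// opprD mulrN. Qed.

Let Jgtab i : (i < 6)%N -> has_table 6 E (Jg (E i)) 1 (JsgT i).
Proof.
move=> i6 l; rewrite tuplesP; case: l => [|k [|k' l]]//= /andP[k6 _].
rewrite /Jg [fun _ => _](_ : _ = vec [:: J (E k)]); last first.
  by apply/funext => j; rewrite (ord1 j).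
rewrite contract_vec (ad_J adE)//.
rewrite (@ml_vecZ _ _ _ _ msg _ (E (Jidx k)) [:: E i] [::])//.
have kk6 : (Jidx k < 6)%N by move: k6; do 6?[case: k => [|k]//].
rewrite -[[:: E i] ++ _]/(map E [:: i; Jidx k]) (ad_sg adE) ?tuplesP /= ?i6 ?kk6//.
by rewrite mul1r mul1r rmorphN rmorphM.
Qed.

(** For a 1-form gamma, gamma + i J gamma is of type (1,0), so its product with the (3,0)-form psi
    is zero; these are the real and imaginary parts, for gamma = i_U sg. *)
Let Jg_wedge (s : bool) U f : cwedge (Jg U) (psi (~~ s)) f =
  (if s then - 1 else 1) * cwedge (contract U sg) (psi s) f.
Proof.
apply: (@linear_forms_eq _ _ _ _ fE 4 (fun U => cwedge (Jg U) (psi (~~ s)))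
  (fun U => cwedge (contract U sg) (psi s)) _ _ _ 1
  (fun i => table_wedge 1 (JsgT i) (psT (~~ s)))
  (fun i => table_wedge 1 (fun l => sgT (i :: l)) (psT s)) 1 (if s then - 1 else 1)).
- by move=> V; exact: (cwedge_multilinear (@Jgml V) (mpsi (~~ s))).
- by move=> V; exact: (@cwedge_alternating _ _ 1 3).
- by move=> V; exact: (cwedge_multilinear (mc V msg) (mpsi s)).
- by move=> V; exact: (@cwedge_alternating _ _ 1 3).
- move=> c V V' g; have -> : Jg (c *: V + V') = fun g => c * Jg V g + Jg V' g.
    by apply/funext => g'; exact: Jglin.
  by rewrite cwedge_linl.
- by move=> *; exact: (@cwedge_contractl _ _ 1 3).
- move=> i i6.
  exact: (table_wedgeP (mpsi _) (apsi _) (Jgtab i6) (ad_psi adE (~~ s))).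
- move=> i i6; have ts := table_contract i6 (ad_sg adE).
  exact: (table_wedgeP (mpsi s) (apsi s) ts (ad_psi adE s)).
- by case: s; vm_compute.
- by rewrite !mulr1 invr1.
- by case: s; rewrite ?rmorphN1 ?rmorph1 invr1 !mulr1 ?mul1r.
Qed.

Lemma J_wedge_psm U f :
  cwedge (fun g => - contract U sg (fun i => J (g i))) (psi true) f =
  cwedge (contract U sg) (psi false) f.
Proof. by rewrite (Jg_wedge false) mul1r. Qed.

Lemma J_wedge_psp U f :
  cwedge (fun g => - contract U sg (fun i => J (g i))) (psi false) f =
  - cwedge (contract U sg) (psi true) f.
Proof. by rewrite (Jg_wedge true) mulN1r. Qed.

(* Contracting with the pairs (E_2k, E_2k+1) inverts the product with sg. *)
Lemma sg_nondegenerate u : (forall v, sg (vec [:: u; v]) = 0) -> u = 0.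
Proof.
move=> u0; have [c uE] := fE u; rewrite uE big1_seq// => k; rewrite mem_iota => /andP[_ k6].
have kk6 : (Jidx k < 6)%N by move: k6; do 6?[case: k => [|k]//].
have := u0 (E (Jidx k)).
rewrite uE (@ml_vec_sum _ _ _ _ msg _ _ c E [::] [:: E (Jidx k)])//.
have sE i : (i < 6)%N -> sg (vec [:: E i; E (Jidx k)]) = (sgT [:: i; Jidx k])%:~R.
  move=> i6; rewrite -[[:: _; _]]/(map E [:: i; Jidx k]) (ad_sg adE) ?mul1r//.
  by rewrite tuplesP /= i6 kk6.
rewrite (eq_big_seq (fun i => c i * (sgT [:: i; Jidx k])%:~R)); last first.
  by move=> i; rewrite mem_iota => /andP[_ i6]; rewrite sE.
rewrite unlock /=; move: k6 {kk6 sE}; do 6?[case: k => [|k]//] => _;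
  rewrite /= ?mulrNz ?mulr0 ?mulr1 ?add0r ?addr0 ?mulrN1 => /eqP;
  rewrite ?oppr_eq0 => /eqP ->; exact: scale0r.
Qed.

End SU3Identities.

(** The Levi-Civita symbol of a word, by expansion of the associated 0-1 matrix along its first row;
    [unbump] renumbers the columns left after the deletion. *)
Fixpoint levi n (l : seq nat) : int :=
  if n is n'.+1 then
    if l is i :: l' then
      if i \in l' then 0 else (if odd i then - 1 else 1) * levi n' (map (unbump i) l')
    else 0
  else 1.

Lemma det_levi (R : realType) n l : size l = n -> all (ltn^~ n) l ->
  \det (\matrix_(k < n, j < n) ((nth 0%N l k == j)%:R : R)) = (levi n l)%:~R.
Proof.
elim: n l => [|n IH] [|i l] //; first by rewrite det_mx00.
move=> [sl] /= /andP[iln all_l]; rewrite (expand_det_row _ ord0).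
rewrite (bigD1 (Ordinal iln))//= big1 ?addr0; last first.
  move=> j; rewrite -val_eqE /= => ji; rewrite mxE /= eq_sym.
  by rewrite (negbTE ji) mul0r.
rewrite mxE /= eqxx mul1r /cofactor add0n.
case: ifPn => il.
  (* The first index recurs later in the word: the corresponding row of the minor is zero. *)
  rewrite rmorph0; have kl : (index i l < n)%N by rewrite -sl index_mem.
  rewrite (expand_det_row _ (Ordinal kl)) big1 ?mulr0// => j _.
  by rewrite !mxE lift0 /= nth_index// (negbTE (neq_bump _ _)) mul0r.
rewrite intrM -signr_odd; congr (_ * _).
  by case: (odd i); rewrite ?expr1 ?expr0 ?rmorphN1.
rewrite -IH ?size_map//.
  congr (\det _); apply/matrixP => k j; rewrite !mxE lift0 /=.
  rewrite (nth_map 0%N) ?sl//; congr (_%:R); congr nat_of_bool.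
  have kl : nth 0%N l k \in l by rewrite mem_nth ?sl.
  have ni : nth 0%N l k != i by apply: contraNneq il => <-.
  apply/eqP/eqP => [->|<-]; first by rewrite bumpK.
  by rewrite unbumpKcond (negbTE ni) add0n.
apply/allP => _ /mapP [x xl ->]; have xn := allP all_l x xl.
have xi : x != i by apply: contraNneq il => <-.
rewrite /unbump; move: xn iln xi; rewrite /=; case: ltnP => /=; lia.
Qed.

(** The sum defining the Hodge dual of the model 3-form, before division by 3! = 6. The test for
    zero avoids computing most of the symbols. *)
Definition hodge_sum (l : seq nat) : int :=
  foldr (fun f s => (if g3T f == 0 then 0 else g3T f * levi 7 (f ++ l)) + s)
    0 (tuples 3 7).

Lemma hodge_sum_check : all (fun l => 6 * g4T l == hodge_sum l) (tuples 4 7).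
Proof. by vm_compute. Qed.

(** * Algebra of the G2 model and its Hodge dual *)

Section G2Algebra.
Variables (R : realType) (A : 'M[R]_7).
Hypothesis uA : A \in unitmx.
Local Notation V := 'rV[R]_7.

Definition dual_frame (i : nat) : V := row (inord i) (invmx A).
Local Notation E := dual_frame.

Lemma dual_frame_frame : frame 7 E.
Proof.
move=> v; exists (fun i => (v *m A) ord0 (inord i)).
rewrite -[LHS]mulmx1 -(mulmxV uA) mulmxA mulmx_sum_row.
rewrite -[iota 0 7]/(index_iota 0 7) big_mkord; apply: eq_bigr => i _.
by rewrite /E inord_val.
Qed.

Lemma dual_frameE i j : (i < 7)%N -> (E i *m A) ord0 j = (i == j)%:R.
Proof.
by move=> i7; rewrite /E -row_mul mulVmx// !mxE -val_eqE /= inordK.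
Qed.

Lemma coframe_metric_frame i j : (i < 7)%N -> (j < 7)%N ->
  coframe_metric A (E i) (E j) = (dl i j)%:~R.
Proof.
move=> i7 j7; rewrite /coframe_metric (bigD1 (inord i))//= big1 => [|k ki].
  by rewrite !dual_frameE// inordK// eqxx mul1r addr0 /dl; case: eqP.
rewrite dual_frameE//; case: eqP => [ik|_]; last by rewrite mul0r.
by move: ki; rewrite -val_eqE /= inordK// ik eqxx.
Qed.

Lemma coframe_multilinear k : multilinear (coframe A k).
Proof.
move=> v i c u w upd; rewrite /coframe /upd (ord1 i) /=.
by rewrite mulmxDl -scalemxAl !mxE.
Qed.

Lemma coframe_table k : (0 < k <= 7)%N ->
  has_table 7 E (coframe A k) 1 (fun l => if l is [:: i] then dl k.-1 i else 0).
Proof.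
move=> /andP[k0 k7] l; rewrite tuplesP; case: l => [|i [|i' l]]//= /andP[i7 _].
rewrite /coframe /vec /= dual_frameE// mul1r /dl inordK; last by case: (k) k0 k7.
by case: eqP.
Qed.

Let e2 a b := cwedge (coframe A a) (coframe A b).
Let e3 a b c := cwedge (e2 a b) (coframe A c).

Let e2ml a b : multilinear (e2 a b).
Proof. by apply: cwedge_multilinear; exact: coframe_multilinear. Qed.

Let e3ml a b c : multilinear (e3 a b c).
Proof. by apply: (cwedge_multilinear (e2ml a b)); exact: coframe_multilinear. Qed.

Let e2al a b : alternating (e2 a b). Proof. exact: (@cwedge_alternating _ _ 1 1). Qed.
Let e3al a b c : alternating (e3 a b c). Proof. exact: (@cwedge_alternating _ _ 2 1). Qed.

Let w1 : cov R 7 2 := fun u => e2 1 2 u + e2 3 4 u + e2 5 6 u.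

Let ml2 p (a b : cov R 7 p) : multilinear a -> multilinear b ->
  multilinear (fun f => a f + b f) /\ multilinear (fun f => a f - b f).
Proof.
move=> ma mb; split=> v i c u w upd; rewrite ma mb;
  by move: (a _) (a _) (b _) (b _) => x y z t; ring.
Qed.

Let al2 p (a b : cov R 7 p) : alternating a -> alternating b ->
  alternating (fun f => a f + b f) /\ alternating (fun f => a f - b f).
Proof.
by move=> aa ab; split=> f i j ij fij; rewrite (aa _ _ _ ij fij) (ab _ _ _ ij fij) ?addr0 ?subr0.
Qed.

Lemma g2_model_multilinear : multilinear (g2_model A).
Proof.
have mw1 : multilinear w1.
  exact: (proj1 (ml2 (proj1 (ml2 (@e2ml _ _) (@e2ml _ _))) (@e2ml _ _))).
have m3 := proj2 (ml2 (proj2 (ml2 (proj2 (ml2 (@e3ml 1 3 5) (@e3ml 1 4 6)))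
  (@e3ml 2 3 6))) (@e3ml 2 4 5)).
exact: (proj1 (ml2 (cwedge_multilinear mw1 (@coframe_multilinear 7)) m3)).
Qed.

Lemma g2_model_alternating : alternating (g2_model A).
Proof.
have m3 := proj2 (al2 (proj2 (al2 (proj2 (al2 (@e3al 1 3 5) (@e3al 1 4 6)))
  (@e3al 2 3 6))) (@e3al 2 4 5)).
exact: (proj1 (al2 (@cwedge_alternating _ _ 2 1 w1 (coframe A 7)) m3)).
Qed.

Let d1 k (l : seq nat) : int := if l is [:: i] then dl k.-1 i else 0.

Let e2tab a b : (0 < a <= 7)%N -> (0 < b <= 7)%N ->
  has_table 7 E (e2 a b) 1 (table_wedge 1 (d1 a) (d1 b)).
Proof.
move=> a7 b7; have := table_wedgeP (@coframe_multilinear b) (@alternating1 _ _ (coframe A b))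
  (coframe_table a7) (coframe_table b7).
by rewrite -[(1`!)%:R]/(1 : R) invr1 !mul1r.
Qed.

Let e3tab a b c : (0 < a <= 7)%N -> (0 < b <= 7)%N -> (0 < c <= 7)%N ->
  has_table 7 E (e3 a b c) 2^-1 (table_wedge 2 (table_wedge 1 (d1 a) (d1 b)) (d1 c)).
Proof.
move=> a7 b7 c7; have := table_wedgeP (@coframe_multilinear c)
  (@alternating1 _ _ (coframe A c)) (e2tab a7 b7) (coframe_table c7).
by rewrite !mulr1.
Qed.

Lemma g2_model_table : has_table 7 E (g2_model A) 1 g3T.
Proof.
have tw1 := tableD (tableD (e2tab (a := 1) (b := 2) isT isT) (e2tab (a := 3) (b := 4) isT isT))
  (e2tab (a := 5) (b := 6) isT isT).
have tw := table_wedgeP (@coframe_multilinear 7) (@alternating1 _ _ (coframe A 7)) tw1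
  (coframe_table (k := 7) isT).
rewrite !mulr1 in tw.
have t3 := tableB (tableB (tableB (e3tab (a := 1) (b := 3) (c := 5) isT isT isT)
  (e3tab (a := 1) (b := 4) (c := 6) isT isT isT)) (e3tab (a := 2) (b := 3) (c := 6) isT isT isT))
  (e3tab (a := 2) (b := 4) (c := 5) isT isT isT).
(* Each term is a product whose left factor has degree 2 and carries 1/2, while the computed
   integers are twice those of [g3T]. *)
apply: (table_rescale (k := 2) (tableD tw t3)); first by vm_compute.
by rewrite -[2%:~R]/(2 : R) mulVf.
Qed.

Lemma coframe_vol_multilinear m (C : 'M[R]_m) : multilinear (coframe_vol C).
Proof.
move=> v i c u w upd; rewrite /coframe_vol -(mul1r (\det (\matrix_k (upd w k *m C)))).
have E z (k : 'I_m) : k != i -> upd z k = v k by rewrite /upd => /negbTE ->.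
apply: (@determinant_multilinear _ _ _ _ _ i).
- by rewrite !rowK /upd eqxx mulmxDl -scalemxAl scale1r.
- by apply/matrixP => k j; rewrite !mxE !E// eq_sym neq_lift.
- by apply/matrixP => k j; rewrite !mxE !E// eq_sym neq_lift.
Qed.

Lemma coframe_vol_alternating m (C : 'M[R]_m) : alternating (coframe_vol C).
Proof.
move=> v i j ij vij; apply: (determinant_alternate ij) => k.
by rewrite !mxE vij.
Qed.

Section Hodge.
Variables (p q : nat) (B : 'M[R]_(p + q)) (a : cov R (p + q) p).

Let full (e : 'I_p -> 'rV[R]_(p + q)) (w : 'I_q -> 'rV[R]_(p + q)) :=
  fun k => match fintype.split k with inl i => e i | inr j => w j end.

Let full_rshift e w j : full e w (rshift p j) = w j.
Proof. by rewrite /full (unsplitK (inr j)). Qed.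

Lemma hodge_multilinear : multilinear (hodge B a).
Proof.
move=> w i c u z upd; rewrite /hodge [c * _]mulrCA -mulrDr; congr (_ * _).
rewrite mulr_sumr -big_split /=; apply: eq_bigr => f _.
rewrite [c * _]mulrCA -mulrDr; congr (_ * _).
pose e i := row (f i) (invmx B).
have E x : full e (upd x) = fun k => if k == rshift p i then x else full e w k.
  apply/funext => k; rewrite /full; case: (split_ordP k) => j ->.
    by rewrite ?(unsplitK (inl j)) eq_lrshift.
  by rewrite ?(unsplitK (inr j)) /upd eq_rshift.
by rewrite -!/(full e _) !E; exact: coframe_vol_multilinear.
Qed.

Lemma hodge_alternating : alternating (hodge B a).
Proof.
move=> w i j ij wij; rewrite /hodge big1 ?mulr0// => f _.
rewrite (_ : coframe_vol B _ = 0) ?mulr0//.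
apply: (@coframe_vol_alternating _ _ _ (rshift p i) (rshift p j)).
  by rewrite eq_rshift.
by rewrite ?(unsplitK (inr i)) ?(unsplitK (inr j)).
Qed.

End Hodge.

Let vol_frame (l : seq nat) : size l = 7%N -> all (ltn^~ 7%N) l ->
  coframe_vol A (vec (map E l)) = (levi 7 l)%:~R.
Proof.
move=> sl al; rewrite -(det_levi R sl al) /coframe_vol; congr (\det _).
apply/matrixP => k j; rewrite !mxE /vec (nth_map 0%N) ?sl//.
have := dual_frameE j (allP al _ (mem_nth 0%N (_ : k < size l)%N)).
by rewrite sl => /(_ (ltn_ord k)) <-; rewrite mxE.
Qed.

Let sum_ffun3 (F : {ffun 'I_3 -> 'I_7} -> R) :
  \sum_f F f = \sum_(i < 7) \sum_(j < 7) \sum_(k < 7) F [ffun x => tnth [tuple i; j; k] x].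
Proof.
rewrite pair_bigA pair_bigA /=.
rewrite (reindex (fun x : 'I_7 * 'I_7 * 'I_7 =>
  [ffun y => tnth [tuple x.1.1; x.1.2; x.2] y] : {ffun 'I_3 -> 'I_7})).
  by apply: eq_bigr => -[[i j] k].
exists (fun f : {ffun 'I_3 -> 'I_7} =>
    (f ord0, f (Ordinal (isT : 1 < 3)%N), f (Ordinal (isT : 2 < 3)%N))).
  by move=> [[i j] k] _; rewrite !ffunE.
move=> f _; apply/ffunP => -[[|[|[|y]]] Hy] //; rewrite ffunE (tnth_nth ord0) /=;
  congr (f _); exact: val_inj.
Qed.

(** On the dual frame the volume form is the Levi-Civita symbol, so the sum over index maps becomes
    the integer computation [hodge_sum]. *)
Lemma hodge_g2_model_table : has_table 7 E (@hodge R 3 4 A (g2_model A)) 1 g4T.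
Proof.
move=> l; rewrite tuplesP => lp; have /andP[/eqP sl al] := lp.
have /eqP H : 6 * g4T l == hodge_sum l by apply: (allP hodge_sum_check); rewrite tuplesP.
have {}H : 6 * (g4T l)%:~R = (hodge_sum l)%:~R :> R by rewrite -H intrM.
rewrite [RHS]mul1r; apply: (mulfI (_ : (6 : R) != 0)); first by [].
rewrite H /hodge mulrA [X in X * _]mulfV// mul1r sum_ffun3.
have foldr_sum (g : seq nat -> int) r : foldr (fun j s => g j + s) 0 r = \sum_(j <- r) g j.
  by elim: r => [|j r IHr]; rewrite ?big_nil// big_cons -IHr.
rewrite /hodge_sum foldr_sum rmorph_sum.
have big_tuples (G : seq nat -> R) : \sum_(f <- tuples 3 7) G f =
    \sum_(i < 7) \sum_(j < 7) \sum_(k < 7) G [:: val i; val j; val k].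
  have T p (H' : seq nat -> R) : \sum_(f <- tuples p.+1 7) H' f =
      \sum_(i < 7) \sum_(f <- tuples p 7) H' (val i :: f).
    rewrite -[tuples p.+1 7]/([seq i :: l | i <- iota 0 7, l <- tuples p 7]) big_allpairs_dep.
    by rewrite -[iota 0 7]/(index_iota 0 7) big_mkord.
  rewrite T; apply: eq_bigr => i _; rewrite T; apply: eq_bigr => j _.
  by rewrite T; apply: eq_bigr => k _; rewrite /= big_seq1.
rewrite big_tuples; apply: eq_bigr => i _; apply: eq_bigr => j _; apply: eq_bigr => k _.
pose f := [:: val i; val j; val k].
have fp : f \in tuples 3 7 by rewrite tuplesP /= !ltn_ord.
set ff := [ffun x => _].
have Ef : (fun x : 'I_3 => row (ff x) (invmx A)) = vec (map E f).
  apply/funext => -[[|[|[|y]]] Hy] //; rewrite ffunE (tnth_nth ord0) /vec /= /E inord_val//.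
rewrite Ef g2_model_table// mul1r.
have -> : (fun k0 => match @fintype.split 3 4 k0 with
    | inl i0 => row (ff i0) (invmx A) | inr j0 => vec (map E l) j0 end) =
    vec (map E (f ++ l)).
  apply/funext => x; case: (@split_ordP 3 4 x) => y ->.
    rewrite ?(unsplitK (inl y)) -[LHS]/((fun x : 'I_3 => row (ff x) (invmx A)) y) Ef.
    by rewrite /vec map_cat nth_cat size_map /= ltn_ord.
  rewrite ?(unsplitK (inr y)) /vec map_cat nth_cat size_map.
  by case: ltnP => /= [|_]; [lia|congr nth; lia].
rewrite vol_frame ?size_cat ?sl// ?all_cat ?al ?andbT; last by rewrite /= !ltn_ord.
by rewrite -/f; case: eqP => [->|_]; rewrite ?mul0r ?rmorph0// rmorphM.
Qed.

Local Notation phi := (g2_model A).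
Local Notation sphi := (@hodge R 3 4 A (g2_model A)).

Definition coframe_flat (v : V) : cov R 7 1 := fun f => coframe_metric A v (f ord0).

Let flat_ml v : multilinear (coframe_flat v).
Proof.
move=> f i c u w upd; rewrite /coframe_flat /upd (ord1 i) /= /coframe_metric.
rewrite mulr_sumr -big_split; apply: eq_bigr => j _ /=.
by rewrite mulmxDl -scalemxAl !mxE; ring.
Qed.

Let flat_lin (c : R) u w f : coframe_flat (c *: u + w) f = c * coframe_flat u f + coframe_flat w f.
Proof.
rewrite /coframe_flat /coframe_metric mulr_sumr -big_split; apply: eq_bigr => j _ /=.
by rewrite mulmxDl -scalemxAl !mxE; ring.
Qed.

Let flat_table i : (i < 7)%N -> has_table 7 E (coframe_flat (E i)) 1
  (fun l => if l is [:: k] then dl i k else 0).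
Proof.
move=> i7 l; rewrite tuplesP; case: l => [|k [|k' l]]//= /andP[k7 _].
by rewrite /coframe_flat /vec /= coframe_metric_frame// mul1r /dl eq_sym.
Qed.

Let table_scale p (a : cov R 7 p) c A0 (k : int) d : has_table 7 E a c A0 ->
  c = d * k%:~R -> has_table 7 E a d (fun l => k * A0 l).
Proof. by move=> ta ck l lp; rewrite ta// ck intrM mulrA. Qed.

Let metric_lin (c : R) u w v : coframe_metric A (c *: u + w) v =
  c * coframe_metric A u v + coframe_metric A w v.
Proof.
rewrite /coframe_metric mulr_sumr -big_split; apply: eq_bigr => j _ /=.
by rewrite mulmxDl -scalemxAl !mxE; ring.
Qed.

Let metric_sym u v : coframe_metric A u v = coframe_metric A v u.
Proof. by apply: eq_bigr => i _; rewrite mulrC. Qed.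

Let Q u v : cov R 7 4 := fun f => cwedge (contract u phi) (contract v phi) f +
    (cwedge (coframe_flat u) (contract v sphi) f +
     cwedge (coframe_flat v) (contract u sphi) f).

Let Q_lin (c : R) u w v f : Q (c *: u + w) v f = c * Q u v f + Q w v f.
Proof.
rewrite /Q (@cwedge_contractl _ _ 2 2 phi (contract v phi) g2_model_multilinear).
rewrite (@cwedge_contractr _ _ 1 3 (coframe_flat v) sphi (@hodge_multilinear 3 4 A phi)).
have -> : coframe_flat (c *: u + w) =
    fun f => c * coframe_flat u f + coframe_flat w f by apply/funext => g; exact: flat_lin.
rewrite (@cwedge_linl _ _ 1 3).
move: (@cwedge R 7 2 2 _ _ f) (@cwedge R 7 2 2 _ _ f) (@cwedge R 7 1 3 _ _ f)
  (@cwedge R 7 1 3 _ _ f) (@cwedge R 7 1 3 _ _ f) (@cwedge R 7 1 3 _ _ f) => *; ring.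
Qed.

Let Q_sym u v f : Q u v f = Q v u f.
Proof.
rewrite /Q [in RHS](addrC (@cwedge R 7 1 3 _ _ f)); congr (_ + _).
have [l sl ->] := vecP f; case: l sl => [|x [|y [|z [|w [|]]]]]// _.
have m := g2_model_multilinear; have al := g2_model_alternating.
rewrite !wedge22; try exact: contract_multilinear; try exact: contract_alternating.
by ring.
Qed.

Let Q_ml u v : multilinear (Q u v) /\ alternating (Q u v).
Proof.
have m := g2_model_multilinear; have mh := @hodge_multilinear 3 4 A phi.
have cm x := @contract_multilinear _ _ _ x _ m.
have ch x := @contract_multilinear _ _ _ x _ mh.
split.
  exact: (proj1 (ml2 (cwedge_multilinear (cm u) (cm v)) (proj1 (ml2
    (cwedge_multilinear (@flat_ml u) (ch v)) (cwedge_multilinear (@flat_ml v) (ch u)))))).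
exact: (proj1 (al2 (@cwedge_alternating _ _ 2 2 _ _) (proj1 (al2
  (@cwedge_alternating _ _ 1 3 _ _) (@cwedge_alternating _ _ 1 3 _ _))))).
Qed.

(* Polarised in [u] and [v] so that it can be checked on the frame. *)
Let hodge_polar u v f : Q u v f = 2 * (coframe_metric A u v * sphi f).
Proof.
have m := g2_model_multilinear; have al := g2_model_alternating.
have mh := @hodge_multilinear 3 4 A phi; have ah := @hodge_alternating 3 4 A phi.
have fE := dual_frame_frame.
apply/eqP; rewrite -subr_eq0; apply/eqP; move: v.
apply: (linear_frame0 fE) => [c v w|j j7].
  rewrite Q_sym Q_lin metric_sym metric_lin !(Q_sym _ u) !(metric_sym _ u).
  by move: (Q _ _ f) (Q _ _ f) (sphi f) => *; ring.
apply/eqP; rewrite subr_eq0; apply/eqP; move: u f.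
(* The common denominator is 1/2, from the degree 2 factor of the first product; the other two
   tables are doubled to match it, and the coefficient 2 of the metric term becomes 4. *)
apply: (@linear_forms_eq _ _ _ _ fE 4 (fun u => Q u (E j))
  (fun u f => coframe_metric A u (E j) * sphi f) 2^-1 1 2 2^-1
  (fun i l => table_wedge 2 (fun l => g3T (i :: l)) (fun l => g3T (j :: l)) l +
     (2 * table_wedge 1 (fun l => if l is [:: k] then dl i k else 0)
       (fun l => g4T (j :: l)) l +
      2 * table_wedge 1 (fun l => if l is [:: k] then dl j k else 0)
       (fun l => g4T (i :: l)) l))
  (fun i l => dl i j * g4T l) 1 4).
- by move=> u; have [] := Q_ml u (E j).
- by move=> u; have [] := Q_ml u (E j).
- by move=> u f i c x y upd; rewrite mh; move: (sphi _) (sphi _) => *; ring.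
- by move=> u f i k ik fik; rewrite (ah _ _ _ ik fik) mulr0.
- by move=> *; exact: Q_lin.
- by move=> *; rewrite metric_lin; move: (sphi _) => *; ring.
- move=> i i7.
  have cm x := @contract_multilinear _ _ _ x _ m.
  have ch x := @contract_multilinear _ _ _ x _ mh.
  have t1 := table_wedgeP (cm (E j)) (@contract_alternating _ _ _ (E j) _ al)
    (table_contract i7 g2_model_table) (table_contract j7 g2_model_table).
  have t2 := table_wedgeP (ch (E j)) (@contract_alternating _ _ _ (E j) _ ah)
    (flat_table i7) (table_contract j7 hodge_g2_model_table).
  have t3 := table_wedgeP (ch (E i)) (@contract_alternating _ _ _ (E i) _ ah)
    (flat_table j7) (table_contract i7 hodge_g2_model_table).
  have half : (1`!)%:R^-1 * (1 * 1) = 2^-1 * 2%:~R :> R.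
    by rewrite -[2%:~R]/(2 : R) invr1 !mulr1 mulVf.
  rewrite !mulr1 in t1; apply: (tableD t1).
  exact: (tableD (table_scale t2 half) (table_scale t3 half)).
- move=> i i7 l lp; rewrite coframe_metric_frame// hodge_g2_model_table//.
  by rewrite !mul1r intrM.
- by do 7?[case: j j7 => [|j] j7 //]; vm_compute.
- by rewrite mulr1.
- by rewrite mulr1 -[4%:~R]/(4 : R); field.
Qed.

(** For a unit vector this splits the dual form into v^flat ^ i_v and the horizontal part, half the
    square of the 2-form i_v phi. It is what determines the dual form from data on the quotient. *)
Lemma hodge_g2_model_contract v f : coframe_metric A v v * sphi f =
  2^-1 * cwedge (contract v phi) (contract v phi) f +
  cwedge (coframe_flat v) (contract v sphi) f.
Proof.
apply: (mulfI (_ : (2 : R) != 0)) => //; rewrite -hodge_polar /Q.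
by move: (@cwedge R 7 2 2 _ _ f) (@cwedge R 7 1 3 _ _ f) => a b; field.
Qed.

End G2Algebra.

(** Supplies, for Gram-Schmidt, a nonzero vector orthogonal to fewer vectors than the dimension. *)
Lemma common_zero (R : realType) n k (fs : 'I_k -> 'rV[R]_n -> R) : (k < n)%N ->
  (forall i (c : R) u v, fs i (c *: u + v) = c * fs i u + fs i v) ->
  exists2 v, v != 0 & forall i, fs i v = 0.
Proof.
move=> kn lf; pose M : 'M[R]_(n, k) := \matrix_(i, j) fs j 'e_i.
have fM v j : fs j v = (v *m M) ord0 j.
  have f0 : fs j 0 = 0.
    have E0 : -1 *: (0 : 'rV[R]_n) + 0 = 0 by rewrite scaler0 addr0.
    by have := lf j (-1) 0 0; rewrite E0; move: (fs j 0) => x; rewrite mulN1r addNr.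
  rewrite {1}(rV_delta v) mxE.
  elim: (index_enum _) => [|i s IH]; first by rewrite !big_nil.
  by rewrite !big_cons lf IH mxE.
have : kermx M != 0.
  by rewrite kermx_eq0 /row_free neq_ltn (leq_ltn_trans (rank_leq_col M) kn).
case/rowV0Pn => v vM v0; exists v => // i.
by rewrite fM; have /sub_kermxP -> := vM; rewrite mxE.
Qed.

(** * Existence of adapted frames *)

Section AdaptedFrame.
Variables (R : realType) (h : cov R 6 2) (J : 'rV[R]_6 -> 'rV[R]_6) (sg : cov R 6 2).
Variable psi : bool -> cov R 6 3.
Local Notation V := 'rV[R]_6.
Local Notation b u w := (h (vec [:: u; w])).
Local Notation P s u v w := (psi s (vec [:: u; v; w])).
Hypotheses (mh : multilinear h) (hC : forall u w, b u w = b w u).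
Hypothesis hpos : forall u, u != 0 -> 0 < b u u.
Hypothesis lJ : forall (c : R) u w, J (c *: u + w) = c *: J u + J w.
Hypotheses (JJ : forall u, J (J u) = - u) (hJ : forall u w, b (J u) (J w) = b u w).
Hypotheses (sgE : forall u w, sg (vec [:: u; w]) = b (J u) w) (msg : multilinear sg).
Hypothesis asg : alternating sg.
Hypotheses (mp : forall s, multilinear (psi s)) (ap : forall s, alternating (psi s)).
Hypothesis pJ : forall s u v w, P s (J u) v w = if s then P false u v w else - P true u v w.
Hypothesis pvol : forall f,
  cwedge (psi false) (psi true) f = 2 / 3 * cwedge (cwedge sg sg) sg f.

Let bl (c : R) u v w : b (c *: u + v) w = c * b u w + b v w.
Proof. exact: (@ml_vec _ _ _ _ mh c u v [::] [:: w]). Qed.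

Let br (c : R) u v w : b w (c *: u + v) = c * b w u + b w v.
Proof. by rewrite !(hC w) bl. Qed.

Let bN u w : b (- u) w = - b u w.
Proof. exact: (@ml_vecN _ _ _ _ mh u [::] [:: w]). Qed.

Let bZ (c : R) u w : b (c *: u) w = c * b u w.
Proof. exact: (@ml_vecZ _ _ _ _ mh c u [::] [:: w]). Qed.

Let bJ u w : b (J u) w = - b u (J w).
Proof. by rewrite -(hJ (J u)) JJ bN. Qed.

Let bJ0 u : b (J u) u = 0.
Proof.
by have := bJ u u; rewrite (hC u) => /eqP; rewrite -subr_eq0 opprK -mulr2n mulrn_eq0 => /eqP.
Qed.

Let unit_orthogonal (L : seq V) : (size L < 6)%N ->
  exists2 v, b v v = 1 & forall x, x \in L -> b x v = 0.
Proof.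
move=> L6; have [v v0 vL] := @common_zero R 6 (size L) (fun i v => b (nth 0 L i) v) L6
  (fun i c u v => br c u v _).
have bv := hpos v0; pose s := Num.sqrt (b v v).
have s0 : s != 0 by rewrite gt_eqF// sqrtr_gt0.
have s2 : b v v = s ^+ 2 by rewrite sqr_sqrtr// ltW.
exists (s^-1 *: v); first by rewrite bZ hC bZ s2; field.
move=> x /(nthP 0) [i iL <-]; rewrite hC bZ hC.
by have := vL (Ordinal iL) => /= ->; rewrite mulr0.
Qed.

Let B (e : V * V * V) (k : nat) : V :=
  match k with 0 => e.1.1 | 1 => e.1.2 | _ => e.2 end.

Let E e i : V := if odd i then J (B e i./2) else B e i./2.

(** A unitary triple: the two conditions are the real and imaginary parts of orthonormality for the
    Hermitian form of h. *)
Let good_triple e := (forall k k', (k < 3)%N -> (k' < 3)%N -> b (B e k) (B e k') = (k == k')%:R)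
  /\ forall k k', (k < 3)%N -> (k' < 3)%N -> b (J (B e k)) (B e k') = 0.

Let triple_intro u v w : b u u = 1 -> b v v = 1 -> b w w = 1 ->
  (forall x, x \in [:: u; J u] -> b x v = 0) ->
  (forall x, x \in [:: u; J u; v; J v] -> b x w = 0) -> good_triple (u, v, w).
Proof.
move=> uu vv ww vL wL.
have H x y l : (forall z, z \in l -> b z y = 0) -> x \in l -> b x y = 0 by move=> h1 /h1.
have uv : b u v = 0 by apply: vL; rewrite !inE eqxx.
have juv : b (J u) v = 0 by apply: vL; rewrite !inE eqxx orbT.
have uw : b u w = 0 by apply: wL; rewrite !inE eqxx.
have juw : b (J u) w = 0 by apply: wL; rewrite !inE eqxx !orbT.
have vw : b v w = 0 by apply: wL; rewrite !inE eqxx !orbT.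
have jvw : b (J v) w = 0 by apply: wL; rewrite !inE eqxx !orbT.
split=> -[|[|[|k]]] [|[|[|k']]] // _ _ /=; rewrite ?(hC v u) ?(hC w u) ?(hC w v) ?bJ0 //.
- by rewrite bJ hC juv oppr0.
- by rewrite bJ hC juw oppr0.
- by rewrite bJ hC jvw oppr0.
Qed.

Let half3 i : (i < 6)%N -> (i./2 < 3)%N. Proof. by do 6?[case: i => [|i]//]. Qed.

Let half_odd i j : (i == j) = (i./2 == j./2) && (odd i == odd j).
Proof.
apply/eqP/andP => [->|[/eqP h2 /eqP ho]]; first by rewrite !eqxx.
by rewrite -[i]odd_double_half -[j]odd_double_half h2 ho.
Qed.

Let E_orth e i j : good_triple e -> (i < 6)%N -> (j < 6)%N ->
  b (E e i) (E e j) = (dl i j)%:~R.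
Proof.
move=> [g1 g2] i6 j6; have [i3 j3] := (half3 i6, half3 j6).
rewrite /E /dl eq_sym half_odd; case: (odd i); case: (odd j); rewrite ?hJ ?g1 ?g2 ?andbT ?andbF//.
- by case: eqP.
- by rewrite hC g2.
- by case: eqP.
Qed.

Let E_sg e i j : good_triple e -> (i < 6)%N -> (j < 6)%N ->
  sg (vec [:: E e i; E e j]) = (sgT [:: i; j])%:~R.
Proof.
move=> [g1 g2] i6 j6; have [i3 j3] := (half3 i6, half3 j6).
have lt2 x y : x./2 = y./2 -> (x < y)%N = (odd x < odd y)%N.
  by move=> h2; rewrite -{1}[x]odd_double_half -{1}[y]odd_double_half h2 ltn_add2r.
rewrite sgE /E /sgT; case: eqP => h2.
  rewrite (lt2 _ _ h2) (lt2 _ _ (esym h2)).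
  by case: (odd i); case: (odd j);
    rewrite /= ?JJ ?hJ ?bN ?g1 ?g2 ?h2 ?eqxx ?rmorphN1 ?rmorph1 ?rmorph0// hC
      -?h2 g2// oppr0.
have /eqP/negbTE n2 := h2.
by case: (odd i); case: (odd j); rewrite ?JJ ?hJ ?bN ?g1 ?g2 ?n2 ?oppr0// hC g2// oppr0.
Qed.

Let E_J e i : (i < 6)%N -> J (E e i) = (Jsgn i)%:~R *: E e (Jidx i).
Proof.
move=> i6; rewrite /E /Jsgn /Jidx; case oi: (odd i).
  have [k ik] : exists k, i = k.*2.+1.
    by exists i./2; rewrite -{1}[i]odd_double_half oi.
  rewrite JJ ik /= odd_double /= uphalf_double doubleK rmorphN1 scaleN1r//.
have [k ik] : exists k, i = k.*2 by exists i./2; rewrite -{1}[i]odd_double_half oi.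
by rewrite ik /= odd_double /= uphalf_double doubleK scale1r.
Qed.

Let E_frame e : good_triple e -> frame 6 (E e).
Proof.
move=> ge v; pose F : 'M[R]_6 := \matrix_(i < 6) E e i.
pose M : 'M[R]_6 := \matrix_(i, j) b 'e_i (E e j).
have FM : F *m M = 1%:M.
  apply/matrixP => i j; rewrite !mxE.
  transitivity (b (E e i) (E e j)); last first.
    by rewrite E_orth// /dl (eq_sym (j : nat)) (_ : (i == j :> nat) = (i == j))//; case: (i == j).
  rewrite (rV_delta (E e i)) (@ml_vec_sum _ _ _ _ mh _ _ _ _ [::] [:: E e j])//.
  by apply: eq_bigr => k _; rewrite !mxE.
have uF : F \in unitmx by case/mulmx1_unit: FM.
exists (fun i => (v *m invmx F) ord0 (inord i)).
rewrite -[LHS]mulmx1 -(mulVmx uF) mulmxA mulmx_sum_row.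
rewrite -[iota 0 6]/(index_iota 0 6) big_mkord; apply: eq_bigr => i _.
by rewrite inord_val rowK.
Qed.

Let pA s u v w : [/\ P s u w v = - P s u v w, P s v u w = - P s u v w,
  P s v w u = P s u v w, P s w u v = P s u v w & P s w v u = - P s u v w].
Proof. exact: alt3. Qed.

Let p0 s u v : [/\ P s u u v = 0, P s u v u = 0 & P s v u u = 0].
Proof.
have h1 := @alt_vec0 _ _ _ _ (mp s) (@ap s) u [::] [:: v] erefl.
have h2 := @alt_vec0 _ _ _ _ (mp s) (@ap s) u [:: v] [::] erefl.
by split => //; have [_ _ -> _ _] := pA s u u v.
Qed.

Let pJ2 s u v w : P s u (J v) w = if s then P false u v w else - P true u v w.
Proof.
have [_ -> _ _ _] := pA s (J v) u w; rewrite pJ.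
by have [_ e1 _ _ _] := pA false u v w; have [_ e2 _ _ _] := pA true u v w;
  case: s; rewrite ?e1 ?e2 ?opprK.
Qed.

Let pJ3 s u v w : P s u v (J w) = if s then P false u v w else - P true u v w.
Proof.
have [_ _ -> _ _] := pA s (J w) u v; rewrite pJ.
by have [_ _ _ -> _] := pA false u v w; have [_ _ _ -> _] := pA true u v w.
Qed.

(** Each [J] multiplies psi^+ + i psi^- by i; [rc] gives the parts of the resulting power of i. *)
Let P_J s (a c d : bool) u v w :
  P s (if a then J u else u) (if c then J v else v) (if d then J w else w) =
  (rc s (a + c + d))%:~R * P false u v w +
  (if s then (rc false (a + c + d))%:~R else - (rc true (a + c + d))%:~R) * P true u v w.
Proof.
case: s; case: a; case: c; case: d; rewrite ?pJ ?pJ2 ?pJ3 /= ?opprK ?rmorphN ?rmorph0 ?rmorph1;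
  move: (P false u v w) (P true u v w) => x y; ring.
Qed.

Let P_eps s e i j k : (i < 3)%N -> (j < 3)%N -> (k < 3)%N ->
  P s (B e i) (B e j) (B e k) = (eps3 i j k)%:~R * P s (B e 0) (B e 1) (B e 2).
Proof.
have [a1 a2 a3 a4 a5] := pA s (B e 0) (B e 1) (B e 2).
have z1 u v : P s u u v = 0 by case: (p0 s u v).
have z2 u v : P s u v u = 0 by case: (p0 s u v).
have z3 u v : P s v u u = 0 by case: (p0 s u v).
case: i => [|[|[|i]]]//; case: j => [|[|[|j]]]//; case: k => [|[|[|k]]]// _ _ _;
  rewrite ?a1 ?a2 ?a3 ?a4 ?a5 ?z1 ?z2 ?z3 /eps3 /=
    ?rmorphN1 ?mulN1r ?rmorph1 ?mul1r ?rmorph0 ?mul0r //.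
Qed.

Let E_psi e r : P false (B e 0) (B e 1) (B e 2) = r -> P true (B e 0) (B e 1) (B e 2) = 0 ->
  forall s, has_table 6 (E e) (psi s) r (psT s).
Proof.
move=> pf pt s l; rewrite tuplesP; case: l => [|i [|j [|k [|m l]]]]//= /and4P[i6 j6 k6 _].
have [i3 j3 k3] := And3 (half3 i6) (half3 j6) (half3 k6).
rewrite /E P_J (P_eps false e i3 j3 k3) (P_eps true e i3 j3 k3) pf pt !mulr0 addr0 rmorphM.
by move: (eps3 _ _ _) (rc _ _) => x y; ring.
Qed.

(** If psi takes the value x + i y on the triple, multiplying the third vector by the conjugate
    phase (x - i y) / r makes this value equal to r = |x + i y|. *)
Let good_phase e : good_triple e -> exists e', good_triple e' /\
  exists2 r, 0 <= r & P false (B e' 0) (B e' 1) (B e' 2) = r /\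
                      P true (B e' 0) (B e' 1) (B e' 2) = 0.
Proof.
move=> ge; have [g1 g2] := ge; case: e ge g1 g2 => [[u v] w] ge g1 g2.
pose x := P false u v w; pose y := P true u v w.
pose r := Num.sqrt (x ^+ 2 + y ^+ 2).
(* Nothing to rotate if psi vanishes on the triple; the volume normalisation rules this case out
   afterwards. *)
have [r0|r0] := eqVneq r 0.
  have : x ^+ 2 + y ^+ 2 = 0.
    by apply/eqP; rewrite eq_le -sqrtr_eq0 -/r r0 eqxx addr_ge0 ?sqr_ge0.
  move/eqP; rewrite paddr_eq0 ?sqr_ge0// !sqrf_eq0 => /andP[/eqP x0 /eqP y0].
  by exists (u, v, w); split => //; exists 0.
have r2 : x ^+ 2 + y ^+ 2 = r ^+ 2 by rewrite sqr_sqrtr// addr_ge0 ?sqr_ge0.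
have sJ z (k : R) : k *: z = k *: z + 0 by rewrite addr0.
pose w' := (x / r) *: w + (- (y / r)) *: J w.
have b0 z : b z w = 0 -> b (J z) w = 0 -> b z w' = 0.
  move=> h1 h2; rewrite /w' br h1 (hC z) bZ bJ (hC w) h2; ring.
have uu : b u u = 1 by have := g1 0%N 0%N isT isT.
have vv : b v v = 1 by have := g1 1%N 1%N isT isT.
have ww : b w w = 1 by have := g1 2%N 2%N isT isT.
have uv : b u v = 0 by have := g1 0%N 1%N isT isT.
have uw : b u w = 0 by have := g1 0%N 2%N isT isT.
have vw : b v w = 0 by have := g1 1%N 2%N isT isT.
have juv : b (J u) v = 0 by have := g2 0%N 1%N isT isT.
have juw : b (J u) w = 0 by have := g2 0%N 2%N isT isT.
have jvw : b (J v) w = 0 by have := g2 1%N 2%N isT isT.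
have ww' : b w' w' = 1.
  have h1 : b w w' = x / r by rewrite /w' br ww hC bZ bJ0; ring.
  have h2 : b (J w) w' = - (y / r) by rewrite /w' br bJ0 hC bZ hJ ww; ring.
  rewrite {1}/w' bl bZ h1 h2.
  have -> : x / r * (x / r) + - (y / r) * - (y / r) = (x ^+ 2 + y ^+ 2) / r ^+ 2 by field.
  by rewrite r2 divff// expf_eq0.
exists (u, v, w'); split.
  apply: triple_intro => // z; rewrite !inE.
    by case/orP => /eqP ->.
  by case/or4P => /eqP ->; apply: b0 => //; rewrite JJ bN ?uw ?vw oppr0.
exists r; first exact: sqrtr_ge0.
have Pw' s : P s u v w' = x / r * P s u v w + - (y / r) * P s u v (J w).
  rewrite /w' (@ml_vec _ _ _ _ (mp s) _ _ _ [:: u; v] [::])//.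
  by rewrite (@ml_vecZ _ _ _ _ (mp s) _ (J w) [:: u; v] [::]).
rewrite /= !Pw' !pJ3 -/x -/y; split; last by ring.
have -> : x / r * x + - (y / r) * - y = (x ^+ 2 + y ^+ 2) / r by field.
by rewrite r2 expr2 mulfK.
Qed.

(** Gram-Schmidt gives a unitary triple. Since psi is of type (3,0) it is a multiple of dz1 dz2 dz3,
    the phase of the factor is absorbed in the triple, and psi^+ ^ psi^- = 2/3 sg^3 fixes its
    modulus. *)
Lemma adapted_frame_exists : exists F : nat -> V, adapted J sg psi F /\
  forall i j, (i < 6)%N -> (j < 6)%N -> b (F i) (F j) = (dl i j)%:~R.
Proof.
have [u uu _] := @unit_orthogonal [::] isT.
have [v vv vL] := @unit_orthogonal [:: u; J u] isT.
have [w ww wL] := @unit_orthogonal [:: u; J u; v; J v] isT.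
have [e [ge [r r0 [pf pt]]]] := good_phase (triple_intro uu vv ww vL wL).
have tp := E_psi pf pt.
have ts : has_table 6 (E e) sg 1 sgT.
  move=> l; rewrite tuplesP; case: l => [|i [|j [|k l]]]//= /and3P[i6 j6 _].
  by rewrite mul1r E_sg.
exists (E e); split; last by move=> i j i6 j6; exact: E_orth.
suff r1 : r = 1 by split; [exact: E_frame|exact: E_J|exact: ts|rewrite -r1].
have l6 : iota 0 6 \in tuples (3 + 3) 6 by [].
(* On the whole frame the left side is 24 r^2 / 3! = 4 r^2 and the right side is 2/3 times 288 / (4!
   2!) = 6, so r^2 = 1; the sign is settled by r >= 0. *)
have t1 := table_wedgeP (mp true) (@ap true) (tp false) (tp true) l6.
have t2 := table_wedgeP msg asg (table_wedgeP msg asg ts ts) ts l6.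
have := pvol (vec (map (E e) (iota 0 6))); rewrite t1 t2.
have -> : table_wedge 3 (psT false) (psT true) (iota 0 6) = 24 by vm_compute.
have -> : table_wedge 4 (table_wedge 2 sgT sgT) sgT (iota 0 6) = 288 by vm_compute.
rewrite (_ : 3`! = 6)%N// (_ : 4`! = 24)%N// (_ : 2`! = 2)%N// !rmorph_nat => E0.
have : r ^+ 2 = 1 by move: E0; rewrite expr2; move: (r * r) => z; lra.
by move/eqP; rewrite sqrf_eq1 => /orP[/eqP //|/eqP rN]; move: r0; rewrite rN ler0N1.
Qed.

End AdaptedFrame.

(** * Exterior calculus on open subsets of R^n *)

Section Slots.
Variables (R : realType) (n m : nat) (A : set 'rV[R]_n).
Hypothesis oA : open A.
Variables (g : 'rV[R]_n -> 'rV[R]_m -> R) (X : 'rV[R]_n -> 'rV[R]_m).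
Hypothesis lg : forall y, A y -> forall (c : R) u v, g y (c *: u + v) = c * g y u + g y v.

Lemma slot_sum y v : A y -> g y v = \sum_j v ord0 j * g y 'e_j.
Proof.
move=> Ay; have g0 : g y 0 = 0.
  have E0 : -1 *: (0 : 'rV[R]_m) + 0 = 0 by rewrite scaler0 addr0.
  by have := lg Ay (-1) 0 0; rewrite E0; move: (g y 0) => z; rewrite mulN1r addNr.
rewrite {1}(rV_delta v); elim: (index_enum _) => [|j s IH]; first by rewrite !big_nil.
by rewrite !big_cons lg// IH.
Qed.

(** The product rule for a linear form applied to a moving vector, after expanding the vector in
    coordinates. *)
Lemma Dslot x u : A x -> (forall e, differentiable (g^~ e) x) -> differentiable X x ->
  differentiable (fun y => g y (X y)) x /\
  'D_u (fun y => g y (X y)) x = 'D_u (fun y => g y (X x)) x + g x ('D_u X x).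
Proof.
move=> Ax dg dX; have dXj j : differentiable (fun y => X y ord0 j) x.
  exact: (differentiable_comp dX (differentiable_coord _ _ _)).
have dj j : differentiable (fun y => X y ord0 j * g y 'e_j) x.
  by apply: differentiableM.
have [dS DS] := Dsum (index_enum 'I_m) u (fun j (_ : predT j) => dj j).
split.
  apply: near_eq_differentiable dS; apply: (open_near oA Ax) => y Ay.
  by rewrite [RHS]slot_sum.
rewrite (D_eq_on u oA Ax (fun y Ay => slot_sum (X y) Ay)) DS.
have dc j : predT j -> differentiable (fun y => X x ord0 j * g y 'e_j) x.
  by move=> _; apply: differentiableM => //; exact: differentiable_cst.
have [_ Dc] := Dsum (index_enum 'I_m) u dc.
rewrite (D_eq_on u oA Ax (fun y Ay => slot_sum (X x) Ay)) Dc.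
rewrite (slot_sum ('D_u X x) Ax) -big_split /=; apply: eq_bigr => j _.
rewrite (Dmul _ (dXj j) (dg _)) (Dmul _ (differentiable_cst _ _) (dg _)).
by rewrite derive_cst mul0r add0r Dcoord// addrC.
Qed.

Lemma smooth_slot : (forall e, smooth_on A (g^~ e)) -> smooth_on A X ->
  smooth_on A (fun y => g y (X y)).
Proof.
move=> sg sX; apply: (smooth_on_eq (f := fun y => \sum_j X y ord0 j * g y 'e_j)) => //.
  by move=> y Ay; rewrite [RHS]slot_sum.
by apply: smooth_sum => // j _; apply: smoothM => //; exact: smooth_on_coord.
Qed.

End Slots.

Section LocalForms.
Variable R : realType.

Definition lform n p (A : set 'rV[R]_n) (S : 'rV[R]_n -> cov R n p) : Prop :=
  [/\ forall x, A x -> multilinear (S x), forall x, A x -> alternating (S x)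
    & forall v, smooth_on A (fun x => S x v)].

(** Convertible with [dext] in a fixed chart, so results pass between the two by conversion. *)
Definition dx n p (S : 'rV[R]_n -> cov R n p) : 'rV[R]_n -> cov R n p.+1 := fun x v =>
  \sum_(a < p.+1) (-1) ^+ a * 'D_(v a) (fun y => S y (fun b => v (lift a b))) x.

Definition pull n m p (f : 'rV[R]_n -> 'rV[R]_m) (S : 'rV[R]_m -> cov R m p) :
  'rV[R]_n -> cov R n p := fun x v => S (f x) (fun a => 'D_(v a) f x).

Lemma pull_vec n m p (f : 'rV[R]_n -> 'rV[R]_m) (S : 'rV[R]_m -> cov R m p) x l :
  size l = p -> pull f S x (vec l) = S (f x) (vec [seq 'D_w f x | w <- l]).
Proof.
move=> sl; rewrite /pull; congr (S _ _); apply/funext => i.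
by rewrite /vec (nth_map 0) ?sl.
Qed.

Lemma dx_vec n p (S : 'rV[R]_n -> cov R n p) x l : size l = p.+1 ->
  dx S x (vec l) = \sum_(a < p.+1) (-1) ^+ a * 'D_(nth 0 l a) (fun y => S y (vec (remn a l))) x.
Proof.
move=> sl; apply: eq_bigr => a _.
have -> : (fun y => S y (fun b => vec l (lift a b))) = (fun y => S y (vec (remn a l))).
  by apply/funext => y; rewrite vec_lift.
by [].
Qed.

Section Dx.
Variables (n : nat) (x u v w z t : 'rV[R]_n).

Lemma dx0E (S : 'rV[R]_n -> cov R n 0) : dx S x (vec [:: u]) = 'D_u (fun y => S y (vec [::])) x.
Proof. by rewrite dx_vec// big_ord_recr big_ord0 /= add0r expr0 mul1r. Qed.

Lemma dx1E (S : 'rV[R]_n -> cov R n 1) : dx S x (vec [:: u; v]) =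
  'D_u (fun y => S y (vec [:: v])) x - 'D_v (fun y => S y (vec [:: u])) x.
Proof.
rewrite dx_vec// !big_ord_recr big_ord0 /= /remn /= !exprS expr0.
by move: ('D_u _ x) ('D_v _ x) => a b; ring.
Qed.

Lemma dx2E (S : 'rV[R]_n -> cov R n 2) : dx S x (vec [:: u; v; w]) =
  'D_u (fun y => S y (vec [:: v; w])) x - 'D_v (fun y => S y (vec [:: u; w])) x
  + 'D_w (fun y => S y (vec [:: u; v])) x.
Proof.
rewrite dx_vec// !big_ord_recr big_ord0 /= /remn /= !exprS expr0.
by move: ('D_u _ x) ('D_v _ x) ('D_w _ x) => a b c; ring.
Qed.

Lemma dx3E (S : 'rV[R]_n -> cov R n 3) : dx S x (vec [:: u; v; w; z]) =
  'D_u (fun y => S y (vec [:: v; w; z])) x - 'D_v (fun y => S y (vec [:: u; w; z])) x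
  + 'D_w (fun y => S y (vec [:: u; v; z])) x - 'D_z (fun y => S y (vec [:: u; v; w])) x.
Proof.
rewrite dx_vec// !big_ord_recr big_ord0 /= /remn /= !exprS expr0.
by move: ('D_u _ x) ('D_v _ x) ('D_w _ x) ('D_z _ x) => a b c d; ring.
Qed.

Lemma dx4E (S : 'rV[R]_n -> cov R n 4) : dx S x (vec [:: u; v; w; z; t]) =
  'D_u (fun y => S y (vec [:: v; w; z; t])) x - 'D_v (fun y => S y (vec [:: u; w; z; t])) x
  + 'D_w (fun y => S y (vec [:: u; v; z; t])) x - 'D_z (fun y => S y (vec [:: u; v; w; t])) x
  + 'D_t (fun y => S y (vec [:: u; v; w; z])) x.
Proof.
rewrite dx_vec// !big_ord_recr big_ord0 /= /remn /= !exprS expr0.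
by move: ('D_u _ x) ('D_v _ x) ('D_w _ x) ('D_z _ x) ('D_t _ x) => a b c d e; ring.
Qed.

End Dx.

Lemma dx_eq_on n p (A : set 'rV[R]_n) (S T : 'rV[R]_n -> cov R n p) x v : open A ->
  A x -> (forall y, A y -> S y =1 T y) -> dx S x v = dx T x v.
Proof.
move=> oA Ax ST; apply: eq_bigr => a _; congr (_ * _); apply: (D_eq_on _ oA Ax) => y Ay.
exact: ST.
Qed.

(* Differentiating a form along a map [f], at vectors which also vary. *)
Section DForm.
Variables (n m : nat) (A : set 'rV[R]_n) (B : set 'rV[R]_m) (f : 'rV[R]_n -> 'rV[R]_m).
Hypotheses (oA : open A) (oB : open B) (sf : smooth_on A f) (AB : forall x, A x -> B (f x)).
Variables (x u : 'rV[R]_n).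
Hypothesis Ax : A x.

Let df : differentiable f x. Proof. exact: smooth_on_diff sf Ax. Qed.

Lemma D_form_cst p (S : 'rV[R]_m -> cov R m p) l : lform B S ->
  differentiable (fun y => S (f y) (vec l)) x /\
  'D_u (fun y => S (f y) (vec l)) x = 'D_('D_u f x) (fun y => S y (vec l)) (f x).
Proof.
move=> [_ _ sS]; have dS := smooth_on_diff (sS (vec l)) (AB Ax).
by split; [exact: (differentiable_comp df dS)|exact: Dcomp].
Qed.

Let lin_slot p (S : 'rV[R]_m -> cov R m p) l1 l2 (e : 'rV[R]_m) : lform B S ->
  (size l1 + size l2).+1 = p ->
  forall y, A y -> forall (c : R) u v, S (f y) (vec (l1 ++ (c *: u + v) :: l2)) =
    c * S (f y) (vec (l1 ++ u :: l2)) + S (f y) (vec (l1 ++ v :: l2)).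
Proof.
move=> [mS _ _] sp y Ay c a b; apply: ml_vec; first exact: mS (AB Ay).
by rewrite size_cat /= addnS.
Qed.

Variables X Y Z : 'rV[R]_n -> 'rV[R]_m.
Hypotheses (dX : differentiable X x) (dY : differentiable Y x) (dZ : differentiable Z x).

Lemma D_form1 (S : 'rV[R]_m -> cov R m 1) : lform B S ->
  differentiable (fun y => S (f y) (vec [:: X y])) x /\
  'D_u (fun y => S (f y) (vec [:: X y])) x =
  'D_('D_u f x) (fun y => S y (vec [:: X x])) (f x) + S (f x) (vec [:: 'D_u X x]).
Proof.
move=> fS; have [d D] := Dslot oA (lin_slot (l1 := [::]) (l2 := [::]) 0 fS erefl) u Ax
  (fun e => proj1 (D_form_cst [:: e] fS)) dX.
by split; [exact: d|rewrite D (proj2 (D_form_cst [:: X x] fS))].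
Qed.

Lemma D_form2 (S : 'rV[R]_m -> cov R m 2) : lform B S ->
  differentiable (fun y => S (f y) (vec [:: X y; Y y])) x /\
  'D_u (fun y => S (f y) (vec [:: X y; Y y])) x =
  'D_('D_u f x) (fun y => S y (vec [:: X x; Y x])) (f x)
  + S (f x) (vec [:: 'D_u X x; Y x]) + S (f x) (vec [:: X x; 'D_u Y x]).
Proof.
move=> fS.
have H e := Dslot oA (lin_slot (l1 := [:: e]) (l2 := [::]) 0 fS erefl) u Ax
  (fun e' => proj1 (D_form_cst [:: e; e'] fS)) dY.
have [d D] := @Dslot _ _ _ A oA (fun y e => S (f y) (vec [:: e; Y y])) X
  (fun y Ay => lin_slot (l1 := [::]) (l2 := [:: Y y]) 0 fS erefl Ay) x u Ax
  (fun e => proj1 (H e)) dX.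
split; first exact: d.
rewrite D (proj2 (H (X x))) (proj2 (D_form_cst [:: X x; Y x] fS)) -!addrA.
by congr (_ + _); rewrite addrC.
Qed.

Lemma D_form3 (S : 'rV[R]_m -> cov R m 3) : lform B S ->
  differentiable (fun y => S (f y) (vec [:: X y; Y y; Z y])) x /\
  'D_u (fun y => S (f y) (vec [:: X y; Y y; Z y])) x =
  'D_('D_u f x) (fun y => S y (vec [:: X x; Y x; Z x])) (f x)
  + S (f x) (vec [:: 'D_u X x; Y x; Z x]) + S (f x) (vec [:: X x; 'D_u Y x; Z x])
  + S (f x) (vec [:: X x; Y x; 'D_u Z x]).
Proof.
move=> fS.
have H e e' := Dslot oA (lin_slot (l1 := [:: e; e']) (l2 := [::]) 0 fS erefl) u Ax
  (fun e'' => proj1 (D_form_cst [:: e; e'; e''] fS)) dZ.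
have K e := @Dslot _ _ _ A oA (fun y e' => S (f y) (vec [:: e; e'; Z y])) Y
  (fun y Ay => lin_slot (l1 := [:: e]) (l2 := [:: Z y]) 0 fS erefl Ay) x u Ax
  (fun e' => proj1 (H e e')) dY.
have [d D] := @Dslot _ _ _ A oA (fun y e => S (f y) (vec [:: e; Y y; Z y])) X
  (fun y Ay => lin_slot (l1 := [::]) (l2 := [:: Y y; Z y]) 0 fS erefl Ay) x u Ax
  (fun e => proj1 (K e)) dX.
split; first exact: d.
rewrite D (proj2 (K (X x))) (proj2 (H (X x) (Y x))).
rewrite (proj2 (D_form_cst [:: X x; Y x; Z x] fS)).
by move: ('D_('D_u f x) _ _) (S _ _) (S _ _) (S _ _) => a b c d'; ring.
Qed.

End DForm.

Section Naturality.
Variables (n m : nat) (A : set 'rV[R]_n) (B : set 'rV[R]_m) (f : 'rV[R]_n -> 'rV[R]_m).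
Hypotheses (oA : open A) (oB : open B) (sf : smooth_on A f) (AB : forall x, A x -> B (f x)).
Variable x : 'rV[R]_n.
Hypothesis Ax : A x.

Lemma schwarz_rV (u v : 'rV[R]_n) : 'D_u ('D_v f) x = 'D_v ('D_u f) x.
Proof.
have dD (w : 'rV[R]_n) : differentiable ('D_w f) x.
  exact: smooth_on_diff (smooth_on_derive w sf) Ax.
have d1 (y : 'rV[R]_n) : A y -> differentiable f y by move=> Ay; exact: smooth_on_diff sf Ay.
have E (w y : 'rV[R]_n) j : A y -> 'D_w f y ord0 j = 'D_w (fun y => f y ord0 j) y.
  by move=> Ay; rewrite (Dcoord w j (d1 y Ay)).
have E1 (w1 w2 : 'rV[R]_n) j : 'D_w1 ('D_w2 f) x ord0 j = 'D_w1 ('D_w2 (fun y => f y ord0 j)) x.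
  by rewrite -(D_eq_on w1 oA Ax (fun y Ay => E w2 y j Ay)) (Dcoord w1 j (dD w2)).
apply/rowP => j; apply: etrans (E1 u v j) _; apply: etrans _ (esym (E1 v u j)).
by apply: (schwarz oA) => //; exact: smooth_on_coord.
Qed.

Let dDf u : differentiable ('D_u f) x.
Proof. exact: smooth_on_diff (smooth_on_derive u sf) Ax. Qed.

(** The terms with second derivatives of [f] cancel, these being symmetric while the alternated sum
    is antisymmetric in the two directions. The same reason serves in degrees 2 and 3. *)
Lemma dx_pull1 (S : 'rV[R]_m -> cov R m 1) l : lform B S -> size l = 2%N ->
  dx (pull f S) x (vec l) = pull f (dx S) x (vec l).
Proof.
case: l => [|u [|v [|? ?]]] fS sl; try discriminate sl.
pose F (a : 'rV[R]_n) := 'D_a f x; pose H (a b : 'rV[R]_n) := 'D_a ('D_b f) x.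
pose G (a : 'rV[R]_m) l := 'D_a (fun y => S y (vec l)) (f x).
have D a b : 'D_a (fun y => pull f S y (vec [:: b])) x =
  G (F a) [:: F b] + S (f x) (vec [:: H a b]).
  have -> : (fun y => pull f S y (vec [:: b])) = (fun y => S (f y) (vec [:: 'D_b f y])).
    by apply/funext => y; rewrite pull_vec.
  exact: (proj2 (D_form1 oA sf AB a Ax (dDf b) fS)).
have HC (a b : 'rV[R]_n) : H a b = H b a by exact: schwarz_rV.
have Q a b : dx S (f x) (vec [:: a; b]) = G a [:: b] - G b [:: a] by exact: dx1E.
apply: etrans (dx1E _ u v _) _.
apply: etrans (f_equal2 (fun a b : R => a - b) (D u v) (D v u)) _.
rewrite pull_vec// -![map _ _]/[:: F u; F v].
apply: etrans _ (esym (Q (F u) (F v))); clearbody F G H.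
rewrite (HC v u); move: (S _ _) (G _ _) (G _ _) => a b c; ring.
Qed.

Lemma dx_pull2 (S : 'rV[R]_m -> cov R m 2) l : lform B S -> size l = 3%N ->
  dx (pull f S) x (vec l) = pull f (dx S) x (vec l).
Proof.
case: l => [|u [|v [|w [|? ?]]]] fS sl; try discriminate sl.
pose F (a : 'rV[R]_n) := 'D_a f x; pose H (a b : 'rV[R]_n) := 'D_a ('D_b f) x.
pose G (a : 'rV[R]_m) l := 'D_a (fun y => S y (vec l)) (f x).
have D a b c : 'D_a (fun y => pull f S y (vec [:: b; c])) x =
  G (F a) [:: F b; F c] + S (f x) (vec [:: H a b; F c]) + S (f x) (vec [:: F b; H a c]).
  have -> : (fun y => pull f S y (vec [:: b; c])) = (fun y => S (f y) (vec [:: 'D_b f y; 'D_c f y])).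
    by apply/funext => y; rewrite pull_vec.
  exact: (proj2 (D_form2 oA sf AB a Ax (dDf b) (dDf c) fS)).
have HC (a b : 'rV[R]_n) : H a b = H b a by exact: schwarz_rV.
have Q a b c : dx S (f x) (vec [:: a; b; c]) = G a [:: b; c] - G b [:: a; c] + G c [:: a; b] by exact: dx2E.
apply: etrans (dx2E _ u v w _) _.
apply: etrans (f_equal3 (fun a b c : R => a - b + c) (D u v w) (D v u w) (D w u v)) _.
rewrite pull_vec// -![map _ _]/[:: F u; F v; F w].
apply: etrans _ (esym (Q (F u) (F v) (F w))); clearbody F G H.
rewrite (HC v u) (HC w u) (HC w v).
have [mS aS _] := fS; have C a b := alt2 a b (mS _ (AB Ax)) (aS _ (AB Ax)).
rewrite (C (H u w) (F v)).
move: (S _ _) (S _ _) (S _ _) (G _ _) (G _ _) (G _ _) => a b c d e g; ring.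
Qed.

Lemma dx_pull3 (S : 'rV[R]_m -> cov R m 3) l : lform B S -> size l = 4%N ->
  dx (pull f S) x (vec l) = pull f (dx S) x (vec l).
Proof.
case: l => [|u [|v [|w [|z [|? ?]]]]] fS sl; try discriminate sl.
pose F (a : 'rV[R]_n) := 'D_a f x; pose H (a b : 'rV[R]_n) := 'D_a ('D_b f) x.
pose G (a : 'rV[R]_m) l := 'D_a (fun y => S y (vec l)) (f x).
have D a b c d : 'D_a (fun y => pull f S y (vec [:: b; c; d])) x =
  G (F a) [:: F b; F c; F d] + S (f x) (vec [:: H a b; F c; F d]) + S (f x) (vec [:: F b; H a c; F d]) + S (f x) (vec [:: F b; F c; H a d]).
  have -> : (fun y => pull f S y (vec [:: b; c; d])) = (fun y => S (f y) (vec [:: 'D_b f y; 'D_c f y; 'D_d f y])).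
    by apply/funext => y; rewrite pull_vec.
  exact: (proj2 (D_form3 oA sf AB a Ax (dDf b) (dDf c) (dDf d) fS)).
have HC (a b : 'rV[R]_n) : H a b = H b a by exact: schwarz_rV.
have Q a b c d : dx S (f x) (vec [:: a; b; c; d]) = G a [:: b; c; d] - G b [:: a; c; d] + G c [:: a; b; d] - G d [:: a; b; c] by exact: dx3E.
apply: etrans (dx3E _ u v w z _) _.
apply: etrans (f_equal4 (fun a b c d : R => a - b + c - d) (D u v w z) (D v u w z) (D w u v z) (D z u v w)) _.
rewrite pull_vec// -![map _ _]/[:: F u; F v; F w; F z].
apply: etrans _ (esym (Q (F u) (F v) (F w) (F z))); clearbody F G H.
rewrite (HC v u) (HC w u) (HC w v) (HC z u) (HC z v) (HC z w).
have [mS aS _] := fS; have C a b c := alt3 a b c (mS _ (AB Ax)) (aS _ (AB Ax)).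
have C1 a b c : S (f x) (vec [:: a; b; c]) = - S (f x) (vec [:: b; a; c]).
  by have [_ -> _ _ _] := C b a c.
have C2 a b c : S (f x) (vec [:: a; b; c]) = S (f x) (vec [:: c; a; b]).
  by have [_ _ -> _ _] := C c a b.
have [E _ _ _ _] := C (F u) (H v z) (F w).
rewrite (C1 (F v) (H u w)) (C2 (F v) (F w) (H u z)) E.
move: (S _ (vec [:: _; _; _])) (S _ (vec [:: _; _; _])) (S _ (vec [:: _; _; _])).
move: (S _ (vec [:: _; _; _])) (S _ (vec [:: _; _; _])) (S _ (vec [:: _; _; _])).
move: (G _ _) (G _ _) (G _ _) (G _ _) => a b c d e g h i j k; ring.
Qed.

End Naturality.

Section Algebra.
Variables (n : nat) (A : set 'rV[R]_n) (x : 'rV[R]_n).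
Hypotheses (oA : open A) (Ax : A x).

Lemma lform_diff p (S : 'rV[R]_n -> cov R n p) v : lform A S -> differentiable (fun y => S y v) x.
Proof. by move=> [_ _ sS]; exact: smooth_on_diff (sS v) Ax. Qed.

Lemma dx_lin p (S T : 'rV[R]_n -> cov R n p) (c : R) v : lform A S -> lform A T ->
  dx (fun y f => c * S y f + T y f) x v = c * dx S x v + dx T x v.
Proof.
move=> fS fT; rewrite /dx mulr_sumr -big_split /=; apply: eq_bigr => a _.
have dS := lform_diff (fun b => v (lift a b)) fS.
have dT := lform_diff (fun b => v (lift a b)) fT.
have dc : differentiable (fun=> c : R) x by exact: differentiable_cst.
rewrite Dadd//; last exact: (differentiableM dc dS).
by rewrite Dmul// derive_cst mul0r add0r mulrDr mulrCA.
Qed.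

Lemma lform_fcons p (S : 'rV[R]_n -> cov R n p.+1) u : lform A S ->
  lform A (fun y f => S y (fcons u f)).
Proof.
move=> [mS aS sS]; split=> [y Ay|y Ay|v]; last exact: sS.
  exact: (contract_multilinear u (mS y Ay)).
exact: (contract_alternating u (aS y Ay)).
Qed.

(** Cartan's formula for the constant field u; it permits induction on the degree. *)
Lemma dx_cons p (S : 'rV[R]_n -> cov R n p.+1) u l : size l = p.+1 ->
  dx S x (vec (u :: l)) = 'D_u (fun y => S y (vec l)) x -
    dx (fun y f => S y (fcons u f)) x (vec l).
Proof.
move=> sl; rewrite dx_vec /= ?sl// (dx_vec _ _ sl) big_ord_recl expr0 mul1r; congr (_ + _).
  by rewrite /remn /= drop0.
rewrite -sumrN; apply: eq_bigr => a _.
have -> : nat_of_ord (lift ord0 a) = a.+1 by [].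
rewrite exprS mulN1r mulNr /=; congr (- (_ * _)).
have -> : (fun y => S y (vec (remn a.+1 (u :: l)))) =
    (fun y => S y (fcons u (vec (remn a l)))); last by [].
by apply/funext => y; rewrite fcons_vec.
Qed.

Lemma dx_swap p (S : 'rV[R]_n -> cov R n p.+1) u w l : lform A S -> size l = p ->
  dx S x (vec (u :: w :: l)) = - dx S x (vec (w :: u :: l)).
Proof.
move=> fS; case: p S fS => [|p] S fS sl.
  by case: l sl => // _; rewrite !dx1E opprB.
rewrite !dx_cons ?sl//; try by rewrite /= sl.
have fSu := lform_fcons u fS; have fSw := lform_fcons w fS.
under [in X in _ - (X - _) = _]eq_fun do rewrite fcons_vec.
under [in X in _ = - (_ - (X - _))]eq_fun do rewrite fcons_vec.
have [mS aS _] := fS.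
(* i_w i_u S = - i_u i_w S, written as a combination with a zero summand to fit the linearity lemma
   [dx_lin]. *)
have -> : dx (fun y f => S y (fcons u (fcons w f))) x (vec l) =
  dx (fun y f => -1 * S y (fcons w (fcons u f)) + 0 * S y (fcons w (fcons u f))) x (vec l).
  apply: (dx_eq_on _ oA Ax) => y Ay f; have [l' sl' ->] := vecP f.
  rewrite !fcons_vec mul0r addr0 mulN1r.
  by apply: (@alt_vec _ _ _ _ (mS y Ay) (aS y Ay) u w [::] l'); rewrite /= sl'.
have fwu := lform_fcons u (lform_fcons w fS).
have f0 : lform A (fun y f => 0 * S y (fcons w (fcons u f))).
  have [m1 a1 s1] := fwu; split=> [y Ay|y Ay|v].
  - by move=> v i d a b upd; rewrite !mul0r mulr0 addr0.
  - by move=> v i j _ _; rewrite mul0r.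
  - apply: (smooth_on_eq (f := fun=> 0)) => //; last exact: smooth_on_cst.
    by move=> y _; rewrite mul0r.
rewrite dx_lin//.
have -> : dx (fun y f => 0 * S y (fcons w (fcons u f))) x (vec l) = 0.
  rewrite /dx big1// => a _.
  rewrite (_ : (fun y => _) = fun=> 0) ?derive_cst ?mulr0 //.
  by apply/funext => y; rewrite mul0r.
move: ('D__ _ _) ('D__ _ _) (dx _ _ _) => a b d; ring.
Qed.

Lemma dx_swap2 p (S : 'rV[R]_n -> cov R n p.+2) u v w l : lform A S -> size l = p ->
  dx S x (vec (u :: v :: w :: l)) = - dx S x (vec (u :: w :: v :: l)).
Proof.
move=> fS sl; have [mS aS _] := fS.
have X a b : dx S x (vec [:: u, a, b & l]) = 'D_u (fun y => S y (vec [:: a, b & l])) x -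
    dx (fun y f => S y (fcons u f)) x (vec [:: a, b & l]) by rewrite dx_cons//= sl.
rewrite !X; have -> := dx_swap v w (lform_fcons u fS) sl.
rewrite (D_eq_on u oA Ax (g := fun y => - S y (vec (w :: v :: l)))); last first.
  by move=> y Ay; apply: (@alt_vec _ _ _ _ (mS y Ay) (aS y Ay) v w [::] l); rewrite /= sl.
by rewrite Dopp ?opprD//; exact: lform_diff fS.
Qed.

Lemma dx_multilinear p (S : 'rV[R]_n -> cov R n p) : lform A S -> multilinear (dx S x).
Proof.
elim: p S => [|p IH] S fS v i c u w upd.
  have E z : upd z = vec [:: z].
    by apply/funext => j; rewrite /upd /vec (ord1 i) (ord1 j).
  by rewrite !E !dx0E Dlin//; exact: lform_diff fS.
have H v' : dx S x v' = 'D_(v' ord0) (fun y => S y (fun b => v' (lift ord0 b))) x -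
    dx (fun y f => S y (fcons (v' ord0) f)) x (fun b => v' (lift ord0 b)).
  have [l sl ->] := vecP v'; case: l sl => [|a l] sl; first by [].
  case: sl => sl; rewrite dx_cons ?sl//.
rewrite !H.
(* A slot after the first is handled by induction on the contracted form; for the first slot,
   linearity of the derivative in its direction and of S in its first argument are used. *)
have [i' iE|iE] := unliftP ord0 i.
  have u0 z : upd z ord0 = v ord0 by rewrite /upd iE.
  have us z : (fun b => upd z (lift ord0 b)) =
      (fun b => if b == i' then z else v (lift ord0 b)).
    by apply/funext => b; rewrite /upd iE (inj_eq (@lift_inj _ ord0)).
  rewrite !u0 !us (IH _ (lform_fcons (v ord0) fS)).
  have [mS _ _] := fS.
  rewrite (D_eq_on _ oA Ax (g := fun y => c * S y (fun b => if b == i' then u else v (lift ord0 b))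
    + S y (fun b => if b == i' then w else v (lift ord0 b)))); last first.
    by move=> y Ay; exact: (mS y Ay).
  have dS z := lform_diff z fS; have dc : differentiable (fun=> c : R) x by exact: differentiable_cst.
  rewrite Dadd//; last exact: (differentiableM dc (dS _)).
  rewrite Dmul// derive_cst mul0r add0r.
  by move: ('D__ _ _) ('D__ _ _) (dx _ _ _) (dx _ _ _) => a b d e; ring.
have u0 z : upd z ord0 = z by rewrite /upd iE eqxx.
have us z : (fun b => upd z (lift ord0 b)) = fun b => v (lift ord0 b).
  by apply/funext => b; rewrite /upd iE.
rewrite !u0 !us.
have [l sl ->] := vecP (fun b => v (lift ord0 b)).
rewrite Dlin; last exact: lform_diff fS.
have [mS _ _] := fS.
have -> : dx (fun y f => S y (fcons (c *: u + w) f)) x (vec l) =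
    dx (fun y f => c * S y (fcons u f) + S y (fcons w f)) x (vec l).
  apply: (dx_eq_on _ oA Ax) => y Ay f; have [l' sl' ->] := vecP f.
  by rewrite !fcons_vec; apply: (@ml_vec _ _ _ _ (mS y Ay) c u w [::] l'); rewrite /= sl'.
rewrite dx_lin; try exact: lform_fcons.
rewrite /GRing.scale /=; move: ('D__ _ _) ('D__ _ _) (dx _ _ _) (dx _ _ _) => a b d e; ring.
Qed.

Lemma dx1_alternating (S : 'rV[R]_n -> cov R n 1) : alternating (dx S x).
Proof.
move=> v i j ij vij; have [l sl E] := vecP v; move: vij; rewrite E.
case: l sl {E v} => [|a [|b [|? ?]]] sl; try discriminate sl.
move=> vij; have ab : a = b.
  move: i j ij vij => [[|[|i]] Hi] [[|[|j]] Hj] //=.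
by rewrite ab dx1E subrr.
Qed.

Lemma dx_dx1 (S : 'rV[R]_n -> cov R n 1) u v w : lform A S ->
  dx (dx S) x (vec [:: u; v; w]) = 0.
Proof.
move=> [_ _ sS]; rewrite dx2E.
have E a b c : 'D_a (fun y => dx S y (vec [:: b; c])) x =
    'D_a ('D_b (fun y => S y (vec [:: c]))) x - 'D_a ('D_c (fun y => S y (vec [:: b]))) x.
  have -> : (fun y => dx S y (vec [:: b; c])) =
      fun y => 'D_b (fun y => S y (vec [:: c])) y + - 'D_c (fun y => S y (vec [:: b])) y.
    by apply/funext => y; rewrite dx1E.
  have dd e g : differentiable ('D_e (fun y => S y (vec [:: g]))) x.
    exact: smooth_on_diff (smooth_on_derive e (sS _)) Ax.
  by rewrite Dadd ?Dopp//; exact: differentiableN.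
have C a b c : 'D_a ('D_b (fun y => S y (vec [:: c]))) x = 'D_b ('D_a (fun y => S y (vec [:: c]))) x.
  by apply: (schwarz oA).
rewrite (E u v w) (E v u w) (E w u v) (C v u w) (C w u v) (C w v u).
by move: ('D_u _ _) ('D_u _ _) ('D_v _ _) => a b c; ring.
Qed.

End Algebra.
End LocalForms.

Section FormCalculus.
Variables (R : realType) (n : nat) (A : set 'rV[R]_n) (x : 'rV[R]_n).
Hypotheses (oA : open A) (Ax : A x).

Lemma D_multilinear p (S : 'rV[R]_n -> cov R n p) a : lform A S ->
  multilinear (fun f => 'D_a (fun y => S y f) x).
Proof.
move=> fS v i c u w upd; have [mS _ _] := fS.
rewrite (D_eq_on _ oA Ax (g := fun y => c * S y (upd u) + S y (upd w))); last first.
  by move=> y Ay; exact: (mS y Ay).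
have dS z := lform_diff Ax z fS.
have dc : differentiable (fun=> c : R) x by exact: differentiable_cst.
rewrite Dadd//; last exact: (differentiableM dc (dS _)).
by rewrite Dmul// derive_cst mul0r add0r.
Qed.

Lemma D_alternating p (S : 'rV[R]_n -> cov R n p) a : lform A S ->
  alternating (fun f => 'D_a (fun y => S y f) x).
Proof.
move=> [_ aS _] v i j ij vij.
rewrite (D_eq_on _ oA Ax (g := fun y => 0)) ?derive_cst// => y Ay.
exact: (aS y Ay _ _ _ ij vij).
Qed.

Lemma D_cwedge p q (S : 'rV[R]_n -> cov R n p) (T : 'rV[R]_n -> cov R n q) a f :
  lform A S -> lform A T ->
  'D_a (fun y => cwedge (S y) (T y) f) x =
  cwedge (fun g => 'D_a (fun y => S y g) x) (T x) f +
  cwedge (S x) (fun g => 'D_a (fun y => T y g) x) f.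
Proof.
move=> fS fT; have dS v := lform_diff Ax v fS; have dT v := lform_diff Ax v fT.
have dc (c : R) : differentiable (fun=> c) x by exact: differentiable_cst.
have dST (s : 'S_(p + q)) := differentiableM (dS (fun i => f (s (lshift q i))))
  (dT (fun j => f (s (rshift p j)))).
have dS1 (s : 'S_(p + q)) : predT s -> differentiable (fun y => (-1) ^+ s *
    (S y (fun i => f (s (lshift q i))) * T y (fun j => f (s (rshift p j))))) x.
  by move=> _; exact: (differentiableM (dc _) (dST s)).
have [d1 D1] := Dsum (index_enum 'S_(p + q)) a dS1.
rewrite /cwedge Dmul// D1 derive_cst mul0r add0r -mulrDr -big_split /=; congr (_ * _).
apply: eq_bigr => s _; rewrite Dmul//; last exact: dST.
by rewrite derive_cst mul0r add0r -mulrDr Dmul.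
Qed.

Lemma lform_wedge p q (S : 'rV[R]_n -> cov R n p) (T : 'rV[R]_n -> cov R n q) :
  lform A S -> lform A T -> lform A (fun y => cwedge (S y) (T y)).
Proof.
move=> [mS aS sS] [mT aT sT]; split=> [y Ay|y Ay|v].
- exact: (cwedge_multilinear (mS y Ay) (mT y Ay)).
- exact: cwedge_alternating.
- apply: smoothM => //; first exact: smooth_on_cst.
  apply: smooth_sum => // s _; apply: smoothM => //; first exact: smooth_on_cst.
  by apply: smoothM.
Qed.

Lemma lform_scale p (c : 'rV[R]_n -> R) (S : 'rV[R]_n -> cov R n p) :
  smooth_on A c -> lform A S -> lform A (fun y f => c y * S y f).
Proof.
move=> sc [mS aS sS]; split=> [y Ay v i d u w upd|y Ay v i j ij vij|v].
- by rewrite (mS y Ay v i d u w) mulrDr mulrCA.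
- by rewrite (aS y Ay v i j ij vij) mulr0.
- exact: smoothM.
Qed.

Lemma lform_add p (S T : 'rV[R]_n -> cov R n p) :
  lform A S -> lform A T -> lform A (fun y f => S y f + T y f).
Proof.
move=> [mS aS sS] [mT aT sT]; split=> [y Ay v i d u w upd|y Ay v i j ij vij|v].
- rewrite (mS y Ay v i d u w) (mT y Ay v i d u w); move: (S y _) (S y _) (T y _) (T y _).
  by move=> a b e g; ring.
- by rewrite (aS y Ay v i j ij vij) (aT y Ay v i j ij vij) addr0.
- exact: smoothD.
Qed.

Lemma lform_contract p (V : 'rV[R]_n -> 'rV[R]_n) (S : 'rV[R]_n -> cov R n p.+1) :
  smooth_on A V -> lform A S -> lform A (fun y => contract (V y) (S y)).
Proof.
move=> sV [mS aS sS]; split=> [y Ay|y Ay|v].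
- exact: (contract_multilinear _ (mS y Ay)).
- exact: (contract_alternating _ (aS y Ay)).
- have [l sl ->] := vecP v.
  apply: (smooth_on_eq (f := fun y => S y (vec (V y :: l)))) => //.
    by move=> y Ay; rewrite contract_vec.
  apply: (@smooth_slot _ _ _ _ oA (fun y e => S y (vec (e :: l)))) => // y Ay c u v'.
  by apply: (@ml_vec _ _ _ _ (mS y Ay) c u v' [::] l); rewrite /= sl.
Qed.

Lemma dx_scale p (c : 'rV[R]_n -> R) (S : 'rV[R]_n -> cov R n p) l :
  smooth_on A c -> lform A S -> size l = p.+1 ->
  dx (fun y f => c y * S y f) x (vec l) =
  cwedge (fun f : 'I_1 -> 'rV[R]_n => 'D_(f ord0) c x) (S x) (vec l) + c x * dx S x (vec l).
Proof.
move=> sc fS sl; have [mS aS _] := fS.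
rewrite [cwedge _ _ _]wedge1E//; try exact: mS; try exact: aS.
rewrite !dx_vec// mulr_sumr -big_split /=; apply: eq_bigr => a _.
rewrite Dmul; [|exact: smooth_on_diff sc Ax|exact: lform_diff fS].
rewrite mulrDr; congr (_ + _); last by rewrite mulrCA.
Qed.

Let mD p (S : 'rV[R]_n -> cov R n p) a (fS : lform A S) := D_multilinear a fS.
Let aD p (S : 'rV[R]_n -> cov R n p) a (fS : lform A S) := D_alternating a fS.

Lemma dx_wedge21 (S : 'rV[R]_n -> cov R n 2) (T : 'rV[R]_n -> cov R n 1) u v w z :
  lform A S -> lform A T -> (forall l, size l = 3%N -> dx S x (vec l) = 0) ->
  dx (fun y => cwedge (S y) (T y)) x (vec [:: u; v; w; z]) =
  cwedge (S x) (dx T x) (vec [:: u; v; w; z]).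
Proof.
move=> fS fT S0; pose F (a : 'rV[R]_n) l := 'D_a (fun y => S y (vec l)) x.
pose G (a : 'rV[R]_n) b := 'D_a (fun y => T y (vec [:: b])) x.
have [mS aS _] := fS; have [mT _ _] := fT; have mSx := mS x Ax; have aSx := aS x Ax.
(* Closedness of [S], solved for one derivative, so that what remains is an identity of
   polynomials. *)
have FE a b c : F a [:: b; c] = F b [:: a; c] - F c [:: a; b].
  apply/eqP; rewrite -subr_eq0 opprB addrA -addrA addrC -(S0 [:: a; b; c])//.
  by rewrite dx2E /F; apply/eqP; move: ('D_a _ _) ('D_b _ _) ('D_c _ _) => e g h; ring.
have E a b c d : 'D_a (fun y => cwedge (S y) (T y) (vec [:: b; c; d])) x =
  F a [:: b; c] * T x (vec [:: d]) - F a [:: b; d] * T x (vec [:: c])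
  + F a [:: c; d] * T x (vec [:: b]) + (S x (vec [:: b; c]) * G a d
  - S x (vec [:: b; d]) * G a c + S x (vec [:: c; d]) * G a b).
  rewrite (D_cwedge _ _ fS fT); congr (_ + _).
    exact: (wedge21 _ _ _ (mD a fS) (aD a fS) (mT x Ax)).
  exact: (wedge21 _ _ _ mSx aSx (mD a fT)).
have GE a b : dx T x (vec [:: a; b]) = G a b - G b a by exact: dx1E.
have mdT := dx_multilinear oA Ax fT; have adT := @dx1_alternating _ _ x T.
apply: etrans (dx3E _ _ _ _ _ _) _.
apply: etrans (f_equal4 (fun a b c d : R => a - b + c - d)
  (E u v w z) (E v u w z) (E w u v z) (E z u v w)) _.
apply: etrans _ (esym (wedge22 u v w z mSx aSx mdT adT)).
rewrite !GE (FE u v w) (FE u v z) (FE u w z) (FE v w z).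
clearbody F G; move: (T x) (S x) => t s.
move: (F w _) (F w _) (F w _) (F z _) (F z _) (F z _) (F v _) => a1 a2 a3 a4 a5 a6 a7.
move: (t _) (t _) (t _) (t _) => t1 t2 t3 t4.
move: (s _) (s _) (s _) (s _) (s _) (s _) => s1 s2 s3 s4 s5 s6.
ring.
Qed.

(** d(S ^ T) = dS ^ T - S ^ dT, the sign coming from the odd degree of S. The product dS ^ T is left
    expanded, since its terms are later discarded one by one. *)
Lemma dx_wedge31 (S : 'rV[R]_n -> cov R n 3) (T : 'rV[R]_n -> cov R n 1) u v w z e :
  lform A S -> lform A T ->
  dx (fun y => cwedge (S y) (T y)) x (vec [:: u; v; w; z; e]) =
  dx S x (vec [:: u; v; w; z]) * T x (vec [:: e]) - dx S x (vec [:: u; v; w; e]) * T x (vec [:: z])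
  + dx S x (vec [:: u; v; z; e]) * T x (vec [:: w]) - dx S x (vec [:: u; w; z; e]) * T x (vec [:: v])
  + dx S x (vec [:: v; w; z; e]) * T x (vec [:: u]) - cwedge (S x) (dx T x) (vec [:: u; v; w; z; e]).
Proof.
move=> fS fT; pose F (a : 'rV[R]_n) l := 'D_a (fun y => S y (vec l)) x.
pose G (a : 'rV[R]_n) b := 'D_a (fun y => T y (vec [:: b])) x.
have [mS aS _] := fS; have [mT _ _] := fT; have mSx := mS x Ax; have aSx := aS x Ax.
have E a b c d k : 'D_a (fun y => cwedge (S y) (T y) (vec [:: b; c; d; k])) x =
  F a [:: b; c; d] * T x (vec [:: k]) - F a [:: b; c; k] * T x (vec [:: d])
  + F a [:: b; d; k] * T x (vec [:: c]) - F a [:: c; d; k] * T x (vec [:: b])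
  + (S x (vec [:: b; c; d]) * G a k - S x (vec [:: b; c; k]) * G a d
  + S x (vec [:: b; d; k]) * G a c - S x (vec [:: c; d; k]) * G a b).
  rewrite (D_cwedge _ _ fS fT); congr (_ + _).
    exact: (wedge31 _ _ _ _ (mD a fS) (aD a fS) (mT x Ax)).
  exact: (wedge31 _ _ _ _ mSx aSx (mD a fT)).
have GE a b : dx T x (vec [:: a; b]) = G a b - G b a by exact: dx1E.
have FE a b c d : dx S x (vec [:: a; b; c; d]) =
  F a [:: b; c; d] - F b [:: a; c; d] + F c [:: a; b; d] - F d [:: a; b; c] by exact: dx3E.
have mdT := dx_multilinear oA Ax fT; have adT := @dx1_alternating _ _ x T.
have f5 a a' b b' c c' d d' k k' : a = a' -> b = b' -> c = c' -> d = d' -> k = k' ->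
  a - b + c - d + k = a' - b' + c' - d' + k' :> R by move=> -> -> -> -> ->.
apply: etrans (dx4E _ _ _ _ _ _ _) _.
apply: etrans (f5 _ _ _ _ _ _ _ _ _ _ (E u v w z e) (E v u w z e) (E w u v z e)
  (E z u v w e) (E e u v w z)) _.
rewrite !FE (wedge32 u v w z e mSx aSx mdT adT) !GE.
clearbody F G; move: (T x) (S x) => t s.
move: (F u [:: v; w; z]) (F u [:: v; w; e]) (F u [:: v; z; e]) (F u [:: w; z; e]) (F v [:: u; w; z]) => a0 a1 a2 a3 a4.
move: (F v [:: u; w; e]) (F v [:: u; z; e]) (F v [:: w; z; e]) (F w [:: u; v; z]) (F w [:: u; v; e]) => a5 a6 a7 a8 a9.
move: (F w [:: u; z; e]) (F w [:: v; z; e]) (F z [:: u; v; w]) (F z [:: u; v; e]) (F z [:: u; w; e]) => a10 a11 a12 a13 a14.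
move: (F z [:: v; w; e]) (F e [:: u; v; w]) (F e [:: u; v; z]) (F e [:: u; w; z]) (F e [:: v; w; z]) => a15 a16 a17 a18 a19.
move: (t _) (t _) (t _) (t _) (t _) => t1 t2 t3 t4 t5.
move: (s _) (s _) (s _) (s _) (s _) => s1 s2 s3 s4 s5.
move: (s _) (s _) (s _) (s _) (s _) => s6 s7 s8 s9 s10.
ring.
Qed.

Lemma dx_wedge22_closed (S : 'rV[R]_n -> cov R n 2) u v w z e :
  lform A S -> (forall l, size l = 3%N -> dx S x (vec l) = 0) ->
  dx (fun y => cwedge (S y) (S y)) x (vec [:: u; v; w; z; e]) = 0.
Proof.
move=> fS S0; pose F (a : 'rV[R]_n) l := 'D_a (fun y => S y (vec l)) x.
have [mS aS _] := fS; have mSx := mS x Ax; have aSx := aS x Ax.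
have FE a b c : F a [:: b; c] = F b [:: a; c] - F c [:: a; b].
  apply/eqP; rewrite -subr_eq0 opprB addrA -addrA addrC -(S0 [:: a; b; c])//.
  by rewrite dx2E /F; apply/eqP; move: ('D_a _ _) ('D_b _ _) ('D_c _ _) => k g h; ring.
have E a b c d k : 'D_a (fun y => cwedge (S y) (S y) (vec [:: b; c; d; k])) x =
  (F a [:: b; c] * S x (vec [:: d; k]) - F a [:: b; d] * S x (vec [:: c; k])
  + F a [:: b; k] * S x (vec [:: c; d]) + F a [:: c; d] * S x (vec [:: b; k])
  - F a [:: c; k] * S x (vec [:: b; d]) + F a [:: d; k] * S x (vec [:: b; c])) *+ 2.
  rewrite (D_cwedge _ _ fS fS) mulr2n.
  pose s l := S x (vec l).
  have E1 : cwedge (fun g => 'D_a (fun y => S y g) x) (S x) (vec [:: b; c; d; k]) =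
    F a [:: b; c] * s [:: d; k] - F a [:: b; d] * s [:: c; k] + F a [:: b; k] * s [:: c; d]
    + F a [:: c; d] * s [:: b; k] - F a [:: c; k] * s [:: b; d] + F a [:: d; k] * s [:: b; c].
    exact: (wedge22 b c d k (mD a fS) (aD a fS) mSx aSx).
  have E2 : cwedge (S x) (fun g => 'D_a (fun y => S y g) x) (vec [:: b; c; d; k]) =
    s [:: b; c] * F a [:: d; k] - s [:: b; d] * F a [:: c; k] + s [:: b; k] * F a [:: c; d]
    + s [:: c; d] * F a [:: b; k] - s [:: c; k] * F a [:: b; d] + s [:: d; k] * F a [:: b; c].
    exact: (wedge22 b c d k mSx aSx (mD a fS) (aD a fS)).
  apply: etrans (f_equal2 (fun a b : R => a + b) E1 E2) _.
  rewrite -!/(s _); clear E1 E2; move: (F a) s => f s.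
  move: (f _) (f _) (f _) (f _) (f _) (f _) => f1 f2 f3 f4 f5 f6.
  move: (s _) (s _) (s _) (s _) (s _) (s _) => s1 s2 s3 s4 s5 s6; ring.
have f5 a a' b b' c c' d d' k k' : a = a' -> b = b' -> c = c' -> d = d' -> k = k' ->
  a - b + c - d + k = a' - b' + c' - d' + k' :> R by move=> -> -> -> -> ->.
apply: etrans (dx4E _ _ _ _ _ _ _) _.
apply: etrans (f5 _ _ _ _ _ _ _ _ _ _ (E u v w z e) (E v u w z e) (E w u v z e)
  (E z u v w e) (E e u v w z)) _.
rewrite (FE u v w) (FE u v z) (FE u v e) (FE u w z) (FE u w e) (FE u z e) (FE v w z) (FE v w e) (FE v z e) (FE w z e).
clearbody F; move: (S x) => s.
move: (F v [:: u; w]) (F w [:: u; v]) (F v [:: u; z]) (F z [:: u; v]) (F v [:: u; e]) => a0 a1 a2 a3 a4.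
move: (F e [:: u; v]) (F w [:: u; z]) (F z [:: u; w]) (F w [:: u; e]) (F e [:: u; w]) => a5 a6 a7 a8 a9.
move: (F z [:: u; e]) (F e [:: u; z]) (F w [:: v; z]) (F z [:: v; w]) (F w [:: v; e]) => a10 a11 a12 a13 a14.
move: (F e [:: v; w]) (F z [:: v; e]) (F e [:: v; z]) (F z [:: w; e]) (F e [:: w; z]) => a15 a16 a17 a18 a19.
move: (s _) (s _) (s _) (s _) (s _) => s1 s2 s3 s4 s5.
move: (s _) (s _) (s _) (s _) (s _) => s6 s7 s8 s9 s10.
ring.
Qed.

Lemma Dslot_form p (S : 'rV[R]_n -> cov R n p.+1) (V : 'rV[R]_n -> 'rV[R]_n) a l :
  lform A S -> differentiable V x -> size l = p ->
  'D_a (fun y => S y (vec (V y :: l))) x =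
  'D_a (fun y => S y (vec (V x :: l))) x + S x (vec ('D_a V x :: l)).
Proof.
move=> fS dV sl; have [mS _ _] := fS.
apply: (proj2 (@Dslot _ _ _ A oA (fun y e => S y (vec (e :: l))) V _ x a Ax _ dV)).
  by move=> y Ay c u v; apply: (@ml_vec _ _ _ _ (mS y Ay) c u v [::] l); rewrite /= sl.
by move=> e; exact: lform_diff fS.
Qed.

Lemma cartan p (S : 'rV[R]_n -> cov R n p.+1) (V : 'rV[R]_n -> 'rV[R]_n) l :
  lform A S -> differentiable V x -> size l = p.+1 ->
  'D_(V x) (fun y => S y (vec l)) x +
    \sum_(a < p.+1) (-1) ^+ a * S x (vec ('D_(nth 0 l a) V x :: remn a l)) =
  dx S x (vec (V x :: l)) + dx (fun y => contract (V y) (S y)) x (vec l).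
Proof.
move=> fS dV sl; rewrite dx_cons// -addrA; congr (_ + _).
rewrite !dx_vec// addrC -sumrB; apply: eq_bigr => a _; rewrite -mulrBr; congr (_ * _).
have sr : size (remn a l) = p by rewrite size_remn ?sl.
have -> : (fun y => contract (V y) (S y) (vec (remn a l))) =
    (fun y => S y (vec (V y :: remn a l))) by apply/funext => y; rewrite contract_vec.
have -> : (fun y => S y (fcons (V x) (vec (remn a l)))) =
    (fun y => S y (vec (V x :: remn a l))) by apply/funext => y; rewrite fcons_vec.
by rewrite (Dslot_form (nth 0 l a) fS dV sr) addrAC subrr add0r.
Qed.

Lemma cartan2 (S : 'rV[R]_n -> cov R n 2) (V : 'rV[R]_n -> 'rV[R]_n) (v : 'I_2 -> 'rV[R]_n) :
  lform A S -> differentiable V x ->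
  'D_(V x) (fun y => S y v) x +
    \sum_(a < 2) S x (fun b => if b == a then 'D_(v a) V x else v b) =
  dx S x (fcons (V x) v) + dx (fun y => contract (V y) (S y)) x v.
Proof.
move=> fS dV; have [l sl ->] := vecP v; rewrite fcons_vec -cartan//; congr (_ + _).
case: l sl => [|a [|b [|? ?]]] sl; try discriminate sl.
rewrite !big_ord_recr !big_ord0 /= !add0r expr0 expr1 mul1r mulN1r /remn /=.
have [mS aS _] := fS; congr (_ + _).
  congr (S x); apply/funext => i; rewrite /vec.
  by case: i => [[|[|i]] Hi].
rewrite (alt2 a ('D_b V x) (mS x Ax) (aS x Ax)) opprK.
congr (S x); apply/funext => i; rewrite /vec.
by case: i => [[|[|i]] Hi].
Qed.

Lemma cartan3 (S : 'rV[R]_n -> cov R n 3) (V : 'rV[R]_n -> 'rV[R]_n) (v : 'I_3 -> 'rV[R]_n) :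
  lform A S -> differentiable V x ->
  'D_(V x) (fun y => S y v) x +
    \sum_(a < 3) S x (fun b => if b == a then 'D_(v a) V x else v b) =
  dx S x (fcons (V x) v) + dx (fun y => contract (V y) (S y)) x v.
Proof.
move=> fS dV; have [l sl ->] := vecP v; rewrite fcons_vec -cartan//; congr (_ + _).
case: l sl => [|a [|b [|c [|? ?]]]] sl; try discriminate sl.
rewrite !big_ord_recr !big_ord0 /= !add0r expr0 expr1 mul1r mulN1r /remn /=.
rewrite expr2 mulrNN mulr1 mul1r.
have [mS aS _] := fS; congr (_ + _ + _).
- by congr (S x); apply/funext => i; rewrite /vec; case: i => [[|[|[|i]]] Hi].
- have [_ <- _ _ _] := alt3 ('D_b V x) a c (mS x Ax) (aS x Ax).
  by congr (S x); apply/funext => i; rewrite /vec; case: i => [[|[|[|i]]] Hi].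
have [_ _ <- _ _] := alt3 ('D_c V x) a b (mS x Ax) (aS x Ax).
by congr (S x); apply/funext => i; rewrite /vec; case: i => [[|[|[|i]]] Hi].
Qed.

End FormCalculus.

(** * Integrability and the differential of a form of type (q+2,0) *)

Section TypeLemma.
Variables (R : realType) (n : nat) (A : set 'rV[R]_n) (x : 'rV[R]_n).
Hypotheses (oA : open A) (Ax : A x).
Variable J : 'rV[R]_n -> 'rV[R]_n -> 'rV[R]_n.
Hypotheses (sJ : forall v, smooth_on A (fun y => J y v)).
Hypotheses (lJ : forall (c : R) u w, J x (c *: u + w) = c *: J x u + J x w).
Hypotheses (JJ : forall u, J x (J x u) = - u) (nJ : forall u w, nijenhuis J x u w = 0).
Variables (q : nat) (S : bool -> 'rV[R]_n -> cov R n q.+2).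
Hypothesis fS : forall s, lform A (S s).
Hypothesis SJ : forall s y, A y -> forall u l, size l = q.+1 -> S s y (vec (J y u :: l)) =
  if s then S false y (vec (u :: l)) else - S true y (vec (u :: l)).

Let K (a u : 'rV[R]_n) : 'rV[R]_n := 'D_a (fun y => J y u) x.
Let P s (a : 'rV[R]_n) l : R := 'D_a (fun y => S s y (vec l)) x.

(** The vanishing of the Nijenhuis tensor on constant fields, in terms of the derivative [K] of
    [J]. *)
Let JK u w : J x (K u w - K w u) = K (J x u) w - K (J x w) u.
Proof.
have JN (v : 'rV[R]_n) : J x (- v) = - J x v.
  have J0 : J x 0 = 0.
    have := lJ (-1) 0 0; rewrite scaler0 addr0 => /eqP.
    by rewrite scaleN1r addNr => /eqP.
  by have := lJ (-1) v 0; rewrite !addr0 !scaleN1r J0 addr0.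
have := nJ u w; rewrite /nijenhuis /bracket !derive_cst !subr0 sub0r -!/(K _ _).
have JD (v v' : 'rV[R]_n) : J x (v + v') = J x v + J x v'.
  by have := lJ 1 v v'; rewrite !scale1r.
rewrite JD !JN opprK => /eqP; rewrite subr_eq0 => /eqP <-.
by rewrite addrK.
Qed.

Let PJ s a u l : size l = q.+1 -> P s a (J x u :: l) =
  (if s then P false a (u :: l) else - P true a (u :: l)) - S s x (vec (K a u :: l)).
Proof.
move=> sl; apply/eqP; rewrite eq_sym subr_eq eq_sym; apply/eqP.
rewrite /P -(Dslot_form oA Ax a (fS s) (smooth_on_diff (sJ u) Ax) sl).
rewrite (D_eq_on a oA Ax (fun y Ay => SJ s Ay u sl)).
by case: s => //; rewrite Dopp//; exact: (lform_diff Ax _ (fS _)).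
Qed.

Let dx2 s u w l : size l = q.+1 -> dx (S s) x (vec (u :: w :: l)) =
  P s u (w :: l) - P s w (u :: l) +
  \sum_(k < q.+1) (-1) ^+ k * P s (nth 0 l k) (u :: w :: remn k l).
Proof.
move=> sl; rewrite dx_cons/= ?sl// dx_cons// opprB addrA addrAC; congr (_ - _ + _).
  by rewrite /P; congr ('D_w _ x); apply/funext => y; rewrite fcons_vec.
rewrite dx_vec//; apply: eq_bigr => k _; congr (_ * _).
by rewrite /P; congr ('D_ _ _ x); apply/funext => y; rewrite !fcons_vec.
Qed.

(** For Psi = S false + i S true this is the real part of d Psi(u + i J u, w + i J w, ...) = 0: with
    [J] integrable, the differential of a form killed by (0,1)-vectors has no part with two such
    arguments. *)
Lemma type_identity u w l : size l = q.+1 ->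
  dx (S false) x (vec (u :: w :: l)) - dx (S false) x (vec (J x u :: J x w :: l)) -
  dx (S true) x (vec (J x u :: w :: l)) - dx (S true) x (vec (u :: J x w :: l)) = 0.
Proof.
move=> sl; rewrite !dx2//.
rewrite !(PJ _ _ _ sl).
(* The terms differentiated along an entry of [l] cancel by the type of the forms alone;
   integrability is spent on the remaining ones. *)
have sum0 : \sum_(k < q.+1) (-1) ^+ k * P false (nth 0 l k) (u :: w :: remn k l) -
  \sum_(k < q.+1) (-1) ^+ k * P false (nth 0 l k) (J x u :: J x w :: remn k l) -
  \sum_(k < q.+1) (-1) ^+ k * P true (nth 0 l k) (J x u :: w :: remn k l) -
  \sum_(k < q.+1) (-1) ^+ k * P true (nth 0 l k) (u :: J x w :: remn k l) = 0.
  rewrite -!sumrB big1// => k _; rewrite -!mulrBr.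
  have sr : size (remn k l) = q by rewrite size_remn ?sl.
  have sr1 e : size (e :: remn k l) = q.+1 by rewrite /= sr.
  rewrite !(PJ _ _ _ (sr1 _)).
  have [mf af _] := fS false; have [mt aT _] := fS true.
  have E1 a b := @alt_vec _ _ _ _ (mf x Ax) (af x Ax) a b [::] (remn k l).
  have E2 a b := @alt_vec _ _ _ _ (mt x Ax) (aT x Ax) a b [::] (remn k l).
  have -> : S false x (vec [:: K (nth 0 l k) u, J x w & remn k l]) =
      - S true x (vec [:: K (nth 0 l k) u, w & remn k l]).
    rewrite E1 /= ?sr// (SJ _ Ax _ (sr1 _)) opprK E2//= ?sr//.
  move: (P _ _ _) (P _ _ _) (S _ _ _) => a b c; ring.
have E : S false x (vec (K (J x u) w - K (J x w) u :: l)) = - S true x (vec (K u w - K w u :: l)).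
  by rewrite -JK (SJ _ Ax _ sl).
have [mf _ _] := fS false; have [mt _ _] := fS true.
have EB s v v' : S s x (vec (v - v' :: l)) = S s x (vec (v :: l)) - S s x (vec (v' :: l)).
  have [ms _ _] := fS s.
  rewrite (@ml_vecD _ _ _ _ (ms x Ax) v (- v') [::] l) /= ?sl//.
  by rewrite (@ml_vecN _ _ _ _ (ms x Ax) v' [::] l) /= ?sl.
rewrite !EB in E; move: sum0 E.
move: (\sum_(k < _) _) (\sum_(k < _) _) (\sum_(k < _) _) (\sum_(k < _) _).
move: (P _ _ _) (P _ _ _) (P _ _ _) (P _ _ _).
move: (S false x _) (S false x _) (S true x _) (S true x _).
by move=> a1 a2 a3 a4 a5 a6 a7 a8 a9 a10 a11 a12; lra.
Qed.

End TypeLemma.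

Section TypeVanish.
Variables (R : realType) (n : nat) (A : set 'rV[R]_n) (x : 'rV[R]_n).
Hypotheses (oA : open A) (Ax : A x).
Variable J : 'rV[R]_n -> 'rV[R]_n -> 'rV[R]_n.
Hypotheses (sJ : forall v, smooth_on A (fun y => J y v)).
Hypotheses (lJ : forall (c : R) u w, J x (c *: u + w) = c *: J x u + J x w).
Hypotheses (JJ : forall u, J x (J x u) = - u) (nJ : forall u w, nijenhuis J x u w = 0).
Variables (q : nat) (S : bool -> 'rV[R]_n -> cov R n q.+2).
Hypothesis fS : forall s, lform A (S s).
Hypothesis SJ : forall s y, A y -> forall u l, size l = q.+1 -> S s y (vec (J y u :: l)) =
  if s then S false y (vec (u :: l)) else - S true y (vec (u :: l)).

(* If one differential vanishes, the other one, [g], satisfies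
   [g (J u, w, ..) = - g (u, J w, ..)]; moving [J] once around three slots
   gives [g = - g]. *)
Lemma type_vanish b : (forall l, size l = q.+3 -> dx (S b) x (vec l) = 0) ->
  forall l, size l = q.+3 -> dx (S (~~ b)) x (vec l) = 0.
Proof.
move=> S0; have T := type_identity oA Ax sJ lJ nJ fS SJ.
have ml s := dx_multilinear oA Ax (fS s).
have N1 s u l : size l = q.+2 -> dx (S s) x (vec (- u :: l)) = - dx (S s) x (vec (u :: l)).
  by move=> sl; apply: (@ml_vecN _ _ _ _ (ml s) u [::] l); rewrite /= sl.
have N2 s u w l : size l = q.+1 ->
    dx (S s) x (vec (u :: - w :: l)) = - dx (S s) x (vec (u :: w :: l)).
  by move=> sl; apply: (@ml_vecN _ _ _ _ (ml s) w [:: u] l); rewrite /= sl.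
pose g l := dx (S (~~ b)) x (vec l).
have gJ u w l : size l = q.+1 -> g (J x u :: w :: l) = - g (u :: J x w :: l).
  move=> sl; have := T u (J x w) l sl; rewrite JJ !N2//; have := T u w l sl.
  rewrite /g {g}; case: b S0 => /= S0; rewrite !S0 /= ?sl//.
    by move: (dx _ _ _) (dx _ _ _) (dx _ _ _) (dx _ _ _) => a1 a2 a3 a4; lra.
  by move: (dx _ _ _) (dx _ _ _) (dx _ _ _) (dx _ _ _) => a1 a2 a3 a4; lra.
have gc a e c l : size l = q -> g (a :: e :: c :: l) = g (e :: c :: a :: l).
  move=> sl; rewrite /g (dx_swap oA Ax a e (fS _)) /= ?sl//.
  by rewrite (dx_swap2 oA Ax e a c (fS _)) /= ?sl// opprK.
have g0 a e c l : size l = q -> g (J x a :: e :: c :: l) = 0.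
  move=> sl; have s1 u : size (u :: l) = q.+1 by rewrite /= sl.
  have E1 := gJ a e (c :: l) (s1 _).
  have E2 : g (a :: J x e :: c :: l) = - g (a :: e :: J x c :: l).
    by rewrite (gc a (J x e) c l sl) (gJ e c _ (s1 _)) (gc a e (J x c) l sl).
  have E3 : g (a :: e :: J x c :: l) = - g (J x a :: e :: c :: l).
    by rewrite -(gc (J x c) a e l sl) (gJ c a _ (s1 _)) (gc c (J x a) e l sl).
  by move: E1 E2 E3; move: (g _) (g _) (g _) => a1 a2 a3; lra.
move=> [|a [|e [|c l]]] //= [] sl.
have := g0 (J x a) e c l sl; rewrite JJ /g N1 /= ?sl// => /eqP.
by rewrite oppr_eq0 => /eqP.
Qed.

End TypeVanish.

(** * Lefschetz injectivity of the product with the Kähler form *)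

Section SymplecticWedge.
Variables (R : realType) (sg : cov R 6 2) (E : nat -> 'rV[R]_6).
Hypotheses (fE : frame 6 E) (tsg : has_table 6 E sg 1 sgT).
Hypotheses (msg : multilinear sg) (asg : alternating sg).

Let sE i j : (i < 6)%N -> (j < 6)%N -> sg (vec [:: E i; E j]) = (sgT [:: i; j])%:~R.
Proof. by move=> i6 j6; rewrite -[vec _]/(vec (map E [:: i; j])) tsg ?mul1r// tuplesP /= i6 j6. Qed.

(** To read the value on E_i, evaluate the product on E_i and a pair (E_2k, E_2k+1) not containing
    it. *)
Lemma sg_wedge_inj1 (g : cov R 6 1) : multilinear g ->
  (forall u v w, cwedge sg g (vec [:: u; v; w]) = 0) -> forall f, g f = 0.
Proof.
move=> mg H; apply: (multilinear_frame0 fE mg) => -[|i [|? ?]]; rewrite tuplesP //= andbT => i6.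
have W a b (c : nat) : (a < 6)%N -> (b < 6)%N -> sgT [:: a; b] = 1 -> sgT [:: a; c] = 0 ->
    sgT [:: b; c] = 0 -> (c < 6)%N -> g (vec [:: E c]) = 0.
  move=> a6 b6 ab ac bc c6; have := H (E a) (E b) (E c).
  by rewrite wedge21// !sE// ab ac bc !mul0r mul1r subr0 addr0.
move: i6; do 6?[case: i => [|i]] => // _; first [by refine (@W 0%N 1%N _ _ _ _ _ _ _)
  |by refine (@W 2 3 _ _ _ _ _ _ _)].
Qed.

(** A component with indices in two different pairs is read off by adding the third pair. For the
    values on the three pairs, the product gives that any two sum to zero, so all vanish. *)
Lemma sg_wedge_inj2 (g : cov R 6 2) : multilinear g -> alternating g ->
  (forall u v w z, cwedge sg g (vec [:: u; v; w; z]) = 0) -> forall f, g f = 0.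
Proof.
move=> mg ag H; apply: (alternating_frame0 fE mg ag) => -[|i [|j [|? ?]]]; rewrite tuplesP //=.
have W a b c d := H (E a) (E b) (E c) (E d).
have W1 a b c d : (a < 6)%N -> (b < 6)%N -> (c < 6)%N -> (d < 6)%N ->
    [&& a./2 == b./2, (a < b)%N, a./2 != c./2, a./2 != d./2 & c./2 != d./2] ->
    g (vec [:: E c; E d]) = 0.
  move=> a6 b6 c6 d6 /and5P[/eqP ab lab ac ad cd]; have := W a b c d.
  rewrite wedge22// !sE// /sgT -!ab eqxx lab (negbTE ac) (negbTE ad) (negbTE cd).
  by rewrite !mul0r mul1r !addr0 !subr0.
have W2 a c : (a < 6)%N -> (c < 6)%N -> (a.+1 < 6)%N -> (c.+1 < 6)%N ->
    [&& a./2 == a.+1./2, c./2 == c.+1./2 & a./2 != c./2] ->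
    g (vec [:: E c; E c.+1]) + g (vec [:: E a; E a.+1]) = 0.
  move=> a6 c6 a7 c7 /and3P[/eqP aa /eqP cc ac]; have := W a a.+1 c c.+1.
  rewrite wedge22// !sE// /sgT -!aa -!cc !eqxx !ltnSn (negbTE ac).
  by rewrite !mul0r !mul1r !addr0 !subr0.
have Z0 : g (vec [:: E 0%N; E 1%N]) = 0 /\ g (vec [:: E 2; E 3]) = 0 /\ g (vec [:: E 4; E 5]) = 0.
  have := W2 0%N 2%N isT isT isT isT isT; have := W2 0%N 4%N isT isT isT isT isT.
  have := W2 2%N 4%N isT isT isT isT isT; move: (g _) (g _) (g _) => a b c; lra.
have [Z1 [Z2 Z3]] := Z0; rewrite andbT => /andP[i6 j6]; rewrite andbT => ij.
move: i6 j6 ij; do 6?[case: i => [|i]] => //; do 6?[case: j => [|j]] => // _ _ _;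
  first [exact: Z1|exact: Z2|exact: Z3|by refine (@W1 0%N 1%N _ _ _ _ _ _ _)
    |by refine (@W1 2 3 _ _ _ _ _ _ _)|by refine (@W1 4 5 _ _ _ _ _ _ _)].
Qed.

End SymplecticWedge.

Lemma cwedge_scalel (R : realType) n p q (a : cov R n p) (b : cov R n q) (c : R) f :
  cwedge (fun g => c * a g) b f = c * cwedge a b f.
Proof.
rewrite /cwedge [RHS]mulrCA; congr (_ * _); rewrite mulr_sumr; apply: eq_bigr => s _.
by rewrite -mulrA mulrCA.
Qed.

Lemma cwedge_scaler (R : realType) n p q (a : cov R n p) (b : cov R n q) (c : R) f :
  cwedge a (fun g => c * b g) f = c * cwedge a b f.
Proof.
rewrite /cwedge [RHS]mulrCA; congr (_ * _); rewrite mulr_sumr; apply: eq_bigr => s _.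
by rewrite !(mulrCA _ c).
Qed.

(** * The Kähler SU(3) structure in one chart, with the Hamiltonian field *)

Section LocalStructure.
Variables (R : realType) (P : set 'rV[R]_6).
Hypothesis oP : open P.
Variables (J : 'rV[R]_6 -> 'rV[R]_6 -> 'rV[R]_6) (sg : 'rV[R]_6 -> cov R 6 2).
Variables (psi : bool -> 'rV[R]_6 -> cov R 6 3) (t : 'rV[R]_6 -> R).

(** What the local arguments use of the structure in a chart; the compatibility with the metric
    enters through the adapted frames. *)
Record su3_local : Prop := Su3Local {
  sl_sJ : forall v, smooth_on P (fun y => J y v);
  sl_lJ : forall x, P x -> forall (c : R) u w, J x (c *: u + w) = c *: J x u + J x w;
  sl_JJ : forall x, P x -> forall u, J x (J x u) = - u;
  sl_nJ : forall x, P x -> forall u w, nijenhuis J x u w = 0;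
  sl_sg : lform P sg;
  sl_dsg : forall x, P x -> forall l, size l = 3%N -> dx sg x (vec l) = 0;
  sl_psi : forall s, lform P (psi s);
  sl_psiJ : forall s y, P y -> forall u l, size l = 2%N -> psi s y (vec (J y u :: l)) =
    if s then psi false y (vec (u :: l)) else - psi true y (vec (u :: l));
  sl_frame : forall x, P x -> exists E, adapted (J x) (sg x) (fun s => psi s x) E;
  sl_t : smooth_on P t;
  sl_t0 : forall x, P x -> 0 < t x }.

Hypothesis H : su3_local.

Definition dfn (x : 'rV[R]_6) : cov R 6 1 := fun v => 'D_(v ord0) t x.
(** These are the forms Psi^+ and Psi^- of the quotient construction. *)
Definition psi' s : 'rV[R]_6 -> cov R 6 3 := fun x f => t x `^ (1 / 2) * psi s x f.

Let st12 : smooth_on P (fun x => t x `^ (1 / 2)).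
Proof. by apply: smooth_pow => //; [exact: sl_t0 H|exact: sl_t H]. Qed.

Lemma lform_psi' s : lform P (psi' s).
Proof. exact: (lform_scale oP st12 (sl_psi H s)). Qed.

Let dft x : P x -> differentiable t x.
Proof. exact: (smooth_on_diff (sl_t H)). Qed.

Lemma D_pow (a : R) x v : P x -> 'D_v (fun y => t y `^ a) x = a * t x `^ (a - 1) * 'D_v t x.
Proof.
move=> Px; have [d D] := is_derive_powR a (sl_t0 H Px).
rewrite (@Dcomp _ _ _ _ (fun y : R => y `^ a) t x v (dft Px) d) D.
by rewrite mulrC.
Qed.

Lemma pow_half x : P x -> [/\ 0 < t x `^ (1 / 2), t x `^ (1 / 2) * t x `^ (1 / 2) = t x
  & t x `^ (1 / 2 - 1) * t x = t x `^ (1 / 2)].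
Proof.
move=> Px; have tx := sl_t0 H Px; split; first exact: powR_gt0.
  by rewrite -powRD; [rewrite (_ : 1 / 2 + 1 / 2 = 1) ?powRr1 ?ltW//; lra|rewrite gt_eqF ?implybT].
rewrite -{2}(powRr1 (ltW tx)) -powRD; last by rewrite (gt_eqF tx) implybT.
by congr (_ `^ _); lra.
Qed.

Variable U : 'rV[R]_6 -> 'rV[R]_6.
Hypothesis sU : smooth_on P U.
Hypothesis hU : forall x, P x -> forall v, contract (U x) (sg x) v = - dfn x v.

Section AtPoint.
Variable x : 'rV[R]_6.
Hypothesis Px : P x.

Let msg : multilinear (sg x). Proof. by have [m _ _] := sl_sg H; exact: m. Qed.
Let asg : alternating (sg x). Proof. by have [_ a _] := sl_sg H; exact: a. Qed.
Let mpsi s : multilinear (psi s x). Proof. by have [m _ _] := sl_psi H s; exact: m. Qed.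
Let apsi s : alternating (psi s x). Proof. by have [_ a _] := sl_psi H s; exact: a. Qed.
Let dU : differentiable U x. Proof. exact: smooth_on_diff sU Px. Qed.

Let hUe : contract (U x) (sg x) = fun v => - 1 * dfn x v.
Proof. by apply/funext => v; rewrite hU// mulN1r. Qed.

Let wU q (b : cov R 6 q) f : cwedge (contract (U x) (sg x)) b f = - cwedge (dfn x) b f.
Proof.
by rewrite hUe cwedge_scalel mulN1r.
Qed.

(** The coefficient 1/2 of condition (i) is the exponent of t in the rescaling. *)
Lemma dx_psi' s l : size l = 4%N -> dx (psi' s) x (vec l) =
  t x `^ (1 / 2) * (dx (psi s) x (vec l) + 1 / 2 * (t x)^-1 * cwedge (dfn x) (psi s x) (vec l)).
Proof.
move=> sl; rewrite (dx_scale Px st12 (sl_psi H s) sl).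
have -> : (fun f : 'I_1 -> 'rV[R]_6 => 'D_(f ord0) (fun y => t y `^ (1 / 2)) x) =
    fun f => (1 / 2 * t x `^ (1 / 2 - 1)) * dfn x f.
  by apply/funext => f; rewrite (D_pow _ _ Px).
have [_ _ <-] := pow_half Px; rewrite cwedge_scalel.
have := sl_t0 H Px; move: (t x) (t x `^ _) (dx _ _ _) (cwedge _ _ _) => a b c d a0.
by field; rewrite gt_eqF.
Qed.

(* The form [dcl] is [d^c log t]. *)
Lemma dc_log_wedge (dcl : cov R 6 1) s f :
  (forall v, dcl v = - 'D_(J x (v ord0)) (fun y => ln (t y)) x) ->
  cwedge dcl (psi (~~ s) x) f = (if s then - 1 else 1) * ((t x)^-1 * cwedge (dfn x) (psi s x) f).
Proof.
move=> dclE; have tx := sl_t0 H Px; have [E adE] := sl_frame H Px.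
have Dln v : 'D_v (fun y => ln (t y)) x = (t x)^-1 * 'D_v t x.
  have dl := is_derive1_ln tx; have dln : differentiable (@ln R) (t x).
    by apply/derivable1_diffP; exact: ex_derive.
  rewrite (@Dcomp _ _ _ _ (@ln R) t x v (dft Px) dln).
  have E1 (c : R) : 'D_c (@ln R) (t x) = c * 'D_1 (@ln R) (t x).
    rewrite -(@DZr R R (@ln R) (t x) c 1 dln); congr ('D_ _ _ _).
    by rewrite /GRing.scale /= mulr1.
  by rewrite E1 derive_val mulrC.
have -> : dcl = fun v => - (t x)^-1 * (- contract (U x) (sg x) (fun i => J x (v i))).
  by apply/funext => v; rewrite dclE Dln hU// /dfn opprK mulNr.
rewrite cwedge_scalel.
case: s => /=.
  rewrite (J_wedge_psp adE msg mpsi apsi (sl_lJ H Px)) wU.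
  by move: (_^-1) (cwedge _ _ _) => a b; ring.
rewrite (J_wedge_psm adE msg mpsi apsi (sl_lJ H Px)) wU.
by move: (_^-1) (cwedge _ _ _) => a b; ring.
Qed.

Lemma D_U_t : 'D_(U x) t x = 0.
Proof.
have := hU Px (vec [:: U x]); rewrite contract_vec /dfn => /eqP.
rewrite (@alt_vec0 _ _ _ _ msg asg (U x) [::] [::])// eq_sym oppr_eq0 => /eqP.
exact.
Qed.

(** Hamiltonian fields preserve a symplectic form: by Cartan's formula, what remains is the
    differential of - dt. *)
Lemma lie_sg v : 'D_(U x) (fun y => sg y v) x +
  \sum_(a < 2) sg x (fun b => if b == a then 'D_(v a) U x else v b) = 0.
Proof.
rewrite (cartan2 oP Px _ (sl_sg H) dU); have [l sl ->] := vecP v.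
rewrite fcons_vec (sl_dsg H Px) ?add0r /= ?sl//.
case: l sl => [|a [|b [|? ?]]] sl; try discriminate sl.
rewrite (@dx_eq_on _ _ _ P _ (fun y f => - dfn y f)) //.
rewrite dx1E /dfn /=.
have E (c : 'rV[R]_6) : (fun y => - 'D_(vec [:: c] ord0) t y) = fun y => - 'D_c t y by [].
have dd c : differentiable ('D_c t) x by exact: smooth_on_diff (smooth_on_derive c (sl_t H)) Px.
apply: etrans (f_equal2 (fun a b => a - b) (Dopp a (dd b)) (Dopp b (dd a))) _.
by rewrite (schwarz oP (sl_t H) a b Px) opprK addNr.
Qed.

(** [U] annihilates [t], so the factor t^(1/2) passes through the Lie derivative; Cartan's formula
    for the closed form psi' leaves only the differential of its contraction. *)
Lemma lie_psi s v : (forall l, size l = 4%N -> dx (psi' s) x (vec l) = 0) ->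
  t x `^ (1 / 2) * ('D_(U x) (fun y => psi s y v) x +
    \sum_(a < 3) psi s x (fun b => if b == a then 'D_(v a) U x else v b)) =
  dx (fun y => contract (U y) (psi' s y)) x v.
Proof.
move=> d0; have := cartan3 oP Px v (lform_psi' s) dU.
have -> : dx (psi' s) x (fcons (U x) v) = 0.
  by have [l sl ->] := vecP v; rewrite fcons_vec d0//= sl.
rewrite add0r => <-; rewrite mulrDr mulr_sumr; congr (_ + _).
rewrite /psi' Dmul; [|exact: smooth_on_diff st12 Px|by apply: (lform_diff Px); exact: sl_psi].
by rewrite (D_pow _ _ Px) D_U_t mulr0 mul0r add0r.
Qed.

Lemma psi'J s y u l : P y -> size l = 2%N -> psi' s y (vec (J y u :: l)) =
  if s then psi' false y (vec (u :: l)) else - psi' true y (vec (u :: l)).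
Proof. by move=> Py sl; rewrite /psi' (sl_psiJ H)//; case: s => //; rewrite mulrN. Qed.

Lemma dpsi'_type b : (forall l, size l = 4%N -> dx (psi' b) x (vec l) = 0) ->
  forall l, size l = 4%N -> dx (psi' (~~ b)) x (vec l) = 0.
Proof.
apply: (type_vanish oP Px (sl_sJ H) (sl_lJ H Px) (sl_JJ H Px) (sl_nJ H Px) lform_psi').
by move=> s y Py u l sl; exact: psi'J.
Qed.

(** Contraction with [U] preserves the behaviour under [J], up to two exchanges of arguments, so the
    type argument applies to these 2-forms as well. *)
Lemma dUpsi'_type b :
  (forall l, size l = 3%N -> dx (fun y => contract (U y) (psi' b y)) x (vec l) = 0) ->
  forall l, size l = 3%N -> dx (fun y => contract (U y) (psi' (~~ b) y)) x (vec l) = 0.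
Proof.
apply: (@type_vanish _ _ P x oP Px J (sl_sJ H) (sl_lJ H Px) (sl_JJ H Px) (sl_nJ H Px) 0
  (fun b y => contract (U y) (psi' b y))).
  by move=> s; exact: (lform_contract oP sU (lform_psi' s)).
move=> s y Py u l sl; rewrite !contract_vec; have [m a _] := lform_psi' s.
have sw s' v w : psi' s' y (vec [:: v, w & l]) = - psi' s' y (vec [:: w, v & l]).
  have [m' a' _] := lform_psi' s'.
  by apply: (@alt_vec _ _ _ _ (m' y Py) (a' y Py) v w [::] l); rewrite /= sl.
rewrite sw psi'J//= ?sl//; case: s {m a} => //=; first by rewrite -sw.
Qed.

Let t12 := t x `^ (1 / 2).

Lemma sg_wedge_omega f : cwedge (sg x) (contract (U x) (psi' false x)) f = cwedge (dfn x) (psi' false x) f.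
Proof.
have [E adE] := sl_frame H Px.
rewrite [LHS]cwedge_scaler [RHS]cwedge_scaler.
by rewrite (sg_wedge_contract adE msg mpsi apsi) wU mulN1r opprK.
Qed.

Lemma psm_wedge_omega f : cwedge (psi' true x) (contract (U x) (psi' false x)) f =
  - (t x * cwedge (dfn x) (cwedge (sg x) (sg x)) f).
Proof.
have [E adE] := sl_frame H Px.
rewrite [LHS]cwedge_scaler [X in _ * X]cwedge_scalel.
rewrite (psm_wedge_contract adE msg asg mpsi apsi) wU.
have [_ E2 _] := pow_half Px; rewrite -[in RHS]E2.
move: (_ `^ _) (cwedge _ _ _) => a b; ring.
Qed.

End AtPoint.
End LocalStructure.

Lemma pull_cwedge (R : realType) n m p q (f : 'rV[R]_n -> 'rV[R]_m)
    (a : 'rV[R]_m -> cov R m p) (b : 'rV[R]_m -> cov R m q) x v :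
  pull f (fun y => cwedge (a y) (b y)) x v = cwedge (pull f a x) (pull f b x) v.
Proof. by []. Qed.

Lemma lform_pull (R : realType) n m p (A : set 'rV[R]_n) (B : set 'rV[R]_m)
    (f : 'rV[R]_n -> 'rV[R]_m) (S : 'rV[R]_m -> cov R m p) :
  open A -> open B -> smooth_on A f -> (forall x, A x -> B (f x)) -> lform B S -> lform A (pull f S).
Proof.
move=> oA oB sf AB [mS aS sS]; split=> [x Ax v i c u w upd|x Ax v i j ij vij|v].
- have df := smooth_on_diff sf Ax.
  have E z : (fun a => 'D_(upd z a) f x) = fun a => if a == i then 'D_z f x else 'D_(v a) f x.
    by apply/funext => a; rewrite /upd; case: ifP.
  by rewrite /pull !E (Dlin _ _ _ df) (mS _ (AB _ Ax)).
- by apply: (aS _ (AB _ Ax) _ i j ij); rewrite vij.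
have -> : (fun x => pull f S x v) =
    fun x => S (f x) (vec [seq 'D_(v i) f x | i <- enum 'I_p]).
  apply/funext => x; rewrite /pull; congr (S _ _).
  by rewrite [LHS]vec_eta.
(* The arguments D f(v_i) are freed one at a time: those in [w] are constant, those from [l2] still
   move with the point. *)
suff H (l1 l2 : seq 'rV[R]_n) (w : seq 'rV[R]_m) : (size w + size l2 = p)%N ->
    smooth_on A (fun x => S (f x) (vec (w ++ [seq 'D_u f x | u <- l2]))).
  have := H [::] [seq v i | i <- enum 'I_p] [::]; rewrite size_map size_enum_ord.
  move=> /(_ erefl); congr smooth_on; apply/funext => x /=.
  by rewrite -map_comp.
elim: l2 w => [|u l2 IH] w; rewrite ?addn0 => sw.
  by rewrite /= cats0; exact: (@smooth_comp R n A oA m B (fun y => S y (vec w)) f (sS _) sf AB).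
apply: (@smooth_slot _ _ _ _ oA (fun x e => S (f x) (vec (w ++ e :: [seq 'D_u f x | u <- l2])))).
- move=> y Ay c a b; apply: (@ml_vec _ _ _ _ (mS _ (AB _ Ay)) c a b).
  by rewrite size_cat /= size_map.
- move=> e; have := IH (rcons w e); rewrite size_rcons addSn -addnS => /(_ sw).
  by congr smooth_on; apply/funext => x; rewrite cat_rcons.
exact: smooth_on_derive.
Qed.

(** * From the equations on the total space to those on the base, and back *)

Section Descent.
Variables (R : realType) (O : set 'rV[R]_7) (P : set 'rV[R]_6) (f : 'rV[R]_7 -> 'rV[R]_6).
Hypotheses (oO : open O) (oP : open P) (sf : smooth_on O f) (OP : forall x, O x -> P (f x)).
Variables (J : 'rV[R]_6 -> 'rV[R]_6 -> 'rV[R]_6) (sg : 'rV[R]_6 -> cov R 6 2).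
Variables (psi : bool -> 'rV[R]_6 -> cov R 6 3) (t : 'rV[R]_6 -> R).
Hypothesis H : su3_local P J sg psi t.
Variable U : 'rV[R]_6 -> 'rV[R]_6.
Hypothesis sU : smooth_on P U.
Hypothesis hU : forall x, P x -> forall v, contract (U x) (sg x) v = - dfn t x v.
Variable eta : 'rV[R]_7 -> cov R 7 1.
Hypothesis feta : lform O eta.
Variables (phi : 'rV[R]_7 -> cov R 7 3) (sphi : 'rV[R]_7 -> cov R 7 4).
Local Notation psi' := (psi' psi t).
Definition omega : 'rV[R]_6 -> cov R 6 2 := fun y => contract (U y) (psi' false y).
Local Notation tpsi := (fun y g => t y * psi' false y g).
Local Notation tsg2 := (fun y g => (1 / 2 * (t y * t y)) * cwedge (sg y) (sg y) g).
Hypothesis phiE : forall x, O x -> forall v,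
  phi x v = cwedge (pull f sg x) (eta x) v + pull f tpsi x v.
Hypothesis sphiE : forall x, O x -> forall v,
  sphi x v = cwedge (pull f (psi' true) x) (eta x) v + pull f tsg2 x v.

Let fsg : lform P sg := sl_sg H.
Let fpsi s : lform P (psi' s) := lform_psi' oP H s.
Let st : smooth_on P t := sl_t H.
Let fY : lform O (pull f sg) := lform_pull oO oP sf OP fsg.
Let fpY s : lform O (pull f (psi' s)) := lform_pull oO oP sf OP (fpsi s).
Let ftpsi : lform P tpsi := lform_scale oP st (fpsi false).
Let ft2 : smooth_on P (fun y => 1 / 2 * (t y * t y)).
Proof. by do ?apply: smoothM => //; exact: smooth_on_cst. Qed.
Let fsg2 : lform P (fun y => cwedge (sg y) (sg y)) := lform_wedge oP fsg fsg.
Let ftsg2 : lform P tsg2 := lform_scale oP ft2 fsg2.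
Let fomega : lform P omega := lform_contract oP sU (fpsi false).

Section At.
Variable x : 'rV[R]_7.
Hypothesis Ox : O x.
Let Px : P (f x) := OP Ox.

Let dsgY l : size l = 3%N -> dx (pull f sg) x (vec l) = 0.
Proof.
move=> sl; rewrite (dx_pull2 oO sf OP Ox fsg sl) pull_vec// (sl_dsg H Px)//.
by rewrite size_map.
Qed.

Lemma dx_tpsi l : size l = 4%N -> dx tpsi (f x) (vec l) =
  cwedge (dfn t (f x)) (psi' false (f x)) (vec l) + t (f x) * dx (psi' false) (f x) (vec l).
Proof. by move=> sl; exact: (dx_scale Px st (fpsi false) sl). Qed.

Lemma dx_tsg2 l : size l = 5%N -> dx tsg2 (f x) (vec l) =
  t (f x) * cwedge (dfn t (f x)) (cwedge (sg (f x)) (sg (f x))) (vec l).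
Proof.
move=> sl; rewrite (dx_scale Px ft2 fsg2 sl).
have -> : dx (fun y => cwedge (sg y) (sg y)) (f x) (vec l) = 0.
  case: l sl => [|a [|b [|c [|d [|e [|? ?]]]]]] sl; try discriminate sl.
  exact: (dx_wedge22_closed oP Px a b c d e fsg (sl_dsg H Px)).
rewrite mulr0 addr0 -cwedge_scalel; congr (cwedge _ _ _); apply/funext => g.
have dt : differentiable t (f x) by exact: smooth_on_diff st Px.
rewrite Dmul; [|exact: differentiable_cst|exact: differentiableM].
rewrite derive_cst mul0r add0r Dmul// /dfn; move: (t _) ('D__ _ _) => a b; by field.
Qed.

Lemma dx_phi u v w z : dx phi x (vec [:: u; v; w; z]) =
  cwedge (pull f sg x) (dx eta x) (vec [:: u; v; w; z]) +
  dx tpsi (f x) (vec [:: 'D_u f x; 'D_v f x; 'D_w f x; 'D_z f x]).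
Proof.
rewrite (dx_eq_on _ oO Ox (T := fun y g => 1 * cwedge (pull f sg y) (eta y) g + pull f tpsi y g)).
  rewrite (dx_lin Ox _ _ (lform_wedge oO fY feta) (lform_pull oO oP sf OP ftpsi)) mul1r.
  congr (_ + _); first exact: (dx_wedge21 oO Ox u v w z fY feta dsgY).
  by rewrite (dx_pull3 oO sf OP Ox ftpsi)// pull_vec.
by move=> y Oy g; rewrite phiE// mul1r.
Qed.

(** Naturality in degree 4 for this one form: both sides reduce to t dt ^ sg ^ sg, because sg and
    its pullback are closed. *)
Lemma dx_pull4_tsg2 l : size l = 5%N -> dx (pull f tsg2) x (vec l) = pull f (dx tsg2) x (vec l).
Proof.
move=> sl; rewrite pull_vec// dx_tsg2 ?size_map//.
have sft : smooth_on O (fun y => 1 / 2 * (t (f y) * t (f y))).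
  exact: (@smooth_comp R 7 O oO 6 P (fun y => 1 / 2 * (t y * t y)) f ft2 sf OP).
have E : forall y g, pull f tsg2 y g =
    (1 / 2 * (t (f y) * t (f y))) * cwedge (pull f sg y) (pull f sg y) g by [].
rewrite (@dx_scale _ _ O x Ox _ _ (fun y => cwedge (pull f sg y) (pull f sg y)) l sft
  (lform_wedge oO fY fY) sl).
have -> : dx (fun y => cwedge (pull f sg y) (pull f sg y)) x (vec l) = 0.
  case: l sl => [|a [|b [|c [|d [|e [|? ?]]]]]] sl; try discriminate sl.
  exact: (dx_wedge22_closed oO Ox a b c d e fY dsgY).
rewrite mulr0 addr0.
have dt : differentiable t (f x) by exact: smooth_on_diff st Px.
have df : differentiable f x by exact: smooth_on_diff sf Ox.
have dtf : differentiable (fun y => t (f y)) x by exact: (differentiable_comp df dt).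
have -> : (fun g : 'I_1 -> 'rV[R]_7 => 'D_(g ord0) (fun y => 1 / 2 * (t (f y) * t (f y))) x) =
    fun g => t (f x) * pull f (dfn t) x g.
  apply/funext => g; rewrite Dmul; [|exact: differentiable_cst|exact: differentiableM].
  rewrite derive_cst mul0r add0r Dmul// (Dcomp _ df dt) /pull /dfn.
  by move: (t _) ('D__ _ _) => a b; by field.
by rewrite cwedge_scalel -[RHS](pull_vec f (fun y h => t y * cwedge (dfn t y) (cwedge (sg y) (sg y)) h)).
Qed.

Lemma dx_sphi u v w z e : dx sphi x (vec [:: u; v; w; z; e]) =
  pull f (dx (psi' true)) x (vec [:: u; v; w; z]) * eta x (vec [:: e])
  - pull f (dx (psi' true)) x (vec [:: u; v; w; e]) * eta x (vec [:: z])
  + pull f (dx (psi' true)) x (vec [:: u; v; z; e]) * eta x (vec [:: w])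
  - pull f (dx (psi' true)) x (vec [:: u; w; z; e]) * eta x (vec [:: v])
  + pull f (dx (psi' true)) x (vec [:: v; w; z; e]) * eta x (vec [:: u])
  - cwedge (pull f (psi' true) x) (dx eta x) (vec [:: u; v; w; z; e])
  + dx tsg2 (f x) (vec [:: 'D_u f x; 'D_v f x; 'D_w f x; 'D_z f x; 'D_e f x]).
Proof.
rewrite (dx_eq_on _ oO Ox (T := fun y g => 1 * cwedge (pull f (psi' true) y) (eta y) g + pull f tsg2 y g)).
  rewrite (dx_lin Ox _ _ (lform_wedge oO (fpY true) feta) (lform_pull oO oP sf OP ftsg2)) mul1r.
  have P3 a b c d := dx_pull3 oO sf OP Ox (fpsi true) (l := [:: a; b; c; d]) erefl.
  congr (_ + _).
    apply: etrans (dx_wedge31 oO Ox u v w z e (fpY true) feta) _.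
    by rewrite (P3 u v w z) (P3 u v w e) (P3 u v z e) (P3 u w z e) (P3 v w z e).
  apply: etrans (dx_pull4_tsg2 (l := [:: u; v; w; z; e]) erefl) _.
  exact: pull_vec.
by move=> y Oy g; apply: etrans (sphiE Oy g) _; congr (_ + _); rewrite mul1r.
Qed.

Lemma closed_of_potential : (forall s l, size l = 4%N -> dx (psi' s) (f x) (vec l) = 0) ->
  (forall v, dx eta x v = - pull f omega x v) ->
  (forall l, size l = 4%N -> dx phi x (vec l) = 0) /\ (forall l, size l = 5%N -> dx sphi x (vec l) = 0).
Proof.
move=> d0 dE; have dEf : dx eta x = fun v => -1 * pull f omega x v.
  by apply/funext => v; rewrite dE mulN1r.
split=> l sl.
  case: l sl => [|u [|v [|w [|z [|? ?]]]]] sl; try discriminate sl.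
  rewrite dx_phi dEf cwedge_scaler -[cwedge _ _ _](pull_cwedge f sg omega) pull_vec//.
  rewrite dx_tpsi// (d0 false)// mulr0 addr0 /omega (sg_wedge_omega H hU Px).
  by rewrite mulN1r addNr.
case: l sl => [|u [|v [|w [|z [|e [|? ?]]]]]] sl; try discriminate sl.
have P0 a b c d : pull f (dx (psi' true)) x (vec [:: a; b; c; d]) = 0.
  by rewrite (@pull_vec _ _ _ _ f (dx (psi' true)) x [:: a; b; c; d] erefl) d0.
apply: etrans (dx_sphi u v w z e) _.
rewrite (P0 u v w z) (P0 u v w e) (P0 u v z e) (P0 u w z e) (P0 v w z e).
have -> : cwedge (pull f (psi' true) x) (dx eta x) (vec [:: u; v; w; z; e]) =
    t (f x) * cwedge (dfn t (f x)) (cwedge (sg (f x)) (sg (f x)))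
      (vec [:: 'D_u f x; 'D_v f x; 'D_w f x; 'D_z f x; 'D_e f x]).
  rewrite dEf cwedge_scaler.
  have Q := @pull_vec _ _ _ _ f (fun y => cwedge (psi' true y) (omega y)) x [:: u; v; w; z; e] erefl.
  rewrite -[cwedge _ _ _](pull_cwedge f (psi' true) omega); apply: etrans (congr1 _ Q) _.
  have E := psm_wedge_omega H hU Px (vec [:: 'D_u f x; 'D_v f x; 'D_w f x; 'D_z f x; 'D_e f x]).
  apply: etrans (congr1 (fun a : R => -1 * a) E) _.
  by rewrite mulN1r opprK.
rewrite (dx_tsg2 (l := [:: 'D_u f x; 'D_v f x; 'D_w f x; 'D_z f x; 'D_e f x]) erefl).
by rewrite !mul0r !subr0 !addr0 sub0r addNr.
Qed.

Variable V : 'rV[R]_7.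
Hypotheses (DV : 'D_V f x = 0) (etaV : eta x (vec [:: V]) = 1).
Hypothesis Dsurj : forall w, exists v, 'D_v f x = w.
Hypothesis Dker : forall u, 'D_u f x = 0 -> exists c, u = c *: V.
Hypotheses (dphi0 : forall l, size l = 4%N -> dx phi x (vec l) = 0).
Hypotheses (dsphi0 : forall l, size l = 5%N -> dx sphi x (vec l) = 0).

Let df : differentiable f x. Proof. exact: smooth_on_diff sf Ox. Qed.

(** A linear right inverse of the differential of [f], chosen on the standard basis; it lifts
    vectors of the base. *)
Let section : exists s : 'rV[R]_6 -> 'rV[R]_7,
  (forall (c : R) u v, s (c *: u + v) = c *: s u + s v) /\ forall u, 'D_(s u) f x = u.
Proof.
have [e eE] := choice Dsurj.
exists (fun u => \sum_j u ord0 j *: e 'e_j); split=> [c u v|u].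
  rewrite scaler_sumr -big_split /=; apply: eq_bigr => j _.
  by rewrite !mxE scalerDl scalerA.
by rewrite Dlinsum// [RHS]rV_delta; apply: eq_bigr => j _; rewrite eE.
Qed.

Let mdeta : multilinear (dx eta x) := dx_multilinear oO Ox feta.
Let adeta : alternating (dx eta x) := @dx1_alternating _ _ x eta.

Let msgx : multilinear (sg (f x)). Proof. by have [m _ _] := fsg; exact: m. Qed.
Let asgx : alternating (sg (f x)). Proof. by have [_ a _] := fsg; exact: a. Qed.

Let zero_slot p (a : cov R 6 p) l1 l2 : multilinear a -> size (l1 ++ 0 :: l2) = p ->
  a (vec (l1 ++ 0 :: l2)) = 0 := fun ma => @ml_vec0 _ _ _ _ ma l1 l2.

Let pullV p (a : 'rV[R]_6 -> cov R 6 p) l : multilinear (a (f x)) -> (size l).+1 = p ->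
  pull f a x (vec (rcons l V)) = 0.
Proof.
move=> ma sl; rewrite pull_vec ?size_rcons// map_rcons DV -cats1.
by apply: zero_slot => //; rewrite size_cat /= size_map addn1.
Qed.

(** On three lifts and [V], d phi = 0 says that sg ^ g = 0 for the 1-form g = d eta(s ., V): every
    pulled-back form with the argument [V] vanishes. Each vector differs from a lift by a multiple
    of [V]. *)
Lemma iota_deta u : dx eta x (vec [:: u; V]) = 0.
Proof.
have [s [ls Ds]] := section; have [E adE] := sl_frame H Px.
pose g : cov R 6 1 := fun v => dx eta x (vec [:: s (v ord0); V]).
have mg : multilinear g.
  move=> v i c a b upd; rewrite /g /upd (ord1 i) eqxx ls.
  exact: (@ml_vec _ _ _ _ mdeta c (s a) (s b) [::] [:: V]).
have mtp : multilinear (dx tpsi (f x)) by exact: (dx_multilinear oP Px ftpsi).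
have g0 : forall v, g v = 0.
  apply: (sg_wedge_inj1 (ad_frame adE) (ad_sg adE) msgx asgx mg) => a b c.
  have := dphi0 (l := [:: s a; s b; s c; V]) erefl; rewrite dx_phi DV.
  rewrite (@ml_vec0 _ _ _ _ mtp [:: 'D_(s a) f x; 'D_(s b) f x; 'D_(s c) f x] [::])// addr0.
  have [mY aY _] := fY; rewrite wedge22 ?mY ?aY//; try exact: mY; try exact: aY.
  rewrite wedge21// /g !pull_vec//= !DV !Ds.
  rewrite !(@ml_vec0 _ _ _ _ msgx [:: _] [::])// !mul0r.
  by move: (sg _ _) (sg _ _) (sg _ _) (dx _ _ _) (dx _ _ _) (dx _ _ _) => a1 a2 a3 b1 b2 b3 <-; ring.
have [c uE] : exists c, u - s ('D_u f x) = c *: V.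
  by apply: Dker; rewrite -scaleN1r addrC Dlin// Ds scaleN1r addNr.
have -> : u = 1 *: s ('D_u f x) + c *: V by rewrite -uE scale1r addrC subrK.
rewrite (@ml_vec _ _ _ _ mdeta 1 _ _ [::] [:: V])// (@ml_vecZ _ _ _ _ mdeta c V [::] [:: V])//.
rewrite (@alt_vec0 _ _ _ _ mdeta adeta V [::] [::])// mulr0 addr0 mul1r.
exact: (g0 (vec [:: 'D_u f x])).
Qed.

(** On four lifts and [V], all terms of d *phi vanish through the argument [V] or through i_V d eta
    = 0, except d psi'^- times eta(V) = 1. *)
Lemma dpsim0 l : size l = 4%N -> dx (psi' true) (f x) (vec l) = 0.
Proof.
have [s [ls Ds]] := section.
case: l => [|a [|b [|c [|d [|? ?]]]]] sl; try discriminate sl.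
have mp : multilinear (dx (psi' true) (f x)) by exact: (dx_multilinear oP Px (fpsi true)).
have mt2 : multilinear (dx tsg2 (f x)) by exact: (dx_multilinear oP Px ftsg2).
have := dsphi0 (l := [:: s a; s b; s c; s d; V]) erefl; rewrite dx_sphi etaV.
rewrite (@pullV 4 (dx (psi' true)) [:: s a; s b; s c] mp)//.
rewrite (@pullV 4 (dx (psi' true)) [:: s a; s b; s d] mp)//.
rewrite (@pullV 4 (dx (psi' true)) [:: s a; s c; s d] mp)//.
rewrite (@pullV 4 (dx (psi' true)) [:: s b; s c; s d] mp)//.
rewrite DV (@ml_vec0 _ _ _ _ mt2 [:: 'D_(s a) f x; 'D_(s b) f x; 'D_(s c) f x; 'D_(s d) f x] [::])//.
have [mY aY _] := fpY true; have [mq _ _] := fpsi true.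
rewrite (wedge32 _ _ _ _ _ (mY x Ox) (aY x Ox) mdeta adeta) !iota_deta.
rewrite (@pullV 3 (psi' true) [:: s a; s b] (mq _ Px))//.
rewrite (@pullV 3 (psi' true) [:: s a; s c] (mq _ Px))//.
rewrite (@pullV 3 (psi' true) [:: s a; s d] (mq _ Px))//.
rewrite (@pullV 3 (psi' true) [:: s b; s c] (mq _ Px))//.
rewrite (@pullV 3 (psi' true) [:: s b; s d] (mq _ Px))//.
rewrite (@pullV 3 (psi' true) [:: s c; s d] (mq _ Px))//.
by rewrite !mulr0 !mul0r !addr0 !subr0 mulr1 pull_vec//= !Ds.
Qed.

Lemma dpsi0 s l : size l = 4%N -> dx (psi' s) (f x) (vec l) = 0.
Proof.
case: s; first exact: dpsim0.
exact: (@dpsi'_type _ _ oP _ _ _ _ H _ Px true dpsim0).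
Qed.

(** On four lifts d phi = 0 reads sg ^ g = 0 for the 2-form g = d eta(s ., s .) + omega, so g = 0;
    the [V] components of the arguments do not contribute, by [iota_deta]. *)
Lemma deta_omega u v : dx eta x (vec [:: u; v]) = - pull f omega x (vec [:: u; v]).
Proof.
have [s [ls Ds]] := section; have [E adE] := sl_frame H Px.
have [mo ao _] := fomega.
pose g : cov R 6 2 := fun v => dx eta x (fun i => s (v i)) + omega (f x) v.
have gE a b : g (vec [:: a; b]) = dx eta x (vec [:: s a; s b]) + omega (f x) (vec [:: a; b]).
  by congr (dx _ _ _ + _); apply/funext => -[[|[|i]] Hi].
have mg : multilinear g.
  move=> w i c a b upd; have Es z : (fun k => s (upd z k)) =
      fun k => if k == i then s z else s (w k).
    by apply/funext => k; rewrite /upd; case: ifP.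
  rewrite /g !Es ls (mo _ Px w i c a b) mdeta.
  by move: (dx _ _ _) (dx _ _ _) (omega _ _) (omega _ _) => a1 a2 a3 a4; ring.
have ag : alternating g.
  move=> w i j ij wij; rewrite /g (ao _ Px w i j ij wij) addr0.
  exact: (@adeta (fun k => s (w k)) i j ij (congr1 s wij)).
have g0 : forall v, g v = 0.
  apply: (sg_wedge_inj2 (ad_frame adE) (ad_sg adE) msgx asgx mg ag) => a b c d.
  have := dphi0 (l := [:: s a; s b; s c; s d]) erefl.
  rewrite dx_phi !Ds dx_tpsi// (dpsi0 false)// mulr0 addr0.
  rewrite -(sg_wedge_omega H hU Px) -/(omega (f x)).
  have [mY aY _] := fY.
  rewrite (wedge22 _ _ _ _ (mY x Ox) (aY x Ox) mdeta adeta) (wedge22 _ _ _ _ msgx asgx mg ag).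
  rewrite (wedge22 _ _ _ _ msgx asgx (mo _ Px) (ao _ Px)) !gE !pull_vec//= !Ds.
  by move=> E0; rewrite -[RHS]E0; ring.
have dec w : exists c, w = c *: V + s ('D_w f x).
  have [c wE] : exists c, w - s ('D_w f x) = c *: V.
    by apply: Dker; rewrite -scaleN1r addrC Dlin// Ds scaleN1r addNr.
  by exists c; rewrite -wE subrK.
have Vl w : dx eta x (vec [:: V; w]) = 0 by rewrite (alt2 w V mdeta adeta) iota_deta oppr0.
have [c uE] := dec u; have [d vE] := dec v.
rewrite {1}uE {1}vE (@ml_vec _ _ _ _ mdeta c V _ [::] [:: _])// Vl mulr0 add0r.
rewrite (@ml_vec _ _ _ _ mdeta d V _ [:: _] [::])// iota_deta mulr0 add0r pull_vec//.
by apply/eqP; rewrite -addr_eq0 -gE g0.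
Qed.

End At.

(** The pullback of omega is - d eta, hence closed, and surjectivity of the differential of [f]
    transfers this to the base. *)
Lemma domega0 x l : O x -> (forall w, exists v, 'D_v f x = w) ->
  (forall y, O y -> forall u v, dx eta y (vec [:: u; v]) = - pull f omega y (vec [:: u; v])) ->
  size l = 3%N -> dx omega (f x) (vec l) = 0.
Proof.
move=> Ox sj dE; case: l => [|a [|b [|c [|? ?]]]] sl; try discriminate sl.
have [a' <-] := sj a; have [b' <-] := sj b; have [c' <-] := sj c.
rewrite -[LHS](pull_vec f (dx omega) x (l := [:: a'; b'; c']))//.
rewrite -(dx_pull2 oO sf OP Ox fomega)//.
have := dx_dx1 oO Ox a' b' c' feta => E.
rewrite (dx_eq_on _ oO Ox (T := fun y g => -1 * dx eta y g + 0 * pull f omega y g)); last first.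
  move=> y Oy g; have [l sg' ->] := vecP g.
  case: l sg' => [|u [|v [|? ?]]] sg'; try discriminate sg'.
  by rewrite dE// mul0r addr0 mulN1r opprK.
have fd : lform O (dx eta).
  split=> [y Oy|y Oy|v]; [exact: (dx_multilinear oO Oy feta)|exact: dx1_alternating|].
  have [_ _ se] := feta; apply: smooth_sum => // k _; apply: smoothM => //.
    exact: smooth_on_cst.
  exact: smooth_on_derive.
have fo := lform_pull oO oP sf OP fomega.
have f0 : lform O (fun y g => 0 * pull f omega y g) by exact: (lform_scale oO (smooth_on_cst (0 : R)) fo).
rewrite (dx_lin Ox _ _ fd f0) E mulr0 add0r.
rewrite /dx big1// => k _; rewrite (_ : (fun y => _) = fun=> 0) ?derive_cst ?mulr0//.
by apply/funext => y; rewrite mul0r.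
Qed.

End Descent.

(** * Charts and transition maps *)

Section Charts.
Variables (R : realType) (n : nat) (M : manifold R n).

Lemma chart_img_open i (D : set M) : open D -> open (@chart_img R n M i D).
Proof.
move=> oD; rewrite openE => _ [p [pi Dp] <-].
have h1 : nbhs (mcrd i p) (@mcrd R n M i @` mdom i).
  by apply: open_nbhs_nbhs; split; [exact: mimg_open|exists p].
have h2 : nbhs (mcrd i p) (mpar M i @^-1` D).
  by apply: mpar_continuous => //; rewrite mcrdK//; exact: open_nbhs_nbhs.
apply: filterS (filterI h1 h2) => _ [[q qi <-] /= Dq].
by exists q => //; split => //; rewrite mcrdK in Dq.
Qed.

Lemma chart_imgP i (D : set M) x : @chart_img R n M i D x ->
  [/\ mdom i (mpar M i x), D (mpar M i x) & mcrd i (mpar M i x) = x].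
Proof. by case=> p [pi Dp] <-; rewrite mcrdK. Qed.

Lemma chart_img_in i (D : set M) p : mdom i p -> D p -> @chart_img R n M i D (mcrd i p).
Proof. by move=> pi Dp; exists p. Qed.

Lemma chart_imgW i (D E : set M) : D `<=` E -> @chart_img R n M i D `<=` @chart_img R n M i E.
Proof. by move=> DE _ [p [pi Dp] <-]; exists p => //; split => //; exact: DE. Qed.

Local Notation trans i j := (rep (fun q : M => q) i j).

Lemma trans_smooth i j : smooth_on (@chart_img R n M i (mdom j)) (trans i j).
Proof. exact: mtransition_smooth. Qed.

Lemma trans_in i j (D : set M) x : @chart_img R n M i (D `&` mdom j) x ->
  @chart_img R n M j (D `&` mdom i) (trans i j x) /\ mpar M j (trans i j x) = mpar M i x.
Proof.
by move=> /chart_imgP[xi [Dx xj] xE]; rewrite /rep mcrdK//; split => //; apply: chart_img_in.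
Qed.

Lemma transK i j x : @chart_img R n M i (mdom j) x -> trans j i (trans i j x) = x.
Proof. by move=> /chart_imgP[xi xj xE]; rewrite /rep mcrdK. Qed.

Let oij i j : open (@chart_img R n M i (mdom j)).
Proof. by apply: chart_img_open; exact: mdom_open. Qed.

Lemma trans_diff i j x : @chart_img R n M i (mdom j) x -> differentiable (trans i j) x.
Proof. exact: (smooth_on_diff (@trans_smooth i j)). Qed.

Lemma trans_inT i j x : @chart_img R n M i (mdom j) x -> @chart_img R n M j (mdom i) (trans i j x).
Proof. by move=> /chart_imgP[xi xj xE]; rewrite /rep; apply: chart_img_in. Qed.

(** The two transition maps are mutually inverse, so by the chain rule their differentials are
    too. *)
Lemma Dtrans_surj i j x w : @chart_img R n M i (mdom j) x ->
  'D_('D_w (trans j i) (trans i j x)) (trans i j) x = w.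
Proof.
move=> xij; set y := trans i j x; have yji : @chart_img R n M j (mdom i) y by exact: trans_inT.
have E : trans j i y = x by exact: transK.
have d1 := trans_diff yji; have d2 : differentiable (trans i j) (trans j i y) by rewrite E; exact: trans_diff.
have De := Dcomp w d1 d2; rewrite [X in _ = 'D_ _ _ X]E in De.
apply: etrans (esym De) _.
rewrite (D_eq_on w (@oij j i) yji (g := id)); last by move=> z zji; exact: transK.
exact: derive_id.
Qed.

End Charts.

(** * Conditions (i) and (ii) read in charts *)

Section SU3Charts.
Variables (R : realType) (N : manifold R 6) (h : tens R 6 2) (J : endo R 6) (sg : tens R 6 2).
Variables (psp psm : tens R 6 3) (W : set N) (t : N -> R).
Hypotheses (kN : kahler N h J sg) (sN : su3 N J sg psp psm).
Hypotheses (oW : open W) (tW : smooth_pos W t).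

Definition psi_ (i : nat) (s : bool) : 'rV[R]_6 -> cov R 6 3 := if s then psm i else psp i.
Definition tc (i : nat) (x : 'rV[R]_6) : R := t (mpar N i x).
Local Notation P i := (@chart_img R 6 N i W).

Lemma form_lform n (M : manifold R n) (D D' : set M) p (S : tens R n p) i : open D ->
  D `<=` D' -> form_on D' S -> lform (@chart_img R n M i D) (S i).
Proof.
move=> oD DD [[_ mS sS] aS]; have DP := chart_imgW (i := i) DD.
split=> [x /DP Dx|x /DP Dx|v]; [exact: mS|exact: aS|].
exact: smooth_onW DP (sS i v).
Qed.

Let WT i : P i `<=` @chart_img R 6 N i [set: N]. Proof. exact: chart_imgW. Qed.

Let fs i s : lform (P i) (psi_ i s).
Proof. by have [fp fm _ _ _] := sN; case: s; exact: (form_lform i oW (@subsetT _ _)). Qed.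

Let lsg i : lform (P i) (sg i).
Proof. by have [_ _ _ [fsg _] _] := kN; exact: (form_lform i oW (@subsetT _ _) fsg). Qed.

Let psJ i s y : P i y -> forall u l, size l = 2%N -> psi_ i s y (vec (J i y u :: l)) =
  if s then psi_ i false y (vec (u :: l)) else - psi_ i true y (vec (u :: l)).
Proof.
have [_ _ [Jp Jm] _ _] := sN.
move=> /(@WT i) Py u l sl.
  have E : (fun a : 'I_3 => if a == ord0 then J i y (vec (u :: l) a) else vec (u :: l) a) =
      vec (J i y u :: l) by apply/funext => -[[|a] Ha].
  by case: s => /=; [have := Jm i y Py (vec (u :: l))|have := Jp i y Py (vec (u :: l))];
    rewrite /Jfirst E.
Qed.

Lemma su3_chart_frame i x : P i x -> exists F, adapted (J i x) (sg i x) (fun s => psi_ i s x) F /\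
  forall a b, (a < 6)%N -> (b < 6)%N -> h i x (vec [:: F a; F b]) = (dl a b)%:~R.
Proof.
have [[[_ mh _] hC hpos] [[_ lJ sJ] JJ nJ] hJ [fsg sgE] dsg] := kN.
have [_ _ _ _ pvol] := sN.
move=> Px; have TPx := WT Px; have [msg asg _] := lsg i.
have [||||||||||||E adE] := @adapted_frame_exists R (h i x) (J i x) (sg i x) (fun s => psi_ i s x).
  all: try (by exists E; exact: adE).
  all: try exact: (mh _ _ TPx).
  all: try exact: (lJ _ _ TPx).
  all: try exact: (JJ _ _ TPx).
  all: try exact: (msg _ Px).
  all: try exact: (asg _ Px).
  all: try (by move=> s; have [m a _] := fs i s; first [exact: m|exact: a]).
  all: try (by move=> u u0; rewrite -pair2E; exact: hpos).
  all: try (by move=> u w; rewrite -!pair2E; first [exact: hC|exact: hJ|exact: sgE]).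
  all: try (by move=> s u v w; rewrite psJ).
  all: try (by move=> s v; exact: psJ).
  by move=> v; exact: pvol.
Qed.

Lemma su3_local_chart i : su3_local (P i) (J i) (sg i) (psi_ i) (tc i).
Proof.
have [_ [[_ lJ sJ] JJ nJ] _ _ dsg] := kN.
split=> //.
- by move=> v; exact: smooth_onW (@WT i) (sJ i v).
- by move=> x /(@WT i) Px; exact: lJ.
- by move=> x /(@WT i) Px; exact: JJ.
- by move=> x /(@WT i) Px; exact: nJ.
- by move=> x /(@WT i) Px l sl; exact: dsg.
- by move=> s y Py u l; exact: psJ.
- by move=> x Px; have [E [adE _]] := su3_chart_frame Px; exists E.
- exact: tW.1 i.
- by move=> x /chart_imgP[_ Wx _]; exact: tW.2.
Qed.

Let oP i : open (P i). Proof. exact: chart_img_open. Qed.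

(** The components of [U] come from those of - dt by inverting the matrix of sg, which also shows
    smoothness. *)
Lemma hamiltonian_exists : exists U, hamiltonian W sg t U.
Proof.
pose Sm i x : 'M[R]_6 := \matrix_(a, b) sg i x (vec [:: 'e_a; 'e_b]).
pose U i x : 'rV[R]_6 := (\row_b - 'D_('e_b) (tc i) x) *m invmx (Sm i x).
have ml i x : P i x -> multilinear (sg i x) by have [m _ _] := sl_sg (su3_local_chart i); exact: m.
have SmE i x u b : P i x -> (u *m Sm i x) ord0 b = sg i x (vec [:: u; 'e_b]).
  move=> Px; rewrite {2}(rV_delta u) (@ml_vec_sum _ _ _ _ (ml i x Px) _ _ _ _ [::] [:: _])//.
  by rewrite mxE; apply: eq_bigr => a _; rewrite !mxE.
have uS i x : P i x -> Sm i x \in unitmx.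
  move=> Px; rewrite -row_free_unit -kermx_eq0; apply/eqP/row_matrixP => k; rewrite row0.
  have [E adE] := sl_frame (su3_local_chart i) Px.
  apply: (sg_nondegenerate adE (ml i x Px)) => v.
  have : row k (kermx (Sm i x)) *m Sm i x = 0 by rewrite -row_mul mulmx_ker row0.
  set r := row k _ => r0.
  rewrite (rV_delta v) (@ml_vec_sum _ _ _ _ (ml i x Px) _ _ _ _ [:: r] [::])// big1// => b _.
  by rewrite -SmE// r0 mxE mulr0.
have UE i x : P i x -> forall v, sg i x (vec [:: U i x; v]) = - 'D_v (tc i) x.
  move=> Px v; have dt : differentiable (tc i) x by exact: smooth_on_diff (tW.1 i) Px.
  rewrite [in RHS](D_deltar _ dt) {1}(rV_delta v) (@ml_vec_sum _ _ _ _ (ml i x Px) _ _ _ _ [:: U i x] [::])//.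
  rewrite -sumrN; apply: eq_bigr => b _.
  by rewrite -SmE// /U -mulmxA mulVmx ?uS// mulmx1 mxE mulrN.
have sm i : smooth_on (P i) (U i).
  apply: (@smooth_rV R 6 (P i) (@oP i) 6 (U i)) => b.
  apply: (smooth_on_eq (f := fun x => \sum_a (- 'D_('e_a) (tc i) x) * invmx (Sm i x) a b)) => //.
    by move=> x Px; rewrite /U mxE; apply: eq_bigr => a _; rewrite mxE.
  apply: smooth_sum => // a _; apply: smoothM => //.
    by apply: smoothN => //; exact: smooth_on_derive (tW.1 i).
  apply: (smooth_invmx (@oP i) (uS i)) => a' b'.
  have [_ _ s] := sl_sg (su3_local_chart i).
  apply: (smooth_on_eq (f := fun x => sg i x (vec [:: 'e_a'; 'e_b']))) => //.
  by move=> x _; rewrite mxE.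
exists U; split; last first.
  by move=> i x Px v; rewrite (vec1E v) /iprod -/(fcons _ _) fcons_vec UE.
split=> // i j x; rewrite -[preimage _ _]/(mdom j) => xij.
have [[psg _ _] _] : form_on [set: N] sg by have [_ _ _ [f _] _] := kN.
have [yji yE] := trans_in xij; set y := rep _ i j x in yji yE *.
have Px : P i x by apply: chart_imgW xij => ? [].
have Py : P j y by apply: chart_imgW yji => ? [].
have xij' : @chart_img R 6 N i (mdom j) x by apply: chart_imgW xij => ? [].
have [E adE] := sl_frame (su3_local_chart j) Py.
(* The expressions in two charts match because both contract with sg to - dt and sg is
   nondegenerate. *)
apply/eqP; rewrite -subr_eq0; apply/eqP; apply: (sg_nondegenerate adE (ml j y Py)) => w.
rewrite (@ml_vecD _ _ _ _ (ml j y Py) _ _ [::] [:: w])// (@ml_vecN _ _ _ _ (ml j y Py) _ [::] [:: w])//.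
rewrite (UE j y Py) opprK.
pose v := 'D_w (rep (fun q : N => q) j i) y.
have vE : 'D_v (rep (fun q : N => q) i j) x = w by exact: Dtrans_surj.
have := psg i j x _ (vec [:: U i x; v]).
have EV : (fun a : 'I_2 => 'D_(vec [:: U i x; v] a) (rep (fun q : N => q) i j) x) =
    vec [:: 'D_(U i x) (rep (fun q : N => q) i j) x; w].
  by apply/funext => -[[|[|a]] Ha] //=.
rewrite EV UE// => <-; last by apply: chart_imgW xij' => z; split.
have dr : differentiable (rep (fun q : N => q) i j) x by exact: trans_diff.
have dty : differentiable (tc j) (rep (fun q : N => q) i j x) by exact: smooth_on_diff (tW.1 j) Py.
have De := Dcomp v dr dty; rewrite vE -/y in De; rewrite -De.
rewrite (D_eq_on v (@chart_img_open R 6 N i _ (openI oW (@mdom_open _ _ N j))) xij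
  (g := fun z => tc j (rep (fun q : N => q) i j z))) ?addNr//.
by move=> z zij; have [_ E2] := trans_in zij; rewrite /tc E2.
Qed.

(* Conditions (i) and (ii) in terms of the rescaled forms [t^(1/2) psi]. *)
Lemma cond_iP : (forall i x, P i x -> forall s l, size l = 4%N ->
    dx (psi' (psi_ i) (tc i) s) x (vec l) = 0) <-> cond_i W J psp psm t.
Proof.
have [U hU] := hamiltonian_exists; have [[_ sU] hUe] := hU.
have key i x l : P i x -> size l = 4%N -> forall s,
  let dcl : cov R 6 1 := dc J (fun p => ln (t p)) i x in
  dx (psi' (psi_ i) (tc i) s) x (vec l) = tc i x `^ (1 / 2) * (dx (psi_ i s) x (vec l) -
   (if s then 1 else - 1) * (1 / 2) * cwedge dcl (psi_ i (~~ s) x) (vec l)).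
  move=> Px sl s dcl; have Hl := su3_local_chart i.
  rewrite (dx_psi' (@oP i) Hl Px s sl).
  have hUi y : P i y -> forall v, contract (U i y) (sg i y) v = - dfn (tc i) y v by exact: hUe.
  have -> : cwedge dcl (psi_ i (~~ s) x) (vec l) =
     (if s then - 1 else 1) * ((tc i x)^-1 * cwedge (dfn (tc i) x) (psi_ i s x) (vec l)).
    exact: (dc_log_wedge Hl hUi Px).
  congr (_ * (_ + _)); case: s; move: (_^-1) (cwedge _ _ _) => a b; ring.
have nz i x : P i x -> tc i x `^ (1 / 2) != 0.
  by move=> Px; rewrite gt_eqF//; have [] := pow_half (su3_local_chart i) Px.
split=> [d0|[dp dm] i x Px s l sl].
  by split=> i x Px v; have [l sl ->] := vecP v;
    [have := d0 i x Px false l sl|have := d0 i x Px true l sl]; rewrite key// => /eqP;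
    rewrite mulf_eq0 (negbTE (nz i x Px)) /= subr_eq0 => /eqP E; apply: etrans E _;
    rewrite /wedge ?mul1r ?mulN1r.
rewrite key//; case: s => /=.
  rewrite -[dx _ _ _]/(dext psm i x _) (dm i x Px) /wedge.
  by move: (_ `^ _) (cwedge _ _ _) => a b; ring.
rewrite -[dx _ _ _]/(dext psp i x _) (dp i x Px) /wedge.
by move: (_ `^ _) (cwedge _ _ _) => a b; ring.
Qed.

Variable U : vfield R 6.
Hypothesis hU : hamiltonian W sg t U.
Let hUi i x (Px : P i x) v : contract (U i x) (sg i x) v = - dfn (tc i) x v := hU.2 i x Px v.
Definition omega_ i : 'rV[R]_6 -> cov R 6 2 := omega (psi_ i) (tc i) (U i).

(** Under (i), the Lie derivatives of psi^+ and psi^- are t^(-1/2) times the differentials of i_U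
    psi'^+ and i_U psi'^-. The second differential vanishes with the first by types, and sg is
    always preserved. *)
Lemma cond_iiP : cond_i W J psp psm t ->
  (forall i x, P i x -> forall l, size l = 3%N -> dx (omega_ i) x (vec l) = 0) <->
  su3_isometry W sg psp psm U.
Proof.
move=> /cond_iP d0.
have sU i : smooth_on (P i) (U i) by have [[_ s] _] := hU; exact: s.
have lieE i x s v : P i x -> tc i x `^ (1 / 2) * lie U (fun i => psi_ i s) i x v =
    dx (fun y => contract (U i y) (psi' (psi_ i) (tc i) s y)) x v.
  move=> Px; apply: (lie_psi (@oP i) (su3_local_chart i) (sU i) (@hUi i) Px).
  exact: d0.
have nz i x : P i x -> tc i x `^ (1 / 2) != 0.
  by move=> Px; rewrite gt_eqF//; have [] := pow_half (su3_local_chart i) Px.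
split=> [dO|[_ _ lp _] i x Px l sl].
  have l0 s i x v : P i x -> lie U (fun i => psi_ i s) i x v = 0.
    move=> Px; apply: (mulfI (nz i x Px)); rewrite mulr0 lieE//.
    have [l sl ->] := vecP v; case: s; last exact: dO.
    exact: (dUpsi'_type (@oP i) (su3_local_chart i) (sU i) Px (b := false) (dO i x Px) sl).
  split=> [|i x Px v|i x Px v|i x Px v]; [by case: hU| |exact: (l0 false)|exact: (l0 true)].
  exact: (lie_sg (@oP i) (su3_local_chart i) (sU i) (@hUi i) Px).
rewrite -[LHS](lieE i x false (vec l) Px).
by rewrite -[lie _ _ _ _ _]/(lie U psp i x (vec l)) lp// mulr0.
Qed.

End SU3Charts.

(** * A given quotient, expressed in charts of the total space and of the base *)

Section QuotientCharts.
Variables (R : realType) (N : manifold R 6) (h : tens R 6 2) (J : endo R 6) (sg : tens R 6 2).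
Variables (psp psm : tens R 6 3) (W : set N) (t : N -> R).
Hypotheses (kN : kahler N h J sg) (sN : su3 N J sg psp psm).
Variables (Y : manifold R 7) (D : set Y) (phi : tens R 7 3) (k : tens R 7 2) (sphi : tens R 7 4).
Variables (V : vfield R 7) (pi : Y -> N).
Hypothesis Q : g2_quotient k V D phi sphi pi W h J sg psp psm t.

Let oD : open D. Proof. by have [[]] := Q. Qed.
Lemma quotient_open : open W. Proof. by have [_ []] := Q. Qed.
Lemma quotient_pos : smooth_pos W t. Proof. by have [_ []] := Q. Qed.
Let oW := quotient_open.
Let tW := quotient_pos.
Let piW : pi @` D = W. Proof. by have [_ [_ _ []]] := Q. Qed.

Lemma quotient_pre_open j : open (D `&` pi @^-1` mdom j).
Proof.
have [_ [_ _ [[[cpi _] _] _ _ _]] _ _ _] := Q.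
rewrite openE => p [Dp pj]; have h1 : nbhs p D by exact: open_nbhs_nbhs.
have h2 : nbhs p (pi @^-1` mdom j).
  by apply: cpi => //; apply: open_nbhs_nbhs; split => //; exact: mdom_open.
exact: filterI h1 h2.
Qed.

Section Pair.
Variables i j : nat.
Definition qdom := @chart_img R 7 Y i (D `&` pi @^-1` mdom j).
Local Notation O := qdom.
Local Notation f := (rep pi i j).
Local Notation P := (@chart_img R 6 N j W).
Local Notation T x := (tc t j (f x)).

Lemma qdom_open : open O. Proof. exact: chart_img_open (quotient_pre_open j). Qed.

Lemma qdom_smooth : smooth_on O f.
Proof. by have [_ [_ _ [[[_ sf] _] _ _ _]] _ _ _] := Q; exact: sf. Qed.

Let OD : O `<=` @chart_img R 7 Y i D. Proof. by apply: chart_imgW => ? []. Qed.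

Lemma qdomP x : O x -> P (f x) /\ mpar N j (f x) = pi (mpar Y i x).
Proof.
move=> /chart_imgP[xi [Dx xj] xE]; rewrite /rep mcrdK//; split => //.
by apply: chart_img_in => //; rewrite -piW; exists (mpar Y i x).
Qed.

Lemma qdom_map x : O x -> P (f x). Proof. by case/qdomP. Qed.

Let mk x : O x -> multilinear (k i x).
Proof. by have [[_ [[_ [[_ m _] _ _] _ _] _ _] _] _ _ _ _] := Q => Ox; apply: m; exact: OD. Qed.

Let kC x u w : O x -> k i x (vec [:: u; w]) = k i x (vec [:: w; u]).
Proof.
by have [[_ [[_ [_ c _] _ _] _ _] _] _ _ _ _] := Q => Ox; rewrite -!pair2E; apply: c; exact: OD.
Qed.

Let kpos x u : O x -> u != 0 -> 0 < k i x (vec [:: u; u]).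
Proof.
by have [[_ [[_ [_ _ c] _ _] _ _] _] _ _ _ _] := Q => Ox; rewrite -!pair2E; apply: c; exact: OD.
Qed.

Lemma quot_tE x : O x -> [/\ quot_t k V i x = T x, 0 < T x &
  k i x (vec [:: V i x; V i x]) * T x ^+ 2 = 1].
Proof.
move=> Ox; have [Px mE] := qdomP Ox.
have [[_ _ [_ _ Vn0]] _ [tE _ _] _ _] := Q.
have E : quot_t k V i x = T x by rewrite /tc mE (tE i x (OD Ox)).
have kVV : 0 < k i x (vec [:: V i x; V i x]) by apply: kpos => //; exact: Vn0 (OD Ox).
split => //; first by rewrite -E /quot_t pair2E; exact: powR_gt0.
rewrite -E /quot_t pair2E expr2 -powRD; last by rewrite (gt_eqF kVV) implybT.
rewrite (_ : - (1 / 2) + - (1 / 2) = - 1); last by lra.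
by rewrite powR_inv1 ?ltW// mulfV// gt_eqF.
Qed.

Lemma quot_etaE x v : O x -> quot_eta k V i x v = T x ^+ 2 * k i x (vec [:: v ord0; V i x]).
Proof.
move=> Ox; have [E _ _] := quot_tE Ox.
by rewrite /quot_eta E pair2E (@ml_vecZ _ _ _ _ (mk Ox) _ _ [:: v ord0] [::]).
Qed.

Lemma quot_etaV x : O x -> quot_eta k V i x (vec [:: V i x]) = 1.
Proof. by move=> Ox; rewrite quot_etaE// mulrC; have [_ _] := quot_tE Ox. Qed.

Lemma quot_eta_lform : lform O (quot_eta k V i).
Proof.
have oO := qdom_open.
have ml x : O x -> multilinear (quot_eta k V i x).
  move=> Ox v a c u w upd; rewrite !quot_etaE// /upd (ord1 a) eqxx.
  rewrite (@ml_vec _ _ _ _ (mk Ox) c u w [::] [:: V i x])//.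
  by move: (T x) (k i x _) (k i x _) => a1 a2 a3; ring.
split=> [//|x Ox|v]; first exact: alternating1.
apply: (smooth_on_eq (f := fun x => (T x * T x) * k i x (vec [:: v ord0; V i x]))) => //.
  by move=> x Ox; rewrite quot_etaE// expr2.
have sT : smooth_on O (fun x => T x).
  exact: (@smooth_comp R 7 O oO 6 P (tc t j) f (tW.1 j) qdom_smooth qdom_map).
apply: smoothM => //; first exact: smoothM.
have [[_ [[_ [[_ _ sk] _ _] _ _] _ _] [[_ sV] _ _]] _ _ _ _] := Q.
apply: (@smooth_slot _ _ _ _ oO (fun x e => k i x (vec [:: v ord0; e]))).
- by move=> y Oy c a b; apply: (@ml_vec _ _ _ _ (mk Oy) c a b [:: v ord0] [::]).
- by move=> e; exact: smooth_onW OD (sk i _).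
exact: smooth_onW OD (sV i).
Qed.

Let sgP x v : O x -> contract (V i x) (phi i x) v = pull f (sg j) x v.
Proof. by move=> Ox; have [_ _ [_ _ sgP] _ _] := Q; exact: (sgP i j x Ox v). Qed.

Lemma quot_phiE x : O x -> forall v, phi i x v =
  cwedge (pull f (sg j) x) (quot_eta k V i x) v +
  pull f (fun y g => tc t j y * psi' (psi_ psp psm j) (tc t j) false y g) x v.
Proof.
move=> Ox v; have [Px _] := qdomP Ox; have [tE t0 _] := quot_tE Ox.
have [_ _ _ _ [pp _]] := Q; have := pp i j x Ox v; rewrite /quot_Psip tE.
rewrite /wedge -[iprod V phi i x]/(contract (V i x) (phi i x)).
have -> : contract (V i x) (phi i x) = pull f (sg j) x by apply/funext => w; exact: sgP.
rewrite /pull /psi' /=; have h2 : 1 / 2 = 2^-1 :> R by rewrite mul1r.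
rewrite !h2 powRN => E.
have t12 : 0 < T x `^ (2^-1) by exact: powR_gt0.
have -> : psp j (f x) (fun a => 'D_(v a) f x) =
  (T x `^ 2^-1)^-1 * ((T x)^-1 * (phi i x v - cwedge (fun w : 'I_2 -> 'rV[R]_7 =>
    sg j (f x) (fun a => 'D_(w a) f x)) (quot_eta k V i x) v)) by exact: esym.
move: t0 t12 (phi i x v) (@cwedge R 7 2 1 _ _ v).
move: (T x `^ _) => a; move: (T x) => b b0 a0 c d.
by field; rewrite !gt_eqF.
Qed.

(** Apply the G2 identity to v = V, with k(V,V) = t^-2, V^flat = t^-2 eta, i_V phi = sg and i_V *phi
    = - psi'^-; the exchange of eta with a 3-form changes the sign once more. *)
Lemma quot_sphiE x : O x -> forall v, sphi i x v =
  cwedge (pull f (psi' (psi_ psp psm j) (tc t j) true) x) (quot_eta k V i x) v +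
  pull f (fun y g => (1 / 2 * (tc t j y * tc t j y)) * cwedge (sg j y) (sg j y) g) x v.
Proof.
move=> Ox v; have [Px _] := qdomP Ox; have [tE t0 kt] := quot_tE Ox.
have [_ _ _ _ [_ pm]] := Q.
have [[_ [[fph _ fs cf] _ _] _] _ _ _ _] := Q.
have [A uA [phA kA sA]] := cf i x (OD Ox).
have ephi : phi i x = g2_model A by apply/funext => w; exact: phA.
have esphi : sphi i x = @hodge R 3 4 A (g2_model A) by apply/funext => w; rewrite sA ephi.
have HC := hodge_g2_model_contract uA (V i x) v.
rewrite -esphi -ephi -kA pair2E in HC; move: HC.
have -> : contract (V i x) (phi i x) = pull f (sg j) x by apply/funext => w; exact: sgP.
have flE : coframe_flat A (V i x) = fun w => T x ^- 2 * quot_eta k V i x w.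
  apply/funext => w; rewrite /coframe_flat -kA pair2E quot_etaE// kC// mulrA mulVf ?mul1r//.
  by rewrite expf_neq0// gt_eqF.
have smE : contract (V i x) (sphi i x) = fun w => - T x `^ (1 / 2) * pull f (psm j) x w.
  apply/funext => w; have := pm i j x Ox w; rewrite /quot_Psim tE powRN => E.
  rewrite -[pull _ _ _ _]/(psm j (f x) (fun a => 'D_(w a) f x)) -E.
  rewrite -[iprod V sphi i x w]/(contract (V i x) (sphi i x) w).
  have t12 : T x `^ (1 / 2) != 0 by rewrite gt_eqF// powR_gt0.
  by move: (T x `^ _) (contract _ _ _) t12 => a b a0; field.
rewrite flE smE cwedge_scalel cwedge_scaler.
have [l sl ->] := vecP v; case: l sl => [|u [|w [|z [|e [|? ?]]]]] sl; try discriminate sl.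
have oO := qdom_open.
have fm : lform P (psm j).
  have [_ fm _ _ _] := sN; exact: (form_lform j oW (@subsetT _ _) fm).
have [mm am _] := lform_pull oO (@chart_img_open R 6 N j W oW) qdom_smooth qdom_map fm.
have [me _ _] := quot_eta_lform.
have EW : cwedge (quot_eta k V i x) (pull f (psm j) x) (vec [:: u; w; z; e]) =
    - cwedge (pull f (psm j) x) (quot_eta k V i x) (vec [:: u; w; z; e]).
  rewrite wedge13; [|exact: mm|exact: am].
  rewrite wedge31; [|exact: mm|exact: am|exact: me].
  move: (pull _ _ _) (quot_eta _ _ _ _) => a b.
  by move: (a _) (a _) (a _) (a _) (b _) (b _) (b _) (b _) => a1 a2 a3 a4 b1 b2 b3 b4; ring.
rewrite EW.
have -> : cwedge (pull f (psi' (psi_ psp psm j) (tc t j) true) x) (quot_eta k V i x) (vec [:: u; w; z; e]) =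
    T x `^ (1 / 2) * cwedge (pull f (psm j) x) (quot_eta k V i x) (vec [:: u; w; z; e]).
  by rewrite -cwedge_scalel.
rewrite -[pull f (fun y g => _) x _]/((1 / 2 * (T x * T x)) * cwedge (pull f (sg j) x) (pull f (sg j) x) (vec [:: u; w; z; e])).
move: kt t0; move: (T x `^ _) => a; move: (T x) => b.
move: (@cwedge R 7 2 2 _ _ _) (@cwedge R 7 3 1 _ _ _) (k i x _) (sphi i x _) => c d K S.
move=> Kb b0 E.
have -> : S = b ^+ 2 * (K * S) by rewrite mulrA (mulrC _ K) Kb mul1r.
by rewrite E; field; rewrite gt_eqF.
Qed.

Lemma quot_DV x : O x -> 'D_(V i x) f x = 0.
Proof. by move=> Ox; have [_ [_ _ [_ _ r _]] _ _ _] := Q; exact: (r i j x Ox). Qed.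

Lemma quot_surj x : O x -> forall w, exists v, 'D_v f x = w.
Proof. by move=> Ox; have [_ [_ _ [[_ s] _ _ _]] _ _ _] := Q; exact: (s i j x Ox). Qed.

(** The horizontal metric vanishes on (u, u), so k(u,u) = t^-2 eta(u)^2. Hence u - eta(u) V has
    length zero for [k], which is positive definite. *)
Lemma quot_ker x u : O x -> 'D_u f x = 0 -> u = quot_eta k V i x (vec [:: u]) *: V i x.
Proof.
move=> Ox Du; have [tE t0 kt] := quot_tE Ox; have [_ _ [_ hP _] _ _] := Q.
have := hP i j x Ox (vec [:: u; u]); rewrite /quot_h tE.
have [[[_ mh _] _ _] _ _ _ _] := kN.
have -> : (fun a : 'I_2 => 'D_(vec [:: u; u] a) f x) = vec [:: 0; 0].
  by apply/funext => -[[|[|a]] Ha] //=.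
rewrite (@ml_vec0 _ _ _ _ (mh j (f x) _) [::] [:: 0])//; last first.
  by apply: chart_imgW (qdom_map Ox).
rewrite -[X in _ * X]/(k i x (vec [:: u; u]) - T x ^- 2 *
  (quot_eta k V i x (fun=> u) * quot_eta k V i x (fun=> u))) => /eqP.
rewrite mulf_eq0 invr_eq0 (gt_eqF t0) /= => /eqP Kuu.
have eE : quot_eta k V i x (fun=> u) = quot_eta k V i x (vec [:: u]) by rewrite !quot_etaE.
set e := quot_eta k V i x (vec [:: u]) in eE *; rewrite eE in Kuu.
have ke : k i x (vec [:: u; V i x]) = T x ^- 2 * e.
  by rewrite /e quot_etaE// mulrA mulVf ?mul1r// expf_neq0// gt_eqF.
apply/eqP; rewrite -subr_eq0; apply/negPn/negP => /(kpos Ox).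
have mkx := mk Ox.
rewrite addrC -scaleNr (@ml_vec _ _ _ _ mkx _ _ _ [::] [:: _])//.
rewrite (@ml_vec _ _ _ _ mkx _ _ _ [:: V i x] [::])// (@ml_vec _ _ _ _ mkx _ _ _ [:: u] [::])//.
rewrite (kC (V i x) u Ox) ke.
have KV : k i x (vec [:: V i x; V i x]) = T x ^- 2.
  by apply: (mulIf (_ : T x ^+ 2 != 0)); rewrite ?kt ?mulVf// expf_neq0// gt_eqF.
rewrite KV; have -> : k i x (vec [:: u; u]) = T x ^- 2 * (e * e).
  by apply/eqP; rewrite -subr_eq0; apply/eqP.
have Z (a b : R) : - b * (- b * a + a * b) + (- b * (a * b) + a * (b * b)) = 0 by ring.
by rewrite Z ltxx.
Qed.

Variable U : vfield R 6.
Hypothesis hU : hamiltonian W sg t U.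
Let Hl := su3_local_chart kN sN oW tW j.
Let sU : smooth_on P (U j). Proof. by have [[_ s] _] := hU; exact: s. Qed.
Let hUj x (Px : P x) v : contract (U j x) (sg j x) v = - dfn (tc t j) x v := hU.2 j x Px v.
Let dphi0 x l : O x -> size l = 4%N -> dx (phi i) x (vec l) = 0.
Proof. by have [[_ [_ d _] _] _ _ _ _] := Q => Ox _; exact: (d i x (OD Ox)). Qed.
Let dsphi0 x l : O x -> size l = 5%N -> dx (sphi i) x (vec l) = 0.
Proof. by have [[_ [_ _ d] _] _ _ _ _] := Q => Ox _; exact: (d i x (OD Ox)). Qed.
Let oP : open P. Proof. exact: chart_img_open. Qed.
Let ker x (Ox : O x) u (Du : 'D_u f x = 0) : exists c, u = c *: V i x :=
  ex_intro _ _ (quot_ker Ox Du).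

Lemma quot_dpsi0 x s l : O x -> size l = 4%N ->
  dx (psi' (psi_ psp psm j) (tc t j) s) (f x) (vec l) = 0.
Proof.
move=> Ox; exact: (dpsi0 qdom_open oP qdom_smooth qdom_map Hl quot_eta_lform quot_phiE
  quot_sphiE Ox (quot_DV Ox) (quot_etaV Ox) (quot_surj Ox) (ker Ox)
  (fun l => @dphi0 x l Ox) (fun l => @dsphi0 x l Ox)).
Qed.

Lemma quot_deta x u v : O x -> dx (quot_eta k V i) x (vec [:: u; v]) =
  - pull f (omega_ psp psm t U j) x (vec [:: u; v]).
Proof.
move=> Ox; exact: (deta_omega qdom_open oP qdom_smooth qdom_map Hl sU hUj quot_eta_lform quot_phiE
  quot_sphiE Ox (quot_DV Ox) (quot_etaV Ox) (quot_surj Ox) (ker Ox)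
  (fun l => @dphi0 x l Ox) (fun l => @dsphi0 x l Ox)).
Qed.

Lemma quot_domega0 x l : O x -> size l = 3%N -> dx (omega_ psp psm t U j) (f x) (vec l) = 0.
Proof.
move=> Ox; apply: (domega0 qdom_open oP qdom_smooth qdom_map Hl sU quot_eta_lform Ox (quot_surj Ox)).
by move=> y Oy u v; exact: quot_deta.
Qed.

End Pair.

(** The equations are obtained at points of the form f x; surjectivity of [pi] makes these all
    points of the base. *)
Lemma quot_chart_point j z : @chart_img R 6 N j W z ->
  exists i x, qdom i j x /\ rep pi i j x = z.
Proof.
move=> [q [qj]]; rewrite -piW => -[p Dp pq] zE; have [i pi_] := mcover p.
exists i, (mcrd i p); split; first by apply: chart_img_in => //; split => //=; rewrite pq.
by rewrite /rep mcrdK// pq.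
Qed.

Lemma quotient_cond_i : cond_i W J psp psm t.
Proof.
apply/(cond_iP kN sN oW tW) => j z /quot_chart_point [i [x [Ox <-]]] s l sl.
exact: quot_dpsi0.
Qed.

Lemma quotient_isometry U : hamiltonian W sg t U -> su3_isometry W sg psp psm U.
Proof.
move=> hU; apply/(cond_iiP kN sN oW tW hU quotient_cond_i).
move=> j z /quot_chart_point [i [x [Ox <-]]] l sl.
exact: (quot_domega0 hU).
Qed.

End QuotientCharts.

(** * The product with a line: projections and changes of charts *)

Section LinearMaps.
Variable R : realType.

Lemma D_linear (V W : normedModType R) (L : {linear V -> W}) x v : continuous L -> 'D_v L x = L v.
Proof. by move=> cL; rewrite deriveE ?diff_lin//; exact: linear_differentiable. Qed.

Lemma D_rsubmx n (x v : 'rV[R]_(1 + n)) :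
  'D_v (rsubmx : 'rV[R]_(1 + n) -> 'rV[R]_n) x = rsubmx v.
Proof. exact: (D_linear _ _ (@continuous_rsubmx R 1 1 n)). Qed.

Lemma diff_rsubmx n (x : 'rV[R]_(1 + n)) :
  differentiable (rsubmx : 'rV[R]_(1 + n) -> 'rV[R]_n) x.
Proof. by apply: linear_differentiable; exact: continuous_rsubmx. Qed.

Lemma smooth_rsubmx n (A : set 'rV[R]_(1 + n)) :
  open A -> smooth_on A (rsubmx : 'rV[R]_(1 + n) -> 'rV[R]_n).
Proof.
move=> oA; apply: (@smooth_on_linear_comp R (1 + n) _ _ (@rsubmx R 1 1 n) A id oA).
  exact: continuous_rsubmx.
exact: smooth_on_id.
Qed.

Lemma D_invariant (V W : normedModType R) (F : V -> W) x v :
  (forall r : R, F (r *: v + x) = F x) -> 'D_v F x = 0.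
Proof.
move=> E; rewrite /derive; have -> : (fun h : R => h^-1 *: ((F \o shift x) (h *: v) - F x)) = fun=> 0.
  by apply/funext => r; rewrite /= E subrr scaler0.
exact: lim_cst.
Qed.

Lemma D_scalel (V W : normedModType R) (c : V -> R) (w : W) x v : differentiable c x ->
  differentiable (fun z => c z *: w) x /\ 'D_v (fun z => c z *: w) x = 'D_v c x *: w.
Proof.
move=> dc; have d : differentiable (fun z => c z *: w) x by apply: differentiableZl.
by split=> //; rewrite !deriveE// diffZl.
Qed.

End LinearMaps.

Section LineCharts.
Variables (R : realType) (n : nat) (N : manifold R n).
Local Notation L := (line_manifold N).
Local Notation repN i j := (rep (fun q : N => q) i j).
Implicit Types (w v : 'rV[R]_(1 + n)).

Lemma line_chart_img i (W : set N) :
  @chart_img R (1 + n) L i [set z : R * N | W z.2] = rsubmx @^-1` (@chart_img R n N i W).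
Proof. exact: (line_img (mdom i `&` W) i). Qed.

Lemma rep_lineE i j w : rep (fun q : L => q) i j w =
  row_inl n (lsubmx w) + row_inr (repN i j (rsubmx w)).
Proof.
rewrite /rep /= /line_crd /line_par /= -row_mx_inlr; congr row_mx.
by apply/rowP => k; rewrite mxE (ord1 k).
Qed.

Lemma D_rep_snd i j w v : @chart_img R n N i (mdom j) (rsubmx w) ->
  'D_v (rep (snd : L -> N) i j) w = 'D_(rsubmx v) (repN i j) (rsubmx w).
Proof.
move=> wij; have dr := trans_diff wij.
by have := Dcomp v (diff_rsubmx w) dr; rewrite D_rsubmx.
Qed.

Lemma D_rep_line i j w v : @chart_img R n N i (mdom j) (rsubmx w) ->
  'D_v (rep (fun q : L => q) i j) w =
  row_inl n (lsubmx v) + row_inr ('D_(rsubmx v) (repN i j) (rsubmx w)).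
Proof.
move=> wij; have dr := trans_diff wij.
have -> : rep (fun q : L => q) i j =
    (fun w => row_inl n (lsubmx w) + row_inr (repN i j (rsubmx w))).
  by apply/funext => w'; exact: rep_lineE.
have d1 : differentiable (fun w => row_inl n (lsubmx w)) w.
  apply: (differentiable_comp (f := lsubmx) (g := row_inl n)).
    by apply: linear_differentiable; exact: continuous_lsubmx.
  by apply: linear_differentiable; exact: row_inl_continuous.
have d2 : differentiable (fun w => repN i j (rsubmx w)) w.
  exact: (differentiable_comp (diff_rsubmx w) dr).
have d3 y : differentiable (@row_inr R n) y.
  by apply: linear_differentiable; exact: row_inr_continuous.
have d4 : differentiable (fun w => row_inr (repN i j (rsubmx w))) w.
  exact: (differentiable_comp d2 (d3 _)).
rewrite (Dadd v d1 d4); congr (_ + _).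
  have d5 : differentiable (lsubmx : 'rV[R]_(1 + n) -> 'rV[R]_1) w.
    by apply: linear_differentiable; exact: continuous_lsubmx.
  have d6 : differentiable (row_inl n) (lsubmx w).
    by apply: linear_differentiable; exact: row_inl_continuous.
  apply: etrans (Dcomp v d5 d6) _.
  apply: etrans (D_linear _ _ (@row_inl_continuous R n)) _; congr row_inl.
  exact: (D_linear _ _ (@continuous_lsubmx R 1 1 n)).
apply: etrans (Dcomp v d2 (d3 _)) _.
apply: etrans (D_linear _ _ (@row_inr_continuous R n)) _; congr row_inr.
by have := Dcomp v (diff_rsubmx w) dr; rewrite D_rsubmx.
Qed.

Lemma D_rep_line_r i j w v : @chart_img R n N i (mdom j) (rsubmx w) ->
  rsubmx ('D_v (rep (fun q : L => q) i j) w) = 'D_(rsubmx v) (repN i j) (rsubmx w).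
Proof. by move=> wij; rewrite D_rep_line// /row_inl /row_inr add_row_mx row_mxKr add0r. Qed.

Lemma D_rep_line_l i j w v : @chart_img R n N i (mdom j) (rsubmx w) ->
  lsubmx ('D_v (rep (fun q : L => q) i j) w) = lsubmx v.
Proof. by move=> wij; rewrite D_rep_line// /row_inl /row_inr add_row_mx row_mxKl addr0. Qed.

Lemma rep_line_r i j w : rsubmx (rep (fun q : L => q) i j w) = repN i j (rsubmx w).
Proof. by rewrite rep_lineE /row_inl /row_inr add_row_mx row_mxKr add0r. Qed.

Lemma line_pair_img i j (W : set N) w :
  @chart_img R (1 + n) L i ([set z : R * N | W z.2] `&` (fun q : L => q) @^-1` mdom j) w ->
  @chart_img R n N i (W `&` mdom j) (rsubmx w) /\ @chart_img R n N i (mdom j) (rsubmx w).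
Proof.
move=> H; have : (rsubmx @^-1` (@chart_img R n N i (W `&` mdom j))) w.
  by rewrite -line_chart_img; exact: H.
by move=> Hw; split => //; apply: chart_imgW Hw => ? [].
Qed.

End LineCharts.

Lemma rsubmx_comb (R : realType) n (a b : R) (u : 'rV[R]_n) :
  rsubmx (a *: row_inr u + b *: row_inl n (const_mx 1)) = a *: u.
Proof. by rewrite /row_inr /row_inl !scale_row_mx add_row_mx row_mxKr scaler0 addr0. Qed.

Lemma lsubmx_comb (R : realType) n (a b : R) (u : 'rV[R]_n) :
  lsubmx (a *: row_inr u + b *: row_inl n (const_mx 1)) ord0 ord0 = b.
Proof.
rewrite /row_inr /row_inl !scale_row_mx add_row_mx row_mxKl !mxE.
by rewrite mulr0 add0r mulr1.
Qed.

(** * The explicit model is a torsion-free G2 structure with the given quotient *)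

Section Model.
Variables (R : realType) (N : manifold R 6) (h : tens R 6 2) (J : endo R 6) (sg : tens R 6 2).
Variables (psp psm : tens R 6 3) (W : set N) (t : N -> R) (U : vfield R 6) (etaN : tens R 6 1).
Hypotheses (kN : kahler N h J sg) (sN : su3 N J sg psp psm).
Hypotheses (oW : open W) (tW : smooth_pos W t) (cW : cond_i W J psp psm t).
Hypotheses (hU : hamiltonian W sg t U) (eN : eta_potential psp t etaN W U).
Local Notation L := (line_manifold N).
Local Notation DD := ([set z : R * N | W z.2] : set L).
Local Notation P i := (@chart_img R 6 N i W).
Local Notation O i := (@chart_img R 7 L i DD).
Local Notation mk := (model_k h t etaN).
Local Notation mphi := (model_phi sg psp t etaN).
Local Notation msphi := (model_sphi sg psm t etaN).
Local Notation meta := (model_eta etaN).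
Local Notation mt := (model_t t).
Local Notation pr := (@rsubmx R 1 1 6).
Local Notation psi i := (psi_ psp psm i).

Let OE i : O i = pr @^-1` (P i). Proof. exact: line_chart_img. Qed.
Let OP i w : O i w -> P i (pr w). Proof. by rewrite OE. Qed.
Let oP i : open (P i). Proof. exact: chart_img_open. Qed.
Let oO i : open (O i).
Proof. by rewrite OE; apply: open_comp => // w _; exact: continuous_rsubmx. Qed.
Let spr i : smooth_on (O i) pr. Proof. exact: smooth_rsubmx (@oO i). Qed.
Let Dpr (w v : 'rV[R]_7) : 'D_v pr w = pr v. Proof. exact: (D_rsubmx (n := 6)). Qed.
Let Hl i := su3_local_chart kN sN oW tW i.

Lemma pullNE p (T : tens R 6 p) i : pullN T i = pull pr (T i).
Proof.
apply/funext => w; apply/funext => v; rewrite /pullN /pull; congr (T i _ _).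
by apply/funext => a; rewrite Dpr.
Qed.

Lemma pullN_lform p (T : tens R 6 p) i : lform (P i) (T i) -> lform (O i) (pullN T i).
Proof. by move=> fT; rewrite pullNE; exact: (lform_pull (@oO i) (@oP i) (@spr i) (@OP i) fT). Qed.

Let fpsi i s : lform (P i) (psi i s) := sl_psi (Hl i) s.
Let fsg i : lform (P i) (sg i) := sl_sg (Hl i).
Let feN i : lform (P i) (etaN i).
Proof. by have [f _] := eN; exact: (form_lform i oW _ f). Qed.

Lemma dy_lform i : lform (O i) (@dy R i).
Proof.
split=> [w _ v a c u z upd|w _|v]; [|exact: alternating1|exact: smooth_on_cst].
by rewrite /dy /upd (ord1 a) eqxx !mxE.
Qed.

Lemma meta_lform i : lform (O i) (meta i).
Proof. exact: (lform_add (@oO i) (dy_lform i) (pullN_lform (feN i))). Qed.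

Let st i : smooth_on (O i) (mt i).
Proof. exact: (@smooth_comp R 7 (O i) (@oO i) 6 (P i) (tc t i) pr (tW.1 i) (@spr i) (@OP i)). Qed.
Let t0 i w : O i w -> 0 < mt i w. Proof. by move=> /OP; exact: (sl_t0 (Hl i)). Qed.

Lemma mphi_lform i : lform (O i) (mphi i).
Proof.
apply: (lform_add (@oO i) (lform_wedge (@oO i) (pullN_lform (fsg i)) (meta_lform i))).
apply: lform_scale => //; first by apply: smooth_pow => //; exact: t0.
exact: (pullN_lform (fpsi i false)).
Qed.

Lemma msphi_lform i : lform (O i) (msphi i).
Proof.
apply: lform_add => //; apply: lform_scale => //.
- by apply: smooth_pow => //; exact: t0.
- exact: (lform_wedge (@oO i) (pullN_lform (fpsi i true)) (meta_lform i)).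
- apply: smoothM => //; first exact: smooth_on_cst.
  by apply: (smooth_on_eq (f := fun w => mt i w * mt i w)) => //; exact: smoothM.
exact: (lform_wedge (@oO i) (pullN_lform (fsg i)) (pullN_lform (fsg i))).
Qed.

Section Compat.
Variables (i j : nat) (w : 'rV[R]_7).
Hypothesis wij : @chart_img R 7 L i (DD `&` (fun q : L => q) @^-1` mdom j) w.
Let F := rep (fun q : L => q) i j.
Let wN := (line_pair_img wij).1.
Let wm := (line_pair_img wij).2.

Lemma pullN_compat p (T : tens R 6 p) : pulled W (fun q : N => q) T T ->
  pullN T i w = fun v => pullN T j (F w) (fun a => 'D_(v a) F w).
Proof.
move=> pT; apply/funext => v; rewrite /pullN (pT i j _ wN) /F rep_line_r; congr (T j _ _).
by apply/funext => a; rewrite D_rep_line_r.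
Qed.

Lemma model_t_compat : mt i w = mt j (F w).
Proof. by rewrite /model_t /F rep_line_r; have [_ ->] := trans_in wN. Qed.

Lemma meta_compat : meta i w = fun v => meta j (F w) (fun a => 'D_(v a) F w).
Proof.
have [[[pe _ _] _] _] := eN; apply/funext => v; rewrite /model_eta (pullN_compat pe).
by congr (_ + _); rewrite /dy D_rep_line_l.
Qed.

End Compat.

Let pulledW p (T : tens R 6 p) : pulled [set: N] (fun q : N => q) T T ->
  pulled W (fun q : N => q) T T.
Proof. by move=> H i j x Hx; apply: H; apply: chart_imgW Hx => ? []. Qed.

Let psgN : pulled W (fun q : N => q) sg sg.
Proof. by have [_ _ _ [[[p _ _] _] _] _] := kN; exact: pulledW. Qed.
Let phN : pulled W (fun q : N => q) h h.
Proof. by have [[[p _ _] _ _] _ _ _ _] := kN; exact: pulledW. Qed.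
Let pppN : pulled W (fun q : N => q) psp psp.
Proof. by have [[[p _ _] _] _ _ _ _] := sN; exact: pulledW. Qed.
Let ppmN : pulled W (fun q : N => q) psm psm.
Proof. by have [_ [[p _ _] _] _ _ _] := sN; exact: pulledW. Qed.

Lemma mphi_form : form_on DD mphi.
Proof.
split=> [|i w Ow]; last by have [_ a _] := mphi_lform i; exact: a.
split=> [i j w wij v|i w Ow|i v]; [|by have [m _ _] := mphi_lform i; exact: m|
  by have [_ _ s] := mphi_lform i; exact: s].
by rewrite /model_phi /wedge (model_t_compat wij) (pullN_compat wij psgN) (pullN_compat wij pppN)
  (meta_compat wij).
Qed.

Lemma msphi_form : form_on DD msphi.
Proof.
split=> [|i w Ow]; last by have [_ a _] := msphi_lform i; exact: a.
split=> [i j w wij v|i w Ow|i v]; [|by have [m _ _] := msphi_lform i; exact: m|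
  by have [_ _ s] := msphi_lform i; exact: s].
by rewrite /model_sphi /wedge (model_t_compat wij) (pullN_compat wij psgN) (pullN_compat wij ppmN)
  (meta_compat wij).
Qed.

Let metal i w : O i w -> multilinear (meta i w).
Proof. by move=> Ow; have [m _ _] := meta_lform i; exact: m. Qed.

Let mh i x : P i x -> multilinear (h i x).
Proof. by have [[[_ m _] _ _] _ _ _ _] := kN => Px; apply: m; apply: chart_imgW Px. Qed.

Let metac i w (a : R) (u v : 'rV[R]_7) : O i w ->
  meta i w (fun=> a *: u + v) = a * meta i w (fun=> u) + meta i w (fun=> v).
Proof.
move=> Ow; have V1 z : (fun _ : 'I_1 => z) = vec [:: z] :> ('I_1 -> 'rV[R]_7).
  exact: (vec1E (fun=> z)).
rewrite !V1; exact: (@ml_vec _ _ _ _ (metal Ow) a u v [::] [::]).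
Qed.

Let mk_vec i w (a b : 'rV[R]_7) : mk i w (vec [:: a; b]) =
  mt i w * h i (pr w) (vec [:: pr a; pr b]) + mt i w ^- 2 * (meta i w (fun=> a) * meta i w (fun=> b)).
Proof.
rewrite /model_k /pullN; congr (_ * h i _ _ + _).
by apply/funext => -[[|[|c]] Hc].
Qed.

Lemma mk_multilinear i w : O i w -> multilinear (mk i w).
Proof.
move=> Ow v a c u z; have mhP := mh (OP Ow).
have [l sl ->] := vecP v; case: l sl => [|x [|y [|? ?]]] sl; try discriminate sl.
have E0 (Ha : (0 < 2)%N) b : (fun j => if j == Ordinal Ha then b else vec [:: x; y] j) = vec [:: b; y].
  by apply/funext => -[[|[|k]] Hk].
have E1 (Ha : (1 < 2)%N) b : (fun j => if j == Ordinal Ha then b else vec [:: x; y] j) = vec [:: x; b].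
  by apply/funext => -[[|[|k]] Hk].
case: a => -[|[|a]] Ha //= .
  rewrite !E0 !mk_vec metac// !linearP (@ml_vec _ _ _ _ mhP c (pr u) (pr z) [::] [:: pr y])//.
  by move: (h i _ _) (h i _ _) (meta _ _ _) (meta _ _ _) (meta _ _ _) (mt _ _) (mt _ _ ^- 2) => a1 a2 a3 a4 a5 a6 a7; ring.
rewrite !E1 !mk_vec metac// !linearP (@ml_vec _ _ _ _ mhP c (pr u) (pr z) [:: pr x] [::])//.
by move: (h i _ _) (h i _ _) (meta _ _ _) (meta _ _ _) (meta _ _ _) (mt _ _) (mt _ _ ^- 2) => a1 a2 a3 a4 a5 a6 a7; ring.
Qed.

(** An adapted SU(3) frame of the base is lifted and completed to a frame in which the metric is the
    identity and both forms have the model tables; its inverse matrix is the coframe. *)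
Lemma model_coframe i w : O i w -> exists2 A : 'M[R]_7, A \in unitmx &
  [/\ mphi i w =1 g2_model A, forall u v, mk i w (pair2 u v) = coframe_metric A u v
    & msphi i w =1 @hodge R 3 4 A (mphi i w)].
Proof.
move=> Ow; have Px := OP Ow; set x := pr w in Px.
have [fsg' [fp fm jp _ pvol]] := (fsg i, sN).
have [Fr [adF hF]] : exists F, adapted (J i x) (sg i x) (fun s => psi i s x) F /\
  forall a b, (a < 6)%N -> (b < 6)%N -> h i x (vec [:: F a; F b]) = (dl a b)%:~R.
  exact: (su3_chart_frame kN sN oW Px).
have T0 : 0 < mt i w := t0 Ow; set T := mt i w in T0.
pose r := T `^ (1 / 2); have r0 : 0 < r by exact: powR_gt0.
have rr : r * r = T by have [_ E _] := pow_half (Hl i) Px; exact: E.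
pose F a := if (a < 6)%N then Fr a else 0.
pose e6 : 'rV[R]_7 := row_inl 6 (const_mx 1).
(* For a < 6, the lift on which eta vanishes, divided by t^(1/2) because the horizontal metric is t
   h. Since [F] is 0 at 6, the last vector is t d/dy, of unit length because d/dy has square length
   t^-2. *)
pose f a : 'rV[R]_7 := r^-1 *: row_inr (F a) +
  (T * (dl 6 a)%:~R - r^-1 * etaN i x (fun=> F a)) *: e6.
have pf a : pr (f a) = r^-1 *: F a.
  exact: rsubmx_comb.
have etaf a : meta i w (fun=> f a) = T * (dl 6 a)%:~R.
  have -> : meta i w (fun=> f a) = lsubmx (f a : 'rV[R]_(1 + 6)) ord0 ord0 + etaN i x (fun=> pr (f a)) by [].
  have -> : lsubmx (f a : 'rV[R]_(1 + 6)) ord0 ord0 = T * (dl 6 a)%:~R - r^-1 * etaN i x (fun=> F a).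
    exact: lsubmx_comb.
  rewrite pf; have -> : (fun _ : 'I_1 => r^-1 *: F a) = vec [:: r^-1 *: F a].
    exact: (vec1E (fun=> r^-1 *: F a)).
  have [me _ _] := feN i; rewrite (@ml_vecZ _ _ _ _ (me x Px) _ _ [::] [::])//.
  have -> : [::] ++ [:: F a] = [:: F a] by [].
  have -> : vec [:: F a] = (fun _ : 'I_1 => F a) by exact: esym (vec1E (fun=> F a)).
  by rewrite subrK.
have sgF a b : (a < 7)%N -> (b < 7)%N -> sg i x (vec [:: F a; F b]) = (sgT [:: a; b])%:~R.
  move=> a7 b7; have [ms _ _] := fsg i; rewrite /F.
  case: ifP => a6; last first.
    rewrite (@ml_vec0 _ _ _ _ (ms x Px) [::] [:: _])//; have -> : a = 6 by lia.
    by case: b b7 => [|[|[|[|[|[|[|b]]]]]]].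
  case: ifP => b6; last first.
    rewrite (@ml_vec0 _ _ _ _ (ms x Px) [:: _] [::])//; have -> : b = 6 by lia.
    by case: a a7 a6 => [|[|[|[|[|[|a]]]]]].
  by rewrite -[vec _]/(vec (map Fr [:: a; b])) (ad_sg adF) ?mul1r// tuplesP /= a6 b6.
have psF s a b c : (a < 7)%N -> (b < 7)%N -> (c < 7)%N ->
    psi i s x (vec [:: F a; F b; F c]) = (psT s [:: a; b; c])%:~R.
  move=> a7 b7 c7; have [ms _ _] := fpsi i s; rewrite /F.
  have e3 d g : eps3 3 d g = 0 /\ eps3 d 3 g = 0 /\ eps3 d g 3 = 0.
    by rewrite /eps3 !inE !eqseq_cons /= !andbF; split; last split; case: d => [|[|[|d]]] //=; case: g => [|[|[|g]]].
  have [e31 [e32 e33]] := e3 0%N 0%N.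
  case: ifP => a6; last first.
    rewrite (@ml_vec0 _ _ _ _ (ms x Px) [::] [:: _; _])//; have -> : a = 6 by lia.
    by rewrite /psT (proj1 (e3 _ _)) mul0r.
  case: ifP => b6; last first.
    rewrite (@ml_vec0 _ _ _ _ (ms x Px) [:: _] [:: _])//; have -> : b = 6 by lia.
    by rewrite /psT (proj1 (proj2 (e3 _ _))) mul0r.
  case: ifP => c6; last first.
    rewrite (@ml_vec0 _ _ _ _ (ms x Px) [:: _; _] [::])//; have -> : c = 6 by lia.
    by rewrite /psT (proj2 (proj2 (e3 _ _))) mul0r.
  by rewrite -[vec _]/(vec (map Fr [:: a; b; c])) (ad_psi adF) ?mul1r// tuplesP /= a6 b6 c6.
have hFF a b : (a < 7)%N -> (b < 7)%N -> h i x (vec [:: F a; F b]) =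
    (dl a b)%:~R - (dl 6 a)%:~R * (dl 6 b)%:~R.
  move=> a7 b7; rewrite /F; have mhx := mh Px.
  case: ifP => a6; last first.
    rewrite (@ml_vec0 _ _ _ _ mhx [::] [:: _])//; have -> : a = 6 by lia.
    by rewrite {2}/dl /= mul1r subrr.
  have d6 : dl 6 a = 0 by rewrite /dl; case: eqP => // E; rewrite E in a6.
  rewrite d6 mul0r subr0; case: ifP => b6; first exact: hF.
  rewrite (@ml_vec0 _ _ _ _ mhx [:: _] [::])//; have -> : b = 6 by lia.
  by rewrite /dl; case: eqP => // E; rewrite -E in a6.
have kf a b : (a < 7)%N -> (b < 7)%N -> mk i w (vec [:: f a; f b]) = (dl a b)%:~R.
  move=> a7 b7; have mhx := mh Px.
  rewrite mk_vec !etaf !pf -/x -/T (@ml_vecZ _ _ _ _ mhx _ _ [::] [:: _])//.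
  rewrite (@ml_vecZ _ _ _ _ mhx _ _ [:: _] [::])// hFF// -{1}rr.
  have -> : T ^- 2 * (T * (dl 6 a)%:~R * (T * (dl 6 b)%:~R)) = (dl 6 a)%:~R * (dl 6 b)%:~R.
    by clearbody r; clearbody T; move: (_%:~R) (_%:~R) => c1 c2; field; rewrite gt_eqF.
  by clearbody r; move: (_%:~R) (_%:~R * _%:~R) => c1 c2; field; rewrite gt_eqF.
pose M : 'M[R]_7 := \matrix_a f a.
(* The frame is orthonormal for [model_k], so pairing a linear relation with each vector kills its
   coefficients. *)
have uM : M \in unitmx.
  rewrite -row_free_unit -kermx_eq0; apply/eqP/row_matrixP => c; rewrite row0.
  set q := row c _; have : q *m M = 0 by rewrite -row_mul mulmx_ker row0.
  rewrite mulmx_sum_row => E; apply/rowP => b; rewrite [RHS]mxE.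
  have mkx := mk_multilinear Ow.
  have := @ml_vec_sum _ _ _ _ mkx _ (index_enum 'I_7) (fun a => q ord0 a) (fun a => row a M) [::] [:: f b] erefl.
  rewrite /= E (@ml_vec0 _ _ _ _ mkx [::] [:: _])// => /esym.
  rewrite (bigD1 b)//= big1 ?addr0 => [|a ab]; rewrite rowK kf//.
    by rewrite /dl eqxx mulr1.
  by rewrite /dl eq_sym val_eqE (negbTE ab) mulr0.
pose A := invmx M; have uA : A \in unitmx by rewrite unitmx_inv.
have fE a : (a < 7)%N -> dual_frame A a = f a.
  by move=> a7; rewrite /dual_frame /A invmxK rowK inordK.
have mapE p l : l \in tuples p 7 -> map (dual_frame A) l = map f l.
  by rewrite tuplesP => /andP[_ /allP al]; apply/eq_in_map => a /al; exact: fE.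
have [mph aph _] := mphi_lform i; have [msp _ _] := msphi_lform i.
have frA := dual_frame_frame uA.
(* Two multilinear forms with the same table on the frame are equal; this compares the model with
   [g2_model], its Hodge dual and the coframe metric. *)
have cmp p (a b : cov R 7 p) tb : multilinear a -> multilinear b ->
    has_table 7 f a 1 tb -> has_table 7 (dual_frame A) b 1 tb -> a =1 b.
  move=> ma mb ta tb' v; have mab := multilinearD (-1) mb ma.
  have := multilinear_frame0 frA mab _ v => /(_ _)/eqP; rewrite mulN1r addrC subr_eq0 => H.
  apply/eqP; apply: H => l lp; rewrite tb'// (mapE p)// ta// mulN1r addNr //.
have Z2 (B : cov R 6 2) (u v : 'rV[R]_6) : multilinear B ->
    B (vec [:: r^-1 *: u; r^-1 *: v]) = T^-1 * B (vec [:: u; v]).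
  move=> mB; rewrite (@ml_vecZ _ _ _ _ mB _ _ [::] [:: _])// (@ml_vecZ _ _ _ _ mB _ _ [:: _] [::])//.
  by rewrite mulrA -invfM rr.
have Z3 (B : cov R 6 3) (u v z : 'rV[R]_6) : multilinear B ->
    B (vec [:: r^-1 *: u; r^-1 *: v; r^-1 *: z]) = (T * r)^-1 * B (vec [:: u; v; z]).
  move=> mB; rewrite (@ml_vecZ _ _ _ _ mB _ _ [::] [:: _; _])// (@ml_vecZ _ _ _ _ mB _ _ [:: _] [:: _])//.
  by rewrite (@ml_vecZ _ _ _ _ mB _ _ [:: _; _] [::])// !mulrA -!invfM rr.
have [msg asg _] := pullN_lform (fsg i).
have pN2 a b : pullN sg i w (vec [:: f a; f b]) = T^-1 * sg i x (vec [:: F a; F b]).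
  have [ms _ _] := fsg i; rewrite -(Z2 _ _ _ (ms x Px)) /pullN; congr (sg i _ _).
  by apply/funext => -[[|[|k]] Hk] //=; rewrite pf.
have pN3 s a b c : pullN (if s then psm else psp) i w (vec [:: f a; f b; f c]) = (T * r)^-1 * psi i s x (vec [:: F a; F b; F c]).
  have [ms _ _] := fpsi i s; rewrite -(Z3 _ _ _ _ (ms x Px)) /pullN; case: s {ms}; congr (_ i _ _);
  by apply/funext => -[[|[|[|k]]] Hk] //=; rewrite pf.
have e1 a : meta i w (vec [:: f a]) = T * (dl 6 a)%:~R.
  by rewrite -etaf (vec1E (fun=> f a)).
have T32 : T `^ (3 / 2) = T * r.
  rewrite (_ : 3 / 2 = 1 + 1 / 2); last by lra.
  by rewrite powRD ?powRr1 ?ltW// (gt_eqF T0) implybT.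
have tphi : has_table 7 f (mphi i w) 1 g3T.
  move=> [|a [|b [|c [|? ?]]]]; rewrite tuplesP //= andbT => /and3P[a7 b7 c7].
  rewrite /model_phi /wedge wedge21; [|exact: msg|exact: asg|exact: metal].
  rewrite !pN2 !e1 (pN3 false) -/T T32 !sgF// psF//.
  rewrite !(rmorphD, rmorphB, rmorphM, rmorphN) /=.
  clearbody r; clearbody T.
  move: (_%:~R) (_%:~R) (_%:~R) (_%:~R) (_%:~R) (_%:~R) (_%:~R) => d1 d2 d3 d4 d5 d6 d7.
  by field; rewrite !gt_eqF.
have tsphi : has_table 7 f (msphi i w) 1 g4T.
  move=> [|a [|b [|c [|d [|? ?]]]]] lp; try (by move: lp; rewrite tuplesP).
  have /and4P[a7 b7 c7 d7] : [&& (a < 7)%N, (b < 7)%N, (c < 7)%N & (d < 7)%N].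
    by move: lp; rewrite tuplesP /= andbT.
  rewrite -[map f _]/[:: f a; f b; f c; f d].
  have [mpm apm _] := pullN_lform (fpsi i true).
  rewrite /model_sphi /wedge wedge31; [|exact: mpm|exact: apm|exact: metal].
  rewrite wedge22; [|exact: msg|exact: asg|exact: msg|exact: asg].
  rewrite !pN2 !e1 !(pN3 true) -/T -/r !sgF// !psF//.
  clearbody r; clearbody T.
  have -> : g4T [:: a; b; c; d] =
    psT true [:: a; b; c] * dl 6 d - psT true [:: a; b; d] * dl 6 c
    + psT true [:: a; c; d] * dl 6 b - psT true [:: b; c; d] * dl 6 a
    + sgT [:: a; b] * sgT [:: c; d] - sgT [:: a; c] * sgT [:: b; d]
    + sgT [:: a; d] * sgT [:: b; c] by [].
  move: (psT _ [:: a; b; c]) (psT _ [:: a; b; d]) (psT _ [:: a; c; d]) (psT _ [:: b; c; d]).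
  move: (sgT [:: a; b]) (sgT [:: a; c]) (sgT [:: a; d]) (sgT [:: b; c]) (sgT [:: b; d]) (sgT [:: c; d]).
  move: (dl 6 a) (dl 6 b) (dl 6 c) (dl 6 d) => d1 d2 d3 d4 s1 s2 s3 s4 s5 s6 p1 p2 p3 p4.
  rewrite !(rmorphD, rmorphB, rmorphM, rmorphN) /=.
  by field; rewrite !gt_eqF.
have phE : mphi i w = g2_model A.
  by apply/funext; exact: (cmp 3 _ _ g3T (mph w Ow) (g2_model_multilinear A) tphi (g2_model_table uA)).
exists A => //; split=> [v|u v|]; first by rewrite phE.
  have mkx := mk_multilinear Ow.
  pose K : cov R 7 2 := fun g => coframe_metric A (g ord0) (g ord_max).
  have mK : multilinear K.
    move=> g a c u' z'; rewrite /K /coframe_metric mulr_sumr -big_split /=.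
    by case: a => -[|[|a]] Ha //=; apply: eq_bigr => b _; rewrite mulmxDl -scalemxAl !mxE; ring.
  pose tK l : int := if l is [:: a; b] then dl a b else 0.
  have t1 : has_table 7 f (mk i w) 1 tK.
    by move=> [|a [|b [|? ?]]]; rewrite tuplesP //= andbT => /andP[a7 b7]; rewrite kf// mul1r.
  have t2 : has_table 7 (dual_frame A) K 1 tK.
    move=> [|a [|b [|? ?]]]; rewrite tuplesP //= andbT => /andP[a7 b7].
    by rewrite mul1r -(coframe_metric_frame uA a7 b7).
  by rewrite pair2E (cmp 2 _ _ tK mkx mK t1 t2).
rewrite phE; exact: (cmp 4 _ _ g4T (msp w Ow) (@hodge_multilinear R 3 4 A (g2_model A)) tsphi (hodge_g2_model_table uA)).
Qed.

Lemma model_riemannian : riemannian DD mk.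
Proof.
split=> [|i w Ow u v|i w Ow u u0].
- split=> [i j w wij v|i w Ow|i v]; last 1 first.
  + have [_ _ sE] := meta_lform i; have [[[_ _ sh] _ _] _ _ _ _] := kN.
    have sPh u : smooth_on (P i) (fun x => h i x u) by exact: smooth_onW (chart_imgW (@subsetT _ _)) (sh i u).
    apply: smoothD => //; apply: smoothM => //.
    * exact: (@smooth_comp R 7 (O i) (@oO i) 6 (P i) (fun x => h i x (fun a => pr (v a))) pr (sPh _) (@spr i) (@OP i)).
    * apply: smoothV => //; first by move=> w Ow; rewrite expf_neq0// gt_eqF// t0.
      by apply: (smooth_on_eq (f := fun w => mt i w * mt i w)) => //; exact: smoothM.
    * by apply: smoothM => //; exact: sE.
  + rewrite /model_k (model_t_compat wij) (pullN_compat wij phN) (meta_compat wij).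
    by congr (_ + _ * (meta j _ _ * meta j _ _)).
  + exact: mk_multilinear.
- have [A _ [_ kA _]] := model_coframe Ow; rewrite !kA /coframe_metric.
  by apply: eq_bigr => a _; rewrite mulrC.
have [A uA [_ kA _]] := model_coframe Ow; rewrite kA /coframe_metric.
rewrite lt_neqAle sumr_ge0 ?andbT => [|a _]; last by rewrite -expr2 sqr_ge0.
rewrite eq_sym psumr_eq0 => [|a _]; last by rewrite -expr2 sqr_ge0.
apply: contra u0 => /allP H; rewrite -(mulmxK uA u).
have -> : u *m A = 0.
  apply/rowP => a; rewrite [RHS]mxE; have := H a (mem_index_enum a).
  by rewrite -expr2 sqrf_eq0 => /eqP.
by rewrite mul0mx.
Qed.

Lemma ddy_pr i w : pr (@ddy R i w) = 0.
Proof. by rewrite /ddy /row_inl row_mxKr. Qed.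

Lemma ddy_meta i w v0 : O i w -> meta i w v0 = meta i w (fun=> v0 ord0).
Proof. by move=> _; congr (meta i w _); apply/funext => a; rewrite (ord1 a). Qed.

Lemma ddy_eta i w : O i w -> meta i w (fun=> @ddy R i w) = 1.
Proof.
move=> Ow; rewrite /model_eta /pullN /dy ddy_pr /ddy /row_inl row_mxKl mxE.
have [me _ _] := feN i.
have -> : (fun _ : 'I_1 => 0 : 'rV[R]_6) = vec [:: 0] by apply/funext => a; rewrite (ord1 a).
by rewrite (@ml_vec0 _ _ _ _ (me _ (OP Ow)) [::] [::])// addr0.
Qed.

Let pull_pr0 p (T : tens R 6 p.+1) i w l : lform (P i) (T i) -> O i w -> size l = p ->
  pullN T i w (vec (@ddy R i w :: l)) = 0.
Proof.
move=> [m _ _] Ow sl; rewrite /pullN.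
have -> : (fun a => pr (vec (@ddy R i w :: l) a)) = vec (0 :: map pr l) :> ('I_p.+1 -> _).
  apply/funext => -[[|a] Ha]; rewrite /vec /= ?ddy_pr// (nth_map 0)// sl; exact: Ha.
by apply: (@ml_vec0 _ _ _ _ (m _ (OP Ow)) [::] _); rewrite /= size_map sl.
Qed.

(** The form dy has constant coefficients, so the differential comes from the pullback of etaN
    alone. *)
Lemma meta_deta i w v : O i w -> dx (meta i) w v = - pull pr (omega_ psp psm t U i) w v.
Proof.
move=> Ow; have [_ dE] := eN; have fp := pullN_lform (feN i).
have -> : dx (meta i) w v = dx (fun y g => 1 * @dy R i y g + pullN etaN i y g) w v.
  by apply: (dx_eq_on _ (@oO i) Ow) => y _ g; rewrite mul1r.
rewrite (dx_lin Ow _ _ (dy_lform i) fp) mul1r.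
rewrite [X in X + _](_ : _ = 0) ?add0r; last first.
  by rewrite /dx big1// => a _; rewrite derive_cst mulr0.
have [l sl ->] := vecP v; rewrite pullNE (dx_pull1 (@oO i) (@spr i) (@OP i) Ow (feN i) sl).
rewrite !pull_vec//; exact: (dE i _ (OP Ow)).
Qed.

Lemma model_closed i w : O i w -> (forall l, size l = 4%N -> dx (mphi i) w (vec l) = 0) /\
  (forall l, size l = 5%N -> dx (msphi i) w (vec l) = 0).
Proof.
move=> Ow; have hUi x : P i x -> forall v, contract (U i x) (sg i x) v = - dfn (tc t i) x v := hU.2 i x.
apply: (closed_of_potential (@oO i) (@oP i) (@spr i) (@OP i) (Hl i) hUi (meta_lform i) _ _ Ow).
- move=> y Oy v; rewrite /model_phi /wedge !pullNE; congr (_ + _).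
  rewrite (_ : 3 / 2 = 1 + 1 / 2 :> R); last by lra.
  rewrite powRD ?powRr1 ?(ltW (t0 Oy))//; last by rewrite (gt_eqF (t0 Oy)) implybT.
  by rewrite -mulrA.
- move=> y Oy v; rewrite /model_sphi /wedge !pullNE -cwedge_scalel; congr (_ + _).
- by move=> s l sl; apply: ((cond_iP kN sN oW tW).2 cW i (pr w) (OP Ow)).
by move=> v; exact: meta_deta.
Qed.

(** The coefficients of the model do not depend on y, and d/dy is a constant field in these
    charts. *)
Lemma model_lie i w v : O i w -> lie (@ddy R) mphi i w v = 0.
Proof.
move=> Ow; rewrite /lie D_invariant ?add0r; last first.
  move=> r; have E : rsubmx (r *: @ddy R i w + w) = pr w.
    by rewrite linearD linearZ /= [rsubmx (ddy i w)]ddy_pr scaler0 add0r.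
  rewrite /model_phi /model_eta /model_t /wedge /pullN E; congr (cwedge _ _ _ + _ * _).
rewrite big1// => a _; rewrite derive_cst.
have [m _ _] := mphi_lform i; have := m w Ow v a (-1) 0 0.
rewrite scaler0 addr0 => E; apply/eqP; have : mphi i w (fun b => if b == a then 0 else v b) = 0.
  by move: E; cbv zeta; move: (mphi i w _) => e; rewrite mulN1r addNr.
by move=> ->.
Qed.

Lemma model_isometry : g2_isometry DD mphi (@ddy R).
Proof.
split=> [|i w Ow v|i w Ow]; last 2 first.
- exact: model_lie.
- apply/eqP => /rowP /(_ ord0); rewrite /ddy /row_inl mxE; case: splitP => //= a _.
  by rewrite !mxE => /eqP; rewrite oner_eq0.
split=> [i j w wij|i]; last exact: smooth_on_cst.
have wm := (line_pair_img wij).2; rewrite (D_rep_line (n := 6) _ wm) [rsubmx (ddy i w)]ddy_pr.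
have dr := trans_diff wm.
have -> : 'D_0 (rep (fun q : N => q) i j) (pr w) = 0.
  by have := DZ (0 : R) (0 : 'rV[R]_6) dr; rewrite !scale0r.
by rewrite /ddy /row_inl row_mxKl linear0 addr0.
Qed.

Let snd_img i j w : @chart_img R 7 L i (DD `&` (snd : L -> N) @^-1` mdom j) w ->
  [/\ O i w, @chart_img R 6 N i (W `&` mdom j) (pr w) & @chart_img R 6 N i (mdom j) (pr w)].
Proof.
move=> H; have Hw : @chart_img R 6 N i (W `&` mdom j) (pr w).
  have : ((@rsubmx R 1 1 6) @^-1` (@chart_img R 6 N i (W `&` mdom j))) w.
    by rewrite -line_chart_img; exact: H.
  exact.
split=> //; last by apply: chart_imgW Hw => ? [].
by rewrite OE; apply: chart_imgW Hw => ? [].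
Qed.

(** The fibres are the lines R x {p}, and s |-> (s, p) is an integral curve through any two points
    of such a line. *)
Lemma model_orbits : orbit_projection DD (@ddy R) W (snd : L -> N).
Proof.
have oWj j : open (W `&` mdom j) by exact: openI oW (@mdom_open _ _ N j).
split.
- split; first split=> [z _|i j]; first exact: cvg_snd.
    apply: (@smooth_onW _ _ _ _ ((@rsubmx R 1 1 6) @^-1` (@chart_img R 6 N i (mdom j)))).
      by move=> w /snd_img [].
    have S := smooth_on_comp_linear (@continuous_rsubmx R 1 1 6) (@trans_smooth R 6 N i j).
    exact: S.
  move=> i j w /snd_img [_ _ wm] u; exists (row_inr ('D_u (rep (fun q : N => q) j i) (rep (fun q : N => q) i j (pr w)))).
  have Er (z : 'rV[R]_6) : rsubmx (row_inr z) = z by rewrite /row_inr row_mxKr.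
  apply: etrans (D_rep_snd (n := 6) _ wm) _; rewrite Er.
  exact: Dtrans_surj.
- apply/seteqP; split=> [_ [z Wz <-] //|p Wp]; by exists (0, p).
- move=> i j w /snd_img [_ _ wm]; rewrite (D_rep_snd (n := 6) _ wm) [rsubmx (ddy i w)]ddy_pr.
  by have := DZ (0 : R) (0 : 'rV[R]_6) (trans_diff wm); rewrite !scale0r.
move=> [a p] [b q] /= Wp Wq <-; exists (fun s => (s, p) : L), a, b; split=> // s _; split=> //.
  have h1 : {for s, continuous (fun r : R => r)} by exact: cvg_id.
  have h2 : {for s, continuous (fun _ : R => p)} by exact: cvg_cst.
  exact: (cvg_pair h1 h2).
move=> i pi; have -> : (fun r : R => @mcrd R 7 L i (r, p)) = fun r => r *: @ddy R i 0 + row_inr (mcrd i p).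
  apply/funext => r; rewrite /= /line_crd /ddy row_mx_inlr; congr (_ + _).
  rewrite -linearZ /=; congr (row_inl 6 _).
  by apply/rowP => c; rewrite !mxE mulr1.
have dk : differentiable (id : R -> R) s by [].
have [d Ds] := @D_scalel R R _ id (@ddy R i 0) s 1 dk.
have dc : differentiable (fun _ : R => row_inr (mcrd i p)) s := differentiable_cst _ _.
apply: DeriveDef; first by apply: diff_derivable; exact: (differentiableD d dc).
apply: etrans (@Dadd R R _ _ _ s 1 d dc) _; rewrite derive_cst addr0; apply: etrans Ds _.
by rewrite derive_id scale1r.
Qed.

Lemma model_quot_t i w : O i w -> quot_t mk (@ddy R) i w = mt i w.
Proof.
move=> Ow; have T0 := t0 Ow; rewrite /quot_t pair2E mk_vec ddy_eta// ddy_pr.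
rewrite (@ml_vec0 _ _ _ _ (mh (OP Ow)) [::] [:: 0])// mulr0 add0r !mulr1.
rewrite -powR_mulrn ?ltW// -powRN -powRrM (_ : - 2%:R * - (1 / 2) = 1) ?powRr1 ?ltW//.
by lra.
Qed.

Lemma model_quot_eta i w v : O i w -> quot_eta mk (@ddy R) i w v = meta i w v.
Proof.
move=> Ow; have T0 := t0 Ow; rewrite /quot_eta model_quot_t// pair2E.
have mkx := mk_multilinear Ow.
rewrite (@ml_vecZ _ _ _ _ mkx _ _ [:: _] [::])// mk_vec ddy_eta// ddy_pr.
rewrite (@ml_vec0 _ _ _ _ (mh (OP Ow)) [:: _] [::])// mulr0 add0r mulr1 mulrA mulfV ?mul1r.
  by rewrite -ddy_meta.
by rewrite expf_neq0// gt_eqF.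
Qed.

Theorem model_quotient : @g2_quotient R L N mk (@ddy R) DD mphi msphi (fun z : R * N => z.2)
  W h J sg psp psm t.
Proof.
have oD : open DD by apply: (@open_comp _ _ snd W) => // z _; exact: cvg_snd.
have pullS p (T : tens R 6 p) : pulled W (fun q : N => q) T T -> forall i j w v,
    @chart_img R 7 L i (DD `&` (snd : L -> N) @^-1` mdom j) w ->
    pullN T i w v = T j (rep (snd : L -> N) i j w) (fun a => 'D_(v a) (rep (snd : L -> N) i j) w).
  move=> pT i j w v /snd_img [_ wW wm]; rewrite /pullN (pT i j _ wW); congr (T j _ _).
  by apply/funext => a; rewrite (D_rep_snd (n := 6) _ wm).
have ctrE i w : O i w -> iprod (@ddy R) mphi i w = pullN sg i w.
  move=> Ow; apply/funext => v; have [l sl ->] := vecP v.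
  rewrite -[iprod _ _ _ _ _]/(contract (@ddy R i w) (mphi i w) (vec l)) contract_vec.
  case: l sl => [|a [|b [|? ?]]] sl; try discriminate sl.
  have [msg asg _] := pullN_lform (fsg i).
  rewrite /model_phi /wedge wedge21; [|exact: msg|exact: asg|exact: metal].
  rewrite !(pull_pr0 (fsg i) Ow)// (pull_pr0 (fpsi i false) Ow)//.
  by rewrite (ddy_meta (vec [:: ddy i w]) Ow) ddy_eta// !mul0r subr0 add0r mulr1 mulr0 addr0.
split.
- split; first exact: oD.
  + split; last 2 first.
    * by move=> i w Ow v; have [l sl ->] := vecP v; exact: (model_closed Ow).1.
    * by move=> i w Ow v; have [l sl ->] := vecP v; exact: (model_closed Ow).2.
    split; [exact: mphi_form|exact: model_riemannian|exact: msphi_form|].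
    by move=> i w Ow; exact: model_coframe.
  exact: model_isometry.
- by split; [exact: oW|exact: tW|exact: model_orbits].
- split=> [i w Ow|i j w wij v|i j w wij v].
  + by rewrite model_quot_t.
  + have [Ow _ _] := snd_img wij; have T0 := t0 Ow.
    rewrite /quot_h model_quot_t// !model_quot_eta// /model_k addrK mulKf ?gt_eqF//.
    exact: (pullS _ _ phN).
  have [Ow _ _] := snd_img wij; rewrite ctrE//; exact: (pullS _ _ psgN).
- move=> i x Px u v; have [_ _ _ [_ sgE] _] := kN; rewrite sgE//.
  by apply: chart_imgW Px.
split=> i j w wij v; have [Ow _ _] := snd_img wij; have T0 := t0 Ow.
  rewrite /quot_Psip model_quot_t// /wedge ctrE//.
  have -> : quot_eta mk (@ddy R) i w = meta i w by apply/funext => u; rewrite model_quot_eta.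
  have -> : mphi i w v = cwedge (pullN sg i w) (meta i w) v + mt i w `^ (3 / 2) * pullN psp i w v by [].
  rewrite addrAC subrr add0r; apply: etrans _ (pullS _ _ pppN _ _ _ _ wij).
  rewrite powRN (_ : 3 / 2 = 1 + 1 / 2 :> R); last by lra.
  rewrite powRD ?powRr1 ?(ltW T0)//; last by rewrite (gt_eqF T0) implybT.
  have r0 : 0 < mt i w `^ (1 / 2) by exact: powR_gt0.
  move: r0 T0; move: (mt i w `^ _) => a; move: (mt i w) (pullN _ _ _ _) => b c a0 b0.
  by field; rewrite !gt_eqF.
rewrite /quot_Psim model_quot_t//; apply: etrans _ (pullS _ _ ppmN _ _ _ _ wij).
rewrite -[iprod _ _ _ _ _]/(contract (@ddy R i w) (msphi i w) v).
have [l sl ->] := vecP v; rewrite contract_vec.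
case: l sl => [|a [|b [|c [|? ?]]]] sl; try discriminate sl.
have [msg asg _] := pullN_lform (fsg i); have [mpm apm _] := pullN_lform (fpsi i true).
rewrite /model_sphi /wedge wedge31; [|exact: mpm|exact: apm|exact: metal].
rewrite wedge22; [|exact: msg|exact: asg|exact: msg|exact: asg].
rewrite !(pull_pr0 (fsg i) Ow)// !(pull_pr0 (fpsi i true) Ow)//.
rewrite (ddy_meta (vec [:: ddy i w]) Ow) ddy_eta// powRN.
have r0 : 0 < mt i w `^ (1 / 2) by exact: powR_gt0.
move: r0; move: (mt i w `^ _) => r; move: (mt i w) => T r0.
rewrite !mul0r !mulr0 !mulr1 !addr0 !subr0 ?add0r ?sub0r ?mulr0 ?addr0.
by move: (pullN psm i w _) => e; field; rewrite gt_eqF.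
Qed.

End Model.

(** * Maps between single charts, transported to all charts *)

Section OneChart.
Variables (R : realType) (n n' : nat) (M : manifold R n) (M' : manifold R n').

Lemma chart_pre_open i (A : set 'rV[R]_n) : open A -> open [set p : M | mdom i p /\ A (mcrd i p)].
Proof.
move=> oA; rewrite openE => p [pi Ap].
have h1 : nbhs p (@mdom R n M i) by apply: open_nbhs_nbhs; split => //; exact: mdom_open.
have h2 : nbhs p (mcrd i @^-1` A) by apply: mcrd_continuous => //; exact: open_nbhs_nbhs.
exact: filterS (filterI h1 h2).
Qed.

Variables (i0 j0 : nat) (D : set M) (f : M -> M').
Hypotheses (oD : open D) (Di : D `<=` mdom i0) (Dj : forall p, D p -> mdom j0 (f p)).
Local Notation D0 := (@chart_img R n M i0 D).
Local Notation f0 := (rep f i0 j0).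
Hypothesis sf : smooth_on D0 f0.

Let oD0 : open D0. Proof. exact: chart_img_open. Qed.

Section Pair.
Variables i j : nat.
Local Notation A := (@chart_img R n M i (D `&` f @^-1` mdom j)).
Local Notation T := (rep (fun q : M => q) i i0).
Local Notation T' := (rep (fun q : M' => q) j0 j).

(** In any pair of charts the map factors as a transition, the expression [f0] and another
    transition; smoothness, pullback and relatedness are all derived from this factorisation. *)
Lemma one_chart_point x : A x -> [/\ @chart_img R n M i (mdom i0) x, D0 (T x),
  @chart_img R n' M' j0 (mdom j) (f0 (T x)) & rep f i j x = T' (f0 (T x))].
Proof.
move=> /chart_imgP[xi [Dx fj] xE].
have E : mpar M i0 (T x) = mpar M i x by rewrite /rep mcrdK//; exact: Di.
split.
- by rewrite -xE; apply: chart_img_in => //; exact: Di.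
- by apply: chart_img_in => //; exact: Di.
- by rewrite /rep mcrdK; [|exact: Di]; apply: chart_img_in => //; exact: Dj.
by rewrite [in LHS]/rep [in RHS]/rep /rep (mcrdK (Di Dx)) (mcrdK (Dj Dx)).
Qed.

Hypothesis oA : open A.

Lemma one_chart_D x v : A x ->
  'D_v (rep f i j) x = 'D_('D_('D_v T x) f0 (T x)) T' (f0 (T x)).
Proof.
move=> Ax; have [x1 x2 x3 _] := one_chart_point Ax.
have d1 := trans_diff x1; have d2 := smooth_on_diff sf x2; have d3 := trans_diff x3.
rewrite (D_eq_on v oA Ax (g := fun y => T' (f0 (T y)))); last first.
  by move=> y Ay; have [] := one_chart_point Ay.
have d12 : differentiable (fun y => f0 (T y)) x by exact: (differentiable_comp d1 d2).
apply: etrans (Dcomp v d12 d3) _; congr ('D_ _ _ _).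
exact: (Dcomp v d1 d2).
Qed.

Lemma one_chart_smooth_pair : smooth_on A (rep f i j).
Proof.
have sT : smooth_on A T.
  by apply: (smooth_onW _ (@trans_smooth R n M i i0)) => x /one_chart_point [].
have s1 : smooth_on A (fun x => f0 (T x)).
  by apply: (smooth_comp_rV oA oD0 sf sT) => x /one_chart_point [].
have oT' : open (@chart_img R n' M' j0 (mdom j)) by apply: chart_img_open; exact: mdom_open.
have s2 : smooth_on A (fun x => T' (f0 (T x))).
  by apply: (smooth_comp_rV oA oT' (@trans_smooth R n' M' j0 j) s1) => x /one_chart_point [].
by apply: (smooth_on_eq oA _ s2) => x /one_chart_point [].
Qed.

End Pair.

Lemma one_chart_continuous p : D p -> {for p, continuous f}.
Proof.
move=> Dp; have pi := Di Dp.
have x0 : D0 (mcrd i0 p) by exact: chart_img_in.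
have c1 : {for p, continuous (fun q => mpar M' j0 (f0 (mcrd i0 q)))}.
  apply: (@continuous_comp _ _ _ (fun q => f0 (mcrd i0 q)) (mpar M' j0)).
    apply: (@continuous_comp _ _ _ (mcrd i0) f0); first exact: mcrd_continuous.
    exact: differentiable_continuous (smooth_on_diff sf x0).
  by rewrite /rep mcrdK//; exact: mpar_continuous (Dj Dp).
have E : forall q, D q -> mpar M' j0 (f0 (mcrd i0 q)) = f q.
  by move=> q Dq; rewrite /rep (mcrdK (Di Dq)) (mcrdK (Dj Dq)).
move=> B; rewrite -(E p Dp) => nB.
have h1 : nbhs p [set q | B (mpar M' j0 (f0 (mcrd i0 q)))] := c1 B nB.
have h2 : nbhs p D by exact: open_nbhs_nbhs.
have h3 : nbhs p [set q | B (f q)].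
  by apply: filterS (filterI h1 h2) => q [/= Bq Dq]; rewrite -E.
exact: h3.
Qed.

Lemma one_chart_open i j : open (@chart_img R n M i (D `&` f @^-1` mdom j)).
Proof.
apply: chart_img_open; rewrite openE => p [Dp fj].
have h1 : nbhs p D by exact: open_nbhs_nbhs.
have h2 : nbhs p (f @^-1` mdom j).
  by apply: one_chart_continuous => //; apply: open_nbhs_nbhs; split => //; exact: mdom_open.
exact: filterI h1 h2.
Qed.

Lemma one_chart_smooth : smooth_map D f.
Proof.
split=> [p Dp|i j]; first exact: one_chart_continuous.
exact: (one_chart_smooth_pair (@one_chart_open i j)).
Qed.

Variable E : set M'.
Hypothesis DE : forall p, D p -> E (f p).

Let A1 i j x : @chart_img R n M i (D `&` f @^-1` mdom j) x ->
  @chart_img R n M i (D `&` mdom i0) x.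
Proof. by apply: chart_imgW => p [Dp _]; split => //; exact: Di. Qed.

Let A2 i j x : @chart_img R n M i (D `&` f @^-1` mdom j) x ->
  @chart_img R n' M' j0 (E `&` mdom j) (f0 (rep (fun q : M => q) i i0 x)).
Proof.
move=> /chart_imgP[xi [Dx fj] xE]; rewrite /rep (mcrdK (Di Dx)).
by apply: chart_img_in; [exact: Dj|split => //; exact: DE].
Qed.

Lemma one_chart_pulled p (S' : tens R n' p) (S : tens R n p) :
  pulled D (fun q : M => q) S S -> pulled E (fun q : M' => q) S' S' ->
  (forall x v, D0 x -> S i0 x v = S' j0 (f0 x) (fun a => 'D_(v a) f0 x)) -> pulled D f S' S.
Proof.
move=> pS pS' H i j x Ax v; have [_ x2 _ xE] := one_chart_point Ax.
rewrite (pS i i0 x (A1 Ax) v) H// (pS' j0 j _ (A2 Ax)) xE; congr (S' j _ _).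
by apply/funext => a; rewrite (one_chart_D (@one_chart_open i j) _ Ax).
Qed.

Lemma one_chart_related (V' : vfield R n') (V : vfield R n) :
  related D (fun q : M => q) V V -> related E (fun q : M' => q) V' V' ->
  (forall x, D0 x -> 'D_(V i0 x) f0 x = V' j0 (f0 x)) -> related D f V V'.
Proof.
move=> rV rV' H i j x Ax; have [_ x2 _ xE] := one_chart_point Ax.
rewrite (one_chart_D (@one_chart_open i j) _ Ax) (rV i i0 x (A1 Ax)) H//.
by rewrite (rV' j0 j _ (A2 Ax)) xE.
Qed.

End OneChart.

Section Restrict.
Variables (R : realType) (N : manifold R 6) (J : endo R 6) (sg : tens R 6 2).
Variables (psp psm : tens R 6 3) (W W' : set N) (t : N -> R) (U : vfield R 6).
Hypothesis WW : W' `<=` W.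

Let CW i : @chart_img R 6 N i W' `<=` @chart_img R 6 N i W. Proof. exact: chart_imgW. Qed.

Lemma smooth_pos_sub : smooth_pos W t -> smooth_pos W' t.
Proof. by move=> [s p]; split=> [i|q /WW]; [exact: smooth_onW (@CW i) (s i)|exact: p]. Qed.

Lemma cond_i_sub : cond_i W J psp psm t -> cond_i W' J psp psm t.
Proof. by move=> [a b]; split=> i x /CW Wx; [exact: a|exact: b]. Qed.

Lemma vfield_on_sub : vfield_on W U -> vfield_on W' U.
Proof.
move=> [r s]; split=> [i j x Hx|i]; last exact: smooth_onW (@CW i) (s i).
by apply: r; apply: chart_imgW Hx => p [/WW].
Qed.

Lemma hamiltonian_sub : hamiltonian W sg t U -> hamiltonian W' sg t U.
Proof. by move=> [v h]; split=> [|i x /CW Wx]; [exact: vfield_on_sub|exact: h]. Qed.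

End Restrict.

(** * Local existence of the potential etaN *)

Section Existence.
Variables (R : realType) (N : manifold R 6) (h : tens R 6 2) (J : endo R 6) (sg : tens R 6 2).
Variables (psp psm : tens R 6 3) (W : set N) (t : N -> R) (U : vfield R 6).
Hypotheses (kN : kahler N h J sg) (sN : su3 N J sg psp psm).
Hypotheses (oW : open W) (tW : smooth_pos W t) (cW : cond_i W J psp psm t).
Hypotheses (hU : hamiltonian W sg t U) (iU : su3_isometry W sg psp psm U).
Local Notation om := (omega_ psp psm t U).

Lemma potential_exists p : W p -> exists (W' : set N) (etaN : tens R 6 1),
  [/\ open W', W' p, W' `<=` W & eta_potential psp t etaN W' U].
Proof.
move=> Wp; have [j pj] := mcover p; pose P := @chart_img R 6 N j W.
have oP : open P by exact: chart_img_open.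
pose x0 := mcrd j p; have Px0 : P x0 by exact: chart_img_in.
have [r r0 rP] := open_ballE oP Px0.
pose B := [set x : 'rV[R]_6 | `|x - x0| < r].
have BP : B `<=` P by move=> x Bx; have := rP _ Bx; rewrite addrC subrK.
have oB : open B by exact: (@open_norm_ball _ _ _ _).
have sU : smooth_on P (U j) by have [[_ s] _] := hU; exact: s.
have Hl := su3_local_chart kN sN oW tW j.
have fo : lform P (om j) by exact: (lform_contract oP sU (lform_psi' oP Hl false)).
have [mo ao so] := fo.
have do0 : forall x, P x -> forall l, size l = 3%N -> dx (om j) x (vec l) = 0.
  exact: ((cond_iiP kN sN oW tW hU cW).2 iU j).
(* The Poincaré lemma applied to - omega, the sign required of d etaN. *)
have [a [la sa da]] : exists a : 'rV[R]_6 -> 'rV[R]_6 -> R,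
  [/\ forall x, B x -> forall c u v, a x (c *: u + v) = c * a x u + a x v,
      forall v, smooth_on B (a ^~ v) &
      forall x, B x -> forall u v, 'D_u (a ^~ v) x - 'D_v (a ^~ u) x = - om j x (vec [:: u; v])].
  apply: (@poincare2 R 6 x0 r (fun x u v => - om j x (vec [:: u; v]))).
  - by move=> x /BP Px c u v z; rewrite (@ml_vec _ _ _ _ (mo x Px) c u v [::] [:: z])// opprD mulrN.
  - by move=> x /BP Px u v; rewrite (alt2 u v (mo x Px) (ao x Px)) opprK.
  - by move=> u v; apply: smoothN => //; exact: smooth_onW BP (so _).
  move=> x /BP Px u v z; have := do0 x Px [:: u; v; z] erefl; rewrite dx2E.
  have dd l := lform_diff Px (vec l) fo.
  by rewrite !Dopp// => E; apply/eqP; rewrite -oppr_eq0 -E opprD opprB opprK opprK; apply/eqP; move: ('D_u _ _) ('D_v _ _) ('D_z _ _) => e1 e2 e3; ring.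
pose W' := [set q : N | mdom j q /\ B (mcrd j q)].
have oW' : open W' by exact: chart_pre_open.
have W'W : W' `<=` W by move=> q [qj /BP /chart_imgP[_ + _]]; rewrite mcrdK.
pose T i := rep (fun q : N => q) i j.
(* The primitive lives in the chart [j] only; in every other chart it is pulled back by the
   transition map, which makes the expressions compatible. *)
pose etaN : tens R 6 1 := fun i x v => a (T i x) ('D_(v ord0) (T i) x).
have inB i x : @chart_img R 6 N i W' x -> @chart_img R 6 N i (mdom j) x /\ B (T i x).
  by move=> Hx; have := chart_imgP Hx => -[xi [xj Bx] xE]; split=> //; apply: chart_imgW Hx => ? [].
have oC i : open (@chart_img R 6 N i W') by exact: chart_img_open.
pose a1 : 'rV[R]_6 -> cov R 6 1 := fun x v => a x (v ord0).
have fa : lform B a1.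
  split=> [x Bx v i c u w upd|x Bx|v]; [|exact: alternating1|exact: sa].
  by rewrite /a1 /upd (ord1 i) eqxx la.
have eE i : etaN i = pull (T i) a1 by [].
have sT i : smooth_on (@chart_img R 6 N i W') (T i).
  by apply: (smooth_onW _ (@trans_smooth R 6 N i j)) => x /inB[].
have TB i x : @chart_img R 6 N i W' x -> B (T i x) by case/inB.
have fe i : lform (@chart_img R 6 N i W') (etaN i).
  by rewrite eE; exact: (lform_pull (oC i) oB (sT i) (@TB i) fa).
exists W', etaN; split=> //; first by split=> //; rewrite /B /= subrr normr0.
split; first split; first split.
- move=> i k x Hx v; rewrite /etaN.
  have x1 : @chart_img R 6 N i (W' `&` mdom k) x by exact: Hx.
  have [x2 xE] := trans_in x1.
  have xi : @chart_img R 6 N i W' x by apply: chart_imgW x1 => ? [].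
  have xk : @chart_img R 6 N k W' (rep (fun q : N => q) i k x) by apply: chart_imgW x2 => ? [].
  have xik : @chart_img R 6 N i (mdom k) x by apply: chart_imgW x1 => ? [].
  have TE y : @chart_img R 6 N i (W' `&` mdom k) y -> T i y = T k (rep (fun q : N => q) i k y).
    by move=> /trans_in [_ E]; rewrite /T /rep [mpar N k _]E.
  have oWk : open (@chart_img R 6 N i (W' `&` mdom k)).
    by apply: chart_img_open; exact: openI oW' (@mdom_open _ _ N k).
  rewrite (TE _ x1) (D_eq_on _ oWk x1 TE); congr (a _ _).
  exact: (Dcomp _ (trans_diff xik) (smooth_on_diff (sT k) xk)).
- by move=> i x Hx; have [m _ _] := fe i; exact: m.
- by move=> i v; have [_ _ s] := fe i; exact: s.
- by move=> i x Hx; exact: alternating1.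
move=> i x Hx v; have [l sl ->] := vecP v.
have -> : dext etaN i x (vec l) = dx (pull (T i) a1) x (vec l) by [].
rewrite (dx_pull1 (oC i) (sT i) (@TB i) Hx fa sl) pull_vec//.
case: l sl => [|u [|w [|? ?]]] sl; try discriminate sl.
have -> : dx a1 (T i x) (vec [seq 'D_w0 (T i) x | w0 <- [:: u; w]]) =
    - om j (T i x) (vec [:: 'D_u (T i) x; 'D_w (T i) x]).
  by rewrite dx1E /a1 -da//; exact: TB.
have xi : @chart_img R 6 N i (W `&` mdom j) x.
  by apply: chart_imgW Hx => q [qj Bq]; split => //; apply: W'W; split.
have xij : @chart_img R 6 N i (mdom j) x by apply: chart_imgW xi => ? [].
congr (- _); rewrite /omega_ /omega contract_vec /psi' /tc /=.
have [x2 ->] := trans_in xi; congr (_ * _).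
have [[[pp _ _] _] _ _ _ _] := sN; have [[rU _] _] := hU.
rewrite -[iprod U psp i x _]/(contract (U i x) (psp i x) (vec [:: u; w])) contract_vec.
have xT : @chart_img R 6 N i ([set: N] `&` (fun q : N => q) @^-1` mdom j) x.
  by apply: chart_imgW xi => ? [].
rewrite (pp i j x xT) -(rU i j x xi); congr (psp j _ _).
by apply/funext => -[[|[|[|c]]] Hc].
Qed.

End Existence.

Lemma sub_exchange (R : realType) (a b c d p : R) :
  a - c = - p -> b - d = - p -> a - b = c - d.
Proof. by move=> e1 e2; lra. Qed.

Lemma rsubmx_inlr (R : realType) n (u : 'rV[R]_1) (v : 'rV[R]_n) :
  rsubmx (row_inl n u + row_inr v) = v.
Proof. by rewrite /row_inl /row_inr add_row_mx row_mxKr add0r. Qed.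

Lemma lsubmx_inlr (R : realType) n (u : 'rV[R]_1) (v : 'rV[R]_n) :
  lsubmx (row_inl n u + row_inr v) = u.
Proof. by rewrite /row_inl /row_inr add_row_mx row_mxKl addr0. Qed.

(** * Every such 7-manifold is locally the explicit model *)

Section Straighten.
Variables (R : realType) (N : manifold R 6) (h : tens R 6 2) (J : endo R 6) (sg : tens R 6 2).
Variables (psp psm : tens R 6 3) (W : set N) (t : N -> R) (U : vfield R 6).
Hypotheses (kN : kahler N h J sg) (sN : su3 N J sg psp psm).
Hypotheses (cW : cond_i W J psp psm t).
Hypotheses (hU : hamiltonian W sg t U) (iU : su3_isometry W sg psp psm U).
Variables (Y : manifold R 7) (D : set Y) (phi : tens R 7 3) (k : tens R 7 2) (sphi : tens R 7 4).
Variables (V : vfield R 7) (pi : Y -> N).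
Hypothesis Q : g2_quotient k V D phi sphi pi W h J sg psp psm t.
Local Notation L := (line_manifold N).

Lemma quotient_straighten : locally_model D phi k sphi V pi W h sg psp psm t U.
Proof.
move=> q Dq; have oW := quotient_open Q; have tW := quotient_pos Q.
have piW : pi @` D = W by have [_ [_ _ []]] := Q.
have Wq : W (pi q) by rewrite -piW; exists q.
have oD : open D by have [[]] := Q.
have [W' [etaN [oW' W'q W'W eN]]] := potential_exists kN sN oW tW cW hU iU Wq.
have [i0 qi] := mcover q; have [j0 qj] := mcover (pi q).
pose O := qdom D pi i0 j0; pose f := rep pi i0 j0.
pose P' := @chart_img R 6 N j0 W'; have oP' : open P' by exact: chart_img_open.
have oO : open O by exact: (qdom_open Q).
have sf : smooth_on O f by exact: (qdom_smooth Q).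
pose O' := O `&` f @^-1` P'.
have cf x : O x -> {for x, continuous f}.
  by move=> Ox; exact: differentiable_continuous (smooth_on_diff sf Ox).
have oO' : open O'.
  rewrite openE => x [Ox Px]; have h1 : nbhs x O by exact: open_nbhs_nbhs.
  by have h2 : nbhs x (f @^-1` P') by [apply: cf => //; exact: open_nbhs_nbhs]; exact: filterI h1 h2.
pose x0 := mcrd i0 q.
have Ox0 : O x0 by apply: chart_img_in.
have fx0 : f x0 = mcrd j0 (pi q) by rewrite /f /rep mcrdK.
have O'x0 : O' x0 by split=> //; rewrite /preimage /= fx0; exact: chart_img_in.
have [r r0 rO] := open_ballE oO' O'x0.
pose B2 := [set x : 'rV[R]_7 | `|x - x0| < r].
have BO' : B2 `<=` O' by move=> x Bx; have := rO _ Bx; rewrite addrC subrK.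
have oB2 : open B2 by exact: (@open_norm_ball _ _ _ _).
pose eta := quot_eta k V i0.
have feta : lform O eta by exact: (quot_eta_lform Q).
have feN : lform P' (etaN j0) by have [fe _] := eN; exact: (form_lform j0 oW' _ fe).
have sf' : smooth_on O' f by apply: smooth_onW sf => x [].
have O'P x : O' x -> P' (f x) by case.
have fpe : lform O' (pull f (etaN j0)) by exact: (lform_pull oO' oP' sf' O'P feN).
have feta' : lform O' eta.
  have [m a s] := feta; split=> [x [Ox _]|x [Ox _]|v]; [exact: m|exact: a|].
  by apply: smooth_onW (s v) => x [].
(* eta minus the pullback of etaN: both have differential minus the pullback of omega, so the
   difference is closed and has a primitive [yf], the coordinate along the orbits. *)
pose b x v : R := eta x (vec [:: v]) - pull f (etaN j0) x (vec [:: v]).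
have [yf sy Dy] : exists2 y, smooth_on B2 y & forall x, B2 x -> forall v, 'D_v y x = b x v.
  apply: (@poincare1 R 7 x0 r b).
  - move=> x /BO' Ox c u v; have [m _ _] := feta'; have [m' _ _] := fpe.
    rewrite /b (@ml_vec _ _ _ _ (m x Ox) c u v [::] [::])// (@ml_vec _ _ _ _ (m' x Ox) c u v [::] [::])//.
    by move: (eta x _) (eta x _) (pull _ _ _ _) (pull _ _ _ _) => e1 e2 e3 e4; ring.
  - move=> v; have [_ _ s] := feta'; have [_ _ s'] := fpe.
    by apply: smoothB => //; [exact: smooth_onW BO' (s _)|exact: smooth_onW BO' (s' _)].
  move=> x /BO' Ox u v; have [Ox1 _] := Ox.
  have E1 := quot_deta kN sN Q hU u v Ox1.
  have E2 := dx_pull1 oO' sf' O'P Ox feN (l := [:: u; v]) erefl.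
  have [_ dE] := eN.
  have E2' : pull f (dx (etaN j0)) x (vec [:: u; v]) =
      - (t (mpar N j0 (f x)) `^ (1 / 2) * iprod U psp j0 (f x) (vec [:: 'D_u f x; 'D_v f x])).
    apply: etrans (@pull_vec _ _ _ _ f (dx (etaN j0)) x [:: u; v] erefl) _.
    exact: (dE j0 _ (O'P _ Ox) _).
  have E3 : pull f (omega_ psp psm t U j0) x (vec [:: u; v]) =
      t (mpar N j0 (f x)) `^ (1 / 2) * iprod U psp j0 (f x) (vec [:: 'D_u f x; 'D_v f x]).
    exact: (@pull_vec _ _ _ _ f (omega_ psp psm t U j0) x [:: u; v] erefl).
  have E4 := etrans (esym (dx1E x u v (pull f (etaN j0)))) (etrans E2 E2').
  have E5 := etrans (esym (dx1E x u v eta)) E1.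
  have d1 z := lform_diff Ox (vec [:: z]) feta'; have d2 z := lform_diff Ox (vec [:: z]) fpe.
  have Db z z' : 'D_z (b^~ z') x = 'D_z (fun y => eta y (vec [:: z'])) x -
      'D_z (fun y => pull f (etaN j0) y (vec [:: z'])) x.
    apply: etrans (Dadd z (d1 z') (differentiableN (d2 z'))) _; congr (_ + _).
    exact: (Dopp z (d2 z')).
  apply: etrans (Db u v) _; apply: etrans _ (esym (Db v u)).
  exact: (sub_exchange (etrans E5 (congr1 -%R E3)) E4).
pose Fc x : 'rV[R]_7 := row_inl 6 (const_mx (yf x)) + row_inr (f x).
have B2O x : B2 x -> O x by move=> /BO' [].
have DFc x v : B2 x -> 'D_v Fc x = row_inl 6 (const_mx ('D_v yf x)) + row_inr ('D_v f x).
  move=> Bx; have dy : differentiable yf x by exact: smooth_on_diff sy Bx.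
  have df : differentiable f x by exact: smooth_on_diff sf (B2O _ Bx).
  have E : Fc = fun y => yf y *: row_inl 6 (const_mx 1) + row_inr (f y).
    apply/funext => y; rewrite /Fc -linearZ /=; congr (row_inl 6 _ + _).
    by apply/matrixP => c e; rewrite !mxE mulr1.
  have dr : differentiable (@row_inr R 6) (f x).
    by apply: linear_differentiable; exact: row_inr_continuous.
  have [d1 D1] := D_scalel (row_inl 6 (const_mx 1)) v dy.
  have d2 : differentiable (fun y => row_inr (f y)) x by exact: (differentiable_comp df dr).
  rewrite E (Dadd v d1 d2); congr (_ + _).
    rewrite D1 -linearZ /=; congr (row_inl 6 _).
    by apply/matrixP => c e; rewrite !mxE mulr1.
  apply: etrans (Dcomp v df dr) _.
  exact: (D_linear _ _ (@row_inr_continuous R 6)).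
have rF x : @rsubmx R 1 1 6 (Fc x) = f x by exact: rsubmx_inlr.
have sFc : smooth_on B2 Fc.
  have S0 : smooth_on B2 (fun x => const_mx (yf x) : 'rV[R]_1).
    apply: (@smooth_rV R 7 B2 oB2 1) => c.
    by apply: (smooth_on_eq (f := yf) oB2) => // y _; rewrite mxE.
  have S1 := smooth_on_linear_comp oB2 (@row_inl_continuous R 6) S0.
  have S2 := smooth_on_linear_comp oB2 (@row_inr_continuous R 6) (smooth_onW B2O sf).
  exact: (smooth_onD oB2 S1 S2).
have B2x0 : B2 x0 by rewrite /B2 /= subrr normr0.
have lFc (u : 'rV[R]_1) (v : 'rV[R]_6) : row_inl 6 u + row_inr v = 0 -> u = 0 /\ v = 0.
  rewrite /row_inl /row_inr add_row_mx addr0 add0r => E.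
  by split; [rewrite -(row_mxKl u v) E linear0|rewrite -(row_mxKr u v) E linear0].
(* If the differential of (y, f) kills v, then v = eta(v) V since v is vertical, and eta(v) = dy(v)
   + etaN(Df v) = 0. *)
have inj v : 'D_v Fc x0 = 0 -> v = 0.
  rewrite DFc// => /lFc [] /matrixP /(_ ord0 ord0); rewrite !mxE Dy// /b => Dy0 Df0.
  rewrite (quot_ker kN Q Ox0 Df0).
  have -> : quot_eta k V i0 x0 (vec [:: v]) = 0; last by rewrite scale0r.
  rewrite -[RHS]Dy0 pull_vec//= Df0.
  have [m _ _] := feN; rewrite (@ml_vec0 _ _ _ _ (m (f x0) _) [::] [::])// ?subr0//.
  exact: O'P.
have [B [g [[oB Bx0 BB2 oFB] [gK sg_]]]] := inverse_function oB2 sFc B2x0 inj.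
pose D' := [set p : Y | mdom i0 p /\ (B `&` O) (mcrd i0 p)].
have D'P p : D' p -> [/\ mdom i0 p, D p, mdom j0 (pi p), B (mcrd i0 p) & f (mcrd i0 p) = mcrd j0 (pi p)].
  by move=> [pi0 [Bp /chart_imgP[_ [+ + _]]]]; rewrite mcrdK// => Dp pj; split=> //; rewrite /f /rep mcrdK.
have oD' : open D' by apply: chart_pre_open; exact: openI.
pose F (p : Y) : L := (yf (mcrd i0 p), pi p).
have FE p : D' p -> line_crd j0 (F p) = Fc (mcrd i0 p).
  move=> /D'P[_ _ _ _ fE]; rewrite /line_crd /F /= row_mx_inlr /Fc; congr (_ + row_inr _).
  exact: esym fE.
pose E := F @` D'.
(* In the chart [j0] of the product, [E] is the image of [B] under [Fc], which the inverse function
   theorem makes open. *)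
have EE : E = [set z : L | @mdom R 7 L j0 z /\ (Fc @` B) (@mcrd R 7 L j0 z)].
  apply/seteqP; split=> [_ [p Dp <-]|z [zj [x Bx xz]]].
    by have [_ _ pj Bp _] := D'P _ Dp; split=> //; exists (mcrd i0 p) => //; rewrite -FE.
  have Ox := B2O _ (BB2 _ Bx); have [xi [Dx xj] xE] := chart_imgP Ox.
  have Dp : D' (mpar Y i0 x) by split=> //; rewrite xE; split.
  exists (mpar Y i0 x) => //.
  have -> : z = @mpar R 7 L j0 (@mcrd R 7 L j0 z) by rewrite (@mcrdK R 7 L).
  have -> : F (mpar Y i0 x) = @mpar R 7 L j0 (@mcrd R 7 L j0 (F (mpar Y i0 x))).
    by rewrite (@mcrdK R 7 L).
  by congr (mpar L j0 _); rewrite -xz -[LHS]/(line_crd j0 (F _)) FE// xE.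
have oE : open E by rewrite EE; exact: (@chart_pre_open R 7 L).
pose G (z : L) : Y := mpar Y i0 (g (@mcrd R 7 L j0 z)).
have GF p : D' p -> G (F p) = p.
  by move=> Dp; have [pi0 _ _ Bp _] := D'P _ Dp; rewrite /G -[mcrd _ _]/(line_crd j0 (F p)) FE// gK// mcrdK.
have D'i : D' `<=` mdom i0 by move=> p [].
have D'j p : D' p -> @mdom R 7 L j0 (F p) by case/D'P.
have D0P x : @chart_img R 7 Y i0 D' x -> [/\ B x, O x, rep F i0 j0 x = Fc x & D' (mpar Y i0 x)].
  move=> /chart_imgP[xi Dp xE]; have [_ [Bx Ox]] := Dp; rewrite xE in Bx Ox.
  by split=> //; rewrite /rep -[LHS]/(line_crd j0 (F _)) FE// xE.
have oD0 : open (@chart_img R 7 Y i0 D') by exact: chart_img_open.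
have sF0 : smooth_on (@chart_img R 7 Y i0 D') (rep F i0 j0).
  apply: (smooth_on_eq (f := Fc) oD0); first by move=> x /D0P[].
  by apply: smooth_onW sFc => x /D0P[Bx _ _ _]; exact: BB2.
have sF := one_chart_smooth oD' D'i D'j sF0.
have Ej z : E z -> @mdom R 7 L j0 z by rewrite EE => -[].
have EG z : E z -> mdom i0 (G z) by move=> [p Dp <-]; rewrite GF//; exact: D'i.
have oE0 : open (@chart_img R 7 L j0 E) by exact: chart_img_open.
have sG0 : smooth_on (@chart_img R 7 L j0 E) (rep G j0 i0).
  have CE x : @chart_img R 7 L j0 E x -> (Fc @` B) x /\ rep G j0 i0 x = g x.
    move=> /chart_imgP[xj Ex xE]; have := Ex; rewrite EE => -[_]; rewrite xE => Fx; split=> //.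
    move: Ex; rewrite /rep => -[p Dp pE]; rewrite -pE GF//.
    have [pi0 _ _ Bp _] := D'P _ Dp; rewrite -xE -pE -[mcrd j0 _]/(line_crd j0 (F p)) FE// gK//.
  apply: (smooth_on_eq (f := g) oE0); first by move=> x /CE[].
  by apply: smooth_onW sg_ => x /CE[].
have sG := one_chart_smooth oE Ej EG sG0.
have tW' := smooth_pos_sub W'W tW; have cW' := cond_i_sub W'W cW; have hU' := hamiltonian_sub W'W hU.
pose D1 := D' `&` pi @^-1` W'.
have D'W p : D' p -> W' (pi p).
  move=> Dp; have [pi0 _ pj Bp fE] := D'P _ Dp; have [_] := BO' _ (BB2 _ Bp).
  by rewrite /preimage /= fE => /chart_imgP[_ + _]; rewrite mcrdK.
have D'E p : D' p -> [set z : R * N | W' z.2] (F p) by exact: D'W.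
have D'D : D' `<=` D by move=> p /D'P[].
have metaE x v : @chart_img R 7 Y i0 D' x ->
    model_eta etaN j0 (rep F i0 j0 x) (fun a => 'D_(v a) (rep F i0 j0) x) = eta x v.
  move=> Dx; have [Bx Ox xE _] := D0P _ Dx; have B2x := BB2 _ Bx.
  have -> : (fun a => 'D_(v a) (rep F i0 j0) x) = fun a => 'D_(v a) Fc x.
    by apply/funext => a; apply: (D_eq_on _ oD0 Dx) => y /D0P[].
  rewrite xE.
  have -> : model_eta etaN j0 (Fc x) (fun a => 'D_(v a) Fc x) =
      'D_(v ord0) yf x + etaN j0 (f x) (vec [:: 'D_(v ord0) f x]).
    rewrite /model_eta; congr (_ + _).
      rewrite /dy (DFc _ _ B2x).
      apply: etrans (congr1 (fun m : 'rV[R]_1 => m ord0 ord0) (lsubmx_inlr _ _)) _.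
      by rewrite mxE.
    rewrite /pullN rF; congr (etaN j0 _ _); apply/funext => a.
    by rewrite (ord1 a) DFc//; exact: rsubmx_inlr.
  rewrite Dy// /b; have E0 : v = vec [:: v ord0] by exact: vec1E.
  rewrite [in RHS]E0.
  have -> : pull f (etaN j0) x (vec [:: v ord0]) = etaN j0 (f x) (vec [:: 'D_(v ord0) f x]).
    exact: (@pull_vec _ _ _ _ f (etaN j0) x [:: v ord0] erefl).
  by rewrite subrK.
have pullE p (T : tens R 6 p) x v : @chart_img R 7 Y i0 D' x ->
    pullN T j0 (rep F i0 j0 x) (fun a => 'D_(v a) (rep F i0 j0) x) = pull f (T j0) x v.
  move=> Dx; have [Bx Ox xE _] := D0P _ Dx; have B2x := BB2 _ Bx.
  rewrite xE /pullN rF; congr (T j0 _ _); apply/funext => a.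
  rewrite (D_eq_on _ oD0 Dx (g := Fc)); last by move=> y /D0P[].
  by rewrite DFc//; exact: rsubmx_inlr.
have mtE x : @chart_img R 7 Y i0 D' x -> model_t t j0 (rep F i0 j0 x) = tc t j0 (f x).
  by move=> Dx; have [_ _ xE _] := D0P _ Dx; rewrite /model_t xE rF.
have pulledD' p (T : tens R 7 p) : pulled D (fun q : Y => q) T T -> pulled D' (fun q : Y => q) T T.
  by move=> H i j x Hx; apply: H; apply: chart_imgW Hx => z [/D'D].
have [[_ [[[[pphi _ _] _] [[pk _ _] _ _] [[psphi _ _] _] _] _ _] [[rV sV] _ _]] _ _ _ _] := Q.
have cwE p1 p2 (a1 a2 : cov R 7 p1) (b1 b2 : cov R 7 p2) v : a1 = a2 -> b1 = b2 -> cwedge a1 b1 v = cwedge a2 b2 v.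
  by move=> -> ->.
(* eta is built from [k], [V] and k(V,V)^(-1/2). The last is the pullback of the function [t], so it
   has the same value in both charts. *)
have peta : pulled D' (fun q : Y => q) (quot_eta k V) (quot_eta k V).
  move=> i j x Hx v.
  have Hx' : @chart_img R 7 Y i (D `&` (fun q : Y => q) @^-1` mdom j) x.
    by apply: chart_imgW Hx => z [/D'D].
  have xi : @chart_img R 7 Y i D x by apply: chart_imgW Hx' => ? [].
  have [[_ _ _] _ [tE _ _] _ _] := Q.
  have tEx := tE i x xi; have [x2 xE] := trans_in Hx'.
  have xj : @chart_img R 7 Y j D (rep (fun q : Y => q) i j x) by apply: chart_imgW x2 => ? [].
  have tEj := tE j _ xj; rewrite xE tEx in tEj.
  have xij : @chart_img R 7 Y i (mdom j) x by apply: chart_imgW Hx' => ? [].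
  rewrite /quot_eta -tEj (pk i j x Hx'); congr (k j _ _).
  apply/funext => -[[|[|a]] Ha] //=.
  by rewrite /pair2 (tnth_nth 0) /= (DZ _ _ (trans_diff xij)) (rV i j x Hx').
exists D', W', E, F, G, etaN; split=> //.
- split; [by split|exact: D'D|exact: oW'|exact: W'W|by move=> z [p Dp <-]; exact: D'W].
- apply: (one_chart_related oD' D'i D'j sF0 D'E) => //.
  + by move=> i j x Hx; apply: rV; apply: chart_imgW Hx => z [/D'D].
  + by have [[rd _] _ _] := model_isometry kN sN oW' tW' eN; exact: rd.
  move=> x Dx; have [Bx Ox xE _] := D0P _ Dx; have B2x := BB2 _ Bx.
  rewrite (D_eq_on _ oD0 Dx (g := Fc)); last by move=> y /D0P[].
  rewrite DFc// Dy// /b (quot_DV Q Ox) linear0 addr0 /ddy; congr (row_inl 6 _).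
  apply/matrixP => c e; rewrite !mxE /eta (quot_etaV Q Ox) pull_vec//= (quot_DV Q Ox).
  have [m _ _] := feN; rewrite (@ml_vec0 _ _ _ _ (m (f x) _) [::] [::])// ?subr0//.
  by apply: O'P; exact: BO'.
split.
- apply: (one_chart_pulled oD' D'i D'j sF0 D'E (pulledD' _ _ pk)).
    by have [[p _ _] _ _] := model_riemannian kN sN oW' tW' eN; exact: p.
  move=> x v Dx; have [Bx Ox xE _] := D0P _ Dx.
  rewrite /model_k (metaE x (fun=> v ord0) Dx) (metaE x (fun=> v ord_max) Dx) mtE// pullE//.
  have [_ _ [_ hP _] _ _] := Q; have [tE T0 _] := quot_tE Q Ox.
  rewrite -[pull f (h j0) x v](hP i0 j0 x Ox v) /quot_h tE.
  rewrite mulrA mulfV ?gt_eqF// mul1r subrK //.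
- apply: (one_chart_pulled oD' D'i D'j sF0 D'E (pulledD' _ _ pphi)).
    by have [[p _ _] _] := mphi_form kN sN oW' tW' eN; exact: p.
  move=> x v Dx; have [Bx Ox xE _] := D0P _ Dx; have [_ T0 _] := quot_tE Q Ox.
  rewrite (quot_phiE Q Ox) /model_phi mtE// pullE//; congr (_ + _).
    apply: (@etrans _ _ (cwedge (fun u => pullN sg j0 (rep F i0 j0 x) (fun a => 'D_(u a) (rep F i0 j0) x))
      (fun u => model_eta etaN j0 (rep F i0 j0 x) (fun a => 'D_(u a) (rep F i0 j0) x)) v)); last by [].
    by apply: cwE; apply/funext => u; [rewrite pullE|rewrite metaE].
  rewrite (_ : 3 / 2 = 1 + 1 / 2 :> R); last by lra.
  by rewrite powRD ?powRr1 ?(ltW T0)//; [rewrite -mulrA|rewrite (gt_eqF T0) implybT].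
- apply: (one_chart_pulled oD' D'i D'j sF0 D'E (pulledD' _ _ psphi)).
    by have [[p _ _] _] := msphi_form kN sN oW' tW' eN; exact: p.
  move=> x v Dx; have [Bx Ox xE _] := D0P _ Dx; have [_ T0 _] := quot_tE Q Ox.
  rewrite (quot_sphiE sN Q Ox) /model_sphi mtE// expr2; congr (_ + _).
    rewrite -cwedge_scalel.
    apply: (@etrans _ _ (cwedge (fun g => tc t j0 (f x) `^ (1 / 2) * pullN psm j0 (rep F i0 j0 x) (fun a => 'D_(g a) (rep F i0 j0) x))
      (fun u => model_eta etaN j0 (rep F i0 j0 x) (fun a => 'D_(u a) (rep F i0 j0) x)) v)); last by [].
    by apply: cwE; apply/funext => u; [rewrite pullE|rewrite metaE].
  apply: (@etrans _ _ (1 / 2 * (tc t j0 (f x) * tc t j0 (f x)) *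
    cwedge (fun u => pullN sg j0 (rep F i0 j0 x) (fun a => 'D_(u a) (rep F i0 j0) x))
    (fun u => pullN sg j0 (rep F i0 j0 x) (fun a => 'D_(u a) (rep F i0 j0) x)) v)); last by [].
  rewrite -[LHS]/(1 / 2 * (tc t j0 (f x) * tc t j0 (f x)) * cwedge (pull f (sg j0) x) (pull f (sg j0) x) v).
  by congr (_ * _); apply: cwE; apply/funext => u; rewrite pullE.
apply: (one_chart_pulled oD' D'i D'j sF0 D'E peta).
  by move=> i j w wij v; rewrite (meta_compat eN wij).
by move=> x v Dx; rewrite metaE.
Qed.

End Straighten.

Theorem proposition1 (R : realType) (N : manifold R 6)
    (h : tens R 6 2) (J : endo R 6) (sg : tens R 6 2) (psp psm : tens R 6 3) :
  kahler N h J sg -> su3 N J sg psp psm ->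
  [/\ (* near each point: the structure is a quotient iff (i) and (ii) hold
         for some smooth positive function t *)
      forall p : N,
        (exists (W : set N) (t : N -> R),
            W p /\ is_g2_quotient W h J sg psp psm t) <->
        (exists (W : set N) (t : N -> R),
            [/\ open W, W p, smooth_pos W t, cond_i W J psp psm t
              & cond_ii W sg psp psm t]),
      (* the function t in (i) and (ii) being k(V,V)^(-1/2) *)
      forall (W : set N) (t : N -> R), open W ->
        (locally_g2_quotient W h J sg psp psm t <->
         [/\ smooth_pos W t, cond_i W J psp psm t & cond_ii W sg psp psm t])
    & (* in this case, with U the Hamiltonian vector field of -t *)
      forall (W : set N) (t : N -> R) (U : vfield R 6),
        open W -> smooth_pos W t -> cond_i W J psp psm t ->
        hamiltonian W sg t U -> su3_isometry W sg psp psm U ->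
        (* every such 7-manifold is locally the explicit model on R x N *)
        (forall (Y : manifold R 7) (D : set Y) (phi : tens R 7 3)
            (k : tens R 7 2) (sphi : tens R 7 4) (V : vfield R 7) (pi : Y -> N),
          g2_quotient k V D phi sphi pi W h J sg psp psm t ->
          locally_model D phi k sphi V pi W h sg psp psm t U) /\
        (* and the explicit model has the given structure as its quotient *)
        (forall (W' : set N) (etaN : tens R 6 1),
          open W' -> W' `<=` W -> eta_potential psp t etaN W' U ->
          @g2_quotient R (line_manifold N) N (model_k h t etaN) (@ddy R)
            [set z : R * N | W' z.2] (model_phi sg psp t etaN)
            (model_sphi sg psm t etaN) (fun z : R * N => z.2)
            W' h J sg psp psm t)].
Proof.
move=> kN sN.
have fwd (W : set N) (t : N -> R) : is_g2_quotient W h J sg psp psm t ->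
    [/\ open W, smooth_pos W t, cond_i W J psp psm t & cond_ii W sg psp psm t].
  move=> [Y [D [phi [k [sphi [V [pi Q]]]]]]].
  have oW := quotient_open Q; have tW := quotient_pos Q.
  have [U hU] := hamiltonian_exists kN sN oW tW.
  split=> //; first exact: (quotient_cond_i kN sN Q).
  by exists U; split=> //; exact: (quotient_isometry kN sN Q hU).
have bwd (W : set N) (t : N -> R) : open W -> smooth_pos W t -> cond_i W J psp psm t ->
    cond_ii W sg psp psm t -> locally_g2_quotient W h J sg psp psm t.
  move=> oW tW cW [U [hU iU]] p Wp.
  have [W' [etaN [oW' Wp' W'W eN]]] := potential_exists kN sN oW tW cW hU iU Wp.
  exists W'; split=> //; do 7 eexists.
  exact: (model_quotient kN sN oW' (smooth_pos_sub W'W tW) (cond_i_sub W'W cW)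
    (hamiltonian_sub W'W hU) eN).
split.
- move=> p; split=> [[W [t [Wp q]]]|[W [t [oW Wp tW cW cii]]]].
    by have [oW tW cW cii] := fwd W t q; exists W, t.
  by have [W' [W'p _ q]] := bwd W t oW tW cW cii p Wp; exists W', t.
- move=> W t oW; split=> [loc|[tW cW cii]]; last exact: bwd.
  (* Smoothness, positivity and (i) are conditions at each point of each chart, so they are
     inherited from the neighbourhoods W' on which a quotient exists. *)
  have pt i x : @chart_img R 6 N i W x -> exists W' : set N,
      [/\ @chart_img R 6 N i W' x, W' `<=` W & is_g2_quotient W' h J sg psp psm t].
    move=> /chart_imgP[xi Wx xE]; have [W' [W'x W'W q]] := loc _ Wx.
    by exists W'; split=> //; rewrite -xE; exact: chart_img_in.
  have tW : smooth_pos W t.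
    split=> [i s x /pt[W' [W'x _ /fwd[_ [sW' _] _ _]]]|p /loc[W' [W'p _ /fwd[_ [_ pos] _ _]]]].
      exact: (sW' i s x).
    exact: pos.
  have cW : cond_i W J psp psm t.
    by split=> i x /pt[W' [W'x _ /fwd[_ _ [a b] _]]]; [exact: a|exact: b].
  have [U hU] := hamiltonian_exists kN sN oW tW.
  (* The Hamiltonian field is taken on all of [W] at once. Its restriction is the Hamiltonian field
     of each W', so the local isometry statements concern one and the same field. *)
  have iso i x : @chart_img R 6 N i W x -> exists W' : set N,
      @chart_img R 6 N i W' x /\ su3_isometry W' sg psp psm U.
    move=> /pt[W' [W'x W'W [Y [D [phi [k [sphi [V [pi Q]]]]]]]]]; exists W'; split=> //.
    exact: (quotient_isometry kN sN Q (hamiltonian_sub W'W hU)).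
  split=> //; exists U; split=> //; split; first by case: hU.
  - by move=> i x /iso[W' [W'x [_ a _ _]]]; exact: a.
  - by move=> i x /iso[W' [W'x [_ _ a _]]]; exact: a.
  - by move=> i x /iso[W' [W'x [_ _ _ a]]]; exact: a.
move=> W t U oW tW cW hU iU; split=> [Y D phi k sphi V pi Q|W' etaN oW' W'W eN].
  exact: (quotient_straighten kN sN cW hU iU Q).
exact: (model_quotient kN sN oW' (smooth_pos_sub W'W tW) (cond_i_sub W'W cW)
  (hamiltonian_sub W'W hU) eN).
Qed.
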